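(* Let $n\in\mathbb{N}^*$, $\alpha>0$, $s\ge 0$, $r_{\mathrm H}\in\mathbb{R}$ and $u_0\in L^2(\mathbf{H}_n)$. Let $u$ be the solution of the Cauchy problem $$\begin{cases}\partial_t u(t,\eta)+(-\Delta_{\mathrm H})^{\alpha}u(t,\eta)=0, & (t,\eta)\in[s,\infty)\times\mathbf{H}_n,\\ u(s,\eta)=u_0(\eta), & \eta\in\mathbf{H}_n.\end{cases}$$ Then: 1) If $P_{r_{\mathrm H}}(u_0)_{-}>0$, then $\|u(t,\cdot)\|_{L^2(\mathbf{H}_n)}^2\gtrsim(1+t-s)^{-\frac{2r_{\mathrm H}+Q}{2\alpha}}$ for $t\ge s$. 2) If $P_{r_{\mathrm H}}(u_0)_{+}<\infty$, then $\|u(t,\cdot)\|_{L^2(\mathbf{H}_n)}^2\lesssim(1+t-s)^{-\frac{2r_{\mathrm H}+Q}{2\alpha}}$ for $t\ge s$.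
   Context: Heisenberg group. $\mathbf{H}_n=\mathbb{R}^{2n+1}$ with product $(x,y,\tau)\circ(x',y',\tau')=(x+x',y+y',\tau+\tau'+\frac12(x\cdot y'-x'\cdot y))$, equipped with Lebesgue (Haar) measure; homogeneous dimension $Q=2n+2$. Let $X_j=\partial_{x_j}-\frac{y_j}{2}\partial_\tau$, $Y_j=\partial_{y_j}+\frac{x_j}{2}\partial_\tau$ ($1\le j\le n$), and $\Delta_{\mathrm H}=\sum_{j=1}^n(X_j^2+Y_j^2)$; powers $(-\Delta_{\mathrm H})^{\alpha}$ are defined by functional calculus. Fourier transform. For $\lambda\in\mathbb{R}^*=\mathbb{R}\setminus\{0\}$, the Schrödinger representation on $L^2(\mathbb{R}^n)$ is $\pi_\lambda(x,y,\tau)\varphi(w)=e^{i\lambda(\tau+\frac12x\cdot y)}e^{i\,\mathrm{sign}(\lambda)\sqrt{|\lambda|}\,y\cdot w}\varphi(w+\sqrt{|\lambda|}x)$. The group Fourier transform is $\widehat f(\lambda)=\int_{\mathbf{H}_n}f(\eta)\pi_\lambda(\eta)^*\,d\eta$, extended to $L^2(\mathbf{H}_n)$ by the Plancherel formula $\|f\|_{L^2}^2=c_n\int_{\mathbb{R}^*}\|\widehat f(\lambda)\|_{\mathrm{HS}}^2|\lambda|^n d\lambda$, $c_n=(2\pi)^{-(3n+1)}$. Let $\{e_k\}_{k\in\mathbb{N}^n}$ be the normalized Hermite functions on $\mathbb{R}^n$, with $(-\Delta_w+|w|^2)e_k=\mu_ke_k$, $\mu_k=2|k|+n$. Put $\widehat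 f(\lambda)_{k,\ell}=(\widehat f(\lambda)e_k,e_\ell)_{L^2(\mathbb{R}^n)}$. Decay indicators. For $u_0\in L^2(\mathbf{H}_n)$ and $r\in\mathbb{R}$, $P_r(u_0)_-$ and $P_r(u_0)_+$ are respectively the $\liminf$ and the $\limsup$ as $\rho\to0^+$ of $$\rho^{-2r-Q}\,c_n\sum_{k,\ell\in\mathbb{N}^n}\int_{\{\lambda\in\mathbb{R}^*:\,|\lambda|\le\mu_k^{-1}\rho^2\}}|\lambda|^n|\widehat u_0(\lambda)_{k,\ell}|^2\,d\lambda .$$ Notation: $f(t)\lesssim g(t)$ (resp. $\gtrsim$) means $f\le Cg$ (resp. $f\ge Cg$) for all $t$ considered, with a constant $C>0$ not depending on $t$.
   Formalization: The coefficients in P_r are taken as (û_0(λ)e_l, e_k) instead of (û_0(λ)e_k, e_l), so that μ_k belongs to the index on which −Δ_H acts; with the order as printed both parts fail for suitable u_0. *)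

(* Defs.v *)
From HB Require Import structures.
From mathcomp Require Import all_boot all_order all_algebra.
From mathcomp Require Import all_classical all_reals all_analysis.
From mathcomp Require Export complex.
Set Implicit Arguments.
Unset Strict Implicit.
Unset Printing Implicit Defensive.
Import Order.TTheory GRing.Theory Num.Theory.
Import numFieldNormedType.Exports.
Local Open Scope classical_set_scope.
Local Open Scope ring_scope.

(** * Lebesgue measure on R^n *)

(* The coordinate sigma-algebra, as the library does for [n.-tuple T]. *)
Section measurable_row.
Context {R : realType} (n : nat).

Let coors : 'I_n -> 'rV[R]_n -> measurableTypeR R := fun i x => x ord0 i.

Let row_set0 : g_sigma_preimage coors set0.
Proof. exact: sigma_algebra0. Qed.

Let row_setC A : g_sigma_preimage coors A -> g_sigma_preimage coors (~` A).
Proof. exact: sigma_algebraC. Qed.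

Let row_bigcup (F : _^nat) : (forall i, g_sigma_preimage coors (F i)) ->
  g_sigma_preimage coors (\bigcup_i (F i)).
Proof. exact: sigma_algebra_bigcup. Qed.

HB.instance Definition _ := @isMeasurable.Build
  measurable_structure.default_measure_display 'rV[R]_n (g_sigma_preimage coors)
  row_set0 row_setC row_bigcup.

End measurable_row.

Lemma measurable_coord (R : realType) n (i : 'I_n) :
  measurable_fun [set: 'rV[R]_n] (fun x : 'rV[R]_n => x ord0 i).
Proof.
move=> _ Y mY; rewrite setTI; apply: sub_sigma_algebra => /=.
rewrite -bigcup_seq/=; exists i => /=; first by rewrite mem_index_enum.
by exists Y => //; rewrite setTI.
Qed.

Lemma measurable_fun_rowP (R : realType) d (T : measurableType d) n
    (f : T -> 'rV[R]_n) :
  (forall i, measurable_fun [set: T] (fun x => f x ord0 i)) ->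
  measurable_fun [set: T] f.
Proof.
move=> mf.
suff H : preimage_set_system [set: T] f measurable `<=` measurable.
  by move=> _ A mA; apply: H; exists A.
rewrite /measurable/= -g_sigma_preimage_comp.
apply: smallest_sub; first exact: sigma_algebra_measurable.
case: n => [|n] in f mf *; first by rewrite big_ord0.
rewrite -bigcup_mkord_ord; apply: bigcup_sub => i Ii.
by move=> A [B mB <-]; exact: mf.
Qed.

Section row_cons.
Context {R : realType} (n : nat).

Definition row_cons (p : measurableTypeR R * 'rV[R]_n) : 'rV[R]_n.+1 :=
  \row_i oapp (fun j => p.2 ord0 j) p.1 (unlift ord0 i).

Definition row_uncons (v : 'rV[R]_n.+1) : measurableTypeR R * 'rV[R]_n :=
  (v ord0 ord0, \row_j v ord0 (lift ord0 j)).

Lemma row_consK : cancel row_cons row_uncons.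
Proof.
case=> a v; rewrite /row_uncons/= mxE unlift_none/=; congr pair.
by apply/rowP => j; rewrite !mxE liftK.
Qed.

Lemma measurable_row_cons : measurable_fun [set: _] row_cons.
Proof.
apply: measurable_fun_rowP => i.
under eq_fun do rewrite mxE.
case: unliftP => [j _|_] /=; last exact: measurable_fst.
exact: (measurableT_comp (measurable_coord j) measurable_snd).
Qed.

Lemma measurable_row_uncons : measurable_fun [set: _] row_uncons.
Proof.
apply/measurable_fun_pairP; split; first exact: measurable_coord.
apply: measurable_fun_rowP => j /=.
under eq_fun do rewrite mxE.
exact: measurable_coord.
Qed.

Variable mu : {sigma_finite_measure set 'rV[R]_n -> \bar R}.

Definition lebesgue_row_cons : set 'rV[R]_n.+1 -> \bar R :=
  pushforward (lebesgue_measure \x mu)%E row_cons.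

Let lebesgue_row_cons0 : lebesgue_row_cons set0 = 0%E.
Proof. by rewrite /lebesgue_row_cons /pushforward preimage_set0 measure0. Qed.

Let lebesgue_row_cons_ge0 A : (0 <= lebesgue_row_cons A)%E.
Proof. by rewrite /lebesgue_row_cons /pushforward measure_ge0. Qed.

Let lebesgue_row_cons_sigma_additive : semi_sigma_additive lebesgue_row_cons.
Proof.
pose m := [the {measure set _ -> \bar R} of (lebesgue_measure \x mu)%E].
move=> F mF tF mUF.
exact: (@measure_semi_sigma_additive _ _ _
  (measure_function_pushforward__canonical__measure_function_Measure m
     measurable_row_cons)).
Qed.

HB.instance Definition _ := isMeasure.Build _ _ _ lebesgue_row_cons
  lebesgue_row_cons0 lebesgue_row_cons_ge0 lebesgue_row_cons_sigma_additive.

Let lebesgue_row_cons_sigma_finite : sigma_finite setT lebesgue_row_cons.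
Proof.
have /sigma_finiteP[F [TF ndF Foo]] := sigma_finiteT (@lebesgue_measure R).
have /sigma_finiteP[G [TG ndG Goo]] := sigma_finiteT mu.
exists (fun k => row_uncons @^-1` (F k `*` G k)).
  rewrite -preimage_bigcup; apply/esym; rewrite -subTset => v _ /=.
  have [/= i _ Fi] : (\bigcup_i F i) (row_uncons v).1 by rewrite -TF.
  have [/= j _ Gj] : (\bigcup_i G i) (row_uncons v).2 by rewrite -TG.
  exists (maxn i j) => //; split.
    by move: Fi; apply/subsetPset/ndF/leq_maxl.
  by move: Gj; apply/subsetPset/ndG/leq_maxr.
move=> k; have [mF Fk] := Foo k; have [mG Gk] := Goo k.
have mFG : measurable (F k `*` G k) by exact: measurableX.
split; first by rewrite -[X in measurable X]setTI; exact: measurable_row_uncons.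
rewrite /lebesgue_row_cons /pushforward -comp_preimage.
have -> : row_uncons \o row_cons = id by apply/funext => p; exact: row_consK.
by rewrite preimage_id product_measure1E// lte_mul_pinfty// ge0_fin_numE.
Qed.

HB.instance Definition _ := Measure_isSigmaFinite.Build _ _ _
  lebesgue_row_cons lebesgue_row_cons_sigma_finite.

End row_cons.

Fixpoint lebesgue_row {R : realType} (n : nat) :
    {sigma_finite_measure set 'rV[R]_n -> \bar R} :=
  if n is m.+1 then lebesgue_row_cons (lebesgue_row m) else \d_(0 : 'rV[R]_0).

(** * Complex-valued L^2 functions *)

Local Notation ReC := (@complex.Re _).
Local Notation ImC := (@complex.Im _).

Section complex_L2.
Context d (T : measurableType d) (R : realType).
Variable mu : {measure set T -> \bar R}.
Implicit Types f g : T -> R[i].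

Definition sqnormC (z : R[i]) : R := ReC z ^+ 2 + ImC z ^+ 2.

Definition measurable_complex f :=
  measurable_fun setT (ReC \o f) /\
  measurable_fun setT (ImC \o f).

Definition integralC f : R[i] :=
  Complex (\int[mu]_x ReC (f x)) (\int[mu]_x ImC (f x)).

Definition L1 f :=
  mu.-integrable setT (EFin \o (ReC \o f)) /\
  mu.-integrable setT (EFin \o (ImC \o f)).

Definition sqL2norm f : \bar R := (\int[mu]_x (sqnormC (f x))%:E)%E.

Definition L2 f := measurable_complex f /\ (sqL2norm f < +oo)%E.

(* Linear in the first argument. *)
Definition inner f g : R[i] := integralC (fun x => f x * conjc (g x)).

(* Spectral resolutions on L^2(mu): [res_proj B] is an everywhere defined symmetric
   operator, hence linear, bounded and well defined up to a.e. equality, and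
   idempotent by [res_projI]; countable additivity is carried by the scalar spectral
   measures [res_spec f], B |-> ||res_proj B f||^2. *)
Record resolution := Resolution {
  res_proj : set R -> (T -> R[i]) -> (T -> R[i]) ;
  res_spec : (T -> R[i]) -> {measure set R -> \bar R} ;
  res_proj_L2 : forall B f, measurable B -> L2 f -> L2 (res_proj B f) ;
  res_proj_sym : forall B f g, measurable B -> L2 f -> L2 g ->
    inner (res_proj B f) g = inner f (res_proj B g) ;
  res_projI : forall A B f, measurable A -> measurable B -> L2 f ->
    {ae mu, forall x, res_proj (A `&` B) f x = res_proj A (res_proj B f) x} ;
  res_projT : forall f, L2 f -> {ae mu, forall x, res_proj setT f x = f x} ;
  res_specE : forall B f, measurable B -> L2 f -> res_spec f B = sqL2norm (res_proj B f)
}.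

Variable E : resolution.

(* Domain of the operator \int phi dE. *)
Definition fcalc_dom (phi : R -> R) f :=
  L2 f /\ (\int[res_spec E f]_x ((phi x) ^+ 2)%:E < +oo)%E.

(* g = (\int phi dE) f, i.e. <g, h> is the integral of phi against the complex
   measure B |-> <res_proj B f, h>, which is written by polarization as
   (1/4) \sum_k i^k res_spec (f + i^k h); the h in the domain are dense. *)
Definition is_fcalc (phi : R -> R) f g :=
  [/\ fcalc_dom phi f, L2 g &
   forall h, fcalc_dom phi h ->
     inner g h = 4%:R^-1 * \sum_(k < 4) (Complex 0 1) ^+ k *
       (Complex (\int[res_spec E (fun x => f x + (Complex 0 1) ^+ k * h x)]_t phi t)
                0)].

End complex_L2.

(** * The Heisenberg group and its sublaplacian *)

Notation heis R n := ('rV[R]_n * 'rV[R]_n * R)%type.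

Definition heis_measure (R : realType) n :
    {measure set ('rV[R]_n * 'rV[R]_n * measurableTypeR R) -> \bar R} :=
  ((lebesgue_row n \x lebesgue_row n) \x @lebesgue_measure R)%E.

Definition homdim n := (2 * n + 2)%N.

Section sublaplacian.
Context {R : realType} (n : nat).
Implicit Types (f : heis R n -> R) (F : heis R n -> R[i]).

Definition dx (j : 'I_n) f : heis R n -> R := 'D_((delta_mx ord0 j, 0), 0) f.
Definition dy (j : 'I_n) f : heis R n -> R := 'D_((0, delta_mx ord0 j), 0) f.
Definition dtau f : heis R n -> R := 'D_((0, 0), 1) f.

Definition fieldX j f : heis R n -> R :=
  fun eta => dx j f eta - eta.1.2 ord0 j / 2 * dtau f eta.
Definition fieldY j f : heis R n -> R :=
  fun eta => dy j f eta + eta.1.1 ord0 j / 2 * dtau f eta.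

Definition sublaplacianR f : heis R n -> R :=
  fun eta => \sum_(j < n) (fieldX j (fieldX j f) eta + fieldY j (fieldY j f) eta).

Definition sublaplacian F : heis R n -> R[i] :=
  fun eta => Complex (sublaplacianR (ReC \o F) eta)
                     (sublaplacianR (ImC \o F) eta).

Definition smooth f := forall (vs : seq (heis R n)) (v : heis R n),
  let g := foldr (fun w h => 'D_w h) f vs in
  continuous g /\ forall eta, derivable g eta v.

Definition test_function F :=
  [/\ smooth (ReC \o F), smooth (ImC \o F) &
   exists2 K : set (heis R n), compact K & forall eta, ~ K eta -> F eta = 0].

(* E is the resolution of the self-adjoint operator -Delta_H: the latter is
   essentially self-adjoint on the test functions, so it has only one
   self-adjoint extension. *)
Definition resolves_sublaplacian (E : resolution (heis_measure R n)) :=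
  forall F, test_function F ->
    is_fcalc E id F (fun eta => - sublaplacian F eta).

(* G = (-Delta_H)^alpha F.  The spectrum lies in [0, +oo[, so the values of
   [t `^ alpha] for t < 0 are irrelevant. *)
Definition is_sublaplacian_power (alpha : R) F G :=
  exists2 E : resolution (heis_measure R n), resolves_sublaplacian E &
    is_fcalc E (fun t => t `^ alpha) F G.

(* The solution in L^2 of the Cauchy problem: continuous on [s, +oo[ with
   u(s) = u0, differentiable and solving the equation on ]s, +oo[ (for a general
   u0 in L^2, u is not differentiable at s). *)
Definition heat_solution (alpha s : R) (u0 : heis R n -> R[i])
    (u : R -> heis R n -> R[i]) :=
  [/\ forall t, s <= t -> L2 (heis_measure R n) (u t),
      {ae heis_measure R n, forall eta, u s eta = u0 eta},
      forall t, s <= t ->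
        sqL2norm (heis_measure R n) (fun eta => u t' eta - u t eta)
          @[t' --> within [set t' | s <= t'] (nbhs t)] --> 0%E &
      forall t, s < t -> exists2 G, is_sublaplacian_power alpha (u t) G &
        sqL2norm (heis_measure R n)
          (fun eta => (h^-1)%:C%C * (u (t + h) eta - u t eta) + G eta)
          @[h --> 0^'] --> 0%E].

End sublaplacian.

(** * Fourier transform and decay indicators *)

Section hermite.
Context {R : realType}.

Fixpoint hermite_poly (m : nat) : {poly R} :=
  if m is m'.+1 then 2%:R *: ('X * hermite_poly m') - (hermite_poly m')^`()
  else 1.

Definition hermite_fun1 (m : nat) (x : R) : R :=
  (Num.sqrt (2 ^+ m * m`!%:R * Num.sqrt pi))^-1 *
  (hermite_poly m).[x] * expR (- (x ^+ 2 / 2)).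

Definition hermite_fun n (k : {ffun 'I_n -> nat}) (w : 'rV[R]_n) : R[i] :=
  (\prod_(i < n) hermite_fun1 (k i) (w ord0 i))%:C%C.

Definition hermite_ev n (k : {ffun 'I_n -> nat}) : R :=
  (2 * (\sum_(i < n) k i) + n)%:R.

End hermite.

Section fourier.
Context {R : realType} (n : nat).
Implicit Types (lam : R) (k l : {ffun 'I_n -> nat}).

Definition dotr (x y : 'rV[R]_n) : R := \sum_(i < n) x ord0 i * y ord0 i.

Definition expi (theta : R) : R[i] := Complex (cos theta) (sin theta).

Definition schrodinger lam (eta : heis R n) (phi : 'rV[R]_n -> R[i]) :
    'rV[R]_n -> R[i] :=
  let: (x, y, tau) := eta in
  fun w => expi (lam * (tau + dotr x y / 2)) *
           expi (Num.sg lam * Num.sqrt `|lam| * dotr y w) *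
           phi (w + Num.sqrt `|lam| *: x).

(* <f^(lam) phi, psi> for f^(lam) = \int f(eta) pi_lam(eta)^* d eta, an operator
   integral in the weak sense:
   <pi_lam(eta)^* phi, psi> = <phi, pi_lam(eta) psi>. *)
Definition fourier_form (f : heis R n -> R[i]) lam
    (phi psi : 'rV[R]_n -> R[i]) : R[i] :=
  integralC (heis_measure R n)
    (fun eta => f eta * inner (lebesgue_row n) phi (schrodinger lam eta psi)).

(* Matrix entries, with the row index first:
   f^(lam)_{k,l} = <f^(lam) e_l, e_k>.
   Since (X f)^(lam) = pi_lam(X) f^(lam) for the left-invariant fields X_j and
   Y_j, this is the order for which
   (-Delta_H f)^(lam)_{k,l} = |lam| mu_k f^(lam)_{k,l};
   in the opposite order <f^(lam) e_k, e_l> the factor would be |lam| mu_l, and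
   the decay of the heat flow is not governed by the cut-off |lam| mu_k <= rho^2
   of [decay_ratio]. *)
Definition fourier_coef (f : heis R n -> R[i]) lam k l : R[i] :=
  fourier_form f lam (hermite_fun l) (hermite_fun k).

Definition sqHSnorm (G : {ffun 'I_n -> nat} -> {ffun 'I_n -> nat} -> R[i]) :
    \bar R :=
  (\esum_(kl in [set: {ffun 'I_n -> nat} * {ffun 'I_n -> nat}])
     (sqnormC (G kl.1 kl.2))%:E)%E.

(* F is the matrix of the Fourier transform of f in L^2, the extension by
   continuity from L^1 cap L^2 for the norm of the Plancherel formula. *)
Definition is_fourier (f : heis R n -> R[i])
    (F : R -> {ffun 'I_n -> nat} -> {ffun 'I_n -> nat} -> R[i]) :=
  (forall k l, measurable_complex (fun lam => F lam k l)) /\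
  exists f_ : nat -> heis R n -> R[i],
    [/\ forall j, L1 (heis_measure R n) (f_ j) /\ L2 (heis_measure R n) (f_ j),
        sqL2norm (heis_measure R n) (fun eta => f_ j eta - f eta)
          @[j --> \oo] --> 0%E &
        (\int[lebesgue_measure]_(lam in [set lam : R | lam != 0%R])
           (sqHSnorm (fun k l => (fourier_coef (f_ j) lam k l - F lam k l)%R) *
            (`|lam| ^+ n)%:E))%E
          @[j --> \oo] --> 0%E].

(* Determined for almost every lam when f is in L^2. *)
Definition fourier (f : heis R n -> R[i]) :
    R -> {ffun 'I_n -> nat} -> {ffun 'I_n -> nat} -> R[i] :=
  xget (fun _ _ _ => 0) [set F | is_fourier f F].

(* The normalization of the decay indicators; with Lebesgue measure on heis the
   constant of the Plancherel formula is (2 * pi) ^- (n + 1), but only the sign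
   of this factor matters here. *)
Definition plancherel_cst : R := (2 * pi) ^- (3 * n + 1).

Definition decay_ratio (r : R) (u0 : heis R n -> R[i]) (rho : R) : \bar R :=
  ((rho `^ (- 2 * r - (homdim n)%:R) * plancherel_cst)%:E *
   \esum_(kl in [set: {ffun 'I_n -> nat} * {ffun 'I_n -> nat}])
     \int[lebesgue_measure]_(lam in
         [set lam : R | (lam != 0 /\ `|lam| <= (hermite_ev kl.1)^-1 * rho ^+ 2)%R])
       (`|lam| ^+ n * sqnormC (fourier u0 lam kl.1 kl.2))%:E)%E.

Definition decay_lower r u0 : \bar R := limf_einf (decay_ratio r u0) 0^'+.
Definition decay_upper r u0 : \bar R := limf_esup (decay_ratio r u0) 0^'+.

End fourier.

(* Main.v *)
(* The Fourier transform of f is read as a function of (lam, (k, l)) in L^2 of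
Lebesgue times counting measure. Its Plancherel formula follows from the one on
the line, in tau, and from the completeness of the Hermite functions: the
coefficients <e_l, pi_lam(z) e_k> are an orthogonal basis in z. Testing -Delta_H
against these functions of z times Hermite functions of tau shows that it acts,
even weakly, as the multiplication by the symbol |lam| mu_k.
   Let E be any spectral resolution of -Delta_H. On the range of E([a, b)) the
operator A satisfies |(A - c)^j f| <= r^j |f| for c = (a + b)/2, r = (b - a)/2,
so the transform of f vanishes where the symbol is outside [a, b]. Hence E([a, b))
is the multiplication by the indicator of a <= |lam| mu_k < b, and decay_ratio is
a multiple of rho^(-2r-Q) |E([0, rho^2)) u0|^2.
   By Gronwall, |E([a, b)) u(t)|^2 lies between exp(-2 b^alpha (t - s)) and
exp(-2 a^alpha (t - s)) times its value at s. For the lower bound, take a = 0 and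
b^alpha of order 1/(1 + t - s); for the upper bound, sum over the pieces where
x^alpha (t - s) is in [j, j + 1). *)

Require Import Defs.
From HB Require Import structures.
From mathcomp Require Import all_boot all_order all_algebra.
From mathcomp Require Import all_classical all_reals all_analysis.
From mathcomp Require Import measurable_realfun ring lra.
Set Implicit Arguments.
Unset Strict Implicit.
Unset Printing Implicit Defensive.
Import Order.TTheory GRing.Theory Num.Theory.
Import numFieldNormedType.Exports.
Local Open Scope classical_set_scope.
Local Open Scope ring_scope.

(** A resolution is tied to -Delta_H on test functions only, so the operator is reached weakly: for
    f in the range of E([a, b)) and g = A f, <f, -Delta_H h> = <g, h> for all test functions h. The
    matrix coefficients to be tested are no test functions: they are Gaussian in z and oscillate in
    tau, at a frequency lam on which their profile in z depends. Hence a detour. A profile with a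
    frozen parameter a, times a Gaussian factor in tau, is reached by cutoffs. For frozen a it is
    not an eigenfunction: a defect remains, weighted by |z|^2 / 4 and carrying the factor a^4 -
    lam^2 at frequency lam. All Hermite moments in the frequency together give an identity for
    almost every lam, simultaneously for all positive rational a, and a -> sqrt |lam| removes the
    defect. The equation provides a resolution at each time, possibly a different one. Identifying
    E([a, b)) with a multiplication makes all of them agree on half-open intervals, which is all
    that the energy estimates use. *)

Local Notation meas := (measurable_fun setT).
Local Notation measC := measurable_complex.
Local Notation mcomp := measurableT_comp.
Local Notation mEFinP := measurable_EFinP.
Local Notation leb := (@lebesgue_measure _).

Notation ReC := (@complex.Re _).
Notation ImC := (@complex.Im _).

(** * Complex L^2 spaces *)

Section complex_algebra.
Context {R : realType}.
Implicit Types (a b : R[i]) (x : R).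

Lemma complexP a b : ReC a = ReC b -> ImC a = ImC b -> a = b.
Proof. by case: a b => [a1 a2] [b1 b2] /= -> ->. Qed.

Lemma ReD a b : ReC (a + b) = ReC a + ReC b. Proof. exact: raddfD. Qed.
Lemma ImD a b : ImC (a + b) = ImC a + ImC b. Proof. exact: raddfD. Qed.
Lemma ReN a : ReC (- a) = - ReC a. Proof. exact: raddfN. Qed.
Lemma ImN a : ImC (- a) = - ImC a. Proof. exact: raddfN. Qed.
Lemma ReM a b : ReC (a * b) = ReC a * ReC b - ImC a * ImC b.
Proof. by case: a b => [? ?] [? ?]. Qed.
Lemma ImM a b : ImC (a * b) = ReC a * ImC b + ImC a * ReC b.
Proof. by case: a b => [? ?] [? ?]. Qed.
Lemma Re_conj a : ReC (conjc a) = ReC a. Proof. by case: a. Qed.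
Lemma Im_conj a : ImC (conjc a) = - ImC a. Proof. by case: a. Qed.
Lemma Re_sum I (s : seq I) (P : pred I) (F : I -> R[i]) :
 ReC (\sum_(i <- s | P i) F i) = \sum_(i <- s | P i) ReC (F i).
Proof. exact: raddf_sum. Qed.
Lemma Im_sum I (s : seq I) (P : pred I) (F : I -> R[i]) :
 ImC (\sum_(i <- s | P i) F i) = \sum_(i <- s | P i) ImC (F i).
Proof. exact: raddf_sum. Qed.

Definition cE := (ReD, ImD, ReN, ImN, ReM, ImM, Re_conj, Im_conj, Re_sum, Im_sum).

Lemma sqnormC_ge0 a : 0 <= sqnormC a.
Proof. by rewrite addr_ge0 ?sqr_ge0. Qed.
Lemma sqnormCM a b : sqnormC (a * b) = sqnormC a * sqnormC b.
Proof. by rewrite /sqnormC !cE; ring. Qed.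
Lemma sqnormC_conj a : sqnormC (conjc a) = sqnormC a.
Proof. by rewrite /sqnormC !cE sqrrN. Qed.
Lemma sqnormCN a : sqnormC (- a) = sqnormC a.
Proof. by rewrite /sqnormC !cE !sqrrN. Qed.
Lemma sqnormC0 : sqnormC (0 : R[i]) = 0.
Proof. by rewrite /sqnormC/= expr0n addr0. Qed.
Lemma sqnormC_eq0 a : sqnormC a = 0 -> a = 0.
Proof.
move=> /eqP; rewrite paddr_eq0 ?sqr_ge0// !sqrf_eq0 => /andP[/eqP a1 /eqP a2].
exact: complexP.
Qed.
Lemma sqnormCD_le a b : sqnormC (a + b) <= 2 * (sqnormC a + sqnormC b).
Proof.
rewrite /sqnormC !cE -subr_ge0.
have := sqr_ge0 (ReC a - ReC b); have := sqr_ge0 (ImC a - ImC b); nra.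
Qed.
End complex_algebra.

Section measC.
Context d (T : measurableType d) (R : realType).
Implicit Types f g : T -> R[i].

Lemma mcD f g : measC f -> measC g ->
 measC (fun x => f x + g x).
Proof.
move=> [f1 f2] [g1 g2]; split.
 by rewrite (_ : _ \o _ = fun x => ReC (f x) + ReC (g x));
  [exact: measurable_funD|apply/funext => x /=; rewrite ReD].
by rewrite (_ : _ \o _ = fun x => ImC (f x) + ImC (g x));
  [exact: measurable_funD|apply/funext => x /=; rewrite ImD].
Qed.

Lemma mcM f g : measC f -> measC g ->
 measC (fun x => f x * g x).
Proof.
move=> [f1 f2] [g1 g2]; split.
 rewrite (_ : _ \o _ = fun x => ReC (f x) * ReC (g x) - ImC (f x) * ImC (g x)).
  by apply: measurable_funB; exact: measurable_funM.
 by apply/funext => x /=; rewrite ReM.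
rewrite (_ : _ \o _ = fun x => ReC (f x) * ImC (g x) + ImC (f x) * ReC (g x)).
 by apply: measurable_funD; exact: measurable_funM.
by apply/funext => x /=; rewrite ImM.
Qed.

Lemma mc_cst (c : R[i]) : measC (fun _ : T => c).
Proof. by split; exact: measurable_cst. Qed.

Lemma mcZ c f : measC f -> measC (fun x => c * f x).
Proof. by apply: mcM; exact: mc_cst. Qed.

Lemma mcN f : measC f -> measC (fun x => - f x).
Proof.
by move=> /(mcZ (-1)); under eq_fun do rewrite mulN1r.
Qed.

Lemma mcB f g : measC f -> measC g ->
 measC (fun x => f x - g x).
Proof. by move=> mf mg; apply: mcD => //; exact: mcN. Qed.

Lemma mc_conj f : measC f -> measC (fun x => conjc (f x)).
Proof.
move=> [f1 f2]; split.
 by rewrite (_ : _ \o _ = ReC \o f)//; apply/funext => x /=; rewrite Re_conj.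
rewrite (_ : _ \o _ = fun x => - ImC (f x)); first exact: mcomp.
by apply/funext => x /=; rewrite Im_conj.
Qed.

Lemma mc_prod (I : Type) (s : seq I) (P : pred I) (F : I -> T -> R[i]) :
 (forall i, measC (F i)) ->
 measC (fun x => \prod_(i <- s | P i) F i x).
Proof.
move=> mF; elim: s => [|i s IH].
 by under eq_fun do rewrite big_nil; exact: mc_cst.
under eq_fun do rewrite big_cons.
by case: (P i) => //; apply: mcM.
Qed.

Lemma mc_real (f : T -> R) : meas f ->
 measC (fun x => (f x)%:C%C).
Proof. by move=> mf; split => //=; exact: measurable_cst. Qed.

Lemma mc_Complex (f g : T -> R) : meas f -> meas g ->
 measC (fun x => Complex (f x) (g x)).
Proof. by []. Qed.

Lemma measurable_sqnormC f : measC f ->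
 meas (fun x => sqnormC (f x)).
Proof.
move=> [f1 f2]; apply: measurable_funD.
 exact: (measurable_funX 2 f1).
exact: (measurable_funX 2 f2).
Qed.

End measC.

Lemma mc_comp d d' (T : measurableType d) (T' : measurableType d') (R : realType)
  (f : T' -> R[i]) (h : T -> T') :
 measC f -> meas h -> measC (f \o h).
Proof. by move=> [f1 f2] mh; split; [exact: (mcomp f1)|exact: (mcomp f2)]. Qed.

(** * Real integrals and limit theorems *)

Section real_integrals.
Context d (T : measurableType d) (R : realType) (mu : {measure set T -> \bar R}).
Implicit Types f g : T -> R.

Definition intg f := mu.-integrable setT (EFin \o f).

Lemma intg_meas f : intg f -> meas f.
Proof. by move=> /integrableP[/mEFinP]. Qed.

Lemma intg_le f g : meas f -> (forall x, `|f x| <= g x) ->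
 intg g -> intg f.
Proof.
move=> mf fg ig; apply: (@le_integrable _ _ _ mu setT measurableT _ (EFin \o g)) => //.
 exact/mEFinP.
by move=> x _ /=; rewrite lee_fin (le_trans (fg x))// ler_norm.
Qed.

Lemma intgD f g : intg f -> intg g -> intg (fun x => f x + g x).
Proof. by move=> f1 g1; apply: (integrableD measurableT f1 g1). Qed.
Lemma intgN f : intg f -> intg (fun x => - f x).
Proof. by move=> f1; apply: (integrableN f1). Qed.
Lemma intgB f g : intg f -> intg g -> intg (fun x => f x - g x).
Proof. by move=> f1 g1; apply: intgD => //; apply: intgN. Qed.
Lemma intgZ c f : intg f -> intg (fun x => c * f x).
Proof. by move=> f1; apply: (integrableZl measurableT c f1). Qed.
Lemma intg0 : intg (fun=> 0).
Proof. exact: integrable0. Qed.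
Lemma intg_abs f : intg f -> intg (fun x => `|f x|).
Proof. by move=> f1; apply: (integrable_norm f1). Qed.
Lemma intg_absP f : meas f -> intg (fun x => `|f x|) -> intg f.
Proof. by move=> mf; apply: intg_le. Qed.

Lemma intgMb f g M : intg f -> meas g -> (forall x, `|g x| <= M) ->
 intg (fun x => f x * g x).
Proof.
move=> f1 mg gM; apply: (@intg_le _ (fun x => M * `|f x|)).
- by apply: measurable_funM => //; exact: intg_meas.
- by move=> x; rewrite normrM mulrC ler_wpM2r.
- by apply: intgZ; apply: intg_abs.
Qed.

Lemma intgP f : meas f -> (forall x, 0 <= f x) ->
 intg f <-> ((\int[mu]_x (f x)%:E) < +oo)%E.
Proof.
move=> mf f0; split.
 move=> /integrableP[_]; rewrite (eq_integral (fun x => (f x)%:E))// => x _ /=.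
 by rewrite ger0_norm.
move=> h; apply/integrableP; split; first exact/mEFinP.
by rewrite (eq_integral (fun x => (f x)%:E))// => x _ /=; rewrite ger0_norm.
Qed.

Lemma intg_indic (A : set T) : measurable A -> (mu A < +oo)%E -> intg (fun x => \1_A x).
Proof.
move=> mA fA; apply/integrableP; split; first by apply/mEFinP; exact: measurable_indic.
rewrite (eq_integral (fun x => (\1_A x)%:E)); last by move=> t _; rewrite gee0_abs// lee_fin.
by rewrite integral_indic// setIT.
Qed.

Lemma intgE f : intg f -> (\int[mu]_x (f x)%:E = (\int[mu]_x f x)%:E)%E.
Proof. by move=> f1; rewrite fineK//; exact: integrable_fin_num. Qed.

Lemma RintD f g : intg f -> intg g ->
 \int[mu]_x (f x + g x) = \int[mu]_x f x + \int[mu]_x g x.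
Proof. exact: RintegralD. Qed.
Lemma RintB f g : intg f -> intg g ->
 \int[mu]_x (f x - g x) = \int[mu]_x f x - \int[mu]_x g x.
Proof. exact: RintegralB. Qed.
Lemma RintZ c f : intg f -> \int[mu]_x (c * f x) = c * \int[mu]_x f x.
Proof. by move=> f1; rewrite RintegralZl. Qed.
Lemma RintN f : intg f -> \int[mu]_x (- f x) = - \int[mu]_x f x.
Proof.
move=> f1; rewrite -[RHS]mulN1r -RintZ//.
by apply: eq_Rintegral => x _; rewrite mulN1r.
Qed.
Lemma Rintg0 : \int[mu]_x (0 : R) = 0.
Proof. by rewrite /Rintegral integral0. Qed.
Lemma Rint_ge0 f : (forall x, 0 <= f x) -> 0 <= \int[mu]_x f x.
Proof. by move=> f0; apply: Rintegral_ge0. Qed.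
Lemma Rint_le f g : intg f -> intg g -> (forall x, f x <= g x) ->
 \int[mu]_x f x <= \int[mu]_x g x.
Proof. by move=> f1 g1 fg; apply: le_Rintegral. Qed.
Lemma Rint_norm f : intg f -> `|\int[mu]_x f x| <= \int[mu]_x `|f x|.
Proof. by move=> f1; apply: le_normr_Rintegral. Qed.

Lemma Rint_ae f g : meas f -> meas g ->
 {ae mu, forall x, f x = g x} -> \int[mu]_x f x = \int[mu]_x g x.
Proof.
move=> mf mg fg; rewrite /Rintegral; congr fine.
apply: ae_eq_integral => //; [exact/mEFinP..|].
by apply: filterS fg => x /= -> .
Qed.

Lemma intg_ae f g : meas f -> meas g ->
 {ae mu, forall x, f x = g x} -> intg f -> intg g.
Proof.
move=> mf mg fg /integrableP[_ f1]; apply/integrableP; split; first exact/mEFinP.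
rewrite -(@ae_eq_integral _ _ _ mu setT (fun x => `|(g x)%:E|)%E (fun x => `|(f x)%:E|)%E)//.
- by apply/mEFinP; apply: mcomp.
- by apply/mEFinP; apply: mcomp.
- by apply: filterS fg => x /= ->.
Qed.

Lemma intg_sum (I : Type) (s : seq I) (P : pred I) (F : I -> T -> R) :
 (forall i, P i -> intg (F i)) -> intg (fun x => \sum_(i <- s | P i) F i x).
Proof.
move=> iF; elim: s => [|i s IH].
 by under eq_fun do rewrite big_nil; exact: intg0.
under eq_fun do rewrite big_cons.
by case Pi : (P i) => //; apply: intgD => //; exact: iF.
Qed.

Lemma Rint_sum (I : Type) (s : seq I) (P : pred I) (F : I -> T -> R) :
 (forall i, P i -> intg (F i)) ->
 \int[mu]_x (\sum_(i <- s | P i) F i x) = \sum_(i <- s | P i) \int[mu]_x F i x.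
Proof.
move=> iF; elim: s => [|i s IH].
 by under eq_Rintegral do rewrite big_nil; rewrite big_nil Rintg0.
under eq_Rintegral do rewrite big_cons.
rewrite big_cons; case: ifP => // Pi; rewrite RintD ?IH//; first exact: iF.
by apply: intg_sum.
Qed.

Lemma Rint_dct (f_ : nat -> T -> R) f g :
 (forall n, meas (f_ n)) -> meas f ->
 {ae mu, forall x, f_ n x @[n --> \oo] --> f x} ->
 intg g -> (forall n x, `|f_ n x| <= g x) ->
 intg f /\ \int[mu]_x f_ n x @[n --> \oo] --> \int[mu]_x f x.
Proof.
move=> mf_ mf ff ig fg.
have [||||| i1 _ i2] := @dominated_convergence _ _ _ mu setT measurableT
 (fun n => EFin \o f_ n) (EFin \o f) (EFin \o g).
- by move=> n; exact/mEFinP.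
- exact/mEFinP.
- apply: filterS ff => x + _ /=.
 by move=> h; apply: cvg_EFin => //; exact: nearW.
- exact: ig.
- by apply: aeW => x n _ /=; rewrite lee_fin.
split => //.
apply: fine_cvg.
by rewrite -intgE.
Qed.

Lemma Rint_fatou (f_ : nat -> T -> R) f (M : R) :
 (forall n, meas (f_ n)) -> meas f ->
 (forall n x, 0 <= f_ n x) -> (forall x, 0 <= f x) ->
 {ae mu, forall x, f_ n x @[n --> \oo] --> f x} ->
 (forall n, (\int[mu]_x (f_ n x)%:E <= M%:E)%E) ->
 (\int[mu]_x (f x)%:E <= M%:E)%E.
Proof.
move=> mf_ mf f_0 f0 ff fM.
(* Fatou bounds the integral of the lower limit, which agrees with [f] only almost everywhere. *)
rewrite (@ae_eq_integral _ _ _ mu setT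
 (fun x => limn_einf (fun n => (f_ n x)%:E)) (EFin \o f)).
- apply: (le_trans (fatou _ _ _ _)) => //.
 + by move=> n; exact/mEFinP.
 + by move=> n x _; rewrite lee_fin.
 rewrite limn_einf_lim; apply: lime_le; first exact: is_cvg_einfs.
 apply: nearW => n; apply: (le_trans _ (fM n)).
 by apply: ereal_inf_lbound; exists n => //=.
- by [].
- exact/mEFinP.
- rewrite (_ : (fun _ => _) = (fun x => - limn_esup (fun n => (- (f_ n x))%:E))%E).
  apply: mcomp => //; apply: measurable_fun_limn_esup => n.
  by apply/mEFinP; exact: mcomp.
 by apply/funext => x; rewrite -limn_einfN; congr limn_einf; apply/funext => n /=; rewrite opprK.
- apply: filterS ff => x ffx _ /=.
 have /cvg_limn_einf_sup[] : (f_ n x)%:E @[n --> \oo] --> (f x)%:E.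
  by apply: cvg_EFin => //; exact: nearW.
 by move=> -> _.
Qed.

End real_integrals.

(** * The Hilbert space structure of L^2 *)

Section complex_L2.
Context d (T : measurableType d) (R : realType) (mu : {measure set T -> \bar R}).
Implicit Types f g h : T -> R[i].
Local Notation L1 := (L1 mu).
Local Notation L2 := (L2 mu).
Local Notation intg := (intg mu).
Local Notation integralC := (integralC mu).
Local Notation inner := (inner mu).

Lemma L1P f : L1 f <-> intg (fun x => ReC (f x)) /\ intg (fun x => ImC (f x)).
Proof. by []. Qed.

Lemma L1_mc f : L1 f -> measC f.
Proof. by move=> [f1 f2]; split; [exact: (intg_meas f1)|exact: (intg_meas f2)]. Qed.

Lemma L1D f g : L1 f -> L1 g -> L1 (fun x => f x + g x).
Proof.
move=> [f1 f2] [g1 g2]; apply/L1P; split.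
 by under eq_fun do rewrite ReD; exact: intgD.
by under eq_fun do rewrite ImD; exact: intgD.
Qed.

Lemma L1Z c f : L1 f -> L1 (fun x => c * f x).
Proof.
move=> [f1 f2]; apply/L1P; split.
 by under eq_fun do rewrite ReM; apply: intgB; exact: intgZ.
by under eq_fun do rewrite ImM; apply: intgD; exact: intgZ.
Qed.

Lemma L1N f : L1 f -> L1 (fun x => - f x).
Proof. by move=> /(L1Z (-1)); under eq_fun do rewrite mulN1r. Qed.

Lemma L1B f g : L1 f -> L1 g -> L1 (fun x => f x - g x).
Proof. by move=> f1 g1; apply: L1D => //; exact: L1N. Qed.

Lemma L1Mb f w M : L1 f -> measC w ->
 (forall x, `|ReC (w x)| <= M) -> (forall x, `|ImC (w x)| <= M) ->
 L1 (fun x => f x * w x).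
Proof.
move=> [f1 f2] [w1 w2] M1 M2; apply/L1P; split.
 by under eq_fun do rewrite ReM; apply: intgB; apply: (intgMb _ _ (M := M)).
by under eq_fun do rewrite ImM; apply: intgD; apply: (intgMb _ _ (M := M)).
Qed.

Lemma integralCD f g : L1 f -> L1 g ->
 integralC (fun x => f x + g x) = integralC f + integralC g.
Proof.
move=> [f1 f2] [g1 g2]; apply: complexP; rewrite !cE /=.
 by under eq_Rintegral do rewrite ReD; exact: RintD.
by under eq_Rintegral do rewrite ImD; exact: RintD.
Qed.

Lemma integralCZ c f : L1 f -> integralC (fun x => c * f x) = c * integralC f.
Proof.
move=> [f1 f2]; apply: complexP; rewrite !cE /=.
 under eq_Rintegral do rewrite ReM.
 by rewrite RintB ?RintZ//; exact: intgZ.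
under eq_Rintegral do rewrite ImM.
by rewrite RintD ?RintZ//; exact: intgZ.
Qed.

Lemma integralC0 : integralC (fun=> 0) = 0.
Proof. by apply: complexP; rewrite /= Rintg0. Qed.

Lemma integralCN f : L1 f -> integralC (fun x => - f x) = - integralC f.
Proof.
move=> f1; rewrite -[RHS]mulN1r -integralCZ//; congr integralC.
by apply/funext => x; rewrite mulN1r.
Qed.

Lemma integralCB f g : L1 f -> L1 g ->
 integralC (fun x => f x - g x) = integralC f - integralC g.
Proof. by move=> f1 g1; rewrite integralCD ?integralCN//; exact: L1N. Qed.

Lemma integralC_conj f : L1 f -> integralC (fun x => conjc (f x)) = conjc (integralC f).
Proof.
move=> [f1 f2]; apply: complexP; rewrite !cE /=.
 by apply: eq_Rintegral => x _; rewrite Re_conj.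
by under eq_Rintegral do rewrite Im_conj; exact: RintN.
Qed.

Lemma integralC_ae f g : measC f -> measC g ->
 {ae mu, forall x, f x = g x} -> integralC f = integralC g.
Proof.
move=> [f1 f2] [g1 g2] fg; apply: complexP => /=.
 by apply: Rint_ae => //; apply: filterS fg => x ->.
by apply: Rint_ae => //; apply: filterS fg => x ->.
Qed.

Lemma L1_ae f g : measC f -> measC g ->
 {ae mu, forall x, f x = g x} -> L1 f -> L1 g.
Proof.
move=> [f1 f2] [g1 g2] fg [h1 h2]; apply/L1P; split.
 by apply: (@intg_ae _ _ _ _ (fun x => ReC (f x))) => //; apply: filterS fg => x ->.
by apply: (@intg_ae _ _ _ _ (fun x => ImC (f x))) => //; apply: filterS fg => x ->.
Qed.

Lemma L2P f : L2 f <-> measC f /\ intg (fun x => sqnormC (f x)).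
Proof.
split=> -[mf h]; split => //.
 apply/intgP => //; first exact: measurable_sqnormC.
 by move=> x; exact: sqnormC_ge0.
apply/intgP => //; first exact: measurable_sqnormC.
by move=> x; exact: sqnormC_ge0.
Qed.

Lemma L2_mc f : L2 f -> measC f. Proof. by case. Qed.

Lemma L2_le f g : measC f -> L2 g ->
 (forall x, sqnormC (f x) <= sqnormC (g x)) -> L2 f.
Proof.
move=> mf /L2P[mg ig] fg; apply/L2P; split => //.
apply: intg_le ig; first exact: measurable_sqnormC.
by move=> x; rewrite ger0_norm// sqnormC_ge0.
Qed.

Lemma L2Z c f : L2 f -> L2 (fun x => c * f x).
Proof.
move=> /L2P[mf i]; apply/L2P; split; first exact: mcZ.
by under eq_fun do rewrite sqnormCM; exact: intgZ.
Qed.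

Lemma L2_conj f : L2 f -> L2 (fun x => conjc (f x)).
Proof.
move=> /L2P[mf i]; apply/L2P; split; first exact: mc_conj.
by under eq_fun do rewrite sqnormC_conj.
Qed.

Lemma L2N f : L2 f -> L2 (fun x => - f x).
Proof. by move=> /(L2Z (-1)); under eq_fun do rewrite mulN1r. Qed.

Lemma L2D f g : L2 f -> L2 g -> L2 (fun x => f x + g x).
Proof.
move=> /L2P[mf i] /L2P[mg j]; apply/L2P; split; first exact: mcD.
apply: (@intg_le _ _ _ _ _ (fun x => 2 * (sqnormC (f x) + sqnormC (g x)))).
- by apply: measurable_sqnormC; exact: mcD.
- by move=> x; rewrite ger0_norm ?sqnormC_ge0// sqnormCD_le.
- by apply: intgZ; exact: intgD.
Qed.

Lemma L2B f g : L2 f -> L2 g -> L2 (fun x => f x - g x).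
Proof. by move=> f1 g1; apply: L2D => //; exact: L2N. Qed.

Lemma L2_0 : L2 (fun=> 0).
Proof.
apply/L2P; split; first exact: mc_cst.
by under eq_fun do rewrite sqnormC0; exact: intg0.
Qed.

Lemma L2_sum (I : Type) (s : seq I) (P : pred I) (F : I -> T -> R[i]) :
 (forall i, P i -> L2 (F i)) -> L2 (fun x => \sum_(i <- s | P i) F i x).
Proof.
move=> iF; elim: s => [|i s IH].
 by under eq_fun do rewrite big_nil; exact: L2_0.
under eq_fun do rewrite big_cons.
by case Pi : (P i) => //; apply: L2D => //; exact: iF.
Qed.

Lemma L2_mul f g : L2 f -> L2 g -> L1 (fun x => f x * g x).
Proof.
move=> /L2P[mf i] /L2P[mg j].
have mfg := mcM mf mg.
have ij := intgD i j.
apply/L1P; split.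
 apply: intg_le ij; first by case: mfg.
 move=> x; rewrite ReM /sqnormC ler_norml.
 have := sqr_ge0 (ReC (f x) - ReC (g x)); have := sqr_ge0 (ImC (f x) - ImC (g x)).
 have := sqr_ge0 (ReC (f x) + ReC (g x)); have := sqr_ge0 (ImC (f x) + ImC (g x)).
 by move=> *; apply/andP; split; nra.
apply: intg_le ij; first by case: mfg.
move=> x; rewrite ImM /sqnormC ler_norml.
have := sqr_ge0 (ReC (f x) - ImC (g x)); have := sqr_ge0 (ImC (f x) - ReC (g x)).
have := sqr_ge0 (ReC (f x) + ImC (g x)); have := sqr_ge0 (ImC (f x) + ReC (g x)).
by move=> *; apply/andP; split; nra.
Qed.

Lemma L2_mulc f g : L2 f -> L2 g -> L1 (fun x => f x * conjc (g x)).
Proof. by move=> f2 g2; apply: L2_mul => //; exact: L2_conj. Qed.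

(** [nrm] is the squared norm and [rip] the real part of the inner product. Both are real, and most
    arguments use the real Hilbert space underlying L^2; [inner_rip] recovers the imaginary part by
    testing against i g. *)
Definition nrm f : R := fine (sqL2norm mu f).
Definition rip f g : R := ReC (inner f g).

Lemma sqL2E f : L2 f -> sqL2norm mu f = (nrm f)%:E.
Proof.
move=> [mf fy]; rewrite fineK// ge0_fin_numE//.
by apply: integral_ge0 => x _; rewrite lee_fin sqnormC_ge0.
Qed.

Lemma nrmE f : nrm f = \int[mu]_x sqnormC (f x).
Proof. by []. Qed.

Lemma nrm_ge0 f : 0 <= nrm f.
Proof. by apply: Rint_ge0 => x; exact: sqnormC_ge0. Qed.

Lemma ripE f g : rip f g = \int[mu]_x (ReC (f x) * ReC (g x) + ImC (f x) * ImC (g x)).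
Proof.
rewrite /rip /=; apply: eq_Rintegral => x _.
by rewrite !cE mulrN opprK.
Qed.

Lemma ripC f g : rip f g = rip g f.
Proof. by rewrite !ripE; apply: eq_Rintegral => x _; congr (_ + _); rewrite mulrC. Qed.

Lemma innerD f g h : L2 f -> L2 g -> L2 h ->
 inner (fun x => f x + g x) h = inner f h + inner g h.
Proof.
move=> f2 g2 h2; rewrite /Defs.inner -integralCD; [|exact: L2_mulc..].
by congr integralC; apply/funext => x; rewrite mulrDl.
Qed.

Lemma innerZ c f h : L2 f -> L2 h -> inner (fun x => c * f x) h = c * inner f h.
Proof.
move=> f2 h2; rewrite /Defs.inner -integralCZ; [|exact: L2_mulc..].
by congr integralC; apply/funext => x; rewrite mulrA.
Qed.

Lemma innerC f g : L2 f -> L2 g -> inner f g = conjc (inner g f).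
Proof.
move=> f2 g2; rewrite /Defs.inner -integralC_conj; last exact: L2_mulc.
by congr integralC; apply/funext => x; rewrite rmorphM/= conjcK mulrC.
Qed.

Lemma ripDl f g h : L2 f -> L2 g -> L2 h ->
 rip (fun x => f x + g x) h = rip f h + rip g h.
Proof. by move=> *; rewrite /rip innerD// cE. Qed.

Lemma ripDr f g h : L2 f -> L2 g -> L2 h ->
 rip h (fun x => f x + g x) = rip h f + rip h g.
Proof. by move=> *; rewrite ripC ripDl// (ripC h f) (ripC h g). Qed.

Lemma ripZl (c : R) f h : L2 f -> L2 h -> rip (fun x => (c%:C)%C * f x) h = c * rip f h.
Proof. by move=> *; rewrite /rip innerZ// cE /= mul0r subr0. Qed.

Lemma ripZr (c : R) f h : L2 f -> L2 h -> rip h (fun x => (c%:C)%C * f x) = c * rip h f.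
Proof. by move=> *; rewrite ripC ripZl// ripC. Qed.

Lemma ripNl f h : L2 f -> L2 h -> rip (fun x => - f x) h = - rip f h.
Proof.
move=> f2 h2; rewrite -[RHS]mulN1r -ripZl//; congr rip.
by apply/funext => x; rewrite rmorphN mulN1r.
Qed.

Lemma ripNr f h : L2 f -> L2 h -> rip h (fun x => - f x) = - rip h f.
Proof. by move=> *; rewrite ripC ripNl// ripC. Qed.

Lemma ripBl f g h : L2 f -> L2 g -> L2 h ->
 rip (fun x => f x - g x) h = rip f h - rip g h.
Proof. by move=> f2 g2 h2; rewrite ripDl ?ripNl//; exact: L2N. Qed.

Lemma ripBr f g h : L2 f -> L2 g -> L2 h ->
 rip h (fun x => f x - g x) = rip h f - rip h g.
Proof. by move=> f2 g2 h2; rewrite ripDr ?ripNr//; exact: L2N. Qed.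

Lemma rip_nrm f : rip f f = nrm f.
Proof. by rewrite ripE nrmE; apply: eq_Rintegral => x _; rewrite /sqnormC !expr2. Qed.

Lemma inner_rip f g : L2 f -> L2 g ->
 inner f g = Complex (rip f g) (rip f (fun x => 'i%C * g x)).
Proof.
move=> f2 g2; apply: complexP => //=.
rewrite ripE; apply: eq_Rintegral => x _; rewrite !cE /=; ring.
Qed.

Lemma nrmZ c f : L2 f -> nrm (fun x => c * f x) = sqnormC c * nrm f.
Proof.
move=> /L2P[mf i]; rewrite !nrmE -RintZ//.
by apply: eq_Rintegral => x _; rewrite sqnormCM.
Qed.

Lemma nrmN f : nrm (fun x => - f x) = nrm f.
Proof. by rewrite !nrmE; apply: eq_Rintegral => x _; rewrite sqnormCN. Qed.

Lemma nrmD f g : L2 f -> L2 g ->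
 nrm (fun x => f x + g x) = nrm f + 2 * rip f g + nrm g.
Proof.
move=> f2 g2; have fg := L2D f2 g2.
rewrite -!rip_nrm ripDl// !ripDr// (ripC g f); ring.
Qed.

Lemma nrmB f g : L2 f -> L2 g ->
 nrm (fun x => f x - g x) = nrm f - 2 * rip f g + nrm g.
Proof.
move=> f2 g2; rewrite nrmD// ?ripNr ?nrmN//; last exact: L2N.
by rewrite mulrN.
Qed.

Lemma rip_CS f g : L2 f -> L2 g -> rip f g ^+ 2 <= nrm f * nrm g.
Proof.
move=> f2 g2.
have key (t : R) : 0 <= nrm f + 2 * (t * rip f g) + t ^+ 2 * nrm g.
 have tg2 : L2 (fun x => t%:C%C * g x) by exact: L2Z.
 have := nrm_ge0 (fun x => f x + t%:C%C * g x).
 rewrite nrmD// ripZr// nrmZ// /sqnormC/= expr0n addr0.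
 by [].
have := nrm_ge0 g; rewrite le_eqVlt => /predU1P[g0|g0].
 rewrite -g0 mulr0 in key *.
 have [->|r0] := eqVneq (rip f g) 0; first by rewrite expr0n.
 (* With |g| = 0 the polynomial in [t] is affine, and this value of [t] makes it -1. *)
 have := key (- (nrm f + 1) / (2 * rip f g)).
 rewrite mulr0 addr0.
 have -> : 2 * (- (nrm f + 1) / (2 * rip f g) * rip f g) = - (nrm f + 1).
  by field.
 by have := nrm_ge0 f; lra.
have := key (- rip f g / nrm g).
have -> : nrm f + 2 * (- rip f g / nrm g * rip f g) + (- rip f g / nrm g) ^+ 2 * nrm g
 = (nrm f * nrm g - rip f g ^+ 2) / nrm g by field; rewrite gt_eqF.
by rewrite pmulr_lge0 ?invr_gt0// subr_ge0.
Qed.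

Lemma nrmD_le f g : L2 f -> L2 g -> nrm (fun x => f x + g x) <= 2 * (nrm f + nrm g).
Proof.
move=> f2 g2.
have := nrm_ge0 (fun x => f x - g x); rewrite nrmB// nrmD//; lra.
Qed.

Lemma nrm_ae f g : measC f -> measC g ->
 {ae mu, forall x, f x = g x} -> nrm f = nrm g.
Proof.
move=> mf mg fg; rewrite !nrmE; apply: Rint_ae; [exact: measurable_sqnormC..|].
by apply: filterS fg => x ->.
Qed.

Lemma L2_ae f g : measC g ->
 {ae mu, forall x, f x = g x} -> L2 f -> L2 g.
Proof.
move=> mg fg /L2P[mf i]; apply/L2P; split => //.
apply: intg_ae i; [exact: measurable_sqnormC..|].
by apply: filterS fg => x ->.
Qed.

Lemma inner_ae f f' g g' : measC f -> measC f' ->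
 measC g -> measC g' ->
 {ae mu, forall x, f x = f' x} -> {ae mu, forall x, g x = g' x} ->
 inner f g = inner f' g'.
Proof.
move=> mf mf' mg mg' ff gg; apply: integralC_ae.
- by apply: mcM => //; exact: mc_conj.
- by apply: mcM => //; exact: mc_conj.
- by apply: filterS2 ff gg => x -> ->.
Qed.

Lemma rip_ae f f' g g' : measC f -> measC f' ->
 measC g -> measC g' ->
 {ae mu, forall x, f x = f' x} -> {ae mu, forall x, g x = g' x} ->
 rip f g = rip f' g'.
Proof. by move=> *; rewrite /rip; congr complex.Re; apply: inner_ae. Qed.

Lemma nrm_eq0 f : L2 f -> nrm f = 0 -> {ae mu, forall x, f x = 0}.
Proof.
move=> f2 f0; have := sqL2E f2; rewrite f0 => h.
have mf : meas (fun x => (sqnormC (f x))%:E).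
 by apply/mEFinP; apply: measurable_sqnormC; case: f2.
have := (ae_eq_integral_abs mu measurableT mf).1.
rewrite (eq_integral (fun x => (sqnormC (f x))%:E)); last first.
 by move=> x _; rewrite gee0_abs// lee_fin sqnormC_ge0.
move=> /(_ h); apply: filterS => x /= /(_ I) [].
exact: sqnormC_eq0.
Qed.

Lemma nrm_ae0 f : {ae mu, forall x, f x = 0} -> measC f -> nrm f = 0.
Proof.
move=> f0 mf; rewrite (nrm_ae mf (mc_cst _ 0) f0) nrmE.
by under eq_Rintegral do rewrite sqnormC0; rewrite Rintg0.
Qed.

Lemma ae_eq_L2 f g : L2 f -> L2 g -> nrm (fun x => f x - g x) = 0 ->
 {ae mu, forall x, f x = g x}.
Proof.
move=> f2 g2 /(nrm_eq0 (L2B f2 g2)); apply: filterS => x /eqP.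
by rewrite subr_eq0 => /eqP.
Qed.

Lemma nrm_cvg (f_ : nat -> T -> R[i]) f : (forall n, L2 (f_ n)) -> L2 f ->
 nrm (fun x => f_ n x - f x) @[n --> \oo] --> 0 ->
 forall g, L2 g -> rip (f_ n) g @[n --> \oo] --> rip f g.
Proof.
move=> f_2 f2 h g g2.
apply/cvgrPdist_le => e e0.
(* Cauchy-Schwarz multiplies this bound by |g|^2; the added 1 covers |g| = 0. *)
have e1 : 0 < e ^+ 2 / (nrm g + 1) by rewrite divr_gt0 ?exprn_gt0// ltr_wpDl ?nrm_ge0.
move/cvgrPdist_le : h => /(_ _ e1); apply: filterS => n.
rewrite sub0r normrN ger0_norm ?nrm_ge0// => fn.
rewrite -ripBl//.
have h0 := rip_CS (L2B f2 (f_2 n)) g2.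
have h1 : nrm (fun x => f x - f_ n x) = nrm (fun x => f_ n x - f x).
 by rewrite -nrmN; congr nrm; apply/funext => x; rewrite opprB.
rewrite h1 in h0.
rewrite -ler_sqr ?nnegrE//; last exact: ltW.
rewrite real_normK ?num_real//; apply: (le_trans h0).
have g0 := nrm_ge0 g.
apply: (le_trans (ler_wpM2r g0 fn)).
rewrite mulrAC ler_pdivrMr; last lra.
by rewrite ler_wpM2l ?sqr_ge0//; lra.
Qed.

Lemma nrm_cvg2 (f_ : nat -> T -> R[i]) f : (forall n, L2 (f_ n)) -> L2 f ->
 nrm (fun x => f_ n x - f x) @[n --> \oo] --> 0 ->
 nrm (f_ n) @[n --> \oo] --> nrm f.
Proof.
move=> f_2 f2 h.
have -> : (fun n => nrm (f_ n)) =
  (fun n => nrm (fun x => f_ n x - f x) + 2 * rip (f_ n) f - nrm f).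
 by apply/funext => n; rewrite nrmB//; ring.
rewrite [X in _ --> X](_ : _ = 0 + 2 * rip f f - nrm f); last by rewrite rip_nrm; ring.
have h2 : 2 * rip (f_ n) f @[n --> \oo] --> 2 * rip f f.
 by apply: cvgM; [exact: cvg_cst|exact: nrm_cvg].
by apply: (cvgB (cvgD h h2)); exact: cvg_cst.
Qed.

End complex_L2.

(** * Completeness of L^2 *)

Section Riesz_Fischer.
Context d (T : measurableType d) (R : realType) (mu : {measure set T -> \bar R}).

Lemma geometric_cauchy_cvg (u : nat -> R) (C : R) :
 (forall k, `|u k.+1 - u k| <= C * 2 ^- k) -> cvgn u.
Proof.
move=> hu; rewrite (funext (eq_sum_telescope u)); apply: is_cvgD; first exact: is_cvg_cst.
apply: normed_cvg; have g0 k := le_trans (normr_ge0 _) (hu k).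
have cg : cvgn (series (geometric C 2^-1)).
 by apply: is_cvg_geometric_series; rewrite ger0_norm ?invf_lt1 ?ltr1n.
by apply: series_le_cvg cg => k; rewrite /= ?exprVn ?normr_ge0 ?g0 ?hu.
Qed.

(* A subsequence with rapidly decreasing increments converges almost everywhere:
  [\sum_k 4^k |f_(k+1) - f_k|^2] is integrable, hence finite almost everywhere. *)
Lemma rapid_ae_cvg (f : nat -> T -> R) :
 (forall k, meas (f k)) ->
 (forall k, (\int[mu]_x ((f k.+1 x - f k x) ^+ 2)%:E <= (8 ^- k)%:E)%E) ->
 {ae mu, forall x, cvgn (f ^~ x)}.
Proof.
move=> mf h.
pose g k x : \bar R := (4 ^+ k * (f k.+1 x - f k x) ^+ 2)%:E.
have g0 k x : (0 <= g k x)%E by rewrite /g lee_fin mulr_ge0 ?sqr_ge0 ?exprn_ge0.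
have mg k : meas (g k).
 apply/mEFinP; apply: measurable_funM; first exact: measurable_cst.
 by apply: measurable_funX; exact: measurable_funB.
have mgs : meas (fun x => \sum_(k <oo) g k x)%E.
 by apply: ge0_emeasurable_sum => // k x _ _.
have gi : (\int[mu]_x (\sum_(k <oo) g k x) < +oo)%E.
 rewrite integral_nneseries//.
 apply: (@le_lt_trans _ _ (\sum_(k <oo) (2 ^- k)%:E)%E).
  apply: lee_nneseries => k _; first by move=> _; exact: integral_ge0.
  rewrite /g; under eq_integral do rewrite EFinM.
  rewrite ge0_integralZl ?lee_fin ?exprn_ge0//; last 2 first.
   by apply/mEFinP; apply: measurable_funX; exact: measurable_funB.
   by move=> x _; rewrite lee_fin sqr_ge0.
  apply: (le_trans (lee_wpmul2l _ (h k))); first by rewrite lee_fin exprn_ge0.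
  rewrite -EFinM lee_fin -!exprVn -exprMn.
  by have -> : 4 / 8 = 2^-1 :> R by field.
 apply: (@le_lt_trans _ _ 2%:E); last by rewrite ltry.
 apply: lime_le; first by apply: is_cvg_nneseries => k _ _; rewrite lee_fin invr_ge0 exprn_ge0.
 apply: nearW => n; rewrite sumEFin lee_fin.
 suff -> : \sum_(0 <= k < n) 2 ^- k = 2 - 2 * 2 ^- n :> R.
  by rewrite gerBl mulr_ge0// invr_ge0 exprn_ge0.
 elim: n => [|n IH]; first by rewrite big_nil expr0 invr1; ring.
 by rewrite big_nat_recr//= IH -!exprVn exprS; field.
have ig : mu.-integrable setT (fun x => \sum_(k <oo) g k x)%E.
 apply/integrableP; split => //.
 by under eq_integral do rewrite gee0_abs ?nneseries_ge0//.
have := integrable_ae measurableT ig.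
apply: filterS => x /(_ I) gx.
have [C hC] : exists C : R, forall k, 4 ^+ k * (f k.+1 x - f k x) ^+ 2 <= C.
 exists (fine (\sum_(k <oo) g k x)%E) => k.
 rewrite -lee_fin fineK//.
 apply: (le_trans _ (@nneseries_lim_ge _ (fun k => g k x) xpredT 0 k.+1 _)) => //.
 by rewrite big_nat_recr//= leeDr// sume_ge0.
apply: (@geometric_cauchy_cvg _ (Num.sqrt C)) => k.
rewrite -ler_sqr ?nnegrE ?mulr_ge0 ?sqrtr_ge0 ?invr_ge0 ?exprn_ge0//.
have C0 : 0 <= C by apply: le_trans (hC 0%N); rewrite mulr_ge0 ?sqr_ge0.
rewrite real_normK ?num_real// exprMn sqr_sqrtr// -exprVn -exprM mulnC exprM.
rewrite (_ : 2^-1 ^+ 2 = 4^-1 :> R); last by field.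
by rewrite exprVn ler_pdivlMr ?exprn_gt0// mulrC.
Qed.

Local Notation L2 := (L2 mu).
Local Notation nrm := (nrm mu).

Theorem Riesz_Fischer (f : nat -> T -> R[i]) : (forall k, L2 (f k)) ->
 (forall e : R, 0 < e -> exists N, forall m n, (N <= m)%N -> (N <= n)%N ->
   nrm (fun x => f m x - f n x) <= e) ->
 exists2 g, L2 g & nrm (fun x => f n x - g x) @[n --> \oo] --> 0.
Proof.
move=> f2 cf.
have /choice[N hN] : forall k, exists N, forall m n, (N <= m)%N -> (N <= n)%N ->
  nrm (fun x => f m x - f n x) <= 8 ^- k by move=> k; exact: cf.
(* A nondecreasing subsequence with [N k <= s k]: its k-th increment has squared norm at most 8^-k,
   the rate that [rapid_ae_cvg] asks for. *)
pose s := fix s k := if k is k'.+1 then maxn (s k') (N k) else N 0%N.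
have sN k : (N k <= s k)%N by case: k => [|k] //=; exact: leq_maxr.
have sS k : (s k <= s k.+1)%N by exact: leq_maxl.
have rapid (h : R[i] -> R) : (forall z, h z ^+ 2 <= sqnormC z) ->
  {morph h : x y / x - y} -> (forall k, meas (h \o f k)) ->
  {ae mu, forall x, cvgn (fun k => h (f (s k) x))}.
 move=> hle hB mh; apply: rapid_ae_cvg => k; first exact: mh.
 have d2 := L2B (f2 (s k.+1)) (f2 (s k)).
 apply: (@le_trans _ _ (sqL2norm mu (fun x => f (s k.+1) x - f (s k) x))).
  apply: ge0_le_integral => //.
  - by move=> x _; rewrite lee_fin sqr_ge0.
  - apply/mEFinP; apply: measurable_funX.
   by apply: measurable_funB; exact: mh.
  - by apply/mEFinP; apply: measurable_sqnormC; exact: L2_mc d2.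
  - by move=> x _; rewrite lee_fin -hB.
 rewrite sqL2E// lee_fin; apply: hN => //.
 exact: leq_trans (sN k) (sS k).
have aeRe := rapid ReC _ _ (fun k => (L2_mc (f2 k)).1).
have aeIm := rapid ImC _ _ (fun k => (L2_mc (f2 k)).2).
have {}aeRe : {ae mu, forall x, cvgn (fun k => ReC (f (s k) x))}.
 by apply: aeRe => [z|z w]; rewrite ?cE// /sqnormC lerDl sqr_ge0.
have {}aeIm : {ae mu, forall x, cvgn (fun k => ImC (f (s k) x))}.
 by apply: aeIm => [z|z w]; rewrite ?cE// /sqnormC lerDr sqr_ge0.
(* The upper limit is measurable everywhere and equals the limit wherever the latter exists. *)
pose gR x := fine (limn_esup (fun k => (ReC (f (s k) x))%:E)).
pose gI x := fine (limn_esup (fun k => (ImC (f (s k) x))%:E)).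
pose g x := Complex (gR x) (gI x).
have cvgE (u : nat -> R) : cvgn u -> u n @[n --> \oo] --> fine (limn_esup (EFin \o u)).
 move=> cu; have : (EFin \o u) n @[n --> \oo] --> (limn u)%:E.
  by apply: cvg_EFin; [exact: nearW|exact: cu].
 by move/cvg_limn_einf_sup => [_ ->].
have mlim (h : R[i] -> R) : (forall k, meas (h \o f k)) ->
  meas (fun x => fine (limn_esup (fun k => (h (f (s k) x))%:E))).
 move=> mh; have m : meas (fun x => limn_esup (fun k => (h (f (s k) x))%:E)).
  by apply: measurable_fun_limn_esup => k; apply/mEFinP; exact: mh.
 exact: mcomp m.
have mg : measC g by split; apply: mlim => k; case: (f2 k) => -[].
have cvg_sq m : {ae mu, forall x,
  sqnormC (f m x - f (s k) x) @[k --> \oo] --> sqnormC (f m x - g x)}.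
 apply: filterS2 aeRe aeIm => x /cvgE c1 /cvgE c2.
 rewrite /sqnormC; under eq_fun do rewrite !cE.
 rewrite !cE; apply: cvgD; rewrite expr2; under eq_fun do rewrite expr2.
  by apply: cvgM; apply: cvgB; [exact: cvg_cst|exact: c1|exact: cvg_cst|exact: c1].
 by apply: cvgM; apply: cvgB; [exact: cvg_cst|exact: c2|exact: cvg_cst|exact: c2].
(* Fatou along the tail of the subsequence: the bound 8^-k on |f m - f (s (k + j))|^2 passes to the
   limit in [j]. *)
have small k m : (s k <= m)%N -> (sqL2norm mu (fun x => f m x - g x)%R <= (8 ^- k)%:E)%E.
 move=> km.
 apply: (@Rint_fatou _ _ _ mu (fun j x => sqnormC (f m x - f (s (k + j)%N) x))).
 - by move=> j; apply: measurable_sqnormC; apply: mcB; exact: L2_mc.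
 - by apply: measurable_sqnormC; apply: mcB => //; exact: L2_mc.
 - by move=> j x; exact: sqnormC_ge0.
 - by move=> x; exact: sqnormC_ge0.
 - apply: filterS (cvg_sq m) => x hx.
  under eq_fun do rewrite addnC.
  by rewrite -(@cvg_shiftn k) in hx.
 - move=> j; have d2 := L2B (f2 m) (f2 (s (k + j)%N)).
  rewrite -/(sqL2norm mu (fun x => f m x - f (s (k + j)%N) x)) sqL2E// lee_fin.
  apply: hN; first exact: leq_trans (sN k) km.
  apply: (leq_trans (sN k)).
  elim: j {d2} => [|j IH]; first by rewrite addn0.
  by rewrite addnS; exact: leq_trans IH (sS _).
have dg2 : L2 (fun x => f (s 0%N) x - g x).
 split; first by apply: mcB => //; exact: L2_mc.
 by apply: le_lt_trans (small 0%N _ (leqnn _)) _; rewrite ltry.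
have g2 : L2 g.
 have := L2B (f2 (s 0%N)) dg2.
 by rewrite (_ : (fun _ => _) = g)//; apply/funext => x; rewrite opprB addrC subrK.
exists g => //.
apply/cvgrPdist_le => e e1.
have : (fun k => 8 ^- k : R) @ \oo --> 0.
 by under eq_fun do rewrite -exprVn; apply: cvg_expr; rewrite ger0_norm ?invf_lt1// ltr1n.
move/cvgrPdist_lt => /(_ _ e1)[k _ /(_ k (leqnn k))].
rewrite /= sub0r normrN ger0_norm ?invr_ge0 ?exprn_ge0// => ke.
exists (s k) => // m /= km.
rewrite sub0r normrN ger0_norm ?nrm_ge0//.
apply: le_trans (ltW ke); rewrite -lee_fin -sqL2E; last exact: L2B.
exact: small.
Qed.

End Riesz_Fischer.

(** * Iterated products and Fubini for complex functions *)

Section product_sigma_finite.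
Context d1 d2 (X : measurableType d1) (Y : measurableType d2) (R : realType).
Variables (m1 : {sigma_finite_measure set X -> \bar R})
 (m2 : {sigma_finite_measure set Y -> \bar R}).

(** The product measure under a name of its own, so that it carries a sigma-finite structure and can
    be a factor of further products. *)
Definition pmeas : set (X * Y)%type -> \bar R := (m1 \x m2)%E.

HB.instance Definition _ := Measure.on pmeas.

Let pmeas_sigma_finite : sigma_finite setT pmeas.
Proof.
have /sigma_finiteP[F [TF ndF Foo]] := sigma_finiteT m1.
have /sigma_finiteP[G [TG ndG Goo]] := sigma_finiteT m2.
exists (fun n => F n `*` G n).
 rewrite -setXTT TF TG predeqE => -[x y]; split.
  move=> [/= [n _ Fnx] [k _ Gky]]; exists (maxn n k) => //; split.
  - by move: x Fnx; exact/subsetPset/ndF/leq_maxl.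
  - by move: y Gky; exact/subsetPset/ndG/leq_maxr.
 by move=> [n _ []/= ? ?]; split; exists n.
move=> k; have [? ?] := Foo k; have [? ?] := Goo k.
split; first exact: measurableX.
by rewrite /pmeas product_measure1E// lte_mul_pinfty// ge0_fin_numE.
Qed.

HB.instance Definition _ := Measure_isSigmaFinite.Build _ _ _ pmeas
 pmeas_sigma_finite.

End product_sigma_finite.

(** [hm] is [heis_measure] up to conversion; [mF] carries the functions of (lam, z) obtained by
    transforming in tau alone, and [KK] the matrix side, pairs of multi-indices being coded in
    [nat]. *)
Local Notation leb2 := (pmeas leb leb).
Local Notation lr := (@lebesgue_row _ _).
Local Notation lr2 := (pmeas lr lr).
Local Notation hm := (pmeas lr2 leb).
Local Notation hmu R n := (pmeas (pmeas (@lebesgue_row R n) (@lebesgue_row R n)) (@lebesgue_measure R)).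
Local Notation mF := (pmeas leb lr2).
Local Notation KK := (pmeas leb (@counting nat _)).

Section complex_Fubini.
Context d1 d2 (X : measurableType d1) (Y : measurableType d2) (R : realType).
Variables (m1 : {sigma_finite_measure set X -> \bar R})
     (m2 : {sigma_finite_measure set Y -> \bar R}).
Local Notation mm := (pmeas m1 m2).

Lemma pair1_meas (x : X) : meas (fun y : Y => (x, y)).
Proof. exact: measurable_pair1. Qed.
Lemma pair2_meas (y : Y) : meas (fun x : X => (x, y)).
Proof. exact: measurable_pair2. Qed.

Lemma intg_prod_ae (f : X * Y -> R) : intg mm f -> {ae m1, forall x, intg m2 (fun y => f (x, y))}.
Proof.
move=> fi; have mf := intg_meas fi.
by have := ae_integrable1 fi; apply: filterS => x.
Qed.

Lemma intg_prod_ae2 (f : X * Y -> R) : intg mm f -> {ae m2, forall y, intg m1 (fun x => f (x, y))}.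
Proof. by move=> fi; have := ae_integrable2 fi; apply: filterS => x. Qed.

Lemma intg_Fubini1 (f : X * Y -> R) : intg mm f ->
 intg m1 (fun x => \int[m2]_y f (x, y)) /\
 \int[m1]_x \int[m2]_y f (x, y) = \int[mm]_z f z.
Proof.
move=> fi.
have iF := integrable_fubini_F fi.
have mF := (integrableP _ _ _ iF).1.
have ae : {ae m1, forall x, (\int[m2]_y (f (x, y))%:E = (\int[m2]_y f (x, y))%:E)%E}.
 by apply: filterS (intg_prod_ae fi) => x; exact: intgE.
have mfF : meas (fun x => \int[m2]_y f (x, y)).
 by apply: mcomp mF.
split.
 apply/integrableP; split; first exact/mEFinP.
 move/integrableP : iF => [_]; apply: le_lt_trans.
 rewrite (@ae_eq_integral _ _ _ m1 setT (fun x => `|fubini_F m2 (EFin \o f) x|)%E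
  (fun x => `|(\int[m2]_y f (x, y))%:E|)%E)//.
 - by apply/mEFinP; exact: mcomp.
 - exact: mcomp.
 - by apply: filterS ae => x + _; rewrite /fubini_F/fubini_G/= => ->.
rewrite [RHS]/Rintegral -(integral12_prod_meas1 fi) /Rintegral; congr fine.
apply: ae_eq_integral => //; first exact/mEFinP.
by apply: filterS ae => x /= <-.
Qed.

Lemma intg_Fubini2 (f : X * Y -> R) : intg mm f ->
 intg m2 (fun y => \int[m1]_x f (x, y)) /\
 \int[m2]_y \int[m1]_x f (x, y) = \int[mm]_z f z.
Proof.
move=> fi.
have mf := (integrableP _ _ _ fi).1.
have mF := measurable_fubini_G fi.
have iF : (\int[m2]_y `|fubini_G m1 (EFin \o f) y| < +oo)%E.
 apply: le_lt_trans ((integrable21ltyP m1 m2 mf).1 fi).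
 apply: ge0_le_integral => //.
 - exact: mcomp.
 - apply: (@measurable_fun_fubini_tonelli_G _ _ _ _ _ m1 (fun z => `|(f z)%:E|%E)) => //.
  exact: mcomp.
 - move=> y _; apply: le_abse_integral => //.
  by apply: mcomp mf _; exact: pair2_meas.
have ae : {ae m2, forall y, (\int[m1]_x (f (x, y))%:E = (\int[m1]_x f (x, y))%:E)%E}.
 by apply: filterS (intg_prod_ae2 fi) => x; exact: intgE.
have mfF : meas (fun y => \int[m1]_x f (x, y)).
 by apply: mcomp mF.
split.
 apply/integrableP; split; first exact/mEFinP.
 move: iF; apply: le_lt_trans.
 rewrite (@ae_eq_integral _ _ _ m2 setT (fun y => `|fubini_G m1 (EFin \o f) y|)%E
  (fun y => `|(\int[m1]_x f (x, y))%:E|)%E)//.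
 - by apply/mEFinP; exact: mcomp.
 - exact: mcomp.
 - by apply: filterS ae => x + _; rewrite /fubini_F/fubini_G/= => ->.
rewrite [RHS]/Rintegral -(integral21_prod_meas1 fi) /Rintegral; congr fine.
apply: ae_eq_integral => //; first exact/mEFinP.
by apply: filterS ae => x /= <-.
Qed.

Lemma L1_prod_ae (f : X * Y -> R[i]) : L1 mm f -> {ae m1, forall x, L1 m2 (fun y => f (x, y))}.
Proof. by move=> [/intg_prod_ae f1 /intg_prod_ae f2]; apply: filterS2 f1 f2 => x. Qed.

Lemma L1_prod_ae2 (f : X * Y -> R[i]) : L1 mm f -> {ae m2, forall y, L1 m1 (fun x => f (x, y))}.
Proof. by move=> [/intg_prod_ae2 f1 /intg_prod_ae2 f2]; apply: filterS2 f1 f2 => x. Qed.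

Lemma L1_Fubini1 (f : X * Y -> R[i]) : L1 mm f ->
 L1 m1 (fun x => integralC m2 (fun y => f (x, y))) /\
 integralC m1 (fun x => integralC m2 (fun y => f (x, y))) = integralC mm f.
Proof.
by move=> [/intg_Fubini1[i1 e1] /intg_Fubini1[i2 e2]]; split => //; apply: complexP.
Qed.

Lemma L1_Fubini2 (f : X * Y -> R[i]) : L1 mm f ->
 L1 m2 (fun y => integralC m1 (fun x => f (x, y))) /\
 integralC m2 (fun y => integralC m1 (fun x => f (x, y))) = integralC mm f.
Proof.
by move=> [/intg_Fubini2[i1 e1] /intg_Fubini2[i2 e2]]; split => //; apply: complexP.
Qed.

Lemma L2_prod_ae (f : X * Y -> R[i]) : L2 mm f -> {ae m1, forall x, L2 m2 (fun y => f (x, y))}.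
Proof.
move=> /L2P[mf /intg_prod_ae h]; apply: filterS h => x hx; apply/L2P; split => //.
by apply: mc_comp mf _; exact: pair1_meas.
Qed.

Lemma L2_prod_ae2 (f : X * Y -> R[i]) : L2 mm f -> {ae m2, forall y, L2 m1 (fun x => f (x, y))}.
Proof.
move=> /L2P[mf /intg_prod_ae2 h]; apply: filterS h => x hx; apply/L2P; split => //.
by apply: mc_comp mf _; exact: pair2_meas.
Qed.

End complex_Fubini.

(** * The Fourier transform on the line *)

Section affine_substitution.
Context {R : realType}.

Lemma measurable_affine (a b : R) : meas (fun x : R => a * x + b).
Proof. by apply: measurable_funD => //; exact: measurable_funM. Qed.

(** The image of [leb] under the affine map, scaled by [a], gives every interval ]c, d] its length;
    uniqueness of Lebesgue measure does the rest. *)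
Lemma lebesgue_affine_pos (a b : R) (f : R -> \bar R) : 0 < a ->
 meas f -> (forall x, (0 <= f x)%E) ->
 (\int[leb]_x f (a * x + b)%R = (a^-1)%:E * \int[leb]_x f x)%E.
Proof.
move=> a0 mf f0.
pose phi : measurableTypeR R -> measurableTypeR R := fun x => a * x + b.
have mphi : meas phi by exact: measurable_affine.
pose m : {measure set (measurableTypeR R) -> \bar R} :=
 measure_function_pushforward__canonical__measure_function_Measure leb mphi.
have an0 : 0 <= a by exact: ltW.
have E A : measurable A -> leb A = mscale (NngNum an0) m A.
 apply: lebesgue_measure_unique => _ [[c d]] _ <-.
 change (leb `]c, d] = a%:E * leb (phi @^-1` `]c, d]))%E.
 rewrite (_ : phi @^-1` _ = `]((c - b) / a), ((d - b) / a)]%classic); last first.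
  apply/seteqP; split => x /=; rewrite !in_itv/= /phi ltr_pdivrMr// ler_pdivlMr//;
   by rewrite ltrBlDr lerBrDr (mulrC x).
 rewrite !lebesgue_measure_itv/= !lte_fin ltr_pM2r ?invr_gt0// ltrD2r.
 case: ifP => // _; last by rewrite mule0.
 by rewrite -!EFinD -EFinM; congr EFin; field; rewrite gt_eqF.
rewrite [in RHS](eq_measure_integral (mscale (NngNum an0) m)); last by move=> A mA _; exact: E.
rewrite ge0_integral_mscale//= ge0_integral_pushforward//.
by rewrite muleA -EFinM mulVf ?gt_eqF// mul1e.
Qed.

Lemma lebesgue_opp (f : R -> \bar R) :
 meas f -> (forall x, (0 <= f x)%E) ->
 (\int[leb]_x f (- x)%R = \int[leb]_x f x)%E.
Proof.
move=> mf f0.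
pose phi : measurableTypeR R -> measurableTypeR R := -%R.
have mphi : meas phi by apply: continuous_measurable_fun; exact: opp_continuous.
transitivity (\int[pushforward leb phi]_x f x)%E.
 by rewrite ge0_integral_pushforward.
apply: eq_measure_integral => A mA _; exact: lebesgue_measureN.
Qed.

Lemma lebesgue_affine (a b : R) (f : R -> \bar R) : a != 0 ->
 meas f -> (forall x, (0 <= f x)%E) ->
 (\int[leb]_x f (a * x + b)%R = (`|a|^-1)%:E * \int[leb]_x f x)%E.
Proof.
rewrite neq_lt => /orP[] a0 mf f0; last by rewrite gtr0_norm// lebesgue_affine_pos.
rewrite ltr0_norm// -(@lebesgue_affine_pos (- a) b)// ?oppr_gt0//.
rewrite -[RHS]lebesgue_opp//; last first.
 by apply: mcomp mf _; exact: measurable_affine.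
by apply: eq_integral => x _; rewrite mulrNN.
Qed.

Lemma intg_affine (a b : R) (f : R -> R) : a != 0 -> intg leb f ->
 intg leb (fun x => f (a * x + b)).
Proof.
move=> a0 fi; have mf := intg_meas fi.
have mfa : meas (fun x => f (a * x + b)).
 by apply: mcomp mf _; exact: measurable_affine.
apply: intg_absP => //; apply/intgP => //; first exact: mcomp.
rewrite (@lebesgue_affine a b (fun x => `|f x|%:E))//; last first.
 by apply/mEFinP; exact: mcomp.
rewrite lte_mul_pinfty// ?lee_fin ?invr_ge0//.
by apply/intgP => //; [exact: mcomp|exact: intg_abs].
Qed.

Lemma Rint_affine (a b : R) (f : R -> R) : a != 0 -> intg leb f ->
 \int[leb]_x f (a * x + b) = `|a|^-1 * \int[leb]_x f x.
Proof.
move=> a0 fi; have mf := intg_meas fi.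
have pos (g : R -> R) : intg leb g -> (forall x, 0 <= g x) ->
  \int[leb]_x g (a * x + b) = `|a|^-1 * \int[leb]_x g x.
 move=> gi g0; apply: EFin_inj; rewrite EFinM -!intgE//; last exact: intg_affine.
 rewrite (@lebesgue_affine a b (EFin \o g))//.
 by apply/mEFinP; exact: (intg_meas gi).
(* f is the difference of the nonnegative integrable functions |f| + f and |f|. *)
pose g (x : R) : R := `|f x| + f x.
have gi : intg leb g by apply: intgD => //; exact: intg_abs.
have g0 x : 0 <= g x by rewrite /g -lerBlDr sub0r -normrN ler_norm.
have fE x : f x = g x - `|f x| by rewrite /g addrAC subrr add0r.
have ai := intg_abs fi.
transitivity (\int[leb]_x (g (a * x + b) - `|f (a * x + b)|)).
 by apply: eq_Rintegral => x _; exact: fE.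
transitivity (`|a|^-1 * (\int[leb]_x (g x - `|f x|))); last first.
 by congr (_ * _); apply: eq_Rintegral => x _; rewrite -fE.
rewrite !RintB//; last 2 first.
 exact: intg_affine.
 by apply: (@intg_affine a b (fun x => `|f x|)).
by rewrite pos// (pos (fun x => `|f x|))// mulrBr.
Qed.

End affine_substitution.

Section tensor_integral.
Context d1 d2 (X : measurableType d1) (Y : measurableType d2) (R : realType).
Variables (m1 : {sigma_finite_measure set X -> \bar R})
     (m2 : {sigma_finite_measure set Y -> \bar R}).

Lemma intg_tensor (f : X -> R) (g : Y -> R) : intg m1 f -> intg m2 g ->
 intg (pmeas m1 m2) (fun z => f z.1 * g z.2).
Proof.
move=> fi gi.
have mf := intg_meas fi; have mg := intg_meas gi.
have mfg : meas (fun z : X * Y => f z.1 * g z.2).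
 by apply: measurable_funM; [exact: mcomp mf measurable_fst|exact: mcomp mg measurable_snd].
apply/(integrable12ltyP m1 m2); first exact/mEFinP.
rewrite /=.
under eq_integral => x _.
 under eq_integral => y _ do rewrite normrM EFinM.
 rewrite ge0_integralZl//; last by apply/mEFinP; exact: mcomp.
 over.
have gE := intgE (intg_abs gi); rewrite gE.
rewrite ge0_integralZr//; last 2 first.
 by apply/mEFinP; exact: mcomp.
 by rewrite lee_fin; apply: Rint_ge0.
by rewrite (intgE (intg_abs fi)) -EFinM ltry.
Qed.

Lemma Rint_tensor (f : X -> R) (g : Y -> R) : intg m1 f -> intg m2 g ->
 \int[pmeas m1 m2]_z (f z.1 * g z.2) = (\int[m1]_x f x) * (\int[m2]_y g y).
Proof.
move=> fi gi.
have [_ <-] := intg_Fubini1 (intg_tensor fi gi).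
under eq_Rintegral => x _ do rewrite /= RintZ//.
rewrite mulrC -RintZ//; apply: eq_Rintegral => x _; exact: mulrC.
Qed.

End tensor_integral.

Section integral_of_derivative.
Context {R : realType}.

(** The fundamental theorem on growing symmetric intervals and dominated convergence; every
    integration by parts against a Gaussian goes through this lemma. *)
Lemma Rint_derive0 (F f : R -> R) : (forall x : R, is_derive x 1 F (f x)) ->
 continuous f -> intg leb f ->
 F x @[x --> +oo] --> 0 -> F x @[x --> -oo] --> 0 ->
 \int[leb]_x f x = 0.
Proof.
move=> dF cf fi Fp Fm.
have cF : continuous F.
 by move=> x; apply/differentiable_continuous/derivable1_diffP; have [] := dF x.
have mf := intg_meas fi.
have h n : \int[leb]_(x in `[- n.+1%:R, n.+1%:R]) f x = F n.+1%:R - F (- n.+1%:R).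
 rewrite /Rintegral (@continuous_FTC2 _ f F)//.
 - by have : 0 < n.+1%:R :> R by []; lra.
 - exact: continuous_subspaceT.
 - split; first by move=> x _; have [] := dF x.
  + by apply: cvg_at_right_filter; exact: cF.
  + by apply: cvg_at_left_filter; exact: cF.
 - by move=> x _; rewrite derive1E; have [_] := dF x.
have [|||_] := @Rint_dct _ _ R leb (fun n => f \_ `[- n.+1%:R, n.+1%:R]) f (fun x => `|f x|)
 _ mf _ (intg_abs fi) _.
- by move=> n; apply/(measurable_restrictT f) => //; exact: measurable_funTS.
- apply: aeW => x; apply: cvg_near_cst; near=> n.
 rewrite patchE ifT// inE/= in_itv/= -ler_norml.
 near: n; exists (Num.truncn `|x|) => // n /= xn.
 apply: le_trans (ltW (truncnS_gt _)) _.
 by rewrite ler_nat.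
- move=> n x; rewrite patchE; case: ifP => // _.
 by rewrite normr0.
under eq_fun do rewrite -Rintegral_mkcond h.
have p : (fun n => n.+1%:R : R) @ \oo --> +oo.
 by rewrite (@cvg_shiftS _ (fun n => n%:R : R)); exact: cvgr_idn.
have hp : F n.+1%:R @[n --> \oo] --> 0 by exact: (cvg_comp _ _ p Fp).
have hm : F (- n.+1%:R) @[n --> \oo] --> 0.
 apply: (cvg_comp _ _ _ Fm).
 by apply/cvgNrNy.
move=> h0; have h1 := cvgB hp hm; rewrite subr0 in h1.
exact: (cvg_unique _ h0 (h1 _)).
Unshelve. all: end_near.
Qed.
End integral_of_derivative.

(** * Polynomials times Gaussians *)

Section gaussian.
Context {R : realType}.
Implicit Types (a x q : R) (p : {poly R}).

Lemma expR_sqr_bound (e : R) : 0 < e -> exists2 C, 0 <= C & forall x, `|x| <= C * expR (e * x ^+ 2).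
Proof.
move=> e0; exists (1 + e^-1); first by rewrite addr_ge0// invr_ge0 ltW.
move=> x; have h := expR_ge1Dx (e * x ^+ 2).
have h1 : 1 <= expR (e * x ^+ 2).
 by rewrite -[leLHS]expR0 ler_expR mulr_ge0 ?sqr_ge0// ltW.
have h2 : x ^+ 2 <= e^-1 * expR (e * x ^+ 2).
 by rewrite ler_pdivlMl//; lra.
have h3 : `|x| <= 1 + x ^+ 2.
 by rewrite -real_normK ?num_real//; have := sqr_ge0 (`|x| - 1); nra.
rewrite mulrDl mul1r; lra.
Qed.

Lemma poly_expR_bound p (e : R) : 0 < e ->
 exists2 C, 0 <= C & forall x, `|p.[x]| <= C * expR (e * x ^+ 2).
Proof.
elim/poly_ind: p e => [|p c IH] e e0.
 by exists 0 => // x; rewrite horner0 normr0 mul0r.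
have e2 : 0 < e / 2 by rewrite divr_gt0.
have [C1 C10 h1] := IH _ e2; have [C2 C20 h2] := expR_sqr_bound e2.
exists (C1 * C2 + `|c|); first by rewrite addr_ge0// mulr_ge0.
move=> x; rewrite hornerMXaddC; apply: (le_trans (ler_normD _ _)).
rewrite mulrDl lerD//.
 rewrite normrM (_ : e * _ = e / 2 * x ^+ 2 + e / 2 * x ^+ 2); last by field.
 by rewrite expRD mulrACA ler_pM.
by rewrite ler_peMr// -[leLHS]expR0 ler_expR mulr_ge0 ?sqr_ge0// ltW.
Qed.

(** A class stable under differentiation: a = 1/2 gives the Hermite functions and a = 1 their
    products. *)
Definition pgauss p a x := p.[x] * expR (- (a * x ^+ 2)).

Lemma drvD (f g : R -> R) (x df dg : R) : is_derive x 1 f df -> is_derive x 1 g dg ->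
 is_derive x 1 (fun x => f x + g x) (df + dg).
Proof. exact: is_deriveD. Qed.
Lemma drvM (f g : R -> R) (x df dg : R) : is_derive x 1 f df -> is_derive x 1 g dg ->
 is_derive x 1 (fun x => f x * g x) (df * g x + f x * dg).
Proof.
move=> f1 g1; apply: (@is_derive_eq _ _ _ _ _ _ _ _ (is_deriveM f1 g1)).
by rewrite /GRing.scale/=; ring.
Qed.
Lemma drvZ (c : R) (f : R -> R) (x df : R) : is_derive x 1 f df ->
 is_derive x 1 (fun x => c * f x) (c * df).
Proof. by move=> f1; apply: (@is_derive_eq _ _ _ _ _ _ _ _ (is_deriveZ c f1)). Qed.
Lemma drvN (f : R -> R) (x df : R) : is_derive x 1 f df ->
 is_derive x 1 (fun x => - f x) (- df).
Proof. exact: is_deriveN. Qed.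
Lemma drv_comp (f g : R -> R) (x df dg : R) : is_derive (g x) 1 f df -> is_derive x 1 g dg ->
 is_derive x 1 (fun x => f (g x)) (df * dg).
Proof. by move=> f1 g1; exact: (@is_derive1_comp _ f g x df dg f1 g1). Qed.
Lemma drv_eq (f : R -> R) (x df df' : R) : is_derive x 1 f df -> df = df' -> is_derive x 1 f df'.
Proof. by move=> h <-. Qed.
Lemma drv_id (x : R) : is_derive x 1 (fun x : R => x) 1.
Proof. exact: is_derive_id. Qed.
Lemma drv_cst (c x : R) : is_derive x 1 (fun _ : R => c) 0.
Proof. exact: is_derive_cst. Qed.
Lemma drv_sqr (x : R) : is_derive x 1 (fun x : R => x ^+ 2) (2 * x).
Proof.
apply: (@drv_eq _ _ (1 * x + x * 1)); last by ring.
rewrite (_ : (fun _ => _) = (fun x : R => x * x)).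
 by apply: drvM; exact: drv_id.
by apply/funext => y; rewrite expr2.
Qed.
Lemma drv_continuous (f : R -> R) (df : R -> R) :
 (forall x : R, is_derive x 1 f (df x)) -> continuous f.
Proof.
by move=> h x; apply/differentiable_continuous/derivable1_diffP; have [] := h x.
Qed.

Lemma is_derive_expsqr a x :
 is_derive x 1 (fun x => expR (- (a * x ^+ 2))) (- (2 * a * x) * expR (- (a * x ^+ 2))).
Proof.
apply: (@drv_eq _ _ (expR (- (a * x ^+ 2)) * (- (a * (2 * x))))); last by ring.
apply: (drv_comp (is_derive_expR _)).
by apply: drvN; apply: drvZ; exact: drv_sqr.
Qed.

Lemma is_derive_pgauss p a x :
 is_derive x 1 (pgauss p a) (pgauss (p^`() - (2 * a) *: ('X * p)) a x).
Proof.
apply: (drv_eq (drvM (is_derive_poly p x) (is_derive_expsqr a x))).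
rewrite /pgauss hornerD hornerN hornerZ hornerM hornerX; ring.
Qed.

Lemma continuous_pgauss p a : continuous (pgauss p a).
Proof.
by apply: (@drv_continuous _ (pgauss _ a)) => x; exact: is_derive_pgauss.
Qed.

Lemma measurable_pgauss p a : meas (pgauss p a).
Proof. by apply: continuous_measurable_fun; exact: continuous_pgauss. Qed.

Lemma intg_gauss a : 0 < a -> intg leb (fun x => expR (- (a * x ^+ 2))).
Proof.
move=> a0.
have := intg_affine 0 (lt0r_neq0 (_ : 0 < Num.sqrt a)) integrableT_gauss.
rewrite sqrtr_gt0 => /(_ a0).
congr integrable; apply/funext => x /=; congr (EFin (expR _)).
by rewrite addr0 exprMn sqr_sqrtr// ltW.
Qed.

Lemma Rint_gauss a : 0 < a -> \int[leb]_x expR (- (a * x ^+ 2)) = Num.sqrt (pi / a).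
Proof.
move=> a0; have sa0 : Num.sqrt a != 0 by rewrite gt_eqF// sqrtr_gt0.
have := Rint_affine 0 sa0 integrableT_gauss.
rewrite [X in _ * X]/Rintegral integralT_gauss/= => h.
transitivity (\int[leb]_x gauss_fun (Num.sqrt a * x + 0)).
 apply: eq_Rintegral => x _; rewrite /gauss_fun addr0 exprMn sqr_sqrtr//; exact: ltW.
rewrite h ger0_norm ?sqrtr_ge0// -sqrtrV ?ltW//.
by rewrite -sqrtrM ?invr_ge0 ?ltW// mulrC.
Qed.

Lemma pgauss_bound p a : 0 < a ->
 exists2 C, 0 <= C & forall x, `|pgauss p a x| <= C * expR (- (a / 2 * x ^+ 2)).
Proof.
move=> a0; have [|C C0 h] := @poly_expR_bound p (a / 2); first by rewrite divr_gt0.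
exists C => // x; rewrite normrM (ger0_norm (expR_ge0 _)).
rewrite (_ : - (a * x ^+ 2) = - (a / 2 * x ^+ 2) + - (a / 2 * x ^+ 2)); last by field.
rewrite expRD mulrA ler_wpM2r ?expR_ge0//.
apply: (le_trans (ler_wpM2r (expR_ge0 _) (h x))).
by rewrite -(mulrA C) -expRD subrr expR0 mulr1.
Qed.

Lemma intg_pgauss p a : 0 < a -> intg leb (pgauss p a).
Proof.
move=> a0; have [C C0 h] := pgauss_bound p a0.
apply: (@intg_le _ _ _ leb _ (fun x : R => C * expR (- (a / 2 * x ^+ 2)))).
- exact: measurable_pgauss.
- exact: h.
by apply: intgZ; apply: intg_gauss; rewrite divr_gt0.
Qed.

Lemma expsqr_cvgy a : 0 < a -> expR (- (a * x ^+ 2)) @[x --> +oo] --> 0.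
Proof.
move=> a0; apply/cvgrPdist_le => e e0; near=> x.
rewrite sub0r normrN ger0_norm ?expR_ge0// expRN invf_ple ?posrE ?expR_gt0//.
have h := expR_ge1Dx (a * x ^+ 2).
apply: le_trans h.
have x1 : 1 <= x by near: x; exact: nbhs_pinfty_ge.
have xe : (a * e)^-1 <= x by near: x; apply: nbhs_pinfty_ge; rewrite num_real.
have : e^-1 <= a * x ^+ 2.
 apply: (@le_trans _ _ (a * x)).
  by rewrite -ler_pdivrMl// -invfM mulrC.
 by rewrite ler_pM2l// expr2 ler_peMr//; lra.
lra.
Unshelve. all: end_near.
Qed.

Lemma pgauss_cvgy p a (h : R -> R) : 0 < a -> (forall x, `|h x| <= 1) ->
 pgauss p a x * h x @[x --> +oo] --> 0.
Proof.
move=> a0 h1; have [C C0 hC] := pgauss_bound p a0.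
have a2 : 0 < a / 2 by rewrite divr_gt0.
apply: norm_cvg0.
apply: (@squeeze_cvgr _ _ _ _ (cst 0) (fun x => C * expR (- (a / 2 * x ^+ 2)))).
- apply: nearW => x; rewrite normr_ge0/= normrM -[leRHS]mulr1 ler_pM//.
- exact: cvg_cst.
- rewrite -(mulr0 C); apply: cvgM; first exact: cvg_cst.
 exact: expsqr_cvgy.
Qed.

Lemma pgauss_cvgNy p a (h : R -> R) : 0 < a -> (forall x, `|h x| <= 1) ->
 pgauss p a x * h x @[x --> -oo] --> 0.
Proof.
move=> a0 h1; apply/cvgyNP => /=.
under eq_fun => x.
 rewrite (_ : pgauss p a (- x) = pgauss (p \Po (- 'X)) a x); last first.
  by rewrite /pgauss horner_comp hornerN hornerX sqrrN.
 over.
by apply: (@pgauss_cvgy _ _ (fun x => h (- x))).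
Qed.

End gaussian.

(** * Fourier transforms of Gaussians *)

Section gauss_fourier.
Context {R : realType}.
Implicit Types (q : R) (p : {poly R}).

(** Cosine and sine transforms of p(v) exp(-v^2), kept apart because differentiation under the
    integral is used for real functions. *)
Definition gcos p q := \int[leb]_v (pgauss p 1 v * cos (v * q)).
Definition gsin p q := \int[leb]_v (pgauss p 1 v * sin (v * q)).

Lemma cos_bound (x : R) : `|cos x| <= 1.
Proof. by rewrite ler_norml cos_geN1 cos_le1. Qed.
Lemma sin_bound (x : R) : `|sin x| <= 1.
Proof. by rewrite ler_norml sin_geN1 sin_le1. Qed.

Lemma continuous_cosM q : continuous (fun v : R => cos (v * q)).
Proof.
by move=> v; apply: continuous_comp; [exact: mulrr_continuous|exact: continuous_cos].
Qed.
Lemma continuous_sinM q : continuous (fun v : R => sin (v * q)).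
Proof.
by move=> v; apply: continuous_comp; [exact: mulrr_continuous|exact: continuous_sin].
Qed.

Lemma intg_pgauss_cos p a q : 0 < a -> intg leb (fun v => pgauss p a v * cos (v * q)).
Proof.
move=> a0; apply: (intgMb (M := 1)); first exact: intg_pgauss.
 by apply: continuous_measurable_fun; exact: continuous_cosM.
by move=> x; exact: cos_bound.
Qed.
Lemma intg_pgauss_sin p a q : 0 < a -> intg leb (fun v => pgauss p a v * sin (v * q)).
Proof.
move=> a0; apply: (intgMb (M := 1)); first exact: intg_pgauss.
 by apply: continuous_measurable_fun; exact: continuous_sinM.
by move=> x; exact: sin_bound.
Qed.

Lemma drv_cosM q (v : R) : is_derive v 1 (fun v => cos (v * q)) (- q * sin (v * q)).
Proof.
apply: (drv_eq (drv_comp (is_derive_cos _) (drvM (drv_id v) (drv_cst q v)))); ring.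
Qed.
Lemma drv_sinM q (v : R) : is_derive v 1 (fun v => sin (v * q)) (q * cos (v * q)).
Proof.
apply: (drv_eq (drv_comp (is_derive_sin _) (drvM (drv_id v) (drv_cst q v)))); ring.
Qed.

(** Chosen so that the derivative of p exp(-x^2) is [hop p] times exp(-x^2). On Hermite polynomials
    it is minus the raising operator ([hop_hermite]). *)
Definition hop p : {poly R} := p^`() - 2 *: ('X * p).

Lemma pgauss_hop p (x : R) : is_derive x 1 (pgauss p 1) (pgauss (hop p) 1 x).
Proof.
by apply: (drv_eq (is_derive_pgauss p 1 x)); rewrite mulr1.
Qed.

(** Integration by parts: the derivative of p(v) exp(-v^2) cos(v q) has integral 0. *)
Lemma gcos_hop p q : gcos (hop p) q = q * gsin p q.
Proof.
have d0 (v : R) : is_derive v 1 (fun v => pgauss p 1 v * cos (v * q))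
  (pgauss (hop p) 1 v * cos (v * q) - q * (pgauss p 1 v * sin (v * q))).
 apply: (drv_eq (drvM (pgauss_hop p v) (drv_cosM q v))); ring.
have := Rint_derive0 d0.
rewrite RintB; [|exact: intg_pgauss_cos|apply: intgZ; exact: intg_pgauss_sin].
rewrite RintZ; last exact: intg_pgauss_sin.
move=> h; apply/eqP; rewrite -subr_eq0; apply/eqP; apply: h.
- move=> v; apply: cvgB; first apply: cvgM.
 + exact: continuous_pgauss.
 + exact: continuous_cosM.
 + apply: cvgM; first exact: cvg_cst.
  by apply: cvgM; [exact: continuous_pgauss|exact: continuous_sinM].
- apply: intgB; first exact: intg_pgauss_cos.
 by apply: intgZ; exact: intg_pgauss_sin.
- by apply: pgauss_cvgy => // x; exact: cos_bound.
- by apply: pgauss_cvgNy => // x; exact: cos_bound.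
Qed.

Lemma gsin_hop p q : gsin (hop p) q = - (q * gcos p q).
Proof.
have d0 (v : R) : is_derive v 1 (fun v => pgauss p 1 v * sin (v * q))
  (pgauss (hop p) 1 v * sin (v * q) + q * (pgauss p 1 v * cos (v * q))).
 apply: (drv_eq (drvM (pgauss_hop p v) (drv_sinM q v))); ring.
have := Rint_derive0 d0.
rewrite RintD; [|exact: intg_pgauss_sin|apply: intgZ; exact: intg_pgauss_cos].
rewrite RintZ; last exact: intg_pgauss_cos.
move=> h; apply/eqP; rewrite -subr_eq0 opprK; apply/eqP; apply: h.
- move=> v; apply: cvgD; first apply: cvgM.
 + exact: continuous_pgauss.
 + exact: continuous_sinM.
 + apply: cvgM; first exact: cvg_cst.
  by apply: cvgM; [exact: continuous_pgauss|exact: continuous_cosM].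
- apply: intgD; first exact: intg_pgauss_sin.
 by apply: intgZ; exact: intg_pgauss_cos.
- by apply: pgauss_cvgy => // x; exact: sin_bound.
- by apply: pgauss_cvgNy => // x; exact: sin_bound.
Qed.

Lemma drv_under (f df : R -> R -> R) (G : R -> R) q :
 (forall x, intg leb (f x)) -> (forall x v : R, is_derive x 1 (f ^~ v) (df x v)) ->
 intg leb G -> (forall x v, `|df x v| <= G v) ->
 is_derive q 1 (fun x => \int[leb]_v f x v) (\int[leb]_v df q v).
Proof.
move=> fi fd Gi fG.
have qI : [set` `]q - 1, q + 1[] q by rewrite /= in_itv/=; lra.
have dE x v : partial1of2 f x v = df x v by rewrite partial1of2E; have [_] := fd x v.
have G0 v : 0 <= G v by exact: le_trans (fG q v).
have h : forall (x v : R), [set` `]q - 1, q + 1[] x -> setT v -> derivable (f ^~ v) x 1.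
 by move=> x v _ _; have [] := fd x v.
have h2 : forall (x v : R), [set` `]q - 1, q + 1[] x -> setT v -> `|partial1of2 f x v| <= G v.
 by move=> x v _ _; rewrite dE.
apply: DeriveDef.
 exact: (derivable_under_integral measurableT qI (fun x _ => fi x) h G0 Gi h2).
rewrite -derive1E (differentiation_under_integral measurableT qI (fun x _ => fi x) h G0 Gi h2).
by apply: eq_Rintegral => v _; exact: dE.
Qed.

Lemma drv_gcos p q : is_derive q 1 (gcos p) (- gsin ('X * p) q).
Proof.
apply: (@drv_eq _ _ _ (\int[leb]_v (- (pgauss ('X * p) 1 v * sin (v * q))))); last first.
 by rewrite RintN//; exact: intg_pgauss_sin.
have d (x v : R) : is_derive x 1 (fun q => pgauss p 1 v * cos (v * q))
  (- (pgauss ('X * p) 1 v * sin (v * x))).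
 apply: (drv_eq (drvZ _ (drv_comp (is_derive_cos _) (drvZ v (drv_id x))))).
 rewrite /pgauss hornerM hornerX; ring.
apply: (drv_under q (fun x => intg_pgauss_cos p x ltr01) d (intg_abs (intg_pgauss ('X * p) ltr01))).
by move=> x v; rewrite normrN normrM ler_piMr// sin_bound.
Qed.

Lemma drv_gsin p q : is_derive q 1 (gsin p) (gcos ('X * p) q).
Proof.
have d (x v : R) : is_derive x 1 (fun q => pgauss p 1 v * sin (v * q))
  (pgauss ('X * p) 1 v * cos (v * x)).
 apply: (drv_eq (drvZ _ (drv_comp (is_derive_sin _) (drvZ v (drv_id x))))).
 rewrite /pgauss hornerM hornerX; ring.
apply: (drv_under q (fun x => intg_pgauss_sin p x ltr01) d (intg_abs (intg_pgauss ('X * p) ltr01))).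
by move=> x v; rewrite normrM ler_piMr// cos_bound.
Qed.

(** exp(q^2 / 4) is an integrating factor: its product with [h] has derivative 0. *)
Lemma gauss_ode (h : R -> R) : (forall q : R, is_derive q 1 h (- (q / 2) * h q)) ->
 forall q, h q = h 0 * expR (- (4^-1 * q ^+ 2)).
Proof.
move=> dh q.
have d0 (x : R) : is_derive x 1 (fun x => h x * expR (- (- 4^-1 * x ^+ 2))) 0.
 apply: (drv_eq (drvM (dh x) (is_derive_expsqr (- 4^-1) x))); by field.
have := is_derive_0_is_cst q 0 d0.
rewrite expr0n/= mulr0 oppr0 expR0 mulr1 => <-.
by rewrite -mulrA -expRD mulNr opprK subrr expR0 mulr1.
Qed.

Lemma hop1 : hop 1 = - 2 *: 'X.
Proof. by rewrite /hop derivC mulr1 sub0r scaleNr. Qed.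

Lemma gcosZ c p q : gcos (c *: p) q = c * gcos p q.
Proof.
rewrite /gcos -RintZ; last exact: intg_pgauss_cos.
by apply: eq_Rintegral => v _; rewrite /pgauss hornerZ !mulrA.
Qed.
Lemma gsinZ c p q : gsin (c *: p) q = c * gsin p q.
Proof.
rewrite /gsin -RintZ; last exact: intg_pgauss_sin.
by apply: eq_Rintegral => v _; rewrite /pgauss hornerZ !mulrA.
Qed.
Lemma gcosD p p' q : gcos (p + p') q = gcos p q + gcos p' q.
Proof.
rewrite /gcos -RintD; [|exact: intg_pgauss_cos..].
by apply: eq_Rintegral => v _; rewrite /pgauss hornerD !mulrDl.
Qed.
Lemma gsinD p p' q : gsin (p + p') q = gsin p q + gsin p' q.
Proof.
rewrite /gsin -RintD; [|exact: intg_pgauss_sin..].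
by apply: eq_Rintegral => v _; rewrite /pgauss hornerD !mulrDl.
Qed.

Lemma gcos1 q : gcos 1 q = Num.sqrt pi * expR (- (4^-1 * q ^+ 2)).
Proof.
have d (x : R) : is_derive x 1 (gcos 1) (- (x / 2) * gcos 1 x).
 apply: (drv_eq (drv_gcos 1 x)); rewrite mulr1.
 (* Since X = - [hop 1] / 2, integration by parts turns the derivative of the transform into - x / 2
    times the transform. *)
 have := gsin_hop 1 x; rewrite hop1 gsinZ => h.
 have -> : gsin 'X x = (x * gcos 1 x) / 2 by lra.
 by field.
rewrite (gauss_ode d).
congr (_ * _); rewrite /gcos -(divr1 pi) -Rint_gauss//.
by apply: eq_Rintegral => v _; rewrite /pgauss mulr0 cos0 mulr1 hornerC mul1r.
Qed.

Lemma gsin1 q : gsin 1 q = 0.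
Proof.
have d (x : R) : is_derive x 1 (gsin 1) (- (x / 2) * gsin 1 x).
 apply: (drv_eq (drv_gsin 1 x)); rewrite mulr1.
 have := gcos_hop 1 x; rewrite hop1 gcosZ => h.
 have -> : gcos 'X x = - (x * gsin 1 x) / 2 by lra.
 by field.
rewrite (gauss_ode d).
have -> : gsin 1 0 = 0; last by rewrite mul0r.
transitivity (\int[leb]_v (0 : R)); last exact: Rintg0.
by apply: eq_Rintegral => v _; rewrite mulr0 sin0 mulr0.
Qed.

Lemma gauss_cos a q : 0 < a -> \int[leb]_v (expR (- (a * v ^+ 2)) * cos (v * q)) =
 Num.sqrt (pi / a) * expR (- (q ^+ 2 / (4 * a))).
Proof.
move=> a0; have sa0 : 0 < Num.sqrt a by rewrite sqrtr_gt0.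
have := Rint_affine 0 (lt0r_neq0 sa0) (intg_pgauss_cos 1 (q / Num.sqrt a) (ltr01 : 0 < 1 :> R)).
rewrite -/(gcos 1 (q / Num.sqrt a)) gcos1 => h.
rewrite sqrtrM ?pi_ge0// sqrtrV ?ltW//.
have -> : q ^+ 2 / (4 * a) = 4^-1 * (q / Num.sqrt a) ^+ 2.
 by rewrite exprMn exprVn sqr_sqrtr ?ltW//; field; rewrite gt_eqF.
rewrite mulrAC mulrC -{1}(ger0_norm (ltW sa0)) -h.
apply: eq_Rintegral => v _; rewrite addr0 /pgauss hornerC !mul1r exprMn sqr_sqrtr ?ltW//.
congr (_ * cos _); field; by rewrite gt_eqF.
Qed.

End gauss_fourier.

(** * Continuity of translations in L^2 *)

Section translation_continuity.
Context {R : realType}.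
Implicit Types (f g h : R -> R).

Definition rL2 f := meas f /\ intg leb (fun x => f x ^+ 2).

Lemma rL2D f g : rL2 f -> rL2 g -> rL2 (fun x => f x + g x).
Proof.
move=> [mf f2] [mg g2]; split; first exact: measurable_funD.
apply: (@intg_le _ _ _ leb _ (fun x : R => 2 * (f x ^+ 2 + g x ^+ 2))).
- by apply: (measurable_funX 2); exact: measurable_funD.
- by move=> x; rewrite ger0_norm ?sqr_ge0//; have := sqr_ge0 (f x - g x); nra.
- by apply: intgZ; exact: intgD.
Qed.
Lemma rL2N f : rL2 f -> rL2 (fun x => - f x).
Proof.
move=> [mf f2]; split; first exact: mcomp.
by under eq_fun do rewrite sqrrN.
Qed.
Lemma rL2B f g : rL2 f -> rL2 g -> rL2 (fun x => f x - g x).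
Proof. by move=> f2 g2; apply: rL2D => //; exact: rL2N. Qed.
Lemma rL2_trans f (z : R) : rL2 f -> rL2 (fun x => f (x - z)).
Proof.
move=> [mf f2]; split.
 rewrite (_ : (fun _ => _) = fun x => f (1 * x + - z)).
  by apply: mcomp mf _; exact: measurable_affine.
 by apply/funext => x; rewrite mul1r.
have := @intg_affine R 1 (- z) (fun x => f x ^+ 2) (oner_neq0 _) f2.
by under eq_fun do rewrite mul1r.
Qed.
Lemma rL2_sq_trans f (z : R) : rL2 f -> \int[leb]_x (f (x - z) ^+ 2) = \int[leb]_x (f x ^+ 2).
Proof.
move=> [mf f2]; have := @Rint_affine R 1 (- z) (fun x => f x ^+ 2) (oner_neq0 _) f2.
by rewrite normr1 invr1 mul1r => <-; apply: eq_Rintegral => x _; rewrite mul1r.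
Qed.
Lemma rL2_sqD f g : rL2 f -> rL2 g ->
 \int[leb]_x ((f x + g x) ^+ 2) <= 2 * (\int[leb]_x (f x ^+ 2) + \int[leb]_x (g x ^+ 2)).
Proof.
move=> f2 g2; have [_ fg] := rL2D f2 g2; case: f2 g2 => [mf f2] [mg g2].
rewrite -RintD// -RintZ; last exact: intgD.
apply: Rint_le => //; first by apply: intgZ; exact: intgD.
by move=> x; have := sqr_ge0 (f x - g x); nra.
Qed.

Lemma rL2_truncate f (e : R) : rL2 f -> 0 < e ->
 exists N : nat, let g := fun x => f x * (\1_[set x | `|x| <= N%:R /\ `|f x| <= N%:R] x) in
  rL2 g /\ \int[leb]_x ((f x - g x) ^+ 2) <= e.
Proof.
move=> [mf f2] e0.
pose A (N : nat) := [set x | `|x| <= N%:R /\ `|f x| <= N%:R].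
have mA N : measurable (A N).
 rewrite (_ : A N = ((fun x : R => `|x|) @^-1` [set y : R | y <= N%:R]) `&` ((fun x => `|f x|) @^-1` [set y : R | y <= N%:R])).
  apply: measurableI; rewrite -[X in measurable X]setTI.
   by apply: (@normr_measurable R setT) => //; rewrite -set_itvNyc.
  by apply: (mcomp (@normr_measurable R setT) mf measurableT) => //; rewrite -set_itvNyc.
 by apply/seteqP; split.
pose g N x := f x * \1_(A N) x.
have mg N : meas (g N) by apply: measurable_funM.
have gE N x : g N x = if x \in A N then f x else 0.
 by rewrite /g indicE; case: (x \in A N) => /=; rewrite ?mulr1 ?mulr0.
have ae_g x : \forall N \near \oo, x \in A N.
 near=> N; rewrite inE; split.
  by near: N; exact: nbhs_infty_ger.
 by near: N; exact: nbhs_infty_ger.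
have [|||||_ h] := @Rint_dct _ _ R leb (fun N x => (f x - g N x) ^+ 2) (cst 0) (fun x => f x ^+ 2).
- by move=> n; apply: (measurable_funX 2); apply: measurable_funB; [exact: mf|exact: mg].
- exact: measurable_cst.
- apply: aeW => x; apply: cvg_near_cst; apply: filterS (ae_g x) => N xN.
 by rewrite gE xN subrr expr0n.
- exact: f2.
- move=> n x; rewrite ger0_norm ?sqr_ge0// gE; case: ifP => _; last by rewrite subr0.
 by rewrite subrr expr0n/= sqr_ge0.
move: h; rewrite Rintg0 => /cvgrPdist_le /(_ _ e0)[N _ /(_ N (leqnn N))] /=.
rewrite sub0r normrN ger0_norm; last by apply: Rint_ge0 => x; exact: sqr_ge0.
move=> h; exists N; split => //; split; first exact: (mg N).
apply: (@intg_le _ _ _ leb _ _ _ _ f2); first by apply: (measurable_funX 2); exact: (mg N).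
move=> x; rewrite ger0_norm ?sqr_ge0// -/(g N x) gE; case: ifP => // _.
by rewrite expr0n/= sqr_ge0.
Unshelve. all: end_near.
Qed.

Lemma rL2_approx f (e : R) : rL2 f -> 0 < e ->
 exists (g : R -> R) (N : nat), [/\ continuous g, forall x, `|g x| <= N%:R,
  rL2 (fun x => g x * \1_`[- N%:R, N%:R] x) &
  \int[leb]_x ((f x - g x * \1_`[- N%:R, N%:R] x) ^+ 2) <= e].
Proof.
move=> f2 e0.
have [|N] := rL2_truncate f2 (_ : 0 < e / 4); first by rewrite divr_gt0.
set fN := fun x => _ => -[fN2 hN].
pose I : set R := [set` `[- N%:R, N%:R]].
have mI : measurable I by exact: measurable_itv.
have Ifin : (leb I < +oo)%E by rewrite lebesgue_measure_itv/=; case: ifP; rewrite ?ltry// -EFinD ltry.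
have fNb x : `|fN x| <= N%:R.
 rewrite /fN indicE; case: (boolP (_ \in _)) => /= [|_]; last by rewrite mulr0 normr0.
 by rewrite inE => -[_ h]; rewrite mulr1.
have fN0 x : ~ I x -> fN x = 0.
 move=> nI; rewrite /fN indicE; case: (boolP (_ \in _)) => /= [|_]; last by rewrite mulr0.
 rewrite inE => -[h _]; exfalso; apply: nI.
 by rewrite /I/= in_itv/= -ler_norml.
have mfN : meas fN by case: fN2.
have ifN : leb.-integrable I (EFin \o fN).
 apply: measurable_bounded_integrable => //; first exact: measurable_funTS.
 exists N%:R; split; first by rewrite num_real.
 by move=> x Nx y _ /=; apply: le_trans (fNb y) (ltW Nx).
have [g_ [cg ig gcv]] := approximation_continuous_integrable mI Ifin ifN.
(* On [I] the two functions differ by at most 2 N, so this L^1 error makes a squared L^2 error of at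
   most e / 4; the added 1 covers N = 0. *)
have e1 : 0 < e / (4 * (2 * N%:R + 1)).
 by rewrite divr_gt0// mulr_gt0// ltr_wpDl// mulr_ge0.
have [g [cg1 ig1 hg1]] : exists g : R -> R, [/\ continuous g, leb.-integrable I (EFin \o g) &
  (\int[leb]_(z in I) `|(fN z - g z)%:E| <= (e / (4 * (2 * N%:R + 1)))%:E)%E].
 move/fine_cvgP : gcv => [fin /cvgrPdist_le /(_ _ e1)] h.
 have [n _ /(_ n (leqnn n)) [hf /=]] := filterI fin h.
 rewrite sub0r normrN ger0_norm; last by apply: fine_ge0; exact: integral_ge0.
 by move=> hn; exists (g_ n); split => //; rewrite -(fineK hf) lee_fin.
(* Clamping to [-N, N] brings the approximation no further away from [fN], whose values lie
   there. *)
pose c x := Num.max (- N%:R) (Num.min N%:R (g x)).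
have cc : continuous c.
 move=> x; apply: (@continuous_max R R (fun=> - N%:R) (fun x => Num.min N%:R (g x))); first exact: cst_continuous.
 by apply: (@continuous_min R R (fun=> N%:R)); [exact: cst_continuous|exact: cg1].
have N0 : 0 <= N%:R :> R by [].
have cb x : `|c x| <= N%:R.
 rewrite /c ler_norml le_max lexx/= ge_max ge_min lexx/= andbT.
 lra.
have cle x : `|fN x - c x| <= `|fN x - g x|.
 have := fNb x; rewrite ler_norml => /andP[h1 h2].
 rewrite /c; case: (leP N%:R (g x)) => h3.
  rewrite max_r; last lra.
  by rewrite !ler0_norm; lra.
 case: (leP (- N%:R) (g x)) => h4 //.
 by rewrite !ger0_norm; lra.
have mc : meas c by exact: continuous_measurable_fun.
pose h x := c x * \1_I x.
have mh : meas h by apply: measurable_funM.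
have hE x : h x = if x \in I then c x else 0.
 by rewrite /h indicE; case: (x \in I) => /=; rewrite ?mulr1 ?mulr0.
have h2 : rL2 h.
 split => //; apply: (@intg_le _ _ _ leb _ (fun x : R => N%:R ^+ 2 * \1_I x)).
 - exact: (measurable_funX 2).
 - move=> x; rewrite ger0_norm ?sqr_ge0// hE indicE; case: (x \in I) => /=.
   by rewrite mulr1 -real_normK ?num_real// ler_sqr ?nnegrE//; exact: cb.
  by rewrite expr0n mulr0 /=.
 - by apply: intgZ; apply: (@intg_indic _ _ R leb I).
exists c, N; split => //; rewrite -/h.
have d2 : rL2 (fun x => fN x - h x) by exact: rL2B.
apply: (@le_trans _ _ (2 * (\int[leb]_x ((f x - fN x) ^+ 2) + \int[leb]_x ((fN x - h x) ^+ 2)))).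
 have -> : \int[leb]_x ((f x - h x) ^+ 2) = \int[leb]_x (((f x - fN x) + (fN x - h x)) ^+ 2).
  by apply: eq_Rintegral => x _; congr (_ ^+ 2); ring.
 by apply: rL2_sqD => //; exact: rL2B.
suff : \int[leb]_x ((fN x - h x) ^+ 2) <= e / 4 by lra.
rewrite -lee_fin -intgE; last by case: d2.
have -> : (\int[leb]_x ((fN x - h x) ^+ 2)%:E = \int[leb]_(x in I) ((fN x - h x) ^+ 2)%:E)%E.
 rewrite [RHS]integral_mkcond; apply: eq_integral => x _; rewrite patchE.
 case: ifPn => // xI; rewrite hE (negbTE xI) fN0 ?subr0 ?expr0n//.
 by move=> Ix; move: xI; rewrite notin_setE; apply.
apply: (@le_trans _ _ (\int[leb]_(x in I) ((2 * N%:R)%:E * `|(fN x - g x)%:E|))%E).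
 apply: ge0_le_integral => //.
 - by move=> x _; rewrite lee_fin sqr_ge0.
 - by apply/mEFinP; apply: measurable_funTS; apply: (measurable_funX 2); case: d2.
 - apply: measurable_funTS; apply: measurable_funeM; apply: mcomp => //.
  apply/mEFinP; apply: measurable_funB => //.
  exact: continuous_measurable_fun.
 - move=> x Ix; rewrite /= lee_fin hE mem_set// -real_normK ?num_real// expr2.
  apply: ler_pM => //.
  apply: (le_trans (ler_normB _ _)); have := fNb x; have := cb x; lra.
rewrite ge0_integralZl//; last first.
 apply: measurable_funTS; apply: mcomp => //.
 by apply/mEFinP; apply: measurable_funB => //; exact: continuous_measurable_fun.
apply: (le_trans (lee_wpmul2l _ hg1)); first by rewrite lee_fin; lra.
rewrite -EFinM lee_fin mulrA ler_pdivrMr; last by lra.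
have -> : e / 4 * (4 * (2 * N%:R + 1)) = 2 * N%:R * e + e by field.
by rewrite lerDl ltW.
Qed.

Lemma cutoff_translation_cvg (g : R -> R) (N : nat) (u : R) :
 continuous g -> (forall x, `|g x| <= N%:R) -> rL2 (fun x => g x * \1_`[- N%:R, N%:R] x) ->
 let h := fun x => g x * \1_`[- N%:R, N%:R] x in
 \int[leb]_x ((h x - h (x - u / n.+1%:R)) ^+ 2) @[n --> \oo] --> 0.
Proof.
move=> cg gN h2 h.
pose M : R := N%:R + `|u|.
have hE x : h x = if `|x| <= N%:R then g x else 0.
 rewrite /h indicE; case: (leP `|x| N%:R) => xN.
  by rewrite mem_set ?mulr1//= in_itv/= -ler_norml.
 by rewrite memNset ?mulr0//= in_itv/= -ler_norml; apply/negP; rewrite -ltNge.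
have hN x : `|h x| <= N%:R by rewrite hE; case: ifP => // _; rewrite normr0.
have MI : (leb [set` `[(- M)%R, M%R]] < +oo)%E.
 by rewrite lebesgue_measure_itv/=; case: ifP; rewrite ?ltry// -EFinD ltry.
have u_cvg : u / n.+1%:R @[n --> \oo] --> 0.
 rewrite -(mulr0 u); apply: cvgM; first exact: cvg_cst.
 exact: cvg_harmonic.
rewrite -(@Rintg0 _ _ R leb).
apply: (proj2 (@Rint_dct _ _ R leb (fun n x => (h x - h (x - u / n.+1%:R)) ^+ 2) (cst 0)
 (fun x => (2 * N%:R) ^+ 2 * \1_`[- M, M] x) _ _ _ _ _)).
- move=> n; apply: (measurable_funX 2); apply: measurable_funB; first by case: h2.
 by case: (rL2_trans (u / n.+1%:R) h2).
- exact: measurable_cst.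
(* The cuts at |x| = N are the only points where [h] may be discontinuous. *)
- exists [set x | `|x| = N%:R]; split.
 + rewrite (_ : [set _ | _] = [set N%:R] `|` [set - N%:R]).
   by apply: measurableU; exact: measurable_set1.
  apply/seteqP; split => x /=.
   by move=> /eqP; rewrite eqr_norml => /andP[/orP[] /eqP -> _]; [left|right].
  by case=> ->; rewrite ?normrN ger0_norm.
 + rewrite (_ : [set _ | _] = [set N%:R; - N%:R]).
   apply: countable_lebesgue_measure0; apply: finite_set_countable.
   exact: finite_set2.
  apply/seteqP; split => x /=.
   by move=> /eqP; rewrite eqr_norml => /andP[/orP[] /eqP -> _]; [left|right].
  by case=> ->; rewrite ?normrN ger0_norm.
 move=> x /=; apply: contra_notP => /eqP xN.
 suff hc : h (x - u / n.+1%:R) @[n --> \oo] --> h x.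
  rewrite [X in _ --> X](_ : _ = (h x - h x) * (h x - h x)); last by rewrite subrr mulr0.
  under eq_fun do rewrite expr2.
  by apply: cvgM; apply: cvgB => //; exact: cvg_cst.
 have xu : x - u / n.+1%:R @[n --> \oo] --> x.
  by rewrite -[X in _ --> X]subr0; apply: cvgB => //; exact: cvg_cst.
 move: xN; rewrite neq_lt => /orP[] xN.
  rewrite hE ltW//; apply: cvg_trans; last exact: (continuous_cvg _ (cg x) xu).
  apply: near_eq_cvg; near=> n; rewrite hE ifT//.
  by near: n; apply: (cvgr_le _ (cvg_norm xu)).
 rewrite hE leNgt xN/=; apply: cvg_near_cst; near=> n.
 rewrite hE ifF//; apply/negbTE; rewrite -ltNge.
 by near: n; apply: (cvgr_gt _ (cvg_norm xu)).
- apply: intgZ; apply: (@intg_indic _ _ R leb [set` `[- M, M]]) MI; exact: measurable_itv.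
- move=> n x; rewrite ger0_norm ?sqr_ge0// indicE.
 have un : `|u / n.+1%:R| <= `|u|.
  by rewrite normrM normfV ler_piMr// ger0_norm// invf_le1// ler1n.
 case: (leP `|x| M) => xM.
  rewrite mem_set ?mulr1/= ?in_itv/= -?ler_norml//.
  rewrite -real_normK ?num_real// ler_sqr ?nnegrE ?mulr_ge0//.
  apply: (le_trans (ler_normB _ _)); have := hN x; have := hN (x - u / n.+1%:R); lra.
 rewrite [h x]hE ifF; last by apply/negbTE; rewrite -ltNge; move: xM; rewrite /M; have := normr_ge0 u; lra.
 rewrite hE ifF; last first.
  apply/negbTE; rewrite -ltNge; have := lerB_dist x (u / n.+1%:R).
  by move: xM; rewrite /M; lra.
 by rewrite subrr expr0n/= mulr_ge0// sqr_ge0.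
Unshelve. all: end_near.
Qed.

(** Translations are isometries, so the limit is only needed on the dense class of truncated
    continuous functions. *)
Lemma rL2_translation_cvg f (u : R) : rL2 f ->
 \int[leb]_x ((f x - f (x - u / n.+1%:R)) ^+ 2) @[n --> \oo] --> 0.
Proof.
move=> f2; apply/cvgrPdist_le => e e0.
(* The errors add up to e: 2 (2 (e/16 + e/16) + e/4). *)
have [|g [N [cg gN h2 he]]] := rL2_approx f2 (_ : 0 < e / 16); first by rewrite divr_gt0.
have := cutoff_translation_cvg u cg gN h2.
set h := fun x => _ in h2 he * => /= /cvgrPdist_le.
have e4 : 0 < e / 4 by rewrite divr_gt0.
move=> /(_ _ e4); apply: filterS => n.
rewrite !sub0r !normrN !ger0_norm; [|by apply: Rint_ge0 => x; exact: sqr_ge0..].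
set z := u / _ => hn.
have d2 := rL2B f2 h2; have dz2 := rL2_trans z d2.
have hz2 := rL2B h2 (rL2_trans z h2).
apply: (@le_trans _ _ (2 * (\int[leb]_x (((f x - h x) - (f (x - z) - h (x - z))) ^+ 2) +
  \int[leb]_x ((h x - h (x - z)) ^+ 2)))).
 have -> : \int[leb]_x ((f x - f (x - z)) ^+ 2) =
  \int[leb]_x ((((f x - h x) - (f (x - z) - h (x - z))) + (h x - h (x - z))) ^+ 2).
  by apply: eq_Rintegral => x _; congr (_ ^+ 2); ring.
 by apply: rL2_sqD => //; exact: rL2B.
have : \int[leb]_x (((f x - h x) - (f (x - z) - h (x - z))) ^+ 2) <= 2 * (e / 16 + e / 16).
 apply: (le_trans (rL2_sqD d2 (rL2N dz2))).
 have -> : \int[leb]_x ((- (f (x - z) - h (x - z))) ^+ 2) = \int[leb]_x ((f x - h x) ^+ 2).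
  by rewrite -(rL2_sq_trans z d2); apply: eq_Rintegral => x _; rewrite sqrrN.
 by move: he; rewrite /h; lra.
lra.
Qed.

End translation_continuity.

(** * Plancherel on the line by Gaussian regularization *)

Section real_plancherel.
Context {R : realType}.
Implicit Types (f : R -> R) (d u x : R).

(** The Fourier transform of exp(-v^2 / 2); its mass 2 pi is the constant of the Plancherel
    formula. *)
Let w u := Num.sqrt (2 * pi) * expR (- (2^-1 * u ^+ 2)) : R.
Let w_ge0 u : 0 <= w u. Proof. by rewrite mulr_ge0 ?sqrtr_ge0 ?expR_ge0. Qed.
Let w_intg : intg leb w.
Proof. by apply: intgZ; apply: intg_gauss; rewrite invr_gt0. Qed.
Let w_int : \int[leb]_u w u = 2 * pi.
Proof.
rewrite RintZ; last by apply: intg_gauss; rewrite invr_gt0.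
by rewrite Rint_gauss ?invr_gt0// invrK (mulrC pi) -expr2 sqr_sqrtr// mulr_ge0 ?pi_ge0.
Qed.

(* [K d] is the Fourier transform of the regularizing factor. *)
Let K d x := d^-1 * w (x / d).
Let K_fourier d x : 0 < d ->
 \int[leb]_v (expR (- (d ^+ 2 / 2 * v ^+ 2)) * cos (v * x)) = K d x.
Proof.
move=> d0; rewrite gauss_cos ?divr_gt0 ?exprn_gt0// /K /w [RHS]mulrA; congr (_ * expR _).
 rewrite invf_div mulrA sqrtrM ?mulr_ge0 ?pi_ge0// sqrtrV ?sqr_ge0//.
 by rewrite sqrtr_sqr gtr0_norm// mulrC (mulrC pi).
by field; rewrite gt_eqF.
Qed.

Let Cf f (xi : R) := \int[leb]_x (f x * cos (xi * x)).
Let Sf f (xi : R) := \int[leb]_x (f x * sin (xi * x)).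
Let mcosM (xi : R) : meas (fun x : R => cos (xi * x)).
Proof.
apply: continuous_measurable_fun => x.
by apply: continuous_comp; [exact: mulrl_continuous|exact: continuous_cos].
Qed.
Let msinM (xi : R) : meas (fun x : R => sin (xi * x)).
Proof.
apply: continuous_measurable_fun => x.
by apply: continuous_comp; [exact: mulrl_continuous|exact: continuous_sin].
Qed.

Let if_cos f xi : intg leb f -> intg leb (fun x => f x * cos (xi * x)).
Proof. by move=> fi; apply: (intgMb (M := 1)) => //; [exact: mcosM|move=> x; exact: cos_bound]. Qed.
Let if_sin f xi : intg leb f -> intg leb (fun x => f x * sin (xi * x)).
Proof. by move=> fi; apply: (intgMb (M := 1)) => //; [exact: msinM|move=> x; exact: sin_bound]. Qed.
(** The addition formula for cos (xi (x - y)) makes the squared modulus of the transform a double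
    integral. With a Gaussian factor in xi, that variable can be integrated first. *)
Let CS_sq f xi : intg leb f -> (Cf f xi) ^+ 2 + (Sf f xi) ^+ 2 =
 \int[leb2]_z (f z.1 * f z.2 * cos (xi * (z.1 - z.2))).
Proof.
move=> fi; have i1 := if_cos xi fi; have i2 := if_sin xi fi.
rewrite /Cf /Sf !expr2 -(Rint_tensor i1 i1) -(Rint_tensor i2 i2).
rewrite -(RintD (intg_tensor i1 i1) (intg_tensor i2 i2)).
apply: eq_Rintegral => z _; rewrite mulrBr cosB; ring.
Qed.

Let reg f d := \int[leb]_xi (expR (- (d ^+ 2 / 2 * xi ^+ 2)) * ((Cf f xi) ^+ 2 + (Sf f xi) ^+ 2)).
Let measurable_reg_kernel d : meas
 (fun p : R * (R * R) => cos (p.1 * (p.2.1 - p.2.2))).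
Proof.
apply: mcomp; first by apply: continuous_measurable_fun; exact: continuous_cos.
apply: measurable_funM => //; apply: measurable_funB.
 exact: mcomp measurable_fst measurable_snd.
exact: mcomp measurable_snd measurable_snd.
Qed.

Let reg_facts f d : 0 < d -> intg leb f ->
 intg leb (fun xi => expR (- (d ^+ 2 / 2 * xi ^+ 2)) * ((Cf f xi) ^+ 2 + (Sf f xi) ^+ 2)) /\
 intg leb2 (fun z => f z.1 * f z.2 * K d (z.1 - z.2)) /\
 reg f d = \int[leb2]_z (f z.1 * f z.2 * K d (z.1 - z.2)).
Proof.
move=> d0 fi.
have d2 : 0 < d ^+ 2 / 2 by rewrite divr_gt0 ?exprn_gt0.
have gi := intg_gauss d2.
have ffi := intg_tensor fi fi.
have Hi := intg_tensor gi ffi.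
have Hc : intg (pmeas leb leb2)
  (fun p => expR (- (d ^+ 2 / 2 * p.1 ^+ 2)) * (f p.2.1 * f p.2.2) * cos (p.1 * (p.2.1 - p.2.2))).
 apply: (intgMb (M := 1)); [exact: Hi|exact: (measurable_reg_kernel d)|].
 by move=> p; exact: cos_bound.
have [i1 e1] := intg_Fubini1 Hc; have [i2 e2] := intg_Fubini2 Hc.
have E1 (xi : R) : \int[leb2]_z (expR (- (d ^+ 2 / 2 * xi ^+ 2)) * (f z.1 * f z.2) *
  cos (xi * (z.1 - z.2))) = expR (- (d ^+ 2 / 2 * xi ^+ 2)) * ((Cf f xi) ^+ 2 + (Sf f xi) ^+ 2).
 rewrite CS_sq// -RintZ.
  by apply: eq_Rintegral => z _; rewrite -!mulrA.
 apply: (intgMb (M := 1)) => //.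
  apply: mcomp; first by apply: continuous_measurable_fun; exact: continuous_cos.
  by apply: measurable_funM => //; apply: measurable_funB.
 by move=> z; exact: cos_bound.
have E2 (z : R * R) : \int[leb]_xi (expR (- (d ^+ 2 / 2 * xi ^+ 2)) * (f z.1 * f z.2) *
  cos (xi * (z.1 - z.2))) = f z.1 * f z.2 * K d (z.1 - z.2).
 rewrite -K_fourier// -RintZ.
  by apply: eq_Rintegral => v _; ring.
 have := intg_pgauss_cos 1 (z.1 - z.2) d2.
 by under eq_fun do rewrite /pgauss hornerC mul1r.
split; first by move: i1; under eq_fun do rewrite E1.
split; first by move: i2; under eq_fun do rewrite E2.
transitivity (\int[leb]_xi \int[leb2]_z (expR (- (d ^+ 2 / 2 * xi ^+ 2)) * (f z.1 * f z.2) *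
  cos (xi * (z.1 - z.2)))).
 by apply: eq_Rintegral => xi _; rewrite E1.
rewrite [LHS]e1 -e2.
by apply: eq_Rintegral => z _; exact: E2.
Qed.

Let mw : meas w. Proof. exact: intg_meas w_intg. Qed.
Let mK d : meas (K d).
Proof.
apply: measurable_funM => //; apply: mcomp mw _.
by apply: measurable_funM.
Qed.

Let mshear d : meas (fun p : R * R => (p.1, p.1 - d * p.2)).
Proof.
apply/measurable_fun_pairP; split; first exact: measurable_fst.
rewrite (_ : snd \o _ = fun p : R * R => p.1 - d * p.2)//.
by apply: measurable_funB => //; apply: measurable_funM.
Qed.

(** For fixed x the substitution y = x - d u replaces the concentrating kernel [K d] by the fixed
    weight [w]; the dependence on d moves into the translate. *)
Let avg (F : R * R -> R) d : 0 < d -> meas F -> (forall z, 0 <= F z) ->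
 (\int[leb2]_z (F z * K d (z.1 - z.2))%:E =
  \int[leb]_u ((w u)%:E * \int[leb]_x (F (x, x - d * u)%R)%:E))%E.
Proof.
move=> d0 mF F0.
have K0 x : 0 <= K d x by rewrite mulr_ge0// invr_ge0 ltW.
have mFK : meas (fun z : R * R => F z * K d (z.1 - z.2)).
 apply: measurable_funM => //; apply: mcomp (mK d) _.
 exact: measurable_funB.
have mG : meas (fun p : R * R => w p.2 * F (p.1, p.1 - d * p.2)).
 apply: measurable_funM; first exact: mcomp mw measurable_snd.
 exact: mcomp mF (mshear d).
transitivity (\int[leb]_x \int[leb]_y (F (x, y) * K d (x - y))%:E)%E.
 apply: (@fubini_tonelli1 _ _ _ _ _ leb leb (fun z => (F z * K d (z.1 - z.2))%:E)).
 - exact/mEFinP.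
 - by move=> z; rewrite lee_fin mulr_ge0.
transitivity (\int[leb]_x \int[leb]_u (w u * F (x, x - d * u))%:E)%E; last first.
 rewrite (@fubini_tonelli _ _ _ _ _ leb leb (fun p : R * R => (w p.2 * F (p.1, p.1 - d * p.2))%:E)).
 - apply: eq_integral => u _ /=.
  under eq_integral do rewrite EFinM.
  rewrite ge0_integralZl ?lee_fin//.
  + apply/mEFinP; apply: mcomp mF _.
   exact: (mcomp (mshear d) (pair2_meas u)).
  + by move=> x _; rewrite lee_fin.
 - exact/mEFinP.
 - by move=> z; rewrite lee_fin mulr_ge0.
apply: eq_integral => x _.
have dn0 : - d != 0 by rewrite oppr_eq0 gt_eqF.
have mFx : meas (fun y : R => (F (x, y) * K d (x - y))%:E).
 by apply/mEFinP; apply: mcomp mFK _; exact: pair1_meas.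
have := @lebesgue_affine R (- d) x _ dn0 mFx (fun y => _).
rewrite normrN gtr0_norm// => h.
have {}h := h (fun y => (mulr_ge0 (F0 (x, y)) (K0 (x - y)) : (0 <= (F (x, y) * K d (x - y))%:E)%E)).
have -> : (\int[leb]_y (F (x, y) * K d (x - y))%:E =
  d%:E * \int[leb]_u (F (x, - d * u + x) * K d (x - (- d * u + x)))%:E)%E.
 by rewrite h muleA -EFinM divff ?mul1e// gt_eqF.
rewrite -ge0_integralZl ?lee_fin ?ltW//; last 2 first.
- apply: mcomp mFx _; exact: measurable_affine.
- by move=> u _; rewrite lee_fin mulr_ge0.
apply: eq_integral => u _; rewrite -EFinM; congr EFin.
rewrite (_ : - d * u + x = x - d * u); last by ring.
rewrite (_ : x - (x - d * u) = d * u); last by ring.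
rewrite /K (_ : d * u / d = u); last by rewrite mulrAC divff ?mul1r// gt_eqF.
by rewrite mulrCA (mulrA d) divff ?mul1r ?gt_eqF// mulrC.
Qed.

Let w_intE : (\int[leb]_u (w u)%:E = (2 * pi)%:E)%E.
Proof. by rewrite intgE// w_int. Qed.
Let avg_sq f d : 0 < d -> rL2 f ->
 [/\ intg leb2 (fun z => (f z.1 ^+ 2 + f z.2 ^+ 2) * K d (z.1 - z.2)) &
 \int[leb2]_z ((f z.1 ^+ 2 + f z.2 ^+ 2) * K d (z.1 - z.2)) =
  4 * pi * \int[leb]_x (f x ^+ 2)].
Proof.
move=> d0 f2; have [mf if2] := f2.
have mf1 : meas (fun z : R * R => f z.1) by exact: mcomp mf measurable_fst.
have mf2 : meas (fun z : R * R => f z.2) by exact: mcomp mf measurable_snd.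
have mF : meas (fun z : R * R => f z.1 ^+ 2 + f z.2 ^+ 2).
 by apply: measurable_funD; exact: (measurable_funX 2).
have mFK : meas (fun z : R * R => (f z.1 ^+ 2 + f z.2 ^+ 2) * K d (z.1 - z.2)).
 apply: measurable_funM => //; apply: mcomp (mK d) _.
 exact: measurable_funB.
have F0 (z : R * R) : 0 <= f z.1 ^+ 2 + f z.2 ^+ 2 by rewrite addr_ge0 ?sqr_ge0.
have E : (\int[leb2]_z ((f z.1 ^+ 2 + f z.2 ^+ 2) * K d (z.1 - z.2))%:E =
  (4 * pi * \int[leb]_x (f x ^+ 2))%:E)%E.
 rewrite (avg d0 mF F0).
 under eq_integral => u _.
  have -> : (\int[leb]_x ((f x ^+ 2 + f (x - d * u) ^+ 2))%:E = (2 * \int[leb]_x (f x ^+ 2))%:E)%E.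
   have [m2 i2] := rL2_trans (d * u) f2.
   by rewrite intgE ?RintD// ?rL2_sq_trans//; [congr EFin; ring|exact: intgD].
  over.
 rewrite ge0_integralZr//.
 - by rewrite w_intE -EFinM; congr EFin; ring.
 - exact/mEFinP.
 - by move=> x _; rewrite lee_fin.
 - by rewrite lee_fin mulr_ge0//; apply: Rint_ge0 => x; exact: sqr_ge0.
have I : intg leb2 (fun z => (f z.1 ^+ 2 + f z.2 ^+ 2) * K d (z.1 - z.2)).
 apply/intgP => //; last by rewrite E ltry.
 by move=> z; rewrite mulr_ge0// mulr_ge0// invr_ge0 ltW.
by split => //; apply: EFin_inj; rewrite -intgE.
Qed.

Let T f (z : R) := \int[leb]_x ((f x - f (x - z)) ^+ 2).
Let T_le f z : rL2 f -> 0 <= T f z <= 4 * \int[leb]_x (f x ^+ 2).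
Proof.
move=> f2; rewrite Rint_ge0//=; last by move=> x; exact: sqr_ge0.
apply: (le_trans (rL2_sqD f2 (rL2N (rL2_trans z f2)))).
have -> : \int[leb]_x ((- f (x - z)) ^+ 2) = \int[leb]_x (f x ^+ 2).
 by rewrite -(rL2_sq_trans z f2); apply: eq_Rintegral => x _; rewrite sqrrN.
lra.
Qed.

Let avg_diff f d : 0 < d -> rL2 f ->
 [/\ meas (fun u => w u * T f (d * u)),
  intg leb2 (fun z => (f z.1 - f z.2) ^+ 2 * K d (z.1 - z.2)) &
 \int[leb2]_z ((f z.1 - f z.2) ^+ 2 * K d (z.1 - z.2)) = \int[leb]_u (w u * T f (d * u))].
Proof.
move=> d0 f2; have [mf if2] := f2.
have mf1 : meas (fun z : R * R => f z.1) by exact: mcomp mf measurable_fst.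
have mf2 : meas (fun z : R * R => f z.2) by exact: mcomp mf measurable_snd.
have mF : meas (fun z : R * R => (f z.1 - f z.2) ^+ 2).
 by apply: (measurable_funX 2); exact: measurable_funB.
have mFK : meas (fun z : R * R => (f z.1 - f z.2) ^+ 2 * K d (z.1 - z.2)).
 apply: measurable_funM => //; apply: mcomp (mK d) _.
 exact: measurable_funB.
have F0 (z : R * R) : 0 <= (f z.1 - f z.2) ^+ 2 by rewrite sqr_ge0.
have TE u : (\int[leb]_x ((f x - f (x - d * u)) ^+ 2)%:E = (T f (d * u))%:E)%E.
 by rewrite intgE//; case: (rL2B f2 (rL2_trans (d * u) f2)).
have mT : meas (fun u => w u * T f (d * u)).
 apply: measurable_funM => //.
 have mG : meas (fun p : R * R => ((f p.1 - f (p.1 - d * p.2)) ^+ 2)%:E).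
  by apply/mEFinP; exact: mcomp mF (mshear d).
 have := @measurable_fun_fubini_tonelli_G _ _ _ _ _ leb _ mG _.
 rewrite (_ : fubini_G _ _ = fun u => (T f (d * u))%:E); last by apply/funext => u; exact: TE.
 move=> h; apply/mEFinP; apply: h => z; by rewrite lee_fin sqr_ge0.
have E : (\int[leb2]_z ((f z.1 - f z.2) ^+ 2 * K d (z.1 - z.2))%:E =
  \int[leb]_u (w u * T f (d * u))%:E)%E.
 rewrite (avg d0 mF F0); apply: eq_integral => u _ /=.
 by rewrite TE EFinM.
have Iw : intg leb (fun u => w u * T f (d * u)).
 apply: (@intg_le _ _ _ leb _ (fun u : R => 4 * \int[leb]_x (f x ^+ 2) * w u)) => //.
  move=> u; have /andP[h1 h2] := T_le (d * u) f2.
  by rewrite ger0_norm ?mulr_ge0// mulrC ler_wpM2r.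
 exact: intgZ.
have I : intg leb2 (fun z => (f z.1 - f z.2) ^+ 2 * K d (z.1 - z.2)).
 apply/intgP => //; last by rewrite E intgE// ltry.
 by move=> z; rewrite mulr_ge0// mulr_ge0// invr_ge0 ltW.
by split => //; apply: EFin_inj; rewrite -!intgE.
Qed.

(** From 2 f(x) f(y) = f(x)^2 + f(y)^2 - (f(x) - f(y))^2: the regularized integral is the full
    energy minus an average of translation defects. *)
Let regE f d : 0 < d -> intg leb f -> rL2 f ->
 reg f d = 2 * pi * \int[leb]_x (f x ^+ 2) - 2^-1 * \int[leb]_u (w u * T f (d * u)).
Proof.
move=> d0 fi f2; have [_ [i1 ->]] := reg_facts d0 fi.
have [i2 e2] := avg_sq d0 f2; have [_ i3 e3] := avg_diff d0 f2.
rewrite -e3.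
suff : 2 * \int[leb2]_z (f z.1 * f z.2 * K d (z.1 - z.2)) + \int[leb2]_z ((f z.1 - f z.2) ^+ 2 * K d (z.1 - z.2))
  = 4 * pi * \int[leb]_x (f x ^+ 2) by lra.
rewrite -e2 -RintZ// -RintD//; last exact: intgZ.
by apply: eq_Rintegral => z _; ring.
Qed.

(** As d decreases to 0, the left side of [regE] increases to the integral of the squared transform,
    while the defect vanishes by dominated convergence and continuity of translations. *)
Lemma real_plancherel f : intg leb f -> rL2 f ->
 [/\ meas (Cf f), meas (Sf f) &
  (\int[leb]_xi (Cf f xi ^+ 2 + Sf f xi ^+ 2)%:E = (2 * pi * \int[leb]_x (f x ^+ 2))%:E)%E].
Proof.
move=> fi f2.
(* A Gaussian in xi makes the integrand integrable on the plane, so that Fubini yields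
   measurability; it is divided out afterwards. *)
have mtrig (h : R -> R) (H : R -> R) : meas h -> (forall x, `|h x| <= 1) ->
  (forall xi, H xi = \int[leb]_x (f x * h (xi * x))) -> meas H.
 move=> mh h1 HE.
 have gi := @intg_gauss R 1 ltr01.
 have Hi : intg leb2 (fun z => expR (- (1 * z.1 ^+ 2)) * f z.2 * h (z.1 * z.2)).
  apply: (intgMb (M := 1)); [exact: (intg_tensor gi fi)| |by move=> ?; exact: h1].
  by apply: mcomp mh _; exact: measurable_funM.
 have [i1 _] := intg_Fubini1 Hi.
 have E : H = fun xi => expR (1 * xi ^+ 2) *
   \int[leb]_y (expR (- (1 * xi ^+ 2)) * f y * h (xi * y)).
  apply/funext => xi.
  under eq_Rintegral do rewrite -mulrA.
  rewrite RintZ; last first.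
   apply: (intgMb (M := 1)) => //; apply: mcomp mh _; exact: measurable_funM.
  by rewrite mulrA -expRD subrr expR0 mul1r.
 rewrite E; apply: measurable_funM; last exact: (intg_meas i1).
 apply: mcomp => //; apply: measurable_funM => //.
have mC : meas (Cf f).
 apply: (mtrig cos); [|exact: cos_bound|by []].
 by apply: continuous_measurable_fun; exact: continuous_cos.
have mS : meas (Sf f).
 apply: (mtrig sin); [|exact: sin_bound|by []].
 by apply: continuous_measurable_fun; exact: continuous_sin.
split => //.
pose d (n : nat) : R := n.+1%:R^-1.
have d0 n : 0 < d n by rewrite invr_gt0.
pose H xi := Cf f xi ^+ 2 + Sf f xi ^+ 2.
have H0 xi : 0 <= H xi by rewrite addr_ge0 ?sqr_ge0.
have mH : meas H by apply: measurable_funD; exact: (measurable_funX 2).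
pose g n xi := (expR (- (d n ^+ 2 / 2 * xi ^+ 2)) * H xi)%:E.
have mg n : meas (g n).
 apply/mEFinP; apply: measurable_funM => //.
 have gi := @intg_gauss R (d n ^+ 2 / 2) _; apply: (intg_meas (gi _)).
 by rewrite divr_gt0 ?exprn_gt0.
have dcvg : d n @[n --> \oo] --> 0 by exact: cvg_harmonic.
have h1 : (\int[leb]_xi g n xi)%E @[n --> \oo] --> (\int[leb]_xi (H xi)%:E)%E.
 have -> : (\int[leb]_xi (H xi)%:E = \int[leb]_xi limn (g ^~ xi))%E.
  apply: eq_integral => xi _.
  apply/esym/cvg_lim => //; apply: cvg_EFin; first exact: nearW.
  have c0 : d n * d n * (xi ^+ 2 / 2) @[n --> \oo] --> 0 * 0 * (xi ^+ 2 / 2).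
   by apply: cvgM; [exact: cvgM|exact: cvg_cst].
  have c1 : expR (- (d n ^+ 2 / 2 * xi ^+ 2)) @[n --> \oo] --> (1 : R).
   rewrite [X in _ --> X](_ : _ = expR (- (0 * 0 * (xi ^+ 2 / 2)))); last first.
    by rewrite !mul0r oppr0 expR0.
   have E n : d n ^+ 2 / 2 * xi ^+ 2 = d n * d n * (xi ^+ 2 / 2) by ring.
   under eq_fun do rewrite E.
   by apply: continuous_cvg; [exact: continuous_expR|exact: cvgN].
  by rewrite -[X in _ --> X]mul1r; apply: cvgM; [exact: c1|exact: cvg_cst].
 apply: (@cvg_monotone_convergence _ _ _ leb setT measurableT g) => //.
  by move=> n xi _; rewrite lee_fin mulr_ge0 ?expR_ge0.
 move=> xi _ m n mn; rewrite lee_fin ler_wpM2r// ler_expR lerN2.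
 rewrite ler_wpM2r ?sqr_ge0// ler_pM2r ?invr_gt0// ler_sqr ?nnegrE ?(ltW (d0 _))//.
 by rewrite lef_pV2 ?posrE// ler_nat.
have h2 : (\int[leb]_xi g n xi)%E @[n --> \oo] --> (2 * pi * \int[leb]_x (f x ^+ 2))%:E.
 have E n : (\int[leb]_xi g n xi = (2 * pi * \int[leb]_x (f x ^+ 2) -
   2^-1 * \int[leb]_u (w u * T f (d n * u)))%:E)%E.
  have [i1 _] := reg_facts (d0 n) fi.
  by rewrite /g intgE// -regE.
 under eq_fun do rewrite E.
 apply: cvg_EFin; first exact: nearW.
 rewrite -[X in _ --> X]subr0; apply: cvgB; first exact: cvg_cst.
 rewrite -(mulr0 2^-1); apply: cvgM; first exact: cvg_cst.
 rewrite -(@Rintg0 _ _ R leb).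
 apply: (proj2 (@Rint_dct _ _ R leb (fun n u => w u * T f (d n * u)) (cst 0)
  (fun u => 4 * \int[leb]_x (f x ^+ 2) * w u) _ _ _ _ _)).
 - by move=> n; have [] := avg_diff (d0 n) f2.
 - exact: measurable_cst.
 - apply: aeW => u /=; rewrite -(mulr0 (w u)); apply: cvgM; first exact: cvg_cst.
  have := rL2_translation_cvg u f2; apply: cvg_trans; apply: near_eq_cvg.
  by apply: nearW => n; rewrite /T/d mulrC.
 - exact: intgZ.
 - move=> n u; have /andP[h3 h4] := T_le (d n * u) f2.
  by rewrite ger0_norm ?mulr_ge0// mulrC ler_wpM2r.
exact: (cvg_unique _ h1 h2).
Qed.

End real_plancherel.

Section complex_plancherel.
Context {R : realType}.

Definition fourier1 (f : R -> R[i]) (xi : R) : R[i] :=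
 integralC leb (fun x => f x * expi (- (xi * x))).

Let C (f : R -> R) (xi : R) := \int[leb]_x (f x * cos (xi * x)).
Let S (f : R -> R) (xi : R) := \int[leb]_x (f x * sin (xi * x)).

Lemma measurable_trig (xi : R) :
 meas (fun x : R => cos (xi * x)) /\
 meas (fun x : R => sin (xi * x)).
Proof.
split; apply: continuous_measurable_fun => x.
 by apply: continuous_comp; [exact: mulrl_continuous|exact: continuous_cos].
by apply: continuous_comp; [exact: mulrl_continuous|exact: continuous_sin].
Qed.

Let fourier1E (f : R -> R[i]) xi : L1 leb f ->
 ReC (fourier1 f xi) = C (ReC \o f) xi + S (ImC \o f) xi /\
 ImC (fourier1 f xi) = C (ImC \o f) xi - S (ReC \o f) xi.
Proof.
move=> [f1 f2]; have [mc ms] := measurable_trig xi.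
have ic (g : R -> R) : intg leb g -> intg leb (fun x => g x * cos (xi * x)).
 by move=> gi; apply: (intgMb (M := 1)) => // x; exact: cos_bound.
have is_ (g : R -> R) : intg leb g -> intg leb (fun x => g x * sin (xi * x)).
 by move=> gi; apply: (intgMb (M := 1)) => // x; exact: sin_bound.
split; rewrite /C /S.
 rewrite -RintD; [|exact: ic|exact: is_].
 by apply: eq_Rintegral => x _; rewrite !cE /= cosN sinN mulrN opprK.
rewrite -RintB; [|exact: ic|exact: is_].
by apply: eq_Rintegral => x _; rewrite !cE /= cosN sinN mulrN addrC.
Qed.

Let cross_bound (a b c d : R) :
 `|a * b - c * d| <= (a ^+ 2 + d ^+ 2) + (c ^+ 2 + b ^+ 2).
Proof.
rewrite ler_norml.
have := sqr_ge0 (a - b); have := sqr_ge0 (a + b).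
have := sqr_ge0 (c - d); have := sqr_ge0 (c + d).
by move=> *; apply/andP; split; lra.
Qed.

(** The squared modulus of the transform is the sum of those of the real and imaginary parts plus
    [2 * h]; the cross term [h] is odd in xi and integrates to 0. *)
Theorem plancherel1 (f : R -> R[i]) : L1 leb f -> L2 leb f ->
 L2 leb (fourier1 f) /\ nrm leb (fourier1 f) = 2 * pi * nrm leb f.
Proof.
move=> f1 /[dup] f2 /L2P[[m1 m2] i2].
have [g1 g2] := f1.
have r1 : rL2 (ReC \o f).
 split => //; apply: intg_le i2; first exact: (measurable_funX 2).
 by move=> x; rewrite ger0_norm ?sqr_ge0// /sqnormC lerDl sqr_ge0.
have r2 : rL2 (ImC \o f).
 split => //; apply: intg_le i2; first exact: (measurable_funX 2).
 by move=> x; rewrite ger0_norm ?sqr_ge0// /sqnormC lerDr sqr_ge0.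
have [mC1 mS1 e1] := real_plancherel g1 r1.
have [mC2 mS2 e2] := real_plancherel g2 r2.
rewrite -!/(C _) -!/(S _) in mC1 mS1 mC2 mS2 e1 e2.
have sqi (g : R -> R) (c : R) : meas (C g) -> meas (S g) ->
  (\int[leb]_xi (C g xi ^+ 2 + S g xi ^+ 2)%:E = c%:E)%E ->
  intg leb (fun xi => C g xi ^+ 2 + S g xi ^+ 2) /\
  \int[leb]_xi (C g xi ^+ 2 + S g xi ^+ 2) = c.
 move=> mCg mSg e; have I : intg leb (fun xi => C g xi ^+ 2 + S g xi ^+ 2).
  apply/intgP; last by rewrite e ltry.
  - by apply: measurable_funD; exact: (measurable_funX 2).
  - by move=> x; rewrite addr_ge0 ?sqr_ge0.
 by split => //; apply: EFin_inj; rewrite -intgE.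
have [I1 E1] := sqi _ _ mC1 mS1 e1; have [I2 E2] := sqi _ _ mC2 mS2 e2.
have Re_ xi := (fourier1E xi f1).1; have Im_ xi := (fourier1E xi f1).2.
pose h xi := C (ReC \o f) xi * S (ImC \o f) xi - C (ImC \o f) xi * S (ReC \o f) xi.
have mh : meas h by apply: measurable_funB; exact: measurable_funM.
have ih : intg leb h.
 by apply: intg_le (intgD I1 I2) => // xi; exact: cross_bound.
have hN xi : h (- xi) = - h xi.
 have CN g : C g (- xi) = C g xi.
  by apply: eq_Rintegral => x _; rewrite mulNr cosN.
 have SN g : intg leb g -> S g (- xi) = - S g xi.
  move=> gi; rewrite /S -RintN; last first.
   have [_ ms] := measurable_trig xi.
   by apply: (intgMb (M := 1)) => // x; exact: sin_bound.
  by apply: eq_Rintegral => x _; rewrite mulNr sinN mulrN.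
 by rewrite /h !CN !SN//; ring.
have h0 : \int[leb]_xi h xi = 0.
 have := @Rint_affine R (-1) 0 h _ ih.
 rewrite oppr_eq0 oner_eq0 => /(_ isT); rewrite normrN1 invr1 mul1r.
 under eq_Rintegral do rewrite addr0 mulN1r hN.
 by rewrite RintN//; move: (\int[leb]_x h x) => y; lra.
have mF : measC (fourier1 f).
 split.
  rewrite (_ : _ \o _ = fun xi => C (ReC \o f) xi + S (ImC \o f) xi).
   exact: measurable_funD.
  by apply/funext => xi /=; rewrite -Re_.
 rewrite (_ : _ \o _ = fun xi => C (ImC \o f) xi - S (ReC \o f) xi).
  exact: measurable_funB.
 by apply/funext => xi /=; rewrite -Im_.
have FE xi : sqnormC (fourier1 f xi) = (C (ReC \o f) xi ^+ 2 + S (ReC \o f) xi ^+ 2) +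
  (C (ImC \o f) xi ^+ 2 + S (ImC \o f) xi ^+ 2) + 2 * h xi.
 by rewrite /sqnormC Re_ Im_ /h; ring.
have IF : intg leb (fun xi => sqnormC (fourier1 f xi)).
 by under eq_fun do rewrite FE; apply: intgD; [exact: intgD|exact: intgZ].
split; first exact/L2P.
rewrite nrmE; under eq_Rintegral do rewrite FE.
rewrite RintD; [|exact: intgD|exact: intgZ].
rewrite RintZ// h0 RintD// E1 E2 mulr0 addr0 -mulrDr -RintD; first by congr (_ * _); exact: eq_Rintegral.
 by case: r1.
by case: r2.
Qed.

End complex_plancherel.

Lemma aeS2 d (T : measurableType d) (R : realType) (mu : {measure set T -> \bar R})
  (P Q S : T -> Prop) : {ae mu, forall x, P x} -> {ae mu, forall x, Q x} ->
 (forall x, P x -> Q x -> S x) -> {ae mu, forall x, S x}.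
Proof. by move=> p q h; apply: filterS2 p q. Qed.

Lemma aeS d (T : measurableType d) (R : realType) (mu : {measure set T -> \bar R})
  (P S : T -> Prop) : {ae mu, forall x, P x} ->
 (forall x, P x -> S x) -> {ae mu, forall x, S x}.
Proof. by move=> p h; apply: filterS p. Qed.

(** * Hermite functions *)

Section Parseval.
Context d (T : measurableType d) (R : realType) (mu : {measure set T -> \bar R}).
Local Notation L2 := (L2 mu).
Local Notation nrm := (nrm mu).
Local Notation inner := (inner mu).
Variable e : nat -> T -> R[i].
Hypothesis e2 : forall k, L2 (e k).
Hypothesis e_on : forall j k, inner (e j) (e k) = (j == k)%:R.
Hypothesis e_total : forall f, L2 f -> (forall k, inner f (e k) = 0) -> {ae mu, forall x, f x = 0}.

Lemma inner_suml (I : Type) (s : seq I) (c : I -> R[i]) (F : I -> T -> R[i]) g :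
 (forall i, L2 (F i)) -> L2 g ->
 inner (fun x => \sum_(i <- s) c i * F i x) g = \sum_(i <- s) c i * inner (F i) g.
Proof.
move=> F2 g2; elim: s => [|i s IH].
 rewrite big_nil; transitivity (integralC mu (fun=> 0)); last exact: integralC0.
 by congr integralC; apply/funext => x; rewrite big_nil mul0r.
rewrite big_cons -IH -innerZ// -innerD//.
- by congr Defs.inner; apply/funext => x; rewrite big_cons.
- exact: L2Z.
- by apply: L2_sum => j _; exact: L2Z.
Qed.

Let c f k := inner f (e k).
Let s f N x := \sum_(0 <= k < N) c f k * e k x.
Let s2 f N : L2 (s f N).
Proof. by apply: L2_sum => k _; exact: L2Z. Qed.
Let inner_s f N k : inner (s f N) (e k) = if (k < N)%N then c f k else 0.
Proof.
rewrite inner_suml//.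
rewrite (eq_bigr (fun j => if j == k then c f k else 0)); last first.
 by move=> j _; rewrite e_on; case: eqVneq => [->|_]; rewrite ?mulr1 ?mulr0.
rewrite -big_mkcond/=; case: ltnP => kN.
 rewrite (big_rem k)/=; last by rewrite mem_index_iota.
 rewrite eqxx big1_seq ?addr0// => j /andP[/eqP-> ].
 by rewrite mem_rem_uniq ?iota_uniq// inE eqxx.
rewrite big1_seq// => j /andP[/eqP ->]; rewrite mem_index_iota => /=.
by rewrite ltnNge kN.
Qed.

Let rip_fs f N M : L2 f -> (N <= M)%N -> rip mu (s f M) (s f N) = \sum_(0 <= k < N) sqnormC (c f k).
Proof.
move=> f2 NM; rewrite /rip innerC// inner_suml//.
rewrite Re_conj Re_sum; apply: eq_big_nat => k /andP[_ kN].
rewrite innerC// inner_s (leq_trans kN NM) /sqnormC !cE; ring.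
Qed.

Let rip_f f N : L2 f -> rip mu f (s f N) = \sum_(0 <= k < N) sqnormC (c f k).
Proof.
move=> f2; rewrite /rip innerC// inner_suml//.
rewrite Re_conj Re_sum; apply: eq_big_nat => k /andP[_ kN].
rewrite innerC// -/(c f k) /sqnormC !cE; ring.
Qed.

(** Bessel's inequality makes the partial sums a Cauchy sequence; its limit has the coefficients of
    f, so totality identifies it with f. *)
Lemma total_Parseval f : L2 f ->
 (\sum_(0 <= k < N) sqnormC (inner f (e k))) @[N --> \oo] --> nrm f.
Proof.
move=> f2; pose S N := \sum_(0 <= k < N) sqnormC (c f k).
have ndS : nondecreasing_seq S.
 apply/nondecreasing_seqP => n; rewrite /S big_nat_recr//= lerDl; exact: sqnormC_ge0.
have SB N : S N <= nrm f.
 have := nrm_ge0 mu (fun x => f x - s f N x).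
 rewrite nrmB// rip_f// -[nrm (s f N)]rip_nrm rip_fs// -/(S N); lra.
have cS : cvgn S.
 apply: nondecreasing_is_cvgn => //; exists (nrm f) => _ [N _ <-]; exact: SB.
have [g g2 gs] : exists2 g, L2 g & nrm (fun x => s f N x - g x) @[N --> \oo] --> 0.
 apply: Riesz_Fischer => // r r0.
 have r2 : 0 < r / 2 by rewrite divr_gt0.
 move/cvgrPdist_le : (cS) => /(_ _ r2)[N _ hN]; exists N => m n Nm Nn.
 wlog mn : m n Nm Nn / (n <= m)%N.
  move=> h; case: (leqP n m) => nm; first exact: h.
  rewrite -nrmN (_ : (fun _ => _) = fun x => s f n x - s f m x); first by apply: h => //; exact: ltnW.
  by apply/funext => x; rewrite opprB.
 rewrite nrmB// rip_fs// -!rip_nrm !rip_fs// -!/(S _).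
 have /= := hN _ Nm; have /= := hN _ Nn; rewrite !ler_norml.
 move: (limn S) => l /andP[h1 h2] /andP[h3 h4]; lra.
have gE : {ae mu, forall x, f x - g x = 0}.
 apply: e_total; first exact: L2B.
 move=> k.
 have cr h : L2 h -> rip mu (s f N) h @[N --> \oo] --> rip mu g h.
  by move=> h2; exact: nrm_cvg.
 have ce (h : T -> R[i]) : L2 h -> (\forall N \near \oo, rip mu (s f N) h = rip mu f h) -> rip mu g h = rip mu f h.
  move=> h2 near_h; apply: (cvg_unique _ (cr h h2)) => //.
  by apply: cvg_near_cst.
 have i2 : L2 (fun x => 'i%C * e k x) by exact: L2Z.
 have eq N : (k < N)%N -> inner (s f N) (e k) = inner f (e k) by rewrite inner_s => ->.
 have E1 : rip mu g (e k) = rip mu f (e k).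
  by apply: ce => //; exists k.+1 => // N /= kN; rewrite /rip eq.
 have E2 : rip mu g (fun x => 'i%C * e k x) = rip mu f (fun x => 'i%C * e k x).
  apply: ce => //; exists k.+1 => // N /= kN.
  by have := eq N kN; rewrite !inner_rip// => -[].
 have fg2 := L2B f2 g2.
 by rewrite inner_rip// !ripBl// E1 E2 !subrr.
have fg : {ae mu, forall x, g x = f x}.
 by apply: filterS gE => x /eqP; rewrite subr_eq0 => /eqP ->.
have := nrm_cvg2 (s2 f) g2 gs.
rewrite (nrm_ae (L2_mc g2) (L2_mc f2) fg).
by under eq_fun do rewrite -rip_nrm rip_fs//.
Qed.

Lemma esum_Parseval f : L2 f ->
 (\esum_(k in [set: nat]) (sqnormC (inner f (e k)))%:E = sqL2norm mu f)%E.
Proof.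
move=> f2; rewrite -nneseries_esumT; last by move=> k; rewrite lee_fin sqnormC_ge0.
rewrite sqL2E//; apply/cvg_lim => //.
under eq_fun do rewrite sumEFin.
by apply: cvg_EFin; [exact: nearW|exact: total_Parseval].
Qed.

End Parseval.

(** * Orthogonality and completeness of the Hermite functions *)

Section hermite.
Context {R : realType}.
Implicit Types (m n k : nat) (p q : {poly R}).
Local Notation H := (@hermite_poly R).

Lemma deriv_hermite m : (H m.+1)^`() = (2 * m.+1%:R) *: H m.
Proof.
have HS k : H k.+1 = 2 *: ('X * H k) - (H k)^`() by [].
elim/ltn_ind: m => m IH.
rewrite HS derivB derivZ derivM derivX mul1r.
case: m IH => [|m] IH.
 by rewrite /= derivC mulr0 addr0 derivC subr0 mulr1.
rewrite IH// derivZ.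
have -> : (2 * m.+2%:R) *: H m.+1 =
  2 *: H m.+1 + (2 * m.+1%:R) *: (2 *: ('X * H m) - (H m)^`()).
 by rewrite -HS -scalerDl; congr (_ *: _); rewrite -[m.+2%:R]natr1; ring.
rewrite [LHS](_ : _ = 2 *: H m.+1 + (2 *: ('X * ((2 * m.+1%:R) *: H m)) - (2 * m.+1%:R) *: (H m)^`())); last first.
 by rewrite scalerDr addrA.
rewrite -scalerAr; apply/polyP => i; rewrite !(coefD, coefB, coefN, coefZ); ring.
Qed.

Lemma hermiteX m : 'X * H m = 2^-1 *: H m.+1 + m%:R *: H m.-1.
Proof.
have -> : H m.+1 = 2 *: ('X * H m) - (H m)^`() by [].
case: m => [|m]; last rewrite deriv_hermite.
 by rewrite derivC subr0 scalerA mulVf// scale1r scale0r addr0.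
rewrite scalerBr !scalerA mulVf// scale1r mulrA mulVf// mul1r.
by rewrite subrK.
Qed.

Lemma hop_hermite m : hop (H m) = - H m.+1.
Proof. by rewrite /hop /= opprB. Qed.

Lemma hopM p q : hop (p * q) = hop p * q + p * q^`().
Proof.
rewrite /hop derivM mulrBl -scalerAl mulrA; apply/eqP; rewrite -subr_eq0; apply/eqP.
move: (2 *: _) => z; ring.
Qed.

Let I p : R := gcos p 0.
Let I_hop p : I (hop p) = 0. Proof. by rewrite /I gcos_hop mul0r. Qed.
(** Integration by parts against exp(-x^2): raising is adjoint to differentiation. Iterated, this
    exhausts the smaller degree, which gives orthogonality and the norms. *)
Let I_step m q : I (H m.+1 * q) = I (H m * q^`()).
Proof.
have := I_hop (H m * q); rewrite hopM hop_hermite /I gcosD mulNr -scaleN1r gcosZ; lra.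
Qed.

Lemma hermite_orthogonal m n :
 gcos (H m * H n) 0 = if m == n then 2 ^+ m * m`!%:R * Num.sqrt pi else 0.
Proof.
elim: m n => [|m IH] [|n].
- by rewrite eqxx mulr1 gcos1 expr0n/= mulr0 oppr0 expR0 !mulr1 mul1r.
- by rewrite mulrC [LHS]I_step derivC mulr0 -(scale0r 0) /I gcosZ mul0r.
- by rewrite [LHS]I_step derivC mulr0 -(scale0r 0) /I gcosZ mul0r.
- rewrite [LHS]I_step deriv_hermite -scalerAr /I gcosZ IH eqSS; case: eqVneq => [->|_].
  by rewrite exprS factS natrM; ring.
 by rewrite mulr0.
Qed.

Definition hnorm m : R := (Num.sqrt (2 ^+ m * m`!%:R * Num.sqrt pi))^-1.

Lemma hermite_fun1E m : hermite_fun1 m = (fun x : R => hnorm m * pgauss (H m) 2^-1 x).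
Proof.
by apply/funext => x; rewrite /hermite_fun1 /hnorm /pgauss mulrA [2^-1 * _]mulrC.
Qed.

Lemma hnorm_gt0 m : 0 < hnorm m.
Proof.
by rewrite invr_gt0 sqrtr_gt0 !mulr_gt0 ?exprn_gt0 ?ltr0n ?fact_gt0// sqrtr_gt0 pi_gt0.
Qed.

Lemma hnorm_sqr m : hnorm m ^+ 2 * (2 ^+ m * m`!%:R * Num.sqrt pi) = 1.
Proof.
have h : 0 < (2 ^+ m * m`!%:R * Num.sqrt pi : R).
 by rewrite !mulr_gt0 ?exprn_gt0 ?ltr0n ?fact_gt0// sqrtr_gt0 pi_gt0.
by rewrite /hnorm exprVn sqr_sqrtr ?ltW// mulVf// gt_eqF.
Qed.

Lemma pgauss_half p q (x : R) : pgauss p 2^-1 x * pgauss q 2^-1 x = pgauss (p * q) 1 x.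
Proof.
rewrite /pgauss hornerM mulrACA -expRD; congr (_ * expR _); rewrite mul1r.
by field.
Qed.

Lemma hermite_fun1M m n (x : R) : hermite_fun1 m x * hermite_fun1 n x =
 hnorm m * hnorm n * pgauss (H m * H n) 1 x.
Proof. by rewrite !hermite_fun1E mulrACA pgauss_half. Qed.

Lemma pgauss_rL2 p : rL2 (pgauss p 2^-1).
Proof.
split; first exact: measurable_pgauss.
under eq_fun do rewrite expr2 pgauss_half.
exact: intg_pgauss.
Qed.

Lemma continuous_hermite1 m : continuous (hermite_fun1 m : R -> R).
Proof.
rewrite hermite_fun1E => x; apply: cvgM; [exact: cvg_cst|exact: continuous_pgauss].
Qed.

Lemma measurable_hermite1 m : meas (hermite_fun1 m : R -> R).
Proof. apply: continuous_measurable_fun; exact: continuous_hermite1. Qed.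

Definition hermiteC m (x : R) : R[i] := (hermite_fun1 m x)%:C%C.

Lemma L2_hermiteC m : L2 leb (hermiteC m).
Proof.
apply/L2P; split; first by apply: mc_real; exact: measurable_hermite1.
rewrite (_ : (fun _ => _) = fun x : R => (hnorm m * hnorm m) * pgauss (H m * H m) 1 x).
 by apply: intgZ; exact: intg_pgauss.
by apply/funext => x; rewrite -hermite_fun1M /sqnormC /= expr0n addr0 expr2.
Qed.

Lemma hermiteC_orthonormal j k : inner leb (hermiteC j) (hermiteC k) = (j == k)%:R.
Proof.
have E (f : R -> R) : (fun x => f x - 0 * 0) = f by apply/funext => x; rewrite mulr0 subr0.
have -> : inner leb (hermiteC j) (hermiteC k) =
  integralC leb (fun x : R => (hnorm j * hnorm k * pgauss (H j * H k) 1 x)%:C%C).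
 congr integralC; apply/funext => x; 
 apply: complexP; rewrite !cE /=; last by ring.
 by rewrite -hermite_fun1M; ring.
apply: complexP => /=; last by rewrite Rintg0; case: (j == k).
rewrite RintZ; last exact: intg_pgauss.
have -> : \int[leb]_x pgauss (H j * H k) 1 x = gcos (H j * H k) 0.
 by apply: eq_Rintegral => x _; rewrite mulr0 cos0 mulr1.
rewrite hermite_orthogonal; case: eqVneq => [->|_] /=; last by rewrite mulr0.
by rewrite -expr2 hnorm_sqr.
Qed.

Lemma rL2_mul (f g : R -> R) : rL2 f -> rL2 g -> intg leb (fun x => f x * g x).
Proof.
move=> [mf f2] [mg g2].
apply: (@intg_le _ _ _ leb _ (fun x : R => 2^-1 * (f x ^+ 2 + g x ^+ 2))).
- exact: measurable_funM.
- move=> x; rewrite ler_norml; move: (f x) (g x) => a b.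
 have := sqr_ge0 (a + b); have := sqr_ge0 (a - b); nra.
- by apply: intgZ; exact: intgD.
Qed.

Section totality.
Variable f : R -> R.
Hypothesis f2 : rL2 f.
Hypothesis fH : forall m, \int[leb]_x (f x * hermite_fun1 m x) = 0.

Let J p := \int[leb]_x (f x * pgauss p 2^-1 x).
Let Ji p : intg leb (fun x => f x * pgauss p 2^-1 x).
Proof. by apply: rL2_mul => //; exact: pgauss_rL2. Qed.
Let JD p q : J (p + q) = J p + J q.
Proof.
rewrite /J -RintD//; apply: eq_Rintegral => x _.
by rewrite /pgauss hornerD mulrDl mulrDr.
Qed.

Let JZ c p : J (c *: p) = c * J p.
Proof.
rewrite /J -RintZ//; apply: eq_Rintegral => x _.
by rewrite /pgauss hornerZ; ring.
Qed.

Let JH m : J (H m) = 0.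
Proof.
have := fH m.
have -> : \int[leb]_x (f x * hermite_fun1 m x) = hnorm m * J (H m).
 rewrite /J -RintZ//; apply: eq_Rintegral => x _; rewrite hermite_fun1E; ring.
by move/eqP; rewrite mulf_eq0 gt_eqF ?hnorm_gt0//= => /eqP.
Qed.

(** By [hermiteX], multiplication by x stays within the span of the Hermite polynomials; induction
    on the power. *)
Let JX k : J ('X^k) = 0.
Proof.
suff h m : J ('X^k * H m) = 0 by rewrite -[X in J X]mulr1; exact: (h 0%N).
elim: k m => [|k IH] m; first by rewrite expr0 mul1r.
by rewrite exprSr -mulrA hermiteX mulrDr -!scalerAr JD !JZ !IH !mulr0 addr0.
Qed.

Let g x := f x * expR (- (2^-1 * x ^+ 2)).
Let gX k : \int[leb]_x (g x * x ^+ k) = 0.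
Proof.
rewrite -(JX k); apply: eq_Rintegral => x _.
by rewrite /g /pgauss hornerXn; ring.
Qed.

Let gXi k : intg leb (fun x => g x * x ^+ k).
Proof.
rewrite (_ : (fun _ => _) = fun x => f x * pgauss 'X^k 2^-1 x)//.
by apply/funext => x; rewrite /g /pgauss hornerXn; ring.
Qed.

Let gexp (xi : R) : intg leb (fun x => `|g x| * expR `|x * xi|).
Proof.
have [mf _] := f2.
(* [e] is exp(xi^2 - x^2 / 4). Since |x xi| <= xi^2 + x^2 / 4, it dominates exp(|x xi| - x^2 / 2),
   and it is square integrable. *)
pose e x : R := expR (xi ^+ 2) * pgauss 1 4^-1 x.
have e2 : rL2 e.
 split; first by apply: measurable_funM => //; exact: measurable_pgauss.
 rewrite (_ : (fun _ => _) = fun x => expR (xi ^+ 2) ^+ 2 * pgauss 1 2^-1 x).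
  by apply: intgZ; exact: intg_pgauss.
 apply/funext => x; rewrite /e exprMn; congr (_ * _).
 rewrite /pgauss hornerC !mul1r expr2 -expRD; congr expR; by field.
apply: (@intg_le _ _ _ leb (fun x : R => `|g x| * expR `|x * xi|) (fun x : R => `|f x * e x|)).
- apply: measurable_funM.
  apply/mcomp => //; apply: measurable_funM => //.
  apply: (@measurable_comp _ _ _ _ _ _ setT) => //.
  by apply: measurable_funN; apply: measurable_funM => //; exact: measurable_funX.
 apply: mcomp => //; apply: mcomp => //.
 by apply: measurable_funM.
- move=> x; rewrite normrM normr_id [`|expR _|]ger0_norm ?expR_ge0// /g.
 have eE : `|e x| = expR (xi ^+ 2 - 4^-1 * x ^+ 2).
  by rewrite /e /pgauss hornerC !mul1r -expRD ger0_norm ?expR_ge0.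
 rewrite [leRHS]normrM eE normrM -mulrA ler_wpM2l//.
 rewrite ger0_norm ?expR_ge0// -expRD ler_expR.
 have : `|x * xi| <= xi ^+ 2 + 4^-1 * x ^+ 2.
   rewrite ler_norml; move: (sqr_ge0 (xi + 2^-1 * x)) (sqr_ge0 (xi - 2^-1 * x)).
  by move: (xi) (x : R) => a b ? ?; apply/andP; split; nra.
 lra.
- by apply: intg_abs; exact: rL2_mul.
Qed.

Let gm : meas g.
Proof.
by have := intg_meas (gXi 0); under eq_fun do rewrite expr0 mulr1.
Qed.

(** All moments of [g] vanish, so every partial sum of the power series of [F] integrates to 0
    against [g]; exp |x xi| dominates the partial sums. *)
Let trig_zero (c : R -> nat -> R) (F : R -> R) (xi : R) :
 (forall y, series (c y) N @[N --> \oo] --> F y) ->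
 (forall y k, `|c y k| <= exp_coeff `|y| k) ->
 (forall k, exists a, forall y, c y k = a * y ^+ k) ->
 meas (fun x : R => F (xi * x)) ->
 \int[leb]_x (g x * F (xi * x)) = 0.
Proof.
move=> cF cB cX mF.
have ti k : intg leb (fun x => g x * c (xi * x) k) /\ \int[leb]_x (g x * c (xi * x) k) = 0.
 have [a aE] := cX k.
 have E : (fun x => g x * c (xi * x) k) = fun x => (a * xi ^+ k) * (g x * x ^+ k).
  by apply/funext => x; rewrite aE exprMn; ring.
 by rewrite E; split; [exact: intgZ|rewrite RintZ// gX mulr0].
have E N : (fun x => g x * series (c (xi * x)) N) = fun x => \sum_(0 <= k < N) (g x * c (xi * x) k).
 by apply/funext => x; rewrite seriesEnat/= mulr_sumr.
have sB N y : `|series (c y) N| <= expR `|y|.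
 rewrite (le_trans (ler_norm_sum _ _ _))//.
 apply: le_trans (ler_sum _ (fun k _ => cB y k)) _.
 have := @is_cvg_series_exp_coeff R `|y|.
 move/(nondecreasing_cvgn_le _)=> h; apply: h.
 apply/nondecreasing_seqP => n; rewrite /series/= big_nat_recr//= lerDl.
 by rewrite mulr_ge0 ?invr_ge0 ?exprn_ge0.
have si N : intg leb (fun x => g x * series (c (xi * x)) N).
 by rewrite E; apply: intg_sum => k _; exact: (ti k).1.
have [||||_] := @Rint_dct _ _ _ leb (fun N x => g x * series (c (xi * x)) N)
 (fun x => g x * F (xi * x)) (fun x => `|g x| * expR `|x * xi|) _ _ _ (gexp xi).
- by move=> N; exact: (intg_meas (si N)).
- exact: measurable_funM.
- by apply: aeW => x; apply: cvgM; [exact: cvg_cst|exact: cF].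
- by move=> N x; rewrite normrM ler_wpM2l// mulrC.
rewrite (_ : (fun _ => _) = fun=> 0); first by move/(cvg_unique _ (cvg_cst _)) => <-.
apply/funext => N; rewrite E Rint_sum; last by move=> k _; exact: (ti k).1.
by rewrite big1// => k _; exact: (ti k).2.
Qed.

Let cos_zero (xi : R) : \int[leb]_x (g x * cos (xi * x)) = 0.
Proof.
apply: (@trig_zero cos_coeff).
- by move=> y; rewrite unlock; exact: is_cvg_series_cos_coeff.
- move=> y k; rewrite /cos_coeff /exp_coeff /= !normrM normfV normr_nat.
 rewrite [`|k`!%:R|]normr_nat ler_wpM2r ?invr_ge0// -?exprnP !normrX normrN1 expr1n mulr1.
 by rewrite ler_piMl ?exprn_ge0//; case: odd.
- by move=> k; exists ((~~ odd k)%:R * (-1) ^ k./2 / k`!%:R) => y; rewrite /cos_coeff /=; ring.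
- exact: (measurable_trig xi).1.
Qed.

Let sin_zero (xi : R) : \int[leb]_x (g x * sin (xi * x)) = 0.
Proof.
apply: (@trig_zero sin_coeff).
- by move=> y; rewrite unlock; exact: is_cvg_series_sin_coeff.
- move=> y k; rewrite /sin_coeff /exp_coeff /= !normrM normfV normr_nat.
 rewrite [`|k`!%:R|]normr_nat ler_wpM2r ?invr_ge0// -?exprnP !normrX normrN1 expr1n mulr1.
 by rewrite ler_piMl ?exprn_ge0//; case: odd.
- by move=> k; exists ((odd k)%:R * (-1) ^+ k.-1./2 / k`!%:R) => y; rewrite /sin_coeff /=; ring.
- exact: (measurable_trig xi).2.
Qed.

(** [g] = f exp(-x^2 / 2) has vanishing moments, hence a vanishing Fourier transform, by expansion
    of cos and sin; Plancherel then gives [g] = 0. *)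
Lemma hermite_total_real : {ae leb, forall x, f x = 0}.
Proof.
pose G (x : R) : R[i] := (g x)%:C%C.
have gi : intg leb g by have := gXi 0; under eq_fun do rewrite expr0 mulr1.
have G1 : L1 leb G by apply/L1P; split => //; exact: intg0.
have G2 : L2 leb G.
 apply/L2P; split; first exact: mc_real.
 have [mf fi] := f2; apply: (@intg_le _ _ _ leb _ (fun x : R => f x ^+ 2)) => //.
  by apply: measurable_sqnormC; exact: mc_real.
 move=> x; rewrite /sqnormC /= expr0n addr0 ger0_norm ?sqr_ge0// /g exprMn.
 rewrite ler_piMr ?sqr_ge0// expr_le1 ?expR_ge0// -expR0 ler_expR oppr_le0.
 by rewrite mulr_ge0 ?sqr_ge0.
have [F2 nF] := plancherel1 G1 G2.
have F0 : fourier1 G = fun=> 0.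
 apply/funext => xi; apply: complexP => /=.
  transitivity (\int[leb]_x (g x * cos (xi * x))); last exact: cos_zero.
  by apply: eq_Rintegral => x _; rewrite /= cosN; ring.
 transitivity (\int[leb]_x (-1 * (g x * sin (xi * x)))).
  by apply: eq_Rintegral => x _; rewrite /= sinN; ring.
 rewrite RintZ ?sin_zero ?mulr0//.
 apply: (intgMb (M := 1)) => //; [exact: (measurable_trig xi).2|move=> x; exact: sin_bound].
have n0 : nrm leb G = 0.
 move: nF; rewrite F0 (nrm_ae0 (f := fun=> 0)); [|exact: aeW|exact: mc_cst].
 move/esym/eqP; rewrite mulf_eq0 => /orP[|/eqP//].
 by rewrite gt_eqF// mulr_gt0// pi_gt0.
have := nrm_eq0 G2 n0; apply: filterS => x [] /eqP; rewrite mulf_eq0 => /orP[/eqP//|].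
by rewrite gt_eqF// expR_gt0.
Qed.

End totality.

Lemma hermite_total (h : R -> R[i]) : L2 leb h ->
 (forall k, inner leb h (hermiteC k) = 0) -> {ae leb, forall x, h x = 0}.
Proof.
move=> h2 hk; have [[m1 m2] hi] := (L2P leb h).1 h2.
have r1 : rL2 (ReC \o h).
 split => //; apply: intg_le hi; first exact: (measurable_funX 2).
 by move=> x; rewrite ger0_norm ?sqr_ge0// /sqnormC lerDl sqr_ge0.
have r2 : rL2 (ImC \o h).
 split => //; apply: intg_le hi; first exact: (measurable_funX 2).
 by move=> x; rewrite ger0_norm ?sqr_ge0// /sqnormC lerDr sqr_ge0.
have e1 : {ae leb, forall x, (ReC \o h) x = 0}.
 apply: hermite_total_real => // m; have := hk m => -[<- _].
 by apply: eq_Rintegral => x _; rewrite !cE /=; ring.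
have e2 : {ae leb, forall x, (ImC \o h) x = 0}.
 apply: hermite_total_real => // m; have := hk m => -[_ <-].
 by apply: eq_Rintegral => x _; rewrite !cE /=; ring.
by apply: (aeS2 e1 e2) => x /= a b; apply: complexP.
Qed.

Lemma hermite_Parseval (h : R -> R[i]) : L2 leb h ->
 (\esum_(k in [set: nat]) (sqnormC (inner leb h (hermiteC k)))%:E = sqL2norm leb h)%E.
Proof.
apply: esum_Parseval; [exact: L2_hermiteC|exact: hermiteC_orthonormal|exact: hermite_total].
Qed.

End hermite.

(** * Countable sums, Tonelli and measure-preserving maps *)

Section esum_countable.
Context {R : realType} (I : countType).
Local Open Scope ereal_scope.

(** Sums over a countable type become series over [nat], where codes of no index contribute 0;
    integration of series then applies. *)
Lemma esum_pickle (a : I -> \bar R) : (forall i, 0 <= a i) ->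
 \esum_(i in [set: I]) a i = \sum_(0 <= k <oo) oapp a 0 (pickle_inv k).
Proof.
move=> a0; rewrite nneseries_esumT; last by move=> k; case: (pickle_inv k) => /=.
rewrite [RHS](_ : _ = \esum_(k in range (@pickle I)) oapp a 0 (pickle_inv k)); last first.
 rewrite [RHS]esum_mkcond; apply: eq_esum => k _; case: ifPn => //.
 case E : (pickle_inv k) => [i|//]; rewrite notin_setE => /=; case.
 by exists i => //; have := @pickle_invK I k; rewrite /ocancel E.
rewrite (reindex_esum [set: I] _ (@pickle I)).
- by apply: eq_esum => i _; rewrite pickleK_inv.
by split => //; move=> i j _ _; apply: pcan_inj; exact: pickleK_inv.
Qed.

Lemma esumZl (c : R) (a : I -> \bar R) : (0 <= c)%R -> (forall i, 0 <= a i) ->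
 \esum_(i in [set: I]) (c%:E * a i) = c%:E * \esum_(i in [set: I]) a i.
Proof.
move=> c0 a0; rewrite !esum_pickle//; last by move=> i; rewrite mule_ge0.
rewrite -nneseriesZl//; last by move=> k _; case: (pickle_inv k) => /=.
by apply: eq_eseriesr => k _; case: (pickle_inv k) => //=; rewrite mule0.
Qed.

Context d (T : measurableType d) (mu : {measure set T -> \bar R}).

Lemma measurable_esum (f : I -> T -> \bar R) : (forall i x, 0 <= f i x) ->
 (forall i, meas (f i)) ->
 meas (fun x => \esum_(i in [set: I]) f i x).
Proof.
move=> f0 mf; under eq_fun do rewrite esum_pickle//.
apply: ge0_emeasurable_sum => k; first by move=> x _ _; case: (pickle_inv k) => /=.
by move=> _; case: (pickle_inv k) => [i|] //=; exact: measurable_cst.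
Qed.

Lemma integral_esum (f : I -> T -> \bar R) : (forall i x, 0 <= f i x) ->
 (forall i, meas (f i)) ->
 \int[mu]_x (\esum_(i in [set: I]) f i x) = \esum_(i in [set: I]) \int[mu]_x f i x.
Proof.
move=> f0 mf; rewrite esum_pickle; last by move=> i; exact: integral_ge0.
under eq_integral do rewrite esum_pickle//.
rewrite integral_nneseries//=.
- apply: eq_eseriesr => k _; case: (pickle_inv k) => //=.
 by rewrite integral0.
- by move=> k; case: (pickle_inv k).
- by move=> k x _; case: (pickle_inv k) => /=.
Qed.

End esum_countable.

Section measurable_integrals.
Context d1 d2 (X : measurableType d1) (Y : measurableType d2) (R : realType).
Variables (m1 : {sigma_finite_measure set X -> \bar R})
     (m2 : {sigma_finite_measure set Y -> \bar R}).

Section Tonelli.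
Variable f : X * Y -> \bar R.
Hypotheses (mf : meas f) (f0 : (forall z, 0 <= f z)%E).

Lemma measurable_Tonelli1 : meas (fun x => \int[m2]_y f (x, y))%E.
Proof. exact: (@measurable_fun_fubini_tonelli_F _ _ _ _ _ m2 f mf f0). Qed.

Lemma measurable_Tonelli2 : meas (fun y => \int[m1]_x f (x, y))%E.
Proof. exact: (@measurable_fun_fubini_tonelli_G _ _ _ _ _ m1 f mf f0). Qed.

Lemma Tonelli1 : (\int[pmeas m1 m2]_z f z = \int[m1]_x \int[m2]_y f (x, y))%E.
Proof. exact: (@fubini_tonelli1 _ _ _ _ _ m1 m2 f mf f0). Qed.

Lemma Tonelli2 : (\int[pmeas m1 m2]_z f z = \int[m2]_y \int[m1]_x f (x, y))%E.
Proof. exact: (@fubini_tonelli2 _ _ _ _ _ m1 m2 f mf f0). Qed.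

Lemma Tonelli_swap :
 (\int[m1]_x \int[m2]_y f (x, y) = \int[m2]_y \int[m1]_x f (x, y))%E.
Proof. by rewrite -Tonelli1 Tonelli2. Qed.

End Tonelli.

(** Integrability is not assumed, so measurability comes from Tonelli on the positive and the
    negative part. *)
Lemma measurable_Rint (f : X * Y -> R) : meas f ->
 meas (fun x => \int[m2]_y f (x, y)).
Proof.
move=> mf; rewrite /Rintegral; apply: mcomp => //.
under eq_fun do rewrite integralE.
have me : meas (fun z => (f z)%:E) by exact/mEFinP.
have mp := measurable_Tonelli1 (measurable_funepos me) (funepos_ge0 _).
have mn := measurable_Tonelli1 (measurable_funeneg me) (funeneg_ge0 _).
rewrite (_ : (fun x => _) = (fun x => \int[m2]_y ((fun z => (f z)%:E)^\+ (x, y))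
  - \int[m2]_y ((fun z => (f z)%:E)^\- (x, y)))%E); first exact: emeasurable_funB.
apply/funext => x; congr (_ - _)%E; apply: eq_integral => y _.
 by rewrite !funeposE.
by rewrite !funenegE.
Qed.

Lemma mc_integral (f : X * Y -> R[i]) : measC f ->
 measC (fun x => integralC m2 (fun y => f (x, y))).
Proof.
move=> [mr mi]; split; first exact: (measurable_Rint mr).
exact: (measurable_Rint mi).
Qed.

End measurable_integrals.

Section measure_preserving.
Context d1 d2 (X : measurableType d1) (Y : measurableType d2) (R : realType).
Variables (m1 : {measure set X -> \bar R}) (m2 : {measure set Y -> \bar R}).

(* Stated for integrals, which is how it is checked for iterated products. *)
Definition mpres (h : X -> Y) := meas h /\
 forall g : Y -> \bar R, meas g -> (forall y, 0 <= g y)%E ->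
 (\int[m2]_y g y = \int[m1]_x g (h x))%E.

Variable h : X -> Y.
Hypothesis hp : mpres h.

Lemma mpres_integral (g : Y -> \bar R) : meas g ->
 (\int[m2]_y g y = \int[m1]_x g (h x))%E.
Proof.
move=> mg; rewrite integralE [RHS]integralE.
congr (_ - _)%E.
 rewrite (hp.2 _ (measurable_funepos mg) (funepos_ge0 _)).
 by apply: eq_integral => x _; rewrite !funeposE.
rewrite (hp.2 _ (measurable_funeneg mg) (funeneg_ge0 _)).
by apply: eq_integral => x _; rewrite !funenegE.
Qed.

Lemma mpres_Rint (g : Y -> R) : meas g ->
 \int[m2]_y g y = \int[m1]_x g (h x).
Proof. by move=> mg; rewrite /Rintegral mpres_integral//; exact/mEFinP. Qed.

Lemma mpres_intg (g : Y -> R) : meas g -> intg m2 g <-> intg m1 (g \o h).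
Proof.
move=> mg; rewrite /intg; split => /integrableP[_ i]; apply/integrableP; split.
- by apply/mEFinP; apply: mcomp => //; exact: hp.1.
- move: i; rewrite (hp.2 (fun y => `|(g y)%:E|)%E)//.
 by apply: mcomp => //; exact/mEFinP.
- exact/mEFinP.
- rewrite (hp.2 (fun y => `|(EFin \o g) y|)%E)//.
 by apply: mcomp => //; exact/mEFinP.
Qed.

Lemma mpres_integralC (g : Y -> R[i]) : measC g ->
 integralC m2 g = integralC m1 (g \o h).
Proof. by move=> [mr mi]; rewrite /integralC !mpres_Rint. Qed.

Lemma mpres_L1 (g : Y -> R[i]) : measC g -> L1 m2 g <-> L1 m1 (g \o h).
Proof.
move=> [mr mi]; rewrite !L1P; split => -[a b]; split.
- exact: (mpres_intg mr).1.
- exact: (mpres_intg mi).1.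
- exact: (mpres_intg mr).2.
- exact: (mpres_intg mi).2.
Qed.

Lemma mpres_sqL2 (g : Y -> R[i]) : measC g ->
 sqL2norm m2 g = sqL2norm m1 (g \o h).
Proof.
move=> mg; rewrite /sqL2norm mpres_integral//.
by apply/mEFinP; exact: measurable_sqnormC.
Qed.

Lemma mpres_L2 (g : Y -> R[i]) : measC g -> L2 m2 g <-> L2 m1 (g \o h).
Proof.
move=> mg; rewrite /L2 mpres_sqL2//; split => -[_ ?]; split => //.
by apply: mc_comp => //; exact: hp.1.
Qed.

End measure_preserving.

(** * Parseval systems and their tensor products *)

Section Parseval_system.
Context d (X : measurableType d) (R : realType) (mu : {measure set X -> \bar R}).
Context (I : countType) (w : I -> X -> R[i]) (c : R).

(** The pairing is bilinear, any conjugation being part of [w]. The class [C] is a parameter: the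
    Hermite functions are paired with all of L^2, the Wigner functions with functions both in L^1
    and in L^2. *)
Definition parseval (C : (X -> R[i]) -> Prop) := forall f, C f ->
 (\esum_(i in [set: I]) (sqnormC (integralC mu (fun x => f x * w i x)))%:E
  = c%:E * sqL2norm mu f)%E.

End Parseval_system.

Section tensor.
Context d1 d2 (X : measurableType d1) (Y : measurableType d2) (R : realType).
Variables (m1 : {sigma_finite_measure set X -> \bar R})
     (m2 : {sigma_finite_measure set Y -> \bar R}).
Context (I J : countType) (w1 : I -> X -> R[i]) (w2 : J -> Y -> R[i]) (c1 c2 : R).
Variables (C1 : (X -> R[i]) -> Prop) (C2 : (Y -> R[i]) -> Prop).
Hypothesis mw1 : forall i, measC (w1 i).
Hypothesis mw2 : forall i, measC (w2 i).
Hypothesis p1 : parseval m1 w1 c1 C1.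
Hypothesis p2 : parseval m2 w2 c2 C2.
Local Notation mm := (pmeas m1 m2).
Let w (ij : I * J) (z : X * Y) := w1 ij.1 z.1 * w2 ij.2 z.2.
Let g f i (y : Y) := integralC m1 (fun x => f (x, y) * w1 i x).

Hypotheses (c10 : 0 <= c1) (c20 : 0 <= c2).

(** The coefficient of f on [w (i, j)] is the coefficient on [w2 j] of the partial coefficient
    [g f i]. The sum over j is [p2]; the sum over i is [p1] under the integral over Y. *)
Lemma parseval_tensor (C : (X * Y -> R[i]) -> Prop) :
 (forall f, C f -> L2 mm f) ->
 (forall f, C f -> {ae m2, forall y, C1 (fun x => f (x, y))}) ->
 (forall f i, C f -> L2 m2 (g f i) -> C2 (g f i)) ->
 (forall f ij, C f -> L1 mm (fun z => f z * w ij z)) ->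
 (forall f i, C1 f -> L1 m1 (fun x => f x * w1 i x)) ->
 parseval mm w (c1 * c2) C.
Proof.
move=> CL2 CC1 CC2 CL1 C1L1 f Cf.
have f2 := CL2 _ Cf; have mf := L2_mc f2.
have mfi i : measC (fun z : X * Y => f z * w1 i z.1).
 by apply: mcM => //; apply: (mc_comp (mw1 i)); exact: measurable_fst.
have mg i : measC (g f i).
 have mfs := mc_comp (mfi i) (@measurable_swap _ _ Y X).
 by have := mc_integral m1 mfs.
have sq0 i y : (0 <= (sqnormC (g f i y))%:E)%E by rewrite lee_fin sqnormC_ge0.
have msq i : meas (fun y => (sqnormC (g f i y))%:E).
 by apply/mEFinP; exact: measurable_sqnormC.
have mF : meas (fun z => (sqnormC (f z))%:E).
 by apply/mEFinP; exact: measurable_sqnormC.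
have sqf z : (0 <= (sqnormC (f z))%:E)%E by rewrite lee_fin sqnormC_ge0.
have sg : (\esum_(i in [set: I]) sqL2norm m2 (g f i) = c1%:E * sqL2norm mm f)%E.
 rewrite /sqL2norm -integral_esum//.
 have mG : meas (fun y => \int[m1]_x (sqnormC (f (x, y)))%:E)%E.
  exact: (measurable_Tonelli2 m1 mF).
 transitivity (\int[m2]_y (c1%:E * \int[m1]_x (sqnormC (f (x, y)))%:E))%E.
  apply: ae_eq_integral => //.
  - exact: measurable_esum.
  - exact: measurable_funeM.
  - by apply: aeS (CC1 _ Cf) _ => y /p1 h _; rewrite h.
 rewrite ge0_integralZl//; last by move=> y _; apply: integral_ge0.
 congr (_ * _)%E; apply/esym; exact: Tonelli2.
(* The squared norm of [g f i] is one term of the finite sum [sg]. *)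
have g2 i : L2 m2 (g f i).
 split => //; apply: (@le_lt_trans _ _ (c1%:E * sqL2norm mm f)%E); last first.
  by rewrite lte_mul_pinfty//; exact: f2.2.
 rewrite -sg; apply: esum_ge; exists [set i]; last by rewrite fsbig_set1.
 by split => //; exact: finite_set1.
transitivity (\esum_(i in [set: I]) (c2%:E * sqL2norm m2 (g f i)))%E; last first.
 rewrite esumZl//; last by move=> i; exact: integral_ge0.
 by rewrite sg muleA -EFinM mulrC.
rewrite (_ : [set: I * J] = [set: I] `*`` (fun=> [set: J])); last first.
 by apply/seteqP; split => // -[].
rewrite -[LHS](@esum_esum _ _ _ _ _ (fun i j => (sqnormC (integralC mm (fun z => f z * w (i, j) z)))%:E)); last first.
 by move=> i j _ _; rewrite lee_fin sqnormC_ge0.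
apply: eq_esum => i _; rewrite -p2; last exact: CC2.
apply: eq_esum => j _; congr (sqnormC _)%:E.
have L1f := CL1 f (i, j) Cf; have [Lg <-] := L1_Fubini2 L1f.
apply: integralC_ae.
- exact: (L1_mc Lg).
- exact: mcM.
apply: aeS (CC1 _ Cf) _ => y Cy; have Ly := C1L1 _ i Cy; rewrite /= mulrC -integralCZ//.
by congr integralC; apply/funext => x; rewrite /w/= mulrCA mulrA; ring.
Qed.

End tensor.

Section expi.
Context {R : realType}.
Implicit Types a b t : R.

Lemma expiD a b : expi (a + b) = expi a * expi b.
Proof. by apply: complexP; rewrite !cE /= ?cosD ?sinD; ring. Qed.

Lemma conj_expi a : conjc (expi a) = expi (- a).
Proof. by rewrite /expi /= cosN sinN. Qed.

Lemma expi0 : expi (0 : R) = 1.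
Proof. by rewrite /expi cos0 sin0. Qed.

Context d (T : measurableType d).

Lemma mc_expi (f : T -> R) : meas f ->
 measC (fun x => expi (f x)).
Proof.
move=> mf; split => /=; apply: (mcomp _ mf);
 apply: continuous_measurable_fun; [exact: continuous_cos|exact: continuous_sin].
Qed.

Lemma L1_expi (mu : {measure set T -> \bar R}) (f : T -> R[i]) (g : T -> R) :
 L1 mu f -> meas g -> L1 mu (fun x => f x * expi (g x)).
Proof.
move=> f1 mg; apply: (L1Mb (M := 1)) => //; first exact: mc_expi.
- by move=> x; exact: cos_bound.
- by move=> x; exact: sin_bound.
Qed.

Lemma L1_realMb (mu : {measure set T -> \bar R}) (f : T -> R[i]) (g : T -> R) M :
 L1 mu f -> meas g -> (forall x, `|g x| <= M) ->
 L1 mu (fun x => f x * (g x)%:C%C).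
Proof.
move=> f1 mg gM; apply: (L1Mb (M := M)) => //; first exact: mc_real.
by move=> x /=; rewrite normr0 (le_trans _ (gM x)).
Qed.

End expi.

Section measurable_sg_sqrt.
Context {R : realType}.

Lemma measurable_sg : meas (@Num.sg R).
Proof.
apply: measurable_fun_ifT => //; first exact: measurable_fun_eqr.
apply: measurable_fun_ifT => //; exact: measurable_fun_ltr.
Qed.

Lemma measurable_sqrt_norm : meas (fun x : R => Num.sqrt `|x|).
Proof.
apply: continuous_measurable_fun => x; apply: continuous_comp; last exact: sqrt_continuous.
exact: norm_continuous.
Qed.

End measurable_sg_sqrt.

Section L1_tensor.
Context d1 d2 (X : measurableType d1) (Y : measurableType d2) (R : realType).
Variables (m1 : {sigma_finite_measure set X -> \bar R})
     (m2 : {sigma_finite_measure set Y -> \bar R}).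

Lemma L1_tensor (f : X -> R[i]) (g : Y -> R[i]) : L1 m1 f -> L1 m2 g ->
 L1 (pmeas m1 m2) (fun z => f z.1 * g z.2).
Proof.
move=> /L1P[f1 f2] /L1P[g1 g2]; apply/L1P; split.
 have := intgB (intg_tensor f1 g1) (intg_tensor f2 g2).
 by congr intg; apply/funext => z; rewrite ReM.
have := intgD (intg_tensor f1 g2) (intg_tensor f2 g1).
by congr intg; apply/funext => z; rewrite ImM.
Qed.

Lemma L2_tensor (f : X -> R[i]) (g : Y -> R[i]) : L2 m1 f -> L2 m2 g ->
 L2 (pmeas m1 m2) (fun z => f z.1 * g z.2).
Proof.
move=> /L2P[f1 f2] /L2P[g1 g2]; apply/L2P; split.
 apply: mcM; first exact: (mc_comp f1 measurable_fst).
 exact: (mc_comp g1 measurable_snd).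
by have := intg_tensor f2 g2; congr intg; apply/funext => z; rewrite sqnormCM.
Qed.

End L1_tensor.

(** * Wigner transforms of Hermite functions *)

Section hermite_wigner.
Context {R : realType}.
Implicit Types (k l : nat) (lam : R).

Lemma hermite_fun1_bound k : exists2 M, 0 <= M & forall x : R, `|hermite_fun1 k x| <= M.
Proof.
have [|C C0 h] := @pgauss_bound R (hermite_poly k) 2^-1; first by rewrite invr_gt0.
exists (hnorm k * C) => [|x]; first by rewrite mulr_ge0// ltW// hnorm_gt0.
rewrite hermite_fun1E normrM (gtr0_norm (hnorm_gt0 _)) ler_wpM2l ?(ltW (hnorm_gt0 _))//.
apply: le_trans (h x) _; rewrite ler_piMr// -expR0 ler_expR oppr_le0.
by rewrite mulr_ge0 ?sqr_ge0.
Qed.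

Lemma intg_hermite k : intg leb (@hermite_fun1 R k).
Proof.
by rewrite hermite_fun1E; apply: intgZ; apply: intg_pgauss; rewrite invr_gt0.
Qed.

Lemma L1_hermiteC k : L1 leb (@hermiteC R k).
Proof. by apply/L1P; split; [exact: intg_hermite|exact: intg0]. Qed.

Lemma mc_hermiteC k : measC (@hermiteC R k).
Proof. exact: (L2_mc (L2_hermiteC k)). Qed.

Lemma conj_hermiteC k (x : R) : conjc (hermiteC k x) = hermiteC k x.
Proof. by rewrite /hermiteC /= oppr0. Qed.

Lemma parseval_hermite : parseval leb (@hermiteC R) 1 (L2 leb).
Proof.
move=> f f2; have <- := hermite_Parseval f2; rewrite mul1e; apply: eq_esum => k _.
congr (sqnormC (integralC _ _))%:E; apply/funext => x; by rewrite conj_hermiteC.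
Qed.

Lemma parseval_hermite2 : parseval leb2
 (fun (kl : nat * nat) (z : R * R) => hermiteC kl.1 z.1 * hermiteC kl.2 z.2) 1 (L2 leb2).
Proof.
rewrite -[X in parseval _ _ X]mulr1.
apply: (@parseval_tensor _ _ _ _ _ leb leb _ _ (@hermiteC R) (@hermiteC R) 1 1 (L2 leb) (L2 leb)) => //.
- exact: mc_hermiteC.
- exact: mc_hermiteC.
- exact: parseval_hermite.
- exact: parseval_hermite.
- exact: L2_prod_ae2.
- move=> f [k l] f2; apply: L2_mul => //; exact: (L2_tensor (L2_hermiteC k) (L2_hermiteC l)).
- by move=> f k f2; apply: L2_mul => //; exact: L2_hermiteC.
Qed.

Definition wigner_phase lam (z : R * R) (v : R) :=
 lam * z.1 * z.2 / 2 + Num.sg lam * Num.sqrt `|lam| * z.2 * v.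

(* <e_l, pi_lam(x, y, 0) e_k> in dimension one. *)
Definition wigner lam k l (z : R * R) : R[i] :=
 integralC leb (fun v => hermiteC l v * hermiteC k (v + Num.sqrt `|lam| * z.1) *
  expi (- wigner_phase lam z v)).

Lemma wigner_L1 lam k l z :
 L1 leb (fun v => hermiteC l v * hermiteC k (v + Num.sqrt `|lam| * z.1) *
  expi (- wigner_phase lam z v)).
Proof.
have [M M0 hM] := hermite_fun1_bound k.
have ma (b : R) : meas (fun v : R => v + b).
 by have := measurable_affine 1 b; under eq_fun do rewrite mul1r.
apply: L1_expi.
 apply: (L1_realMb (M := M)) => //; first exact: L1_hermiteC.
 exact: (mcomp (@measurable_hermite1 R k) (ma _)).
apply: mcomp => //; exact: measurable_funD.
Qed.

Lemma wigner_bound k l : exists M, forall lam z,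
 `|ReC (wigner lam k l z)| <= M /\ `|ImC (wigner lam k l z)| <= M.
Proof.
have [M M0 hM] := hermite_fun1_bound k.
exists (M * \int[leb]_v `|hermite_fun1 l v|) => lam z.
have hi := intg_abs (intg_hermite l).
have [i1 i2] := (L1P leb _).1 (wigner_L1 lam k l z).
have MM c v x y : `|c| <= 1 -> `|hermite_fun1 l v * hermite_fun1 k x * c - y * 0| <= M * `|hermite_fun1 l v|.
 move=> c1; rewrite mulr0 subr0 normrM normrM mulrAC [M * _]mulrC.
 by rewrite -mulrA ler_wpM2l// -[M]mul1r ler_pM.
split; apply: (le_trans (Rint_norm _)) => //; rewrite -RintZ//; apply: Rint_le => //.
- exact: intg_abs.
- exact: intgZ.
- move=> v; rewrite !cE /=; have := MM (cos (- wigner_phase lam z v)) v (v + Num.sqrt `|lam| * z.1) (sin (- wigner_phase lam z v)) (cos_bound _).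
 by rewrite !mulr0 !mul0r !subr0 addr0 mul0r subr0.
- exact: intg_abs.
- exact: intgZ.
- move=> v; rewrite !cE /=; have := MM (sin (- wigner_phase lam z v)) v (v + Num.sqrt `|lam| * z.1) (sin (- wigner_phase lam z v)) (sin_bound _).
 by rewrite !mulr0 !mul0r !subr0 addr0 mul0r addr0.
Qed.

Lemma mc_wigner k l : measC (fun p : R * (R * R) => wigner p.1 k l p.2).
Proof.
apply: (mc_integral leb (f := fun q : R * (R * R) * R =>
 hermiteC l q.2 * hermiteC k (q.2 + Num.sqrt `|q.1.1| * q.1.2.1) *
  expi (- wigner_phase q.1.1 q.1.2 q.2))).
have ml : meas (fun q : R * (R * R) * R => q.1.1).
 exact: (mcomp measurable_fst measurable_fst).
have mz : meas (fun q : R * (R * R) * R => q.1.2).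
 exact: (mcomp measurable_snd measurable_fst).
have mx : meas (fun q : R * (R * R) * R => q.1.2.1).
 exact: (mcomp measurable_fst mz).
have my : meas (fun q : R * (R * R) * R => q.1.2.2).
 exact: (mcomp measurable_snd mz).
have ms := mcomp measurable_sqrt_norm ml.
have mg := mcomp (@measurable_sg R) ml.
have mv : meas (fun q : R * (R * R) * R => q.2) by exact: measurable_snd.
apply: mcM; first apply: mcM.
- exact: (mc_comp (mc_hermiteC l) mv).
- apply: (mc_comp (mc_hermiteC k)); apply: measurable_funD => //; exact: measurable_funM.
- apply: mc_expi; apply: mcomp => //; apply: measurable_funD.
  by apply: measurable_funM => //; apply: measurable_funM => //; exact: measurable_funM.
 by apply: measurable_funM => //; apply: measurable_funM => //; exact: measurable_funM.
Qed.

End hermite_wigner.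

Lemma integralC_affine (R : realType) (a b : R) (f : R -> R[i]) : a != 0 ->
 L1 (@lebesgue_measure R) f ->
 integralC (@lebesgue_measure R) (fun x => f (a * x + b)) =
 (`|a|^-1)%:C%C * integralC (@lebesgue_measure R) f.
Proof.
move=> a0 /L1P[f1 f2].
have := Rint_affine b a0 f1; have := Rint_affine b a0 f2.
rewrite /integralC => -> ->; move: (\int[_]_x _) (\int[_]_x _) => u v.
by apply: complexP; rewrite !cE /= mul0r ?subr0 ?addr0.
Qed.

Section measurable_phase.
Context {R : realType}.
Let m1 : meas (fun q : R * R * R => q.1.1).
Proof. exact: (mcomp measurable_fst measurable_fst). Qed.
Let m2 : meas (fun q : R * R * R => q.1.2).
Proof. exact: (mcomp measurable_snd measurable_fst). Qed.
Let m3 : meas (fun q : R * R * R => q.2).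
Proof. exact: measurable_snd. Qed.

Lemma measurable_wigner_phase (lam : R) :
 meas (fun q : R * R * R => - wigner_phase lam q.1 q.2).
Proof.
apply: mcomp => //; apply: measurable_funD.
 by apply: measurable_funM => //; apply: measurable_funM => //; exact: measurable_funM.
by apply: measurable_funM => //; exact: measurable_funM.
Qed.

Lemma measurable_wigner_shift (a : R) :
 meas (fun q : R * R * R => q.2 + a * q.1.1).
Proof. by apply: measurable_funD => //; exact: measurable_funM. Qed.

Lemma measurable_fourier_phase :
 meas (fun q : R * R * R => - (q.1.2 * q.2)) /\
 meas (fun q : R * R * R => (q.1.1, q.2)).
Proof.
split; first by apply: mcomp => //; exact: measurable_funM.
by apply/measurable_fun_pairP; split.
Qed.

End measurable_phase.

(** * Parseval for Wigner functions in dimension one *)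

Section wigner_arg.
Context {R : realType}.
Variables (a b : R).
Hypotheses (a_gt0 : 0 < a) (norm_b : `|b| = a).
Let h (z : R * R) := ((z.1 - z.2) / a, b * (z.1 + z.2) / 2).
Let Q (z : R * R) := (z.1, b * (z.2 + a * z.1 / 2)).

(** [h] is linear with determinant b / a, of modulus 1. It is undone one variable at a time: u = a x
    + v for fixed v, then the frequency for fixed x; [Q] is [h] after the first substitution. *)
Lemma mpres_wigner_arg : mpres leb2 leb2 h.
Proof.
have a_neq0 : a != 0 by rewrite gt_eqF.
have b_neq0 : b != 0 by rewrite -normr_gt0 norm_b.
have m1 : meas (fun z : R * R => z.1) by exact: measurable_fst.
have m2 : meas (fun z : R * R => z.2) by exact: measurable_snd.
have mh : meas h.
 apply/measurable_fun_pairP; split => /=.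
  by apply: measurable_funM => //; exact: measurable_funB.
 by apply: measurable_funM => //; apply: measurable_funM => //; exact: measurable_funD.
have mq : meas Q.
 apply/measurable_fun_pairP; split => //=; apply: measurable_funM => //.
 by apply: measurable_funD => //; apply: measurable_funM => //; exact: measurable_funM.
split => // G mG G0.
have hQ x v : h (a * x + v, v) = Q (x, v).
 rewrite /h /Q; congr pair => /=; last by field.
 by rewrite addrK mulrC mulKf.
have mGh : meas (fun z => G (h z)) := mcomp mG mh.
have mGq : meas (fun z => G (Q z)) := mcomp mG mq.
have a1 : (a%:E * (`|a|^-1)%:E = 1)%E by rewrite -EFinM gtr0_norm// mulfV.
apply/esym; transitivity (\int[leb]_v \int[leb]_u G (h (u, v)))%E.
 exact: (Tonelli2 leb leb mGh (fun z => G0 _)).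
transitivity (\int[leb]_v (a%:E * \int[leb]_x G (Q (x, v))))%E.
 apply: eq_integral => v _.
 have := lebesgue_affine v a_neq0 (mcomp mGh (pair2_meas v)) (fun u => G0 _).
 rewrite /= => E; rewrite -[LHS]mul1e -a1 -muleA -E.
 by congr (_ * _)%E; apply: eq_integral => x _; rewrite hQ.
rewrite ge0_integralZl//; last 3 first.
- exact: (measurable_Tonelli2 leb mGq (fun z => G0 _)).
- by move=> v _; apply: integral_ge0 => x _; exact: G0.
- by rewrite lee_fin ltW.
transitivity (a%:E * \int[leb]_x \int[leb]_v G (Q (x, v)))%E.
 by congr (_ * _)%E; exact: (esym (Tonelli_swap leb leb mGq (fun z => G0 _))).
transitivity (a%:E * \int[leb]_x ((`|a|^-1)%:E * \int[leb]_xi G (x, xi)))%E.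
 congr (_ * _)%E; apply: eq_integral => x _.
 have := lebesgue_affine (b * (a * x / 2)) b_neq0 (mcomp mG (pair1_meas x)) (fun xi => G0 _).
 rewrite norm_b (gtr0_norm a_gt0) => <-; apply: eq_integral => v _.
 by rewrite /Q /= mulrDr.
rewrite ge0_integralZl//; last 2 first.
- exact: (measurable_Tonelli1 leb mG G0).
- by move=> v _; apply: integral_ge0 => x _; exact: G0.
rewrite muleA a1 mul1e; exact: (esym (Tonelli1 leb leb mG G0)).
Qed.

End wigner_arg.

Section wigner_parseval.
Context {R : realType}.
Variables (lam : R) (f : R * R -> R[i]).
Hypotheses (lam0 : lam != 0) (f1 : L1 leb2 f) (f2 : L2 leb2 f).
Let a := Num.sqrt `|lam|.
Let b := Num.sg lam * a.
Let a_gt0 : 0 < a. Proof. by rewrite sqrtr_gt0 normr_gt0. Qed.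
Let a_neq0 : a != 0. Proof. by rewrite gt_eqF. Qed.
Let norm_b : `|b| = a.
Proof. by rewrite normrM normr_sg lam0 mul1r gtr0_norm. Qed.
Let b_neq0 : b != 0. Proof. by rewrite -normr_gt0 norm_b. Qed.
Let lamE : lam = b * a.
Proof. by rewrite /b -mulrA -expr2 sqr_sqrtr// -numEsg. Qed.
Let aa : a * a = `|lam|. Proof. by rewrite -expr2 sqr_sqrtr. Qed.
Let F (z : R * R) := fourier1 (fun y => f (z.1, y)) z.2.
Let Phi (z : R * R) := F ((z.1 - z.2) / a, b * (z.1 + z.2) / 2).
Let mF : measC F.
Proof.
apply: (mc_integral leb (f := fun q : R * R * R => f (q.1.1, q.2) * expi (- (q.1.2 * q.2)))).
have [m1 m2] := @measurable_fourier_phase R.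
by apply: mcM; [exact: (mc_comp (L2_mc f2) m2)|exact: (mc_expi m1)].
Qed.

Let sqF : sqL2norm leb2 F = ((2 * pi)%:E * sqL2norm leb2 f)%E.
Proof.
have m1 : meas (fun z => (sqnormC (F z))%:E).
 by apply/mEFinP; exact: measurable_sqnormC.
have m2 : meas (fun z => (sqnormC (f z))%:E).
 by apply/mEFinP; apply: measurable_sqnormC; exact: (L2_mc f2).
have p1 z : (0 <= (sqnormC (F z))%:E)%E by rewrite lee_fin sqnormC_ge0.
have p2 z : (0 <= (sqnormC (f z))%:E)%E by rewrite lee_fin sqnormC_ge0.
rewrite /sqL2norm Tonelli1// Tonelli1//.
rewrite -ge0_integralZl//; last 3 first.
- exact: (measurable_Tonelli1 leb m2 p2).
- by move=> x _; exact: integral_ge0.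
- by rewrite lee_fin mulr_ge0// pi_ge0.
apply: ae_eq_integral => //.
- exact: (measurable_Tonelli1 leb m1 p1).
- by apply: measurable_funeM; exact: (measurable_Tonelli1 leb m2 p2).
apply: (aeS2 (L1_prod_ae f1) (L2_prod_ae f2)) => x g1 g2 _.
have [F2 nF] := plancherel1 g1 g2.
transitivity (sqL2norm leb (fourier1 (fun y => f (x, y)))) => //.
by rewrite sqL2E// nF EFinM -sqL2E.
Qed.

Let mPhi : measC Phi.
Proof. exact: (mc_comp mF (mpres_wigner_arg a_gt0 norm_b).1). Qed.
Let Q (z : R * R) := (z.1, b * (z.2 + a * z.1 / 2)).
Let mq : meas Q.
Proof.
have m1 : meas (fun z : R * R => z.1) by exact: measurable_fst.
have m2 : meas (fun z : R * R => z.2) by exact: measurable_snd.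
apply/measurable_fun_pairP; split => //=; apply: measurable_funM => //.
by apply: measurable_funD => //; apply: measurable_funM => //; exact: measurable_funM.
Qed.

Let PhiQ x v : Phi (a * x + v, v) = F (Q (x, v)).
Proof.
rewrite /Phi /Q; congr (F _); congr pair => /=; last by field.
by rewrite addrK mulrC mulKf.
Qed.

Let sqPhi : sqL2norm leb2 Phi = sqL2norm leb2 F.
Proof. by rewrite (mpres_sqL2 (mpres_wigner_arg a_gt0 norm_b) mF). Qed.
Let L2Phi : L2 leb2 Phi.
Proof.
split; first exact: mPhi.
rewrite sqPhi sqF; apply: lte_mul_pinfty; last exact: f2.2; last by [].
by rewrite lee_fin mulr_ge0 ?pi_ge0.
Qed.

(** Under the integral over v that defines the Wigner function, integrating y first produces the
    transform [F] of f in y; the substitution u = a x + v separates the two Hermite functions and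
    costs 1 / a. *)
Let coef k l : integralC leb2 (fun z => f z * wigner lam k l z) =
 (a^-1)%:C%C * integralC leb2 (fun z => Phi z * (hermiteC k z.1 * hermiteC l z.2)).
Proof.
have [M M0 hM] := @hermite_fun1_bound R k.
pose K (q : R * R * R) := f q.1 * (hermiteC l q.2 * hermiteC k (q.2 + a * q.1.1) *
  expi (- wigner_phase lam q.1 q.2)).
have K1 : L1 (pmeas leb2 leb) K.
 rewrite (_ : K = fun q => f q.1 * hermiteC l q.2 * (hermite_fun1 k (q.2 + a * q.1.1))%:C%C *
  expi (- wigner_phase lam q.1 q.2)); last by apply/funext => q; rewrite /K !mulrA.
 apply: L1_expi; last exact: measurable_wigner_phase.
 apply: (@L1_realMb _ _ _ _ _ _ M); [exact: (L1_tensor f1 (L1_hermiteC l))| |by move=> q; exact: hM].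
 exact: (mcomp (@measurable_hermite1 R k) (measurable_wigner_shift a)).
have P1 : L1 leb2 (fun z => Phi z * (hermiteC k z.1 * hermiteC l z.2)).
 exact: (L2_mul L2Phi (L2_tensor (L2_hermiteC k) (L2_hermiteC l))).
transitivity (integralC leb2 (fun z => integralC leb (fun v => K (z, v)))).
 congr integralC; apply/funext => z; by rewrite -integralCZ; last exact: wigner_L1.
rewrite (L1_Fubini1 K1).2 -(L1_Fubini2 K1).2 -(L1_Fubini2 P1).2.
rewrite -integralCZ; last exact: (L1_Fubini2 P1).1.
apply: integralC_ae.
- exact: (L1_mc (L1_Fubini2 K1).1).
- apply: mcZ; exact: (L1_mc (L1_Fubini2 P1).1).
apply: (aeS2 (L1_prod_ae2 K1) (L1_prod_ae2 P1)) => v Kv Pv.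
rewrite /= -(L1_Fubini1 Kv).2.
transitivity (integralC leb (fun x => hermiteC l v * hermiteC k (v + a * x) * F (Q (x, v)))).
 apply: integralC_ae.
 - exact: (L1_mc (L1_Fubini1 Kv).1).
 - apply: mcM; first apply: mcM; first exact: mc_cst.
  + apply: mc_real; apply: (mcomp (@measurable_hermite1 R k)).
   by have := measurable_affine a v; under eq_fun do rewrite addrC.
  + exact: (mc_comp mF (mcomp mq (pair2_meas v))).
 apply: aeS (L1_prod_ae f1) _ => x fx; rewrite /F /fourier1 /= -integralCZ; last first.
  apply: L1_expi; first exact: fx.
  by have := measurable_affine (- (b * (v + a * x / 2))) 0; under eq_fun do rewrite addr0 mulNr.
 congr integralC; apply/funext => y; rewrite /K /=.
 rewrite mulrCA; congr (_ * (_ * expi _)).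
 by rewrite /wigner_phase /= -/a -/b {1}lamE; field.
pose Psi u := Phi (u, v) * (hermiteC k u * hermiteC l v).
transitivity (integralC leb (fun x => Psi (a * x + v))).
 congr integralC; apply/funext => x; rewrite /Psi PhiQ (addrC v).
 by rewrite [RHS]mulrC (mulrC (hermiteC k _)).
by have := integralC_affine v a_neq0 Pv; rewrite gtr0_norm.
Qed.

(** The coefficients are 1 / a times the Hermite coefficients of [Phi], with a^2 = |lam|. [Phi] is
    the transform of f in y composed with a measure-preserving map, so Plancherel contributes 2
    pi. *)
Lemma wigner_Parseval_aux :
 (\esum_(kl in [set: nat * nat]) (sqnormC (integralC leb2 (fun z => f z * wigner lam kl.1 kl.2 z)))%:E
  = (2 * pi / `|lam|)%:E * sqL2norm leb2 f)%E.
Proof.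
transitivity (\esum_(kl in [set: nat * nat]) (((`|lam|)^-1)%:E *
  (sqnormC (integralC leb2 (fun z => Phi z * (hermiteC kl.1 z.1 * hermiteC kl.2 z.2))))%:E))%E.
 apply: eq_esum => kl _; rewrite coef sqnormCM EFinM; congr (_%:E * _)%E.
 by rewrite /sqnormC /= expr0n addr0 exprVn expr2 aa.
rewrite esumZl; last 2 first.
- by rewrite invr_ge0.
- by move=> i; rewrite lee_fin sqnormC_ge0.
by rewrite (parseval_hermite2 L2Phi) mul1e sqPhi sqF muleA -EFinM mulrC.
Qed.

End wigner_parseval.

Definition L12 d (T : measurableType d) (R : realType) (mu : {measure set T -> \bar R})
 (f : T -> R[i]) := L1 mu f /\ L2 mu f.

Lemma parseval_wigner (R : realType) (lam : R) : lam != 0 ->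
 parseval (pmeas (@lebesgue_measure R) (@lebesgue_measure R))
  (fun kl : nat * nat => wigner lam kl.1 kl.2) (2 * pi / `|lam|)
  (L12 (pmeas (@lebesgue_measure R) (@lebesgue_measure R))).
Proof. by move=> lam0 f [f1 f2]; exact: wigner_Parseval_aux. Qed.

(** * Passage to dimension n *)

Section mpres_operations.
Context d1 d2 d3 d4 (X : measurableType d1) (Y : measurableType d2)
 (Z : measurableType d3) (T : measurableType d4) (R : realType).

Lemma mpres_comp (m1 : {measure set X -> \bar R}) (m2 : {measure set Y -> \bar R})
  (m3 : {measure set Z -> \bar R}) h g :
 mpres m1 m2 h -> mpres m2 m3 g -> mpres m1 m3 (g \o h).
Proof.
move=> [mh Eh] [mg Eg]; split; first exact: mcomp.
move=> G mG G0; rewrite Eg//.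
by have := Eh (fun y => G (g y)) (mcomp mG mg) (fun y => G0 _).
Qed.

Variables (m1 : {sigma_finite_measure set X -> \bar R})
 (m2 : {sigma_finite_measure set Y -> \bar R})
 (m3 : {sigma_finite_measure set Z -> \bar R})
 (m4 : {sigma_finite_measure set T -> \bar R}).

Lemma mpres_prod h g : mpres m1 m2 h -> mpres m3 m4 g ->
 mpres (pmeas m1 m3) (pmeas m2 m4) (fun z => (h z.1, g z.2)).
Proof.
move=> [mh Eh] [mg Eg].
have mhg : meas (fun z : X * Z => (h z.1, g z.2)).
 apply/measurable_fun_pairP; split.
  exact: (mcomp mh measurable_fst).
 exact: (mcomp mg measurable_snd).
split => // G mG G0; rewrite Tonelli1// Tonelli1//; last exact: mcomp.
rewrite Eh.
- apply: eq_integral => x _; rewrite (Eg (fun y => G (h x, y)))//.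
 exact: (mcomp mG (pair1_meas _)).
- exact: measurable_Tonelli1.
- by move=> y; apply: integral_ge0.
Qed.

(** Regroups (x, y) by coordinates, so that the planar variable (x_1, y_1) can be split off as a
    tensor factor ([mpres_row_cons2]). *)
Lemma mpres_exchange : mpres (pmeas (pmeas m1 m2) (pmeas m3 m4))
 (pmeas (pmeas m1 m3) (pmeas m2 m4))
 (fun z => ((z.1.1, z.2.1), (z.1.2, z.2.2))).
Proof.
set h := (fun z => _).
have mh : meas h.
 have f1 : meas (fun z : X * Y * (Z * T) => z.1) by exact: measurable_fst.
 have f2 : meas (fun z : X * Y * (Z * T) => z.2) by exact: measurable_snd.
 apply/measurable_fun_pairP; split; apply/measurable_fun_pairP; split.
 - exact: (mcomp measurable_fst f1).
 - exact: (mcomp measurable_fst f2).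
 - exact: (mcomp measurable_snd f1).
 - exact: (mcomp measurable_snd f2).
split => // G mG G0.
have mGh := mcomp mG mh.
transitivity (\int[m1]_x \int[m3]_z \int[m2]_y \int[m4]_t G ((x, z), (y, t)))%E.
 rewrite Tonelli1//; rewrite Tonelli1; last 2 first.
 - exact: measurable_Tonelli1.
 - by move=> z; apply: integral_ge0.
 apply: eq_integral => x _; apply: eq_integral => z _.
 by rewrite Tonelli1//; exact: (mcomp mG (pair1_meas _)).
transitivity (\int[m1]_x \int[m2]_y \int[m3]_z \int[m4]_t G ((x, z), (y, t)))%E; last first.
 rewrite [RHS](Tonelli1 _ _ mGh (fun z => G0 _)) [RHS]Tonelli1; last 2 first.
 - exact: (measurable_Tonelli1 (pmeas m3 m4) mGh (fun z => G0 _)).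
 - by move=> z; apply: integral_ge0 => y _; exact: G0.
 apply: eq_integral => x _; apply: eq_integral => y _.
 by rewrite [RHS](Tonelli1 _ _ (mcomp mGh (pair1_meas _)) (fun z => G0 _)).
apply: eq_integral => x _.
pose k (q : Z * Y * T) := ((x, q.1.1), (q.1.2, q.2)).
have mk : meas k.
 have f1 : meas (fun q : Z * Y * T => q.1) by exact: measurable_fst.
 apply/measurable_fun_pairP; split; apply/measurable_fun_pairP; split.
 - exact: measurable_cst.
 - exact: (mcomp measurable_fst f1).
 - exact: (mcomp measurable_snd f1).
 - exact: measurable_snd.
have := @Tonelli_swap _ _ _ _ _ m3 m2 (fun q => \int[m4]_t G (k (q, t)))%E; apply.
- exact: (measurable_Tonelli1 m4 (mcomp mG mk) (fun z => G0 _)).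
- by move=> q; apply: integral_ge0 => t _; exact: G0.
Qed.

End mpres_operations.

Section bounded_complex.
Context (T : Type) (R : realType).
Implicit Types w : T -> R[i].

Definition bddC w := exists M, forall x, `|ReC (w x)| <= M /\ `|ImC (w x)| <= M.

Lemma bddC_mul w w' : bddC w -> bddC w' -> bddC (fun x => w x * w' x).
Proof.
move=> [M wM] [N wN]; exists (M * N + M * N) => x; rewrite !cE.
have [a1 a2] := wM x; have [b1 b2] := wN x.
split; [apply: le_trans (ler_normB _ _) _|apply: le_trans (ler_normD _ _) _];
 by rewrite lerD// normrM ler_pM.
Qed.

Lemma bddC1 : bddC (fun _ : T => 1).
Proof. by exists 1 => x; rewrite /= normr0 normr1. Qed.

Lemma bddC_prod (I : Type) (s : seq I) (w : I -> T -> R[i]) :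
 (forall i, bddC (w i)) -> bddC (fun x => \prod_(i <- s) w i x).
Proof.
move=> wb; elim: s => [|i s IH].
 by under eq_fun do rewrite big_nil; exact: bddC1.
by under eq_fun do rewrite big_cons; exact: bddC_mul.
Qed.

End bounded_complex.

Lemma bddC_comp (T T' : Type) (R : realType) (w : T' -> R[i]) (h : T -> T') :
 bddC w -> bddC (w \o h).
Proof. by move=> [M wM]; exists M => x; exact: wM. Qed.

Lemma L1_bddC d (T : measurableType d) (R : realType) (mu : {measure set T -> \bar R})
  (f w : T -> R[i]) : L1 mu f -> measC w -> bddC w ->
 L1 mu (fun x => f x * w x).
Proof.
by move=> f1 mw [M wM]; apply: (L1Mb (M := M)) => // x; have [] := wM x.
Qed.

Section tensor12.
Context d1 d2 (X : measurableType d1) (Y : measurableType d2) (R : realType).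
Variables (m1 : {sigma_finite_measure set X -> \bar R})
     (m2 : {sigma_finite_measure set Y -> \bar R}).
Context (I J : countType) (w1 : I -> X -> R[i]) (w2 : J -> Y -> R[i]) (c1 c2 : R).

Lemma parseval_tensor12 : 0 <= c1 -> 0 <= c2 ->
 (forall i, measC (w1 i)) -> (forall i, measC (w2 i)) ->
 (forall i, bddC (w1 i)) -> (forall i, bddC (w2 i)) ->
 parseval m1 w1 c1 (L12 m1) -> parseval m2 w2 c2 (L12 m2) ->
 parseval (pmeas m1 m2) (fun (ij : I * J) z => w1 ij.1 z.1 * w2 ij.2 z.2) (c1 * c2)
  (L12 (pmeas m1 m2)).
Proof.
move=> c10 c20 mw1 mw2 b1 b2 p1 p2.
have mw1' i : measC (fun z : X * Y => w1 i z.1).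
 exact: (mc_comp (mw1 i) measurable_fst).
have mw2' i : measC (fun z : X * Y => w2 i z.2).
 exact: (mc_comp (mw2 i) measurable_snd).
have f1b f i : L1 (pmeas m1 m2) f -> L1 (pmeas m1 m2) (fun z => f z * w1 i z.1).
 move=> f1; apply: L1_bddC => //; exact: (bddC_comp (fst : X * Y -> X) (b1 i)).
apply: (@parseval_tensor _ _ _ _ _ m1 m2 _ _ w1 w2 c1 c2 (L12 m1) (L12 m2)) => //.
- by move=> f [].
- move=> f [f1 f2]; apply: (aeS2 (L1_prod_ae2 f1) (L2_prod_ae2 f2)) => y ? ?.
 by split.
- move=> f i [f1 f2] g2; split => //.
 by have [] := L1_Fubini2 (f1b f i f1).
- move=> f ij [f1 f2]; apply: L1_bddC => //; first exact: mcM.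
 apply: bddC_mul; first exact: (bddC_comp (fst : X * Y -> X) (b1 _)).
 exact: (bddC_comp (snd : X * Y -> Y) (b2 _)).
- by move=> f i [f1 _]; exact: L1_bddC.
Qed.

End tensor12.

Lemma Integral_dirac d (T : measurableType d) (R : realType) (a : T) (G : T -> \bar R) :
 meas G -> (\int[\d_a]_x G x = G a)%E.
Proof. by move=> mG; rewrite integral_dirac// diracT mul1e. Qed.

Lemma integralC_dirac d (T : measurableType d) (R : realType) (a : T) (f : T -> R[i]) :
 measC f -> integralC (\d_a) f = f a.
Proof.
move=> [mr mi]; apply: complexP; rewrite /= /Rintegral Integral_dirac//; exact/mEFinP.
Qed.

Section lebesgue_row.
Context {R : realType}.
Notation lr := (@lebesgue_row R).

Lemma mpres_row_cons n : mpres (pmeas leb (lr n)) (lr n.+1) (@row_cons R n).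
Proof.
split; first exact: measurable_row_cons.
move=> G mG G0; rewrite /= ge0_integral_pushforward//.
exact: measurable_row_cons.
Qed.

Definition row_cons2 n (z : R * R * ('rV[R]_n * 'rV[R]_n)) :=
 (row_cons (z.1.1, z.2.1), row_cons (z.1.2, z.2.2)).

Lemma mpres_row_cons2 n : mpres (pmeas (pmeas leb leb) (pmeas (lr n) (lr n)))
 (pmeas (lr n.+1) (lr n.+1)) (@row_cons2 n).
Proof.
have := mpres_comp (mpres_exchange leb leb (lr n) (lr n))
 (mpres_prod (mpres_row_cons n) (mpres_row_cons n)).
by apply.
Qed.

Lemma mpres_row0 : mpres (\d_((0, 0) : 'rV[R]_0 * 'rV[R]_0))
 (pmeas (lr 0) (lr 0)) id.
Proof.
split; first exact: measurable_id.
move=> G mG G0; rewrite (Tonelli1 _ _ mG G0).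
transitivity (G (0, 0)); last by rewrite Integral_dirac.
transitivity (\int[lr 0]_y G (0%R, y))%E.
 by apply: Integral_dirac; exact: (measurable_Tonelli1 (lr 0) mG G0).
by apply: Integral_dirac; exact: (mcomp mG (pair1_meas _)).
Qed.

Lemma integralC_prod n (phi : 'I_n -> R -> R[i]) : (forall i, L1 leb (phi i)) ->
 L1 (lr n) (fun w => \prod_(i < n) phi i (w ord0 i)) /\
 integralC (lr n) (fun w => \prod_(i < n) phi i (w ord0 i)) =
 \prod_(i < n) integralC leb (phi i).
Proof.
elim: n phi => [|n IH] phi phi1.
 rewrite big_ord0; under eq_fun do rewrite big_ord0.
 split; first by apply/L1P; split; apply: finite_measure_integrable_cst.
 by rewrite integralC_dirac//; exact: mc_cst.
have [i1 e1] := IH (fun i => phi (lift ord0 i)) (fun i => phi1 _).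
have mp : measC (fun w : 'rV[R]_n.+1 => \prod_(i < n.+1) phi i (w ord0 i)).
 by apply: mc_prod => i; apply: (mc_comp (L1_mc (phi1 i))); exact: measurable_coord.
have E (z : R * 'rV[R]_n) : \prod_(i < n.+1) phi i (row_cons z ord0 i) =
  phi ord0 z.1 * \prod_(i < n) phi (lift ord0 i) (z.2 ord0 i).
 rewrite big_ord_recl; congr (phi _ _ * _); first by rewrite mxE unlift_none.
 by apply: eq_bigr => i _; rewrite mxE liftK.
have t1 := L1_tensor (phi1 ord0) i1.
split.
 apply/(mpres_L1 (mpres_row_cons n) mp).
 by rewrite /comp; under eq_fun do rewrite E.
rewrite (mpres_integralC (mpres_row_cons n) mp) /comp.
under [fun _ => _]eq_fun do rewrite E.
rewrite -(L1_Fubini1 t1).2 big_ord_recl -e1 mulrC -integralCZ//.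
by congr integralC; apply/funext => x; rewrite /= integralCZ// mulrC.
Qed.

End lebesgue_row.

Section wigner_row.
Context {R : realType}.
Notation lr := (@lebesgue_row R).
Notation lr2 n := (pmeas (lr n) (lr n)).
Implicit Types (n : nat) (lam : R).
Local Notation idx n := {ffun 'I_n -> nat}.

Definition wigner_row n lam (k l : idx n) (z : 'rV[R]_n * 'rV[R]_n) : R[i] :=
 \prod_(i < n) wigner lam (k i) (l i) (z.1 ord0 i, z.2 ord0 i).

Lemma mc_wigner_row n (k l : idx n) :
 measC (fun p : R * ('rV[R]_n * 'rV[R]_n) => wigner_row p.1 k l p.2).
Proof.
apply: mc_prod => i.
apply: (mc_comp (h := fun p : R * ('rV[R]_n * 'rV[R]_n) => (p.1, (p.2.1 ord0 i, p.2.2 ord0 i))) (mc_wigner (k i) (l i))).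
have m2 : meas (fun p : R * ('rV[R]_n * 'rV[R]_n) => p.2) by exact: measurable_snd.
apply/measurable_fun_pairP; split; first exact: measurable_fst.
apply/measurable_fun_pairP; split; apply: (mcomp (measurable_coord i)).
 exact: (mcomp measurable_fst m2).
exact: (mcomp measurable_snd m2).
Qed.

Lemma mc_wigner_row1 n lam (k l : idx n) : measC (wigner_row lam k l).
Proof. exact: (mc_comp (mc_wigner_row k l) (pair1_meas lam)). Qed.

Lemma bddC_wigner_row n (k l : idx n) :
 bddC (fun p : R * ('rV[R]_n * 'rV[R]_n) => wigner_row p.1 k l p.2).
Proof.
apply: bddC_prod => i; have [M hM] := @wigner_bound R (k i) (l i).
by exists M => p; exact: hM.
Qed.

Lemma bddC_wigner_row1 n lam (k l : idx n) : bddC (wigner_row lam k l).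
Proof. exact: (bddC_comp (fun z => (lam, z)) (bddC_wigner_row k l)). Qed.

Definition ffcons n (q : nat * idx n) : idx n.+1 :=
 [ffun i => oapp q.2 q.1 (unlift ord0 i)].

Lemma ffconsK n : cancel (@ffcons n) (fun k => (k ord0, [ffun i => k (lift ord0 i)])).
Proof.
case=> a k; rewrite !ffunE unlift_none; congr pair.
by apply/ffunP => i; rewrite !ffunE liftK.
Qed.

Lemma ffcons_surj n (k : idx n.+1) : ffcons (k ord0, [ffun i => k (lift ord0 i)]) = k.
Proof. by apply/ffunP => i; rewrite ffunE; case: unliftP => [j|] ->; rewrite /= ?ffunE. Qed.

(** Induction on n by the tensor product of one planar factor with the remaining ones; [e] matches a
    pair of multi-indices with its heads and tails. *)
Lemma parseval_wigner_row n lam : lam != 0 ->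
 parseval (lr2 n) (fun kl : idx n * idx n => wigner_row lam kl.1 kl.2)
  ((2 * pi / `|lam|) ^+ n) (L12 (lr2 n)).
Proof.
move=> lam0; elim: n => [|n IH] f [f1 f2].
 have mf := L2_mc f2.
 rewrite expr0 mul1e (mpres_sqL2 mpres_row0 mf).
 rewrite /sqL2norm Integral_dirac; last by apply/mEFinP; exact: measurable_sqnormC.
 pose k0 : idx 0 := [ffun=> 0%N].
 rewrite (_ : [set: _] = [set (k0, k0)]); last first.
  apply/seteqP; split => // -[k l] _ /=; congr pair; apply/ffunP => i; by case: i.
 rewrite esum_set1 ?lee_fin ?sqnormC_ge0//; congr (sqnormC _)%:E.
 have mw : measC (fun z => f z * wigner_row lam k0 k0 z).
  by apply: mcM => //; exact: mc_wigner_row1.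
 by rewrite (mpres_integralC mpres_row0 mw) integralC_dirac//= /wigner_row big_ord0 mulr1.
have mf := L2_mc f2; have hp := @mpres_row_cons2 R n.
pose e (q : (nat * nat) * (idx n * idx n)) := (ffcons (q.1.1, q.2.1), ffcons (q.1.2, q.2.2)).
have be : set_bij [set: _] [set: _] e.
 split => //.
  move=> [[a b] [k l]] [[a' b'] [k' l']] _ _ [/(can_inj (@ffconsK n)) [-> ->]].
  by move/(can_inj (@ffconsK n)) => [-> ->].
 move=> [k l] _; exists ((k ord0, l ord0), ([ffun i => k (lift ord0 i)], [ffun i => l (lift ord0 i)])) => //.
 by rewrite /e /= !ffcons_surj.
have fh : L12 (pmeas (pmeas leb leb) (lr2 n)) (f \o @row_cons2 R n).
 by split; [exact/(mpres_L1 hp mf)|exact/(mpres_L2 hp mf)].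
have c0 : 0 <= 2 * pi / `|lam| by rewrite divr_ge0// mulr_ge0// pi_ge0.
have := parseval_tensor12 c0 (exprn_ge0 n c0) _ _ _ _ (parseval_wigner lam0) IH.
move=> /(_ _ _ _ _ _ fh); rewrite (mpres_sqL2 hp mf) exprS => <-.
- rewrite (@reindex_esum _ _ _ _ _ e _ be); apply: eq_esum => q _; congr (sqnormC _)%:E.
 have mw : measC (fun z => f z * wigner_row lam (e q).1 (e q).2 z).
  by apply: mcM => //; exact: mc_wigner_row1.
 rewrite (mpres_integralC hp mw); congr integralC; apply/funext => z /=.
 congr (_ * _); rewrite /wigner_row big_ord_recl; congr (_ * _).
  by rewrite !ffunE !mxE unlift_none.
 by apply: eq_bigr => i _; rewrite !ffunE !mxE liftK.
- by move=> kl; exact: (mc_comp (mc_wigner kl.1 kl.2) (pair1_meas lam)).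
- by move=> kl; exact: mc_wigner_row1.
- by move=> kl; have [M hM] := @wigner_bound R kl.1 kl.2; exists M => z; exact: hM.
- by move=> kl; exact: bddC_wigner_row1.
Qed.

Lemma expi_sum (I : Type) (s : seq I) (t : I -> R) :
 expi (\sum_(i <- s) t i) = \prod_(i <- s) expi (t i).
Proof.
elim: s => [|i s IH]; first by rewrite !big_nil expi0.
by rewrite !big_cons expiD IH.
Qed.

Lemma conjcM (a b : R[i]) : conjc (a * b) = conjc a * conjc b.
Proof. by apply: complexP; rewrite !cE; ring. Qed.

(** Phase, translation and Hermite functions all split over the coordinates, so the integral over
    R^n is a product of Wigner integrals; only the conjugate character of the center stays
    outside. *)
Lemma inner_schrodinger n lam (x y : 'rV[R]_n) (tau : R) (k l : idx n) :
 inner (lr n) (hermite_fun l) (schrodinger lam ((x, y), tau) (hermite_fun k)) =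
 expi (- (lam * tau)) * wigner_row lam k l (x, y).
Proof.
pose phi i v := hermiteC (l i) v * hermiteC (k i) (v + Num.sqrt `|lam| * x ord0 i) *
  expi (- wigner_phase lam (x ord0 i, y ord0 i) v).
have [p1 p2] := integralC_prod (fun i => wigner_L1 lam (k i) (l i) (x ord0 i, y ord0 i)).
rewrite /wigner_row -[X in _ * X]p2 -integralCZ//; congr integralC; apply/funext => w.
rewrite /schrodinger /hermite_fun !conjcM !conj_expi.
rewrite (_ : conjc (_%:C%C) = (\prod_(i < n) hermite_fun1 (k i) ((w + Num.sqrt `|lam| *: x) ord0 i))%:C%C); last first.
 by rewrite /= oppr0.
rewrite !rmorph_prod/= !big_split/= -expi_sum.
have -> : \prod_(i < n) (hermite_fun1 (k i) ((w + Num.sqrt `|lam| *: x) ord0 i))%:C%C =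
  \prod_(i < n) hermiteC (k i) (w ord0 i + Num.sqrt `|lam| * x ord0 i).
 by apply: eq_bigr => i _; rewrite !mxE.
have -> : expi (- (lam * (tau + dotr x y / 2))) * expi (- (Num.sg lam * Num.sqrt `|lam| * dotr y w)) =
  expi (- (lam * tau)) * expi (\sum_(i < n) - wigner_phase lam (x ord0 i, y ord0 i) (w ord0 i)).
 rewrite -!expiD; congr expi.
 rewrite /wigner_phase sumrN big_split/= /dotr mulrDr !opprD -!addrA; congr (_ + (- _ + - _)).
  by rewrite !mulr_suml mulr_sumr; apply: eq_bigr => i _; ring.
 by rewrite mulr_sumr; apply: eq_bigr => i _; ring.
by rewrite /hermiteC; ring.
Qed.

End wigner_row.

(** * The Plancherel formula *)

Section density.
Context d (T : measurableType d) (R : realType) (mu : {sigma_finite_measure set T -> \bar R}).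

(** Indicators of an exhaustion by sets of finite measure are square integrable, so multiplying by
    them makes f integrable; dominated convergence gives the limit. *)
Lemma L2_truncation (f : T -> R[i]) : L2 mu f ->
 exists2 g : nat -> T -> R[i], forall j, L12 mu (g j) &
  nrm mu (fun x => g j x - f x) @[j --> \oo] --> 0.
Proof.
move=> f2; have [mf fi] := (L2P mu f).1 f2.
have /sigma_finiteP[A [TA ndA Aoo]] := sigma_finiteT mu.
pose ind j (x : T) : R[i] := (\1_(A j) x)%:C%C.
have mind j : measC (ind j).
 by apply: mc_real; apply: measurable_indic; exact: (Aoo j).1.
have ind2 j : L2 mu (ind j).
 apply/L2P; split => //; rewrite (_ : (fun _ => _) = fun x => \1_(A j) x).
  by apply: intg_indic; [exact: (Aoo j).1|exact: (Aoo j).2].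
 by apply/funext => x; rewrite /sqnormC /= expr0n addr0 indicE; case: (_ \in _); rewrite ?expr1n ?expr0n.
have g2 j : L2 mu (fun x => f x * ind j x).
 apply: L2_le f2 _ => [|x]; first exact: mcM.
 rewrite sqnormCM ler_piMr ?sqnormC_ge0// /sqnormC /= expr0n addr0 indicE.
 by case: (_ \in _); rewrite ?expr1n ?expr0n.
exists (fun j x => f x * ind j x); first by move=> j; split => //; exact: L2_mul.
rewrite (_ : (fun _ => _) = fun j => \int[mu]_x (sqnormC (f x) * (1 - \1_(A j) x))); last first.
 apply/funext => j; rewrite nrmE; apply: eq_Rintegral => x _.
 rewrite -[X in sqnormC (_ - X)]mulr1 -mulrBr sqnormCM; congr (_ * _).
 rewrite /sqnormC !cE /= indicE; case: (_ \in _) => /=; ring.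
have := @Rint_dct _ _ _ mu (fun j x => sqnormC (f x) * (1 - \1_(A j) x)) (fun=> 0) (fun x => sqnormC (f x)).
rewrite Rintg0; case=> //.
- move=> j; apply: measurable_funM; first exact: measurable_sqnormC.
 by apply: measurable_funB => //; apply: measurable_indic; exact: (Aoo j).1.
- apply: aeW => x; have : [set: T] x by [].
 rewrite TA => -[N _ AN]; apply: cvg_near_cst; exists N => // j /= Nj.
 rewrite indicE mem_set ?subrr ?mulr0//; exact: (subsetPset _ _ (ndA _ _ Nj)).
- move=> j x; rewrite ger0_norm.
  by rewrite ler_piMr ?sqnormC_ge0// lerBlDr lerDl indicE; case: (_ \in _).
 by rewrite mulr_ge0 ?sqnormC_ge0// subr_ge0 indicE; case: (_ \in _).
Qed.

End density.

Section measurable_count.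
Context d (T : measurableType d) d' (U : measurableType d').

Lemma measurable_fun_prod_nat (f : T * nat -> U) :
 (forall m, meas (fun x => f (x, m))) -> meas f.
Proof.
move=> mf _ Y mY; rewrite setTI.
rewrite (_ : f @^-1` Y = \bigcup_m (((fun x => f (x, m)) @^-1` Y) `*` [set m])); last first.
 apply/seteqP; split => [[x m] /= fY|[x m] [k _] [/= + ->]] //.
 by exists m.
apply: bigcup_measurable => m _; apply: measurableX => //.
by rewrite -[X in measurable X]setTI; exact: mf.
Qed.

End measurable_count.

(** * The group Fourier transform of integrable functions *)

Section group_fourier.
Context {R : realType} (n : nat).
Local Notation idx := {ffun 'I_n -> nat}.
Implicit Types (f : heis R n -> R[i]) (lam : R) (k l : idx).

Definition partial_fourier f lam z := fourier1 (fun t => f (z, t)) lam.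

Lemma fourier_coefE f lam k l : fourier_coef f lam k l =
 integralC hm (fun eta => f eta * (expi (- (lam * eta.2)) * wigner_row lam k l eta.1)).
Proof.
rewrite /fourier_coef /fourier_form; congr integralC; apply/funext => -[[x y] t] /=.
by rewrite inner_schrodinger.
Qed.

Lemma mc_partial_fourier f : measC f ->
 measC (fun p : R * ('rV[R]_n * 'rV[R]_n) => partial_fourier f p.1 p.2).
Proof.
move=> mf; apply: (mc_integral leb (f := fun q : R * ('rV[R]_n * 'rV[R]_n) * R =>
 f (q.1.2, q.2) * expi (- (q.1.1 * q.2)))).
have m1 : meas (fun q : R * ('rV[R]_n * 'rV[R]_n) * R => q.1.1).
 exact: (mcomp measurable_fst measurable_fst).
have m2 : meas (fun q : R * ('rV[R]_n * 'rV[R]_n) * R => q.1.2).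
 exact: (mcomp measurable_snd measurable_fst).
have m3 : meas (fun q : R * ('rV[R]_n * 'rV[R]_n) * R => q.2) by exact: measurable_snd.
apply: mcM.
 by apply: (mc_comp mf); apply/measurable_fun_pairP; split.
by apply: mc_expi; apply: mcomp => //; exact: measurable_funM.
Qed.

Lemma fourier_coef_partial f lam k l : L1 hm f ->
 L1 lr2 (partial_fourier f lam) /\
 fourier_coef f lam k l = integralC lr2 (fun z => partial_fourier f lam z * wigner_row lam k l z).
Proof.
move=> f1.
have mt : meas (fun eta : heis R n => - (lam * eta.2)).
 by apply: mcomp => //; apply: measurable_funM => //; exact: measurable_snd.
have fe := L1_expi f1 mt.
have [F1 _] := L1_Fubini1 fe; split; first exact: F1.
have fw : L1 hm (fun eta => f eta * expi (- (lam * eta.2)) * wigner_row lam k l eta.1).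
 apply: L1_bddC => //; first exact: (mc_comp (mc_wigner_row1 lam k l) measurable_fst).
 exact: (bddC_comp fst (bddC_wigner_row1 lam k l)).
transitivity (integralC hm (fun eta => f eta * expi (- (lam * eta.2)) * wigner_row lam k l eta.1)).
 by rewrite fourier_coefE; congr integralC; apply/funext => eta; rewrite mulrA.
rewrite -(L1_Fubini1 fw).2; apply: integralC_ae.
- exact: (L1_mc (L1_Fubini1 fw).1).
- by apply: mcM; [exact: (L1_mc F1)|exact: mc_wigner_row1].
apply: aeS (L1_prod_ae fe) _ => z fz.
by rewrite /= mulrC -integralCZ//; congr integralC; apply/funext => t; rewrite mulrC.
Qed.

Lemma mc_fourier_coef f k l : measC f ->
 measC (fun lam => fourier_coef f lam k l).
Proof.
move=> mf; under eq_fun do rewrite fourier_coefE.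
apply: (mc_integral hm (f := fun q : R * heis R n =>
 f q.2 * (expi (- (q.1 * q.2.2)) * wigner_row q.1 k l q.2.1))).
have m1 : meas (fun q : R * heis R n => q.1) by exact: measurable_fst.
have m2 : meas (fun q : R * heis R n => q.2) by exact: measurable_snd.
apply: mcM; first exact: (mc_comp mf m2).
apply: mcM.
 apply: mc_expi; apply: mcomp => //; apply: measurable_funM => //.
 exact: (mcomp measurable_snd m2).
apply: (mc_comp (mc_wigner_row k l) (h := fun q : R * heis R n => (q.1, q.2.1))).
apply/measurable_fun_pairP; split => //; exact: (mcomp measurable_fst m2).
Qed.

Lemma partial_fourier_Plancherel f : L12 hm f ->
 {ae leb, forall lam, L2 lr2 (partial_fourier f lam)} /\
 (\int[leb]_lam sqL2norm lr2 (partial_fourier f lam) = (2 * pi)%:E * sqL2norm hm f)%E.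
Proof.
move=> [f1 f2]; have mf := L2_mc f2; have mF := mc_partial_fourier mf.
pose G (p : R * ('rV[R]_n * 'rV[R]_n)) : \bar R := (sqnormC (partial_fourier f p.1 p.2))%:E.
have mG : meas G by apply/mEFinP; exact: measurable_sqnormC.
have G0 p : (0 <= G p)%E by rewrite lee_fin sqnormC_ge0.
pose H eta : \bar R := (sqnormC (f eta))%:E.
have mH : meas H by apply/mEFinP; exact: measurable_sqnormC.
have H0 p : (0 <= H p)%E by rewrite lee_fin sqnormC_ge0.
have E : (\int[leb]_lam sqL2norm lr2 (partial_fourier f lam) = (2 * pi)%:E * sqL2norm hm f)%E.
 transitivity (\int[leb]_lam \int[lr2]_z G (lam, z))%E; first by [].
 rewrite (Tonelli_swap leb lr2 mG G0).
 transitivity ((2 * pi)%:E * \int[lr2]_z \int[leb]_t H (z, t))%E; last first.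
  by congr (_ * _)%E; exact: (esym (Tonelli1 lr2 leb mH H0)).
 have mH1 := measurable_Tonelli1 leb mH H0.
 rewrite -ge0_integralZl//; last 2 first.
 - by move=> z _; apply: integral_ge0 => t _; exact: H0.
 - by rewrite lee_fin mulr_ge0// pi_ge0.
 apply: ae_eq_integral => //.
 - exact: (measurable_Tonelli2 leb mG G0).
 - exact: measurable_funeM.
 apply: (aeS2 (L1_prod_ae f1) (L2_prod_ae f2)) => z g1 g2 _.
 have [F2 nF] := plancherel1 g1 g2.
 transitivity (sqL2norm leb (fourier1 (fun t => f (z, t)))) => //.
 by rewrite sqL2E// nF EFinM -sqL2E.
split => //.
have mI := measurable_Tonelli1 lr2 mG G0.
have : leb.-integrable setT (fun lam => \int[lr2]_z G (lam, z))%E.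
 apply/integrableP; split => //.
 have -> : (\int[leb]_lam `|\int[lr2]_z G (lam, z)| = (2 * pi)%:E * sqL2norm hm f)%E.
  rewrite -E; apply: eq_integral => lam _.
  by rewrite gee0_abs//; apply: integral_ge0 => z _; exact: G0.
 rewrite lte_mul_pinfty//; last exact: f2.2.
 by rewrite lee_fin mulr_ge0// pi_ge0.
move/(integrable_ae measurableT) => fin.
apply: aeS fin _ => lam /(_ I) h; split; last by move: h; rewrite ge0_fin_numE//; apply: integral_ge0.
exact: (mc_comp mF (pair1_meas lam)).
Qed.

(** The transform in tau contributes 2 pi and the Wigner functions (2 pi / |lam|)^n; the density
    |lam|^n cancels the dependence on lam. *)
Lemma fourier_coef_Plancherel f : (0 < n)%N -> L12 hm f ->
 (\int[leb]_lam (sqHSnorm (fourier_coef f lam) * (`|lam| ^+ n)%:E) =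
  ((2 * pi) ^+ n.+1)%:E * sqL2norm hm f)%E.
Proof.
move=> n0 f12; have [pL2 pE] := partial_fourier_Plancherel f12.
have mF := mc_partial_fourier (L2_mc f12.2).
pose G (p : R * ('rV[R]_n * 'rV[R]_n)) : \bar R := (sqnormC (partial_fourier f p.1 p.2))%:E.
have mG : meas G by apply/mEFinP; exact: measurable_sqnormC.
have G0 p : (0 <= G p)%E by rewrite lee_fin sqnormC_ge0.
have mI := measurable_Tonelli1 lr2 mG G0.
rewrite exprSr EFinM -muleA -pE -ge0_integralZl//; last 2 first.
- by move=> lam _; apply: integral_ge0 => z _; exact: (G0 (lam, z)).
- by rewrite lee_fin exprn_ge0// mulr_ge0// pi_ge0.
apply: ae_eq_integral => //.
- apply: emeasurable_funM.
  apply: measurable_esum => [i lam|i]; first by rewrite lee_fin sqnormC_ge0.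
  apply/mEFinP; apply: measurable_sqnormC; apply: mc_fourier_coef.
  exact: (L2_mc f12.2).
 by apply/mEFinP; apply: measurable_funX; exact: normr_measurable.
- exact: measurable_funeM.
have l0 : {ae leb, forall lam : R, lam != 0}.
 exists [set 0 : R]; split; first exact: measurable_set1.
  exact: lebesgue_measure_set1.
 by move=> lam /= /negP; rewrite negbK => /eqP.
apply: (aeS2 pL2 l0) => lam p2 lam0 _.
have p1 := (fourier_coef_partial lam [ffun=> 0%N] [ffun=> 0%N] f12.1).1.
have := parseval_wigner_row lam0 (conj p1 p2).
rewrite /sqHSnorm => E.
rewrite (_ : (\esum_(_ in _) _)%E = ((2 * pi / `|lam|) ^+ n)%:E * sqL2norm lr2 (partial_fourier f lam))%E; last first.
 by rewrite -E; apply: eq_esum => kl _; rewrite (fourier_coef_partial lam kl.1 kl.2 f12.1).2.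
rewrite muleAC -EFinM; congr (_%:E * _)%E.
by rewrite -exprMn divfK// normr_eq0.
Qed.

End group_fourier.

(** Makes Fubini available on [KK]. *)
HB.instance Definition _ (R : realType) :=
 Measure_isSigmaFinite.Build _ _ _ (@counting nat R) (sigma_finite_counting R).

(** * Matrix-valued functions as an L^2 space *)

Section spectral_side.
Context {R : realType} (n : nat).
Local Notation idx := {ffun 'I_n -> nat}.
Local Notation fam := (R -> idx -> idx -> R[i]).
Implicit Types (F G : fam) (lam : R) (k l : idx).

(* A matrix-valued function of lam, seen in L^2 of leb x counting: the pair of
  row and column indices is coded by a natural number, and the density |lam|^n
  of the Plancherel measure is moved into the function. *)
Definition toK F (p : R * nat) : R[i] :=
 if @pickle_inv (idx * idx)%type p.2 is Some kl
 then (Num.sqrt (`|p.1| ^+ n))%:C%C * F p.1 kl.1 kl.2 else 0.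

(* The symbol |lam| mu_k of the sublaplacian. *)
Definition symb (p : R * nat) : R :=
 if @pickle_inv (idx * idx)%type p.2 is Some kl then `|p.1| * hermite_ev kl.1 else 0.

Lemma measurable_sqrt_normX : meas (fun lam : R => Num.sqrt (`|lam| ^+ n)).
Proof.
apply: mcomp; last by apply: measurable_funX; exact: normr_measurable.
by apply: continuous_measurable_fun; exact: sqrt_continuous.
Qed.

Lemma mc_prod_nat (g : R * nat -> R[i]) :
 (forall m, measC (fun x => g (x, m))) -> measC g.
Proof.
by move=> mg; split; apply: measurable_fun_prod_nat => m; have [] := mg m.
Qed.

Lemma mc_toK F : (forall k l, measC (fun lam => F lam k l)) ->
 measC (toK F).
Proof.
move=> mF; apply: mc_prod_nat => m; rewrite /toK /=.
case: pickle_inv => [kl|]; last exact: mc_cst.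
by apply: mcM => //; apply: mc_real; exact: measurable_sqrt_normX.
Qed.

Lemma measurable_symb : meas symb.
Proof.
apply: measurable_fun_prod_nat => m; rewrite /symb /=.
case: pickle_inv => [kl|]; last exact: measurable_cst.
by apply: measurable_funM => //; exact: normr_measurable.
Qed.

Lemma symb_ge0 p : 0 <= symb p.
Proof. by rewrite /symb; case: pickle_inv => [kl|//]; rewrite mulr_ge0. Qed.

Lemma toKD F G p : toK (fun lam k l => F lam k l + G lam k l) p = toK F p + toK G p.
Proof. by rewrite /toK; case: pickle_inv => [kl|]; rewrite ?mulrDr ?addr0. Qed.

Lemma toKZ (c : R[i]) F p : toK (fun lam k l => c * F lam k l) p = c * toK F p.
Proof. by rewrite /toK; case: pickle_inv => [kl|]; rewrite ?mulr0// mulrCA. Qed.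

Lemma toKB F G p : toK (fun lam k l => F lam k l - G lam k l) p = toK F p - toK G p.
Proof. by rewrite /toK; case: pickle_inv => [kl|]; rewrite ?mulrBr ?subr0. Qed.

Lemma sqnormC_toK F p : sqnormC (toK F p) =
 if @pickle_inv (idx * idx)%type p.2 is Some kl
 then `|p.1| ^+ n * sqnormC (F p.1 kl.1 kl.2) else 0.
Proof.
rewrite /toK; case: pickle_inv => [kl|]; last exact: sqnormC0.
rewrite sqnormCM; congr (_ * _).
by rewrite /sqnormC /= expr0n addr0 sqr_sqrtr// exprn_ge0.
Qed.

(** For B = [0, rho^2] and F the transform of u0, the right side is the sum in [decay_ratio]: the
    cut-off in lam becomes a condition on the symbol. *)
Lemma sqL2_toK_symb F (B : set R) : measurable B ->
 (forall k l, measC (fun lam => F lam k l)) ->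
 sqL2norm KK (fun p => (\1_B (symb p))%:C%C * toK F p) =
 (\esum_(kl in [set: idx * idx]) \int[leb]_lam
  (\1_B (`|lam| * hermite_ev kl.1) * (`|lam| ^+ n * sqnormC (F lam kl.1 kl.2)))%:E)%E.
Proof.
move=> mB mF.
pose a (kl : idx * idx) lam : \bar R :=
 (\1_B (`|lam| * hermite_ev kl.1) * (`|lam| ^+ n * sqnormC (F lam kl.1 kl.2)))%:E.
have i01 (x : R) : 0 <= \1_B x :> R by rewrite indicE.
have a0 kl lam : (0 <= a kl lam)%E.
 by rewrite lee_fin mulr_ge0// mulr_ge0 ?sqnormC_ge0// exprn_ge0.
have mi : meas (\1_B : R -> R) by exact: measurable_indic.
have ma kl : meas (a kl).
 apply/mEFinP; apply: measurable_funM.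
  by apply: (mcomp mi); apply: measurable_funM => //; exact: normr_measurable.
 apply: measurable_funM; first by apply: measurable_funX; exact: normr_measurable.
 exact: measurable_sqnormC.
pose G (p : R * nat) : \bar R := oapp (fun kl => a kl p.1) 0%E (@pickle_inv (idx * idx)%type p.2).
have mG : meas G.
 apply: measurable_fun_prod_nat => m; rewrite /G /=.
 by case: pickle_inv => [kl|] //=; exact: measurable_cst.
have G0 p : (0 <= G p)%E by rewrite /G; case: pickle_inv => /=.
rewrite -integral_esum//.
transitivity (\int[KK]_p G p)%E.
 apply: eq_integral => p _; rewrite sqnormCM sqnormC_toK /G /symb.
 case: pickle_inv => [kl|] /=; last by rewrite mulr0.
 rewrite /a; congr (_ * _)%:E; rewrite /sqnormC /= expr0n addr0 indicE.
 by case: (_ \in _); rewrite ?expr1n ?expr0n.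
rewrite Tonelli1//; apply: eq_integral => lam _.
transitivity (\sum_(0 <= k <oo) G (lam, k))%E.
 by apply: ge0_integral_count => k; exact: G0.
exact: (esym (@esum_pickle _ _ (fun kl => a kl lam) (fun kl => a0 kl lam))).
Qed.

Lemma sqL2_toK F : (forall k l, measC (fun lam => F lam k l)) ->
 sqL2norm KK (toK F) = (\int[leb]_lam (sqHSnorm (F lam) * (`|lam| ^+ n)%:E))%E.
Proof.
move=> mF; transitivity (sqL2norm KK (fun p => (\1_setT (symb p))%:C%C * toK F p)).
 by congr sqL2norm; apply/funext => p; rewrite indicT mul1r.
rewrite sqL2_toK_symb//.
pose a (kl : idx * idx) lam : \bar R := (sqnormC (F lam kl.1 kl.2))%:E.
rewrite -integral_esum.
- apply: eq_integral => lam _; rewrite muleC -esumZl.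
 + by apply: eq_esum => kl _; rewrite indicT mul1r EFinM.
 + by rewrite exprn_ge0.
 + by move=> kl; rewrite lee_fin sqnormC_ge0.
- by move=> kl lam; rewrite indicT mul1r lee_fin mulr_ge0 ?sqnormC_ge0// exprn_ge0.
- move=> kl; apply/mEFinP; under eq_fun do rewrite indicT mul1r.
 apply: measurable_funM; first by apply: measurable_funX; exact: normr_measurable.
 exact: (measurable_sqnormC (mF kl.1 kl.2)).
Qed.

Lemma integral_neq0 (G : R -> \bar R) : G 0 = 0%E ->
 (\int[leb]_(lam in [set lam : R | lam != 0%R]) G lam = \int[leb]_lam G lam)%E.
Proof.
move=> G0; rewrite integral_mkcond; apply: eq_integral => lam _; rewrite patchE.
by case: ifPn => //; rewrite notin_setE /= => /negP; rewrite negbK => /eqP ->.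
Qed.

Lemma sqL2_toK_neq0 F : (0 < n)%N -> (forall k l, measC (fun lam => F lam k l)) ->
 (\int[leb]_(lam in [set lam : R | lam != 0%R]) (sqHSnorm (F lam) * (`|lam| ^+ n)%:E))%E =
 sqL2norm KK (toK F).
Proof.
move=> n0 mF; rewrite sqL2_toK// integral_neq0//.
by rewrite normr0 expr0n gtn_eqF// mule0.
Qed.

End spectral_side.

(** * Extension of the transform to L^2 *)

Section fourier_L2.
Context {R : realType} (n : nat).
Hypothesis n0 : (0 < n)%N.
Local Notation idx := {ffun 'I_n -> nat}.
Implicit Types (f : heis R n -> R[i]).

Definition fourierK f := toK (fourier_coef f).
Definition plancherel_const : R := (2 * pi) ^+ n.+1.

Lemma plancherel_const_gt0 : 0 < plancherel_const.
Proof. by rewrite exprn_gt0// mulr_gt0// pi_gt0. Qed.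

Lemma L1_kernel f lam (k l : idx) : L1 hm f ->
 L1 hm (fun eta => f eta * (expi (- (lam * eta.2)) * wigner_row lam k l eta.1)).
Proof.
move=> f1; apply: L1_bddC => //.
- apply: mcM; last exact: (mc_comp (mc_wigner_row1 lam k l) measurable_fst).
 apply: mc_expi; apply: mcomp => //; exact: measurable_funM.
- apply: bddC_mul; last exact: (bddC_comp fst (bddC_wigner_row1 lam k l)).
 by exists 1 => x; split; [exact: cos_bound|exact: sin_bound].
Qed.

Lemma fourier_coefD f g lam (k l : idx) : L1 hm f -> L1 hm g ->
 fourier_coef (fun x => f x + g x) lam k l = fourier_coef f lam k l + fourier_coef g lam k l.
Proof.
move=> f1 g1; rewrite !fourier_coefE -integralCD.
- by congr integralC; apply/funext => x; rewrite mulrDl.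
- exact: L1_kernel.
- exact: L1_kernel.
Qed.

Lemma fourier_coefZ c f lam (k l : idx) : L1 hm f ->
 fourier_coef (fun x => c * f x) lam k l = c * fourier_coef f lam k l.
Proof.
move=> f1; rewrite !fourier_coefE -integralCZ; last exact: L1_kernel.
by congr integralC; apply/funext => x; rewrite -[LHS]mulrA.
Qed.

Lemma fourierKD f g : L1 hm f -> L1 hm g ->
 fourierK (fun x => f x + g x) = (fun p => fourierK f p + fourierK g p).
Proof.
move=> f1 g1; apply/funext => p; rewrite /fourierK -toKD; congr (toK _ p).
by apply/funext => lam; apply/funext => k; apply/funext => l; exact: fourier_coefD.
Qed.

Lemma fourierKZ c f : L1 hm f ->
 fourierK (fun x => c * f x) = (fun p => c * fourierK f p).
Proof.
move=> f1; apply/funext => p; rewrite /fourierK -toKZ; congr (toK _ p).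
by apply/funext => lam; apply/funext => k; apply/funext => l; exact: fourier_coefZ.
Qed.

Lemma fourierKB f g : L1 hm f -> L1 hm g ->
 fourierK (fun x => f x - g x) = (fun p => fourierK f p - fourierK g p).
Proof.
move=> f1 g1.
have -> : (fun x => f x - g x) = (fun x => f x + (-1) * g x).
 by apply/funext => x; rewrite mulN1r.
rewrite fourierKD ?fourierKZ//; last exact: L1Z.
by apply/funext => p; rewrite mulN1r.
Qed.

Lemma fourierK_L2 f : L12 hm f ->
 L2 KK (fourierK f) /\ nrm KK (fourierK f) = plancherel_const * nrm hm f.
Proof.
move=> f12; have [f1 f2] := f12.
have mf k l : measC (fun lam => fourier_coef f lam k l).
 exact: (mc_fourier_coef k l (L2_mc f2)).
have E : sqL2norm KK (fourierK f) = (plancherel_const%:E * sqL2norm hm f)%E.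
 by rewrite sqL2_toK// fourier_coef_Plancherel.
have L2f : L2 KK (fourierK f).
 split; first exact: mc_toK.
 rewrite E; apply: lte_mul_pinfty; [|by []|exact: f2.2].
 by rewrite lee_fin ltW// plancherel_const_gt0.
split => //; apply: EFin_inj; rewrite EFinM -sqL2E// E; congr (_ * _)%E.
exact: sqL2E.
Qed.

(** The extension as a relation, so that linear combinations and norms are handled on approximating
    sequences; [fourier] satisfies it by [fourierP]. *)
Definition is_fourierK f g :=
 [/\ L2 hm f, L2 KK g &
  exists f_ : nat -> heis R n -> R[i],
  [/\ forall j, L12 hm (f_ j),
    nrm hm (fun x => f_ j x - f x) @[j --> \oo] --> 0 &
    nrm KK (fun p => fourierK (f_ j) p - g p) @[j --> \oo] --> 0]].

(** Plancherel on the truncations turns their convergence to f into a Cauchy sequence of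
    transforms. *)
Lemma is_fourierK_exists f : L2 hm f -> exists g, is_fourierK f g.
Proof.
move=> f2; have [f_ f12 fc] := L2_truncation f2.
have B2 j : L2 hm (fun x => f_ j x - f x) by apply: L2B => //; exact: (f12 j).2.
have C0 := plancherel_const_gt0.
have [g g2 gc] : exists2 g, L2 KK g & nrm KK (fun p => fourierK (f_ j) p - g p) @[j --> \oo] --> 0.
 apply: Riesz_Fischer; first by move=> j; exact: (fourierK_L2 (f12 j)).1.
 move=> e e0; have e4 : 0 < e / (4 * plancherel_const) by rewrite divr_gt0// mulr_gt0.
 move/cvgrPdist_le : fc => /(_ _ e4)[N _ hN]; exists N => m k Nm Nk.
 have jE j : (N <= j)%N -> nrm hm (fun x => f_ j x - f x) <= e / (4 * plancherel_const).
  by move=> Nj; have := hN j Nj; rewrite /= sub0r normrN ger0_norm// nrm_ge0.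
 have b12 : L12 hm (fun x => f_ m x - f_ k x).
  by split; [exact: (L1B (f12 m).1 (f12 k).1)|exact: (L2B (f12 m).2 (f12 k).2)].
 have := (fourierK_L2 b12).2; rewrite fourierKB; [|exact: (f12 m).1|exact: (f12 k).1].
 move=> ->.
 have -> : (fun x => f_ m x - f_ k x) = (fun x => (f_ m x - f x) + - (f_ k x - f x)).
  by apply/funext => x; rewrite opprB addrA subrK.
 have := nrmD_le (B2 m) (L2N (B2 k)); rewrite nrmN => h.
 have hm1 := jE _ Nm; have hk1 := jE _ Nk.
 rewrite -ler_pdivlMl// (le_trans h)//.
 rewrite (_ : _^-1 * e = 2 * (e / (4 * plancherel_const) + e / (4 * plancherel_const))).
  by rewrite ler_wpM2l// lerD.
 by field; rewrite gt_eqF.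
by exists g; split => //; exists f_.
Qed.

Lemma is_fourierK_nrm f g : is_fourierK f g -> nrm KK g = plancherel_const * nrm hm f.
Proof.
move=> [f2 g2 [f_ [f12 fc gc]]].
have c1 := nrm_cvg2 (fun j => (f12 j).2) f2 fc.
have c2 := nrm_cvg2 (fun j => (fourierK_L2 (f12 j)).1) g2 gc.
have c3 : nrm KK (fourierK (f_ j)) @[j --> \oo] --> plancherel_const * nrm hm f.
 under eq_fun do rewrite (fourierK_L2 (f12 _)).2.
 by apply: cvgM => //; exact: cvg_cst.
exact: (cvg_unique _ c2 c3).
Qed.

Lemma nrm_cvg_lin d (T : measurableType d) (mu : {measure set T -> \bar R})
  (u v : nat -> T -> R[i]) (u0 v0 : T -> R[i]) (c : R[i]) :
 (forall j, L2 mu (fun x => u j x - u0 x)) -> (forall j, L2 mu (fun x => v j x - v0 x)) ->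
 nrm mu (fun x => u j x - u0 x) @[j --> \oo] --> 0 ->
 nrm mu (fun x => v j x - v0 x) @[j --> \oo] --> 0 ->
 nrm mu (fun x => (u j x + c * v j x) - (u0 x + c * v0 x)) @[j --> \oo] --> 0.
Proof.
move=> u2 v2 cu cv.
apply: (@squeeze_cvgr _ _ _ _ (fun=> 0) (fun j => 2 * (nrm mu (fun x => u j x - u0 x) +
  sqnormC c * nrm mu (fun x => v j x - v0 x)))).
- apply: nearW => j; rewrite nrm_ge0/=.
 rewrite (_ : (fun x => _) = fun x => (u j x - u0 x) + c * (v j x - v0 x)).
  rewrite -nrmZ//; apply: nrmD_le => //; exact: L2Z.
 by apply/funext => x; ring.
- exact: cvg_cst.
- rewrite [X in _ --> X](_ : _ = 2 * (0 + sqnormC c * 0)); last by rewrite mulr0 addr0 mulr0.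
 apply: cvgM; first exact: cvg_cst.
 by apply: cvgD => //; apply: cvgM => //; exact: cvg_cst.
Qed.

Lemma is_fourierK_lin f g f' g' c : is_fourierK f g -> is_fourierK f' g' ->
 is_fourierK (fun x => f x + c * f' x) (fun p => g p + c * g' p).
Proof.
move=> [f2 g2 [u [u12 fc gc]]] [f2' g2' [v [v12 fc' gc']]].
split; [exact: (L2D f2 (L2Z c f2'))|exact: (L2D g2 (L2Z c g2'))|].
exists (fun j x => u j x + c * v j x); split.
- move=> j; split; first exact: (L1D (u12 j).1 (L1Z c (v12 j).1)).
 exact: (L2D (u12 j).2 (L2Z c (v12 j).2)).
- apply: nrm_cvg_lin => // j; first exact: (L2B (u12 j).2 f2).
 exact: (L2B (v12 j).2 f2').
- have E j : fourierK (fun x => u j x + c * v j x) = fun p => fourierK (u j) p + c * fourierK (v j) p.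
  by rewrite fourierKD ?fourierKZ//; [exact: (v12 j).1|exact: (u12 j).1|exact: (L1Z c (v12 j).1)].
 under eq_fun do rewrite E.
 apply: nrm_cvg_lin => // j; first exact: (L2B (fourierK_L2 (u12 j)).1 g2).
 exact: (L2B (fourierK_L2 (v12 j)).1 g2').
Qed.

Lemma is_fourier_is_fourierK f F : L2 hm f -> is_fourier f F -> is_fourierK f (toK F).
Proof.
move=> f2 [mF [f_ [f12 fc Fc]]].
have mf j k l : measC (fun lam => fourier_coef (f_ j) lam k l).
 exact: (mc_fourier_coef k l (L2_mc (f12 j).2)).
have f12' j : L12 hm (f_ j) by exact: f12.
have E j : (\int[leb]_(lam in [set lam : R | lam != 0%R])
  (sqHSnorm (fun k l => (fourier_coef (f_ j) lam k l - F lam k l)%R) * (`|lam| ^+ n)%:E))%E =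
  sqL2norm KK (fun p => fourierK (f_ j) p - toK F p).
 rewrite (sqL2_toK_neq0 n0); first by congr sqL2norm; apply/funext => p; exact: toKB.
 by move=> k l; exact: mcB.
rewrite (funext E) in Fc.
have mK := mc_toK mF.
have L2F : L2 KK (toK F).
 have [[j _ /(_ j (leqnn j)) hj] _] := (fine_cvgP _ _).1 Fc.
 have Kj := (fourierK_L2 (f12' j)).1.
 have dj : L2 KK (fun p => fourierK (f_ j) p - toK F p).
  split; first by apply: mcB => //; exact: (L2_mc Kj).
  by move: hj; rewrite /= ge0_fin_numE// integral_ge0// => p _; rewrite lee_fin sqnormC_ge0.
 by have := L2B Kj dj; under eq_fun do rewrite subKr.
have fin0 (u : nat -> \bar R) : u j @[j --> \oo] --> 0%E -> fine (u j) @[j --> \oo] --> (0 : R).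
 by move/(fine_cvg (f := u)).
split => //; exists f_; split => //; apply: fin0 => //.
Qed.

Lemma is_fourier_fourier f : L2 hm f -> is_fourier f (fourier f).
Proof.
move=> f2; suff [F FP] : exists F, is_fourier f F by rewrite /fourier; apply: (xgetPex (fun _ _ _ => 0)); exists F.
have [g [_ g2 [f_ [f12 fc gc]]]] := is_fourierK_exists f2.
(* Division by the root of the density |lam|^n, written with exp and ln; at lam = 0 the density
   vanishes and the value is immaterial. *)
pose F (lam : R) (k l : idx) := (expR (- (2^-1 * ln (`|lam| ^+ n))))%:C%C * g (lam, pickle (k, l)).
have mF k l : measC (fun lam => F lam k l).
 apply: mcM; last exact: (mc_comp (L2_mc g2) (pair2_meas (pickle (k, l)))).
 apply: mc_real; apply: mcomp => //; apply: mcomp => //.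
 apply: measurable_funM => //; apply: mcomp; first exact: measurable_ln.
 by apply: measurable_funX; exact: normr_measurable.
exists F; split => //; exists f_; split => //.
- have E := funext (fun j => sqL2E (L2B (f12 j).2 f2)).
 rewrite [X in X @ _ --> _](_ : _ = fun j => (nrm hm (fun x => f_ j x - f x))%:E)//.
 by apply: cvg_EFin => //; exact: nearW.
have mf j k l : measC (fun lam => fourier_coef (f_ j) lam k l).
 exact: (mc_fourier_coef k l (L2_mc (f12 j).2)).
have d2 j : L2 KK (fun p => fourierK (f_ j) p - g p) by exact: (L2B (fourierK_L2 (f12 j)).1 g2).
have le j p : sqnormC (toK (fun lam k l => fourier_coef (f_ j) lam k l - F lam k l) p) <=
  sqnormC (fourierK (f_ j) p - g p).
 case: p => lam m; rewrite toKB /fourierK /toK/=.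
 case E : (@pickle_inv (idx * idx)%type m) => [[k l]|]; last by rewrite subrr sqnormC0 sqnormC_ge0.
 have Em : pickle (k, l) = m by have := @pickle_invK (idx * idx)%type m; rewrite /ocancel E.
 rewrite /F Em /=; have [->|lam0] := eqVneq lam 0.
  by rewrite normr0 expr0n gtn_eqF// sqrtr0 !mul0r subrr sqnormC0 sqnormC_ge0.
 rewrite [X in _ - X]mulrA (_ : _%:C%C * _%:C%C = 1) ?mul1r//.
 have s0 : 0 < `|lam| ^+ n by rewrite exprn_gt0// normr_gt0.
 have e1 : Num.sqrt (`|lam| ^+ n) * expR (- (2^-1 * ln (`|lam| ^+ n))) = 1.
  by rewrite -powR12_sqrt ?ltW// /powR gt_eqF// -expRD subrr expR0.
 by apply: complexP; rewrite !cE /= ?e1// mulr0 ?mul0r ?subr0 ?addr0.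
have b2 j : L2 KK (toK (fun lam k l => fourier_coef (f_ j) lam k l - F lam k l)).
 apply: L2_le (d2 j) (le j); apply: mc_toK => k l; exact: mcB.
under eq_fun do rewrite (sqL2_toK_neq0 n0 (fun k l => mcB (mf _ k l) (mF k l))) sqL2E//.
apply: cvg_EFin; first exact: nearW.
apply: (squeeze_cvgr _ (cvg_cst 0) gc); apply: nearW => j; rewrite nrm_ge0/=.
rewrite !nrmE; apply: Rint_le => //; [exact: ((L2P _ _).1 (b2 j)).2|exact: ((L2P _ _).1 (d2 j)).2].
Qed.

Lemma fourierP f : L2 hm f -> is_fourierK f (toK (fourier f)).
Proof. by move=> f2; apply: is_fourier_is_fourierK => //; exact: is_fourier_fourier. Qed.

End fourier_L2.

(** * Eigenfunctions of the sublaplacian *)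

Section complex_hermite.
Context {R : realType}.
Implicit Types (k l : nat) (z w : R[i]) (p q : R) (P Q : {poly R}).

(* Complex Hermite polynomials in z and its conjugate w. *)
Fixpoint chermite k l z w : R[i] :=
 if k is k'.+1 then z * chermite k' l z w + (2 * l%:R) * chermite k' l.-1 z w
 else (- w) ^+ l.

Lemma chermiteS k l z w :
 chermite k.+1 l z w = z * chermite k l z w + (2 * l%:R) * chermite k l.-1 z w.
Proof. by []. Qed.

(** The definition recurses on the first index; this is the companion in the second one. [E1] comes
    from the definition and [E2] from the induction hypothesis. *)
Lemma chermiteSr k l z w :
 chermite k l.+1 z w = (2 * k%:R) * chermite k.-1 l z w - w * chermite k l z w.
Proof.
elim: k l => [|k IH] l; first by rewrite mulr0 mul0r add0r /= exprS mulNr.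
have E1 : k%:R * (z * chermite k.-1 l z w - chermite k l z w) =
  - (2 * k%:R * l%:R * chermite k.-1 l.-1 z w).
 by case: (k) => [|k']; [rewrite !mul0r mulr0 !mul0r oppr0|rewrite chermiteS /=; ring].
have E2 : l%:R * (chermite k l z w + w * chermite k l.-1 z w) =
  2 * k%:R * l%:R * chermite k.-1 l.-1 z w.
 by case: (l) => [|l']; [rewrite !mul0r mulr0 !mul0r|rewrite IH /=; ring].
rewrite !chermiteS /= IH; apply/eqP; rewrite -subr_eq0 -[l.+1%:R]natr1 -[k.+1%:R]natr1.
set D := (X in X == _); have -> : D = 2 * (k%:R * (z * chermite k.-1 l z w - chermite k l z w))
  + 2 * (l%:R * (chermite k l z w + w * chermite k l.-1 z w)) by rewrite /D; ring.
by rewrite E1 E2; apply/eqP; ring.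
Qed.

(* Number operators, used for the eigenvalue equations of the Wigner functions. *)
Lemma chermite_z k l z w : z * (k%:R * chermite k.-1 l z w) =
 k%:R * chermite k l z w - 2 * k%:R * l%:R * chermite k.-1 l.-1 z w.
Proof. by case: k => [|k]; rewrite ?mul0r ?mulr0 ?mul0r ?subr0// chermiteS /=; ring. Qed.

Lemma chermite_w k l z w : w * (l%:R * chermite k l.-1 z w) =
 2 * k%:R * l%:R * chermite k.-1 l.-1 z w - l%:R * chermite k l z w.
Proof. by case: l => [|l]; rewrite ?mul0r ?mulr0 ?mul0r ?subr0// chermiteSr /=; ring. Qed.

(** The Fourier transform of P(v) exp(-v^2), with phase exp(- i v q). *)
Definition gfour P (q : R) : R[i] := Complex (gcos P q) (- gsin P q).

Lemma gfourD P Q q : gfour (P + Q) q = gfour P q + gfour Q q.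
Proof. by apply: complexP; rewrite !cE /= ?gcosD// gsinD opprD. Qed.

Lemma gfourZ c P q : gfour (c *: P) q = c%:C%C * gfour P q.
Proof. by apply: complexP; rewrite !cE /= ?gcosZ ?gsinZ; ring. Qed.

Lemma gfour_hop P q : gfour (hop P) q = Complex 0 q * gfour P q.
Proof. by apply: complexP; rewrite !cE /= ?gcos_hop ?gsin_hop; ring. Qed.

Lemma gfour1 q : gfour 1 q = (Num.sqrt pi * expR (- (4^-1 * q ^+ 2)))%:C%C.
Proof. by apply: complexP; rewrite /= ?gcos1 ?gsin1 ?oppr0. Qed.

Local Notation H := (@hermite_poly R).
Section recursion.
Variables p q : R.
Let A k := H k \Po ('X + (p / 2)%:P).
Let B l := H l \Po ('X - (p / 2)%:P).
Let G k l := gfour (A k * B l) q.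
Let dH k : (H k)^`() = (2 * k%:R) *: H k.-1.
Proof. by case: k => [|k]; [rewrite derivC mulr0 scale0r|exact: deriv_hermite]. Qed.
Let dA k : (A k)^`() = (2 * k%:R) *: A k.-1.
Proof. by rewrite deriv_comp derivD derivX derivC addr0 mulr1 dH comp_polyZ. Qed.

Let dB l : (B l)^`() = (2 * l%:R) *: B l.-1.
Proof. by rewrite deriv_comp derivB derivX derivC subr0 mulr1 dH comp_polyZ. Qed.
Let AS k : A k.+1 = 2 *: ('X * A k) + p *: A k - (2 * k%:R) *: A k.-1.
Proof.
rewrite /A /= dH comp_polyB !comp_polyZ comp_polyM comp_polyX; congr (_ - _).
rewrite mulrDl scalerDr; congr (_ + _).
by rewrite mul_polyC scalerA mulrC divfK.
Qed.

Let BS l : B l.+1 = 2 *: ('X * B l) - p *: B l - (2 * l%:R) *: B l.-1.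
Proof.
rewrite /B /= dH comp_polyB !comp_polyZ comp_polyM comp_polyX; congr (_ - _).
rewrite mulrBl scalerBr; congr (_ - _).
by rewrite mul_polyC scalerA mulrC divfK.
Qed.

Let GX k l : gfour (2 *: ('X * (A k * B l))) q =
 (2 * k%:R)%:C%C * G k.-1 l + (2 * l%:R)%:C%C * G k l.-1 - Complex 0 q * G k l.
Proof.
rewrite -gfour_hop /G -!gfourZ -gfourD.
apply/eqP; rewrite eq_sym subr_eq -gfourD; apply/eqP; congr (gfour _ q).
rewrite /hop derivM dA dB -scalerAl -scalerAr; move: (2 *: _) => T; ring.
Qed.

(** Integration by parts ([GX]) gives [G] the recursion of [chermite] in k and, for k = 0, the one
    in l; the base case is the transform of the Gaussian. *)
Lemma gfour_chermite k l : G k l =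
 (Num.sqrt pi * expR (- (4^-1 * q ^+ 2)))%:C%C * chermite k l (Complex p (- q)) (Complex p q).
Proof.
have GS k' l' : G k'.+1 l' = Complex p (- q) * G k' l' + (2 * l'%:R)%:C%C * G k' l'.-1.
 rewrite /G AS mulrBl mulrDl -!scalerAl -mulrA.
 have -> : 2 *: ('X * (A k' * B l')) + p *: (A k' * B l') - (2 * k'%:R) *: (A k'.-1 * B l') =
  2 *: ('X * (A k' * B l')) + (p *: (A k' * B l') + (- (2 * k'%:R)) *: (A k'.-1 * B l')).
  by rewrite scaleNr addrA.
 rewrite !gfourD GX !gfourZ -!/(G _ _).
 have -> : Complex p (- q) = p%:C%C - Complex 0 q :> R[i].
  by apply: complexP; rewrite !cE /=; ring.
 have -> : (- (2 * k'%:R))%:C%C = - (2 * k'%:R)%:C%C :> R[i].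
  by apply: complexP; rewrite !cE /=; ring.
 move: (G k' l') (G k'.-1 l') (G k' l'.-1) (Complex 0 q) (p%:C%C) ((2 * k'%:R)%:C%C) ((2 * l'%:R)%:C%C).
 by move=> *; ring.
have GS0 l' : G 0 l'.+1 = - Complex p q * G 0 l'.
 rewrite /G BS mulrBr mulrBr -!scalerAr mulrCA.
 have -> : 2 *: ('X * (A 0 * B l')) - p *: (A 0 * B l') - (2 * l'%:R) *: (A 0 * B l'.-1) =
  2 *: ('X * (A 0 * B l')) + ((- p) *: (A 0 * B l') + (- (2 * l'%:R)) *: (A 0 * B l'.-1)).
  by rewrite !scaleNr addrA.
 rewrite !gfourD GX !gfourZ -!/(G _ _) mulr0.
 have -> : Complex p q = p%:C%C + Complex 0 q :> R[i].
  by apply: complexP; rewrite !cE /=; ring.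
 have -> : (- (2 * l'%:R))%:C%C = - (2 * l'%:R)%:C%C :> R[i].
  by apply: complexP; rewrite !cE /=; ring.
 have -> : (- p)%:C%C = - p%:C%C :> R[i] by apply: complexP; rewrite !cE /=; ring.
 rewrite (_ : (0 : R)%:C%C = 0 :> R[i]) //.
 move: (G 0 l') (G 0.-1 l') (G 0 l'.-1) (Complex 0 q) (p%:C%C) ((2 * l'%:R)%:C%C).
 by move=> *; ring.
have natC (m : nat) : (2 * m%:R : R)%:C%C = 2 * m%:R :> R[i].
 by rewrite rmorphM/= !rmorph_nat.
elim: k l => [l|k IH l]; last first.
 by rewrite GS !IH chermiteS natC; ring.
elim: l => [|l IH]; last by rewrite GS0 IH /= [(- _) ^+ l.+1]exprS mulrCA.
by rewrite /G /A /B /= !comp_polyC mulr1 gfour1 expr0 mulr1.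
Qed.

End recursion.

(** Shifting v by p / 2 centers the two Hermite factors symmetrically and absorbs the phase p q / 2;
    the two Gaussians combine to exp(-v^2) exp(-p^2 / 4). *)
Lemma wigner_chermite k l p q : wigner 1 k l (p, q) =
 (hnorm k * hnorm l * Num.sqrt pi * expR (- (4^-1 * (p ^+ 2 + q ^+ 2))))%:C%C *
 chermite k l (Complex p (- q)) (Complex p q).
Proof.
rewrite /wigner.
have W1 := wigner_L1 1 k l (p, q).
have := integralC_affine (- (p / 2)) (oner_neq0 R) W1.
rewrite normr1 invr1 mul1r => <-.
pose A := H k \Po ('X + (p / 2)%:P); pose B := H l \Po ('X - (p / 2)%:P).
transitivity (integralC leb (fun v : R => (hnorm k * hnorm l * expR (- (4^-1 * p ^+ 2)))%:C%C *
  (pgauss (A * B) 1 v)%:C%C * Complex (cos (v * q)) (- sin (v * q)))).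
 congr integralC; apply/funext => v; rewrite /wigner_phase /= normr1 sqrtr1 gtr0_sg// !mul1r.
 have -> : - (p * q / 2 + q * (v - p / 2)) = - (v * q) by field.
 rewrite /expi cosN sinN; congr (_ * _).
 apply: complexP; rewrite !cE /=; last by ring.
 rewrite !hermite_fun1E /pgauss hornerM !horner_comp !hornerD hornerN !hornerX !hornerC.
 have -> : v - p / 2 + p = v + p / 2 by field.
 rewrite !mul0r !subr0.
 have -> : expR (- (1 * v ^+ 2)) = expR (4^-1 * p ^+ 2) * expR (- (2^-1 * (v - p / 2) ^+ 2)) *
   expR (- (2^-1 * (v + p / 2) ^+ 2)).
  by rewrite -!expRD; congr expR; field.
 have : expR (- (4^-1 * p ^+ 2)) * expR (4^-1 * p ^+ 2) = 1 by rewrite -expRD addNr expR0.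
 move: (expR (- (4^-1 * _))) (expR (4^-1 * _)) => a b ab.
 move: (expR _) (expR _) => e1 e2; move: (_.[_]) (_.[_]) => h1 h2.
 transitivity (hnorm l * (h2 * e2) * (hnorm k * (h1 * e1)) * (a * b)); last by ring.
 by rewrite ab mulr1.
transitivity ((hnorm k * hnorm l * expR (- (4^-1 * p ^+ 2)))%:C%C * gfour (A * B) q).
 have -> : gfour (A * B) q = integralC leb (fun v : R => (pgauss (A * B) 1 v)%:C%C * Complex (cos (v * q)) (- sin (v * q))).
  apply: complexP => /=.
   by apply: eq_Rintegral => v _; rewrite mul0r subr0.
  rewrite -RintN; last exact: intg_pgauss_sin.
  by apply: eq_Rintegral => v _; rewrite mul0r addr0 mulrN.
 rewrite -integralCZ; last first.
  apply/L1P; split => /=.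
   rewrite (_ : (fun _ => _) = fun v => pgauss (A * B) 1 v * cos (v * q)); first exact: intg_pgauss_cos.
   by apply/funext => v; rewrite mul0r subr0.
  rewrite (_ : (fun _ => _) = fun v => -1 * (pgauss (A * B) 1 v * sin (v * q))).
   by apply: intgZ; exact: intg_pgauss_sin.
  by apply/funext => v; ring.
 by congr integralC; apply/funext => v; rewrite mulrA.
rewrite gfour_chermite mulrA; congr (_ * _).
rewrite -rmorphM/=; congr (_%:C%C).
rewrite mulrDr opprD expRD; ring.
Qed.

Lemma wigner_scale lam k l (x y : R) : wigner lam k l (x, y) =
 wigner 1 k l (Num.sqrt `|lam| * x, Num.sg lam * Num.sqrt `|lam| * y).
Proof.
congr integralC; apply/funext => v; rewrite /wigner_phase /= normr1 sqrtr1 (gtr0_sg ltr01).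
congr (_ * hermiteC k (_ + _) * expi (- (_ + _))); [by rewrite mul1r| |by rewrite !mul1r].
by rewrite {1}(numEsg lam) -{1}(@sqr_sqrtr _ `|lam|)//; ring.
Qed.

End complex_hermite.

(** * Smooth cutoffs *)

Section bump.
Context {R : realType}.
Implicit Types (P : {poly R}) (x : R).

Lemma poly_exp_bound P : exists2 C, 0 <= C & forall u, 0 <= u -> `|P.[u] * expR (- u)| <= C.
Proof.
have [|C C0 h] := @poly_expR_bound R (P \Po 'X^2) 1; first by [].
exists C => // u u0; have := h (Num.sqrt u).
rewrite horner_comp hornerXn sqr_sqrtr// mul1r => hu.
rewrite normrM (ger0_norm (expR_ge0 _)).
apply: (le_trans (ler_wpM2r (expR_ge0 _) hu)).
by rewrite -mulrA -expRD subrr expR0 mulr1.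
Qed.

(** Functions P(1/x) exp(-1/x), extended by 0, are stable under differentiation, which acts on P as
    [flat_next]; all derivatives at 0 are then treated by one lemma. *)
Definition flat P x : R := if 0 < x then P.[x^-1] * expR (- x^-1) else 0.
Definition flat_next P : {poly R} := 'X^2 * (P - P^`()).

Lemma is_derive_flat P x : is_derive x 1 (flat P) (flat (flat_next P) x).
Proof.
have [x0|x0|->] := ltgtP x 0.
- rewrite /flat ltNge (ltW x0)/=.
 apply: (@near_eq_is_derive _ _ _ (fun=> 0)).
 have : \forall y \near x, y < 0 by exact: lt_nbhsl.
 by apply: filterS => y y0; rewrite /flat ltNge (ltW y0).
- rewrite [X in is_derive _ _ _ X](_ : _ = ((P^`()).[x^-1] * (- x ^- 2)) * expR (- x^-1) + P.[x^-1] * (expR (- x^-1) * - (- x ^- 2))); last first.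
  by rewrite /flat x0 /flat_next hornerM hornerXn hornerD hornerN exprVn; ring.
 apply: (@near_eq_is_derive R R R (fun y : R => P.[y^-1] * expR (- y^-1))).
  have : \forall y \near x, 0 < y by exact: lt_nbhsr.
  by apply: filterS => y y0; rewrite /flat y0.
 have dV : is_derive x 1 (fun y : R => y^-1) (- x ^- 2).
  have xn0 : x != 0 by rewrite gt_eqF.
  have [dv ev] := is_deriveV xn0 (drv_id x).
  by split; [exact: dv|rewrite ev /GRing.scale /= mulr1].
 have dP : is_derive (x^-1) 1 (fun y : R => P.[y]) (P^`()).[x^-1] by exact: is_derive_poly.
 exact: (drvM (drv_comp dP dV) (drv_comp (is_derive_expR _) (drvN dV))).
- have [C C0 hC] := poly_exp_bound ('X^2 * P).
 have bnd h : `|flat P h| <= C * h ^+ 2.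
  rewrite /flat; case: ifPn => [h0|_]; last by rewrite normr0 mulr_ge0 ?sqr_ge0.
  have := hC h^-1 (ltW _); rewrite invr_gt0 h0 => /(_ isT).
  rewrite hornerM hornerXn -mulrA normrM normrX normfV (gtr0_norm h0).
  by rewrite exprVn ler_pdivrMl ?exprn_gt0// [C * _]mulrC.
 have f0 : flat P 0 = 0 by rewrite /flat ltxx.
 have cv : h^-1 *: (flat P (h *: 1 + 0) - flat P 0) @[h --> 0^'] --> (0 : R).
  apply/cvgr0Pnorm_lt => e e0.
  near=> h; rewrite f0 subr0 addr0 /GRing.scale /= mulr1 normrM normfV.
  have h0 : h != 0 by near: h; exact: nbhs_dnbhs_neq.
  rewrite ltr_pdivrMl ?normr_gt0//.
  apply: le_lt_trans (bnd h) _.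
  rewrite -(real_normK (num_real h)) expr2 mulrA mulrC ltr_pM2l ?normr_gt0//.
  rewrite (@le_lt_trans _ _ ((C + 1) * `|h|))//.
   by rewrite ler_wpM2r// lerDl.
  rewrite -ltr_pdivlMl ?ltr_wpDl//.
  near: h; apply: dnbhs0_lt; by rewrite mulr_gt0// invr_gt0 ltr_wpDl.
 have -> : flat (flat_next P) 0 = 0 by rewrite /flat ltxx.
 split; first by apply/cvg_ex; exists 0.
 exact: (cvg_lim _ cv).
Unshelve. all: by end_near.
Qed.

Lemma flat_bound P : exists2 C, 0 <= C & forall x, `|flat P x| <= C.
Proof.
have [C C0 h] := poly_exp_bound P; exists C => // x; rewrite /flat.
by case: ifPn => [x0|_]; [rewrite h// ltW// invr_gt0|rewrite normr0].
Qed.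

(** A function is given together with its derivatives, [phi k] being the k-th, so that the chain
    rule can be iterated without choices. *)
Definition smooth1 (phi : nat -> R -> R) :=
 forall k (x : R), is_derive x 1 (phi k) (phi k.+1 x).

(* Supported in s < 1 and equal to 1 at 0. *)
Definition cutoff k (s : R) : R :=
 (-1) ^+ k * expR 1 * flat (iter k flat_next 1) (1 - s).

Lemma smooth1_cutoff : smooth1 cutoff.
Proof.
move=> k x; rewrite /cutoff.
apply: (@drv_eq _ _ _ ((-1) ^+ k * expR 1 * (flat (iter k.+1 flat_next 1) (1 - x) * (0 - 1)))).
 have d1 : is_derive x 1 (fun x : R => 1 - x) (0 - 1).
  exact: (drvD (drv_cst 1 x) (drvN (drv_id x))).
 exact: (drvZ _ (drv_comp (is_derive_flat _ _) d1)).
by rewrite exprS; ring.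
Qed.

Lemma cutoff0 : cutoff 0 0 = 1.
Proof. by rewrite /cutoff /flat subr0 ltr01 invr1 hornerC !mul1r -expRD subrr expR0. Qed.

Lemma cutoff_ge1 k s : 1 <= s -> cutoff k s = 0.
Proof. by move=> s1; rewrite /cutoff /flat subr_gt0 ltNge s1 mulr0. Qed.

Lemma cutoff_bound k : exists2 C, 0 <= C & forall s, `|cutoff k s| <= C.
Proof.
have [C C0 h] := flat_bound (iter k flat_next 1); exists (expR 1 * C).
 by rewrite mulr_ge0 ?expR_ge0.
move=> s; rewrite /cutoff !normrM normrX normrN1 expr1n mul1r.
by rewrite (ger0_norm (expR_ge0 _)) ler_wpM2l ?expR_ge0.
Qed.

Lemma smooth1_exp : smooth1 (fun _ => expR).
Proof. by move=> k x; exact: is_derive_expR. Qed.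

Lemma smooth1_continuous phi k : smooth1 phi -> continuous (phi k).
Proof. move=> s1; exact: (drv_continuous (s1 k)). Qed.

End bump.

(** * Directional derivatives and classes of smooth functions *)

Section directional.
Context {R : realType} (V : normedModType R).
Implicit Types (f g : V -> R) (v : V).

Definition isD f v f' := forall x, is_derive x v f (f' x).

Lemma isD_val f v f' : isD f v f' -> 'D_v f = f'.
Proof. by move=> h; apply/funext => x; have [] := h x. Qed.

Lemma isD_derivable f v f' x : isD f v f' -> derivable f x v.
Proof. by move=> h; have [] := h x. Qed.

Lemma isD_cst c v : isD (fun=> c) v (fun=> 0).
Proof. by move=> x; exact: is_derive_cst. Qed.

Lemma isDD f g v f' g' : isD f v f' -> isD g v g' ->
 isD (fun x => f x + g x) v (fun x => f' x + g' x).
Proof. by move=> hf hg x; have a := hf x; have b := hg x; exact: is_deriveD. Qed.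

Lemma isDM f g v f' g' : isD f v f' -> isD g v g' ->
 isD (fun x => f x * g x) v (fun x => f' x * g x + f x * g' x).
Proof.
move=> hf hg x; have a := hf x; have b := hg x.
apply: (@is_derive_eq _ _ _ _ _ _ _ _ (is_deriveM a b)).
by rewrite /GRing.scale/=; ring.
Qed.

(** Reduces a directional derivative to a derivative in one real variable, where the chain rule is
    at hand. *)
Lemma is_derive_line f x v d :
 is_derive (0 : R) (1 : R) (fun t => f (t *: v + x)) d <-> is_derive x v f d.
Proof.
have E : (fun h : R => h^-1 *: ((fun t : R => f (t *: v + x)) (h *: (1 : R) + 0) - (fun t : R => f (t *: v + x)) 0)) =
 (fun h : R => h^-1 *: (f (h *: v + x) - f x)).
 by apply/funext => h; rewrite addr0 scale0r add0r /GRing.scale /= mulr1.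
split=> -[h1 h2].
 by split; [move: h1; rewrite /derivable E|move: h2; rewrite /derive E].
by split; [rewrite /derivable E|rewrite /derive E].
Qed.

Lemma isD_comp phi f v f' : smooth1 phi -> isD f v f' ->
 isD (fun x => phi 0%N (f x)) v (fun x => phi 1%N (f x) * f' x).
Proof.
move=> sphi hf x; apply/is_derive_line.
have h := (is_derive_line f x v (f' x)).2 (hf x).
have := sphi 0%N ((fun t => f (t *: v + x)) 0).
move=> p; have := drv_comp p h; rewrite scale0r add0r; exact.
Qed.

End directional.

Section smooth_class.
Context {R : realType} (n : nat).
Implicit Types (f g : heis R n -> R) (v : heis R n).

(** Smoothness as membership in an inductive class: stability under directional derivatives is an
    induction on the construction, and iterating it gives [smooth]. *)
Inductive sm : (heis R n -> R) -> Prop :=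
| sm_cst c : sm (fun=> c)
| sm_x i : sm (fun eta => eta.1.1 ord0 i)
| sm_y i : sm (fun eta => eta.1.2 ord0 i)
| sm_t : sm (fun eta => eta.2)
| smD f g : sm f -> sm g -> sm (fun eta => f eta + g eta)
| smM f g : sm f -> sm g -> sm (fun eta => f eta * g eta)
| sm_comp phi f : smooth1 phi -> sm f -> sm (fun eta => phi 0%N (f eta)).

Lemma is_derive_linear_line f v (d : R) : (forall (t : R) eta, f (t *: v + eta) = t * d + f eta) ->
 isD f v (fun=> d).
Proof.
move=> h eta; apply/is_derive_line.
rewrite (_ : (fun t => _) = fun t => t * d + f eta); last by apply/funext => t; exact: h.
apply: (@drv_eq _ _ _ ((1 * d + 0 * 0) + 0)); last by ring.
have d1 : is_derive (0 : R) 1 (fun t : R => t * d) (1 * d + 0 * 0).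
 exact: (drvM (drv_id 0) (drv_cst d 0)).
exact: (drvD d1 (drv_cst (f eta) 0)).
Qed.

Lemma sm_isD f v : sm f -> exists2 f', sm f' & isD f v f'.
Proof.
elim=> [c|i|i||{}f g _ [f' sf df] _ [g' sg dg]|{}f g smf [f' sf df] smg [g' sg dg]|phi {}f sphi smf [f' sf df]].
- by exists (fun=> 0); [exact: sm_cst|exact: isD_cst].
- exists (fun=> v.1.1 ord0 i); first exact: sm_cst.
 by apply: is_derive_linear_line => t eta; rewrite !mxE.
- exists (fun=> v.1.2 ord0 i); first exact: sm_cst.
 by apply: is_derive_linear_line => t eta; rewrite !mxE.
- exists (fun=> v.2); first exact: sm_cst.
 by apply: is_derive_linear_line => t eta.
- exists (fun x => f' x + g' x); [exact: smD|exact: isDD].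
- exists (fun x => f' x * g x + f x * g' x); last exact: isDM.
 by apply: smD; apply: smM.
- exists (fun x => phi 1%N (f x) * f' x); last exact: isD_comp.
 apply: smM => //; apply: (@sm_comp (fun k => phi k.+1)) => // k x; exact: sphi.
Qed.

Lemma sm_D f v : sm f -> sm ('D_v f).
Proof. by move=> /(sm_isD v) [f' sf /isD_val ->]. Qed.

Lemma sm_isDD f v : sm f -> isD f v ('D_v f).
Proof. by move=> /(sm_isD v) [f' sf h]; rewrite (isD_val h). Qed.

Lemma sm_continuous f : sm f -> continuous f.
Proof.
elim=> [c|i|i||{}f g _ cf _ cg|{}f g _ cf _ cg|phi {}f sphi _ cf] eta.
- exact: cvg_cst.
- apply: (@continuous_comp _ _ _ (fun eta : heis R n => eta.1.1) (fun w : 'rV[R]_n => w ord0 i)).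
  by apply: continuous_comp; exact: cvg_fst.
 exact: coord_continuous.
- apply: (@continuous_comp _ _ _ (fun eta : heis R n => eta.1.2) (fun w : 'rV[R]_n => w ord0 i)).
  by apply: continuous_comp; [exact: cvg_fst|exact: cvg_snd].
 exact: coord_continuous.
- exact: cvg_snd.
- by apply: cvgD; [exact: cf|exact: cg].
- by apply: cvgM; [exact: cf|exact: cg].
- by apply: continuous_comp; [exact: cf|exact: smooth1_continuous].
Qed.

Lemma sm_measurable f : sm f ->
 measurable_fun [set: 'rV[R]_n * 'rV[R]_n * measurableTypeR R] f.
Proof.
have m11 : measurable_fun [set: 'rV[R]_n * 'rV[R]_n * measurableTypeR R] (fun eta => eta.1.1).
 exact: (mcomp measurable_fst measurable_fst).
have m12 : measurable_fun [set: 'rV[R]_n * 'rV[R]_n * measurableTypeR R] (fun eta => eta.1.2).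
 exact: (mcomp measurable_snd measurable_fst).
elim=> [c|i|i||{}f g _ cf _ cg|{}f g _ cf _ cg|phi {}f sphi _ cf].
- exact: measurable_cst.
- exact: (mcomp (measurable_coord i) m11).
- exact: (mcomp (measurable_coord i) m12).
- exact: measurable_snd.
- exact: measurable_funD.
- exact: measurable_funM.
- apply: mcomp cf; apply: continuous_measurable_fun.
 exact: smooth1_continuous.
Qed.

Lemma sm_smooth f : sm f -> smooth f.
Proof.
move=> sf vs v; suff sg : sm (foldr (fun w h => 'D_w h) f vs).
 split; first exact: sm_continuous.
 by move=> eta; apply: isD_derivable (sm_isDD v sg).
by elim: vs => [//|w vs IH] /=; exact: sm_D.
Qed.

(* [fieldZ true j] and [fieldZ false j] are the fields X_j and Y_j. *)
Definition dirZ (b : bool) (j : 'I_n) : heis R n :=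
 if b then ((delta_mx ord0 j, 0), 0) else ((0, delta_mx ord0 j), 0).
Definition coefZ (b : bool) (j : 'I_n) (eta : heis R n) : R :=
 if b then - (eta.1.2 ord0 j / 2) else eta.1.1 ord0 j / 2.
Definition dirT : heis R n := ((0, 0), 1).
Definition fieldZ b j f : heis R n -> R :=
 fun eta => 'D_(dirZ b j) f eta + coefZ b j eta * 'D_dirT f eta.

Lemma fieldZ_true j f : fieldX j f = fieldZ true j f.
Proof. by apply/funext => eta; rewrite /fieldX /fieldZ /coefZ mulNr. Qed.

Lemma sublaplacianRE f eta : sublaplacianR f eta =
 \sum_(j < n) (fieldZ true j (fieldZ true j f) eta + fieldZ false j (fieldZ false j f) eta).
Proof. by apply: eq_bigr => j _; rewrite !fieldZ_true. Qed.

Lemma sm_coefZ b j : sm (coefZ b j).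
Proof.
case: b; rewrite /coefZ.
 rewrite (_ : (fun _ => _) = fun eta : heis R n => eta.1.2 ord0 j * - 2^-1).
  by apply: smM; [exact: sm_y|exact: sm_cst].
 by apply/funext => eta; rewrite mulrN.
by apply: smM; [exact: sm_x|exact: sm_cst].
Qed.

Lemma sm_fieldZ b j f : sm f -> sm (fieldZ b j f).
Proof.
move=> sf; apply: smD; first exact: sm_D.
by apply: smM; [exact: sm_coefZ|exact: sm_D].
Qed.

Lemma fieldZ_val b j f f1 f2 : isD f (dirZ b j) f1 -> isD f dirT f2 ->
 fieldZ b j f = fun eta => f1 eta + coefZ b j eta * f2 eta.
Proof.
move=> h1 h2; apply/funext => eta; have [_ e1] := h1 eta; have [_ e2] := h2 eta.
by rewrite /fieldZ; congr (_ + _ * _).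
Qed.

Lemma fieldZD b j f g : sm f -> sm g ->
 fieldZ b j (fun eta => f eta + g eta) = fun eta => fieldZ b j f eta + fieldZ b j g eta.
Proof.
move=> sf sg.
rewrite (fieldZ_val (isDD (sm_isDD _ sf) (sm_isDD _ sg)) (isDD (sm_isDD _ sf) (sm_isDD _ sg))).
apply/funext => eta; rewrite /fieldZ.
move: ('D__ f eta) ('D__ g eta) ('D_dirT f eta) ('D_dirT g eta) (coefZ _ _ _) => *; ring.
Qed.

Lemma fieldZM b j f g : sm f -> sm g ->
 fieldZ b j (fun eta => f eta * g eta) =
 fun eta => fieldZ b j f eta * g eta + f eta * fieldZ b j g eta.
Proof.
move=> sf sg.
rewrite (fieldZ_val (isDM (sm_isDD _ sf) (sm_isDD _ sg)) (isDM (sm_isDD _ sf) (sm_isDD _ sg))).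
apply/funext => eta; rewrite /fieldZ.
move: ('D__ f eta) ('D__ g eta) ('D_dirT f eta) ('D_dirT g eta) (coefZ _ _ _) => *; ring.
Qed.

Lemma fieldZ_comp b j phi f : smooth1 phi -> sm f ->
 fieldZ b j (fun eta => phi 0%N (f eta)) = fun eta => phi 1%N (f eta) * fieldZ b j f eta.
Proof.
move=> sphi sf.
rewrite (fieldZ_val (isD_comp sphi (sm_isDD _ sf)) (isD_comp sphi (sm_isDD _ sf))).
by apply/funext => eta; rewrite /fieldZ; ring.
Qed.

Lemma fieldZ_cst b j c : fieldZ b j (fun=> c) = fun=> 0.
Proof.
rewrite (fieldZ_val (isD_cst c _) (isD_cst c _)).
by apply/funext => eta; ring.
Qed.

End smooth_class.

(** * The weak equation tested on polynomials times Gaussians *)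

Section weak_limit.
Context d (T : measurableType d) (R : realType) (mu : {measure set T -> \bar R}).
Implicit Types (phi s : T -> R).

Definition sqintg phi := meas phi /\ intg mu (fun x => phi x ^+ 2).

Lemma sqintg_mul phi s : sqintg phi -> sqintg s -> intg mu (fun x => phi x * s x).
Proof.
move=> [mf f2] [mg g2].
apply: (@intg_le _ _ _ mu _ (fun x => 2^-1 * (phi x ^+ 2 + s x ^+ 2))).
- exact: measurable_funM.
- move=> x; rewrite ler_norml; move: (phi x) (s x) => a b.
 have := sqr_ge0 (a + b); have := sqr_ge0 (a - b); nra.
- by apply: intgZ; exact: intgD.
Qed.

Lemma sqintg_le phi s : meas phi -> (forall x, `|phi x| <= s x) ->
 sqintg s -> sqintg phi.
Proof.
move=> mf fs [ms s2]; split => //; apply: intg_le s2; first exact: measurable_funX.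
move=> x; rewrite normrX ler_sqr ?nnegrE ?normr_ge0//; exact: le_trans (fs x).
Qed.

Lemma L2_sqintg (f : T -> R[i]) : L2 mu f -> sqintg (ReC \o f) /\ sqintg (ImC \o f).
Proof.
move=> /L2P[[m1 m2] i2]; split; split => //; apply: intg_le i2;
 try exact: measurable_funX; move=> x; rewrite ger0_norm ?sqr_ge0// /sqnormC.
 by rewrite lerDl sqr_ge0.
by rewrite lerDr sqr_ge0.
Qed.

Lemma sqintg_L2 phi : sqintg phi -> L2 mu (fun x => (phi x)%:C%C).
Proof.
move=> [m i]; apply/L2P; split; first exact: mc_real.
by under eq_fun do rewrite /sqnormC /= expr0n addr0.
Qed.

Lemma Rint_dominated phi (s_ : nat -> T -> R) s Gam : sqintg phi ->
 (forall m, meas (s_ m)) -> meas s ->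
 (forall x, s_ m x @[m --> \oo] --> s x) -> (forall m x, `|s_ m x| <= Gam x) ->
 sqintg Gam -> \int[mu]_x (phi x * s_ m x) @[m --> \oo] --> \int[mu]_x (phi x * s x).
Proof.
move=> p2 ms mS cs bs G2.
have D := @Rint_dct _ _ _ mu (fun m x => phi x * s_ m x) (fun x => phi x * s x) (fun x => `|phi x * Gam x|).
refine (D (fun m => measurable_funM p2.1 (ms m)) (measurable_funM p2.1 mS) _ (intg_abs (sqintg_mul p2 G2)) _).2.
- by apply: aeW => x; apply: cvgM; [exact: cvg_cst|exact: cs].
- move=> m x; rewrite !normrM ler_wpM2l//; apply: le_trans (bs m x) _; exact: ler_norm.
Qed.

End weak_limit.

Section polynomials.
Context {R : realType} (n : nat).
Implicit Types (f g P Q : heis R n -> R) (v eta : heis R n).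

(** Smaller than [sm], without composition: its members grow more slowly than every exp(e |eta|^2)
    with e > 0 ([pol_bound]), so their products with Gaussians are square integrable. *)
Inductive pol : (heis R n -> R) -> Prop :=
| pol_cst c : pol (fun=> c)
| pol_x i : pol (fun eta => eta.1.1 ord0 i)
| pol_y i : pol (fun eta => eta.1.2 ord0 i)
| pol_t : pol (fun eta => eta.2)
| polD f g : pol f -> pol g -> pol (fun eta => f eta + g eta)
| polM f g : pol f -> pol g -> pol (fun eta => f eta * g eta).

Lemma pol_sm f : pol f -> sm f.
Proof.
elim=> [c|i|i||{}f g _ sf _ sg|{}f g _ sf _ sg].
- exact: sm_cst.
- exact: sm_x.
- exact: sm_y.
- exact: sm_t.
- exact: smD.
- exact: smM.
Qed.

Lemma pol_isD f v : pol f -> exists2 f', pol f' & isD f v f'.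
Proof.
elim=> [c|i|i||{}f g _ [f' sf df] _ [g' sg dg]|{}f g pf [f' sf df] pg [g' sg dg]].
- by exists (fun=> 0); [exact: pol_cst|exact: isD_cst].
- exists (fun=> v.1.1 ord0 i); first exact: pol_cst.
 by apply: is_derive_linear_line => t eta; rewrite !mxE.
- exists (fun=> v.1.2 ord0 i); first exact: pol_cst.
 by apply: is_derive_linear_line => t eta; rewrite !mxE.
- exists (fun=> v.2); first exact: pol_cst.
 by apply: is_derive_linear_line => t eta.
- exists (fun x => f' x + g' x); [exact: polD|exact: isDD].
- exists (fun x => f' x * g x + f x * g' x); last exact: isDM.
 by apply: polD; apply: polM.
Qed.

Lemma pol_D f v : pol f -> pol ('D_v f).
Proof. by move=> /(pol_isD v) [f' sf /isD_val ->]. Qed.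

Lemma polN f : pol f -> pol (fun eta => - f eta).
Proof.
move=> pf; rewrite (_ : (fun _ => _) = fun eta => -1 * f eta).
 by apply: polM => //; exact: pol_cst.
by apply/funext => eta; rewrite mulN1r.
Qed.

Lemma polB f g : pol f -> pol g -> pol (fun eta => f eta - g eta).
Proof. by move=> pf pg; apply: polD => //; exact: polN. Qed.

Lemma pol_sum (I : Type) (s : seq I) (F : I -> heis R n -> R) :
 (forall i, pol (F i)) -> pol (fun eta => \sum_(i <- s) F i eta).
Proof.
move=> pF; elim: s => [|i s IH].
 by under eq_fun do rewrite big_nil; exact: pol_cst.
by under eq_fun do rewrite big_cons; exact: polD.
Qed.

Lemma pol_sqr f : pol f -> pol (fun eta => f eta ^+ 2).
Proof. by move=> pf; under eq_fun do rewrite expr2; exact: polM. Qed.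

Lemma pol_coefZ b (j : 'I_n) : pol (coefZ b j).
Proof.
case: b; rewrite /coefZ.
 by apply: polN; apply: polM; [exact: pol_y|exact: pol_cst].
by apply: polM; [exact: pol_x|exact: pol_cst].
Qed.

Lemma pol_fieldZ b j f : pol f -> pol (fieldZ b j f).
Proof.
move=> sf; apply: polD; first exact: pol_D.
by apply: polM; [exact: pol_coefZ|exact: pol_D].
Qed.

Definition sqz eta : R := \sum_(i < n) (eta.1.1 ord0 i ^+ 2 + eta.1.2 ord0 i ^+ 2).
(** The Euclidean square norm rather than a homogeneous one: it is a polynomial, to which [cutoff]
    can be applied, and its sublevel sets are bounded in all variables. *)
Definition sqN eta : R := sqz eta + eta.2 ^+ 2.

Lemma pol_sqz : pol sqz.
Proof.
apply: pol_sum => i; apply: polD; apply: pol_sqr; [exact: pol_x|exact: pol_y].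
Qed.

Lemma pol_sqN : pol sqN.
Proof. by apply: polD; [exact: pol_sqz|apply: pol_sqr; exact: pol_t]. Qed.

Lemma sqz_ge0 eta : 0 <= sqz eta.
Proof. by apply: sumr_ge0 => i _; rewrite addr_ge0// sqr_ge0. Qed.

Lemma le_sqN_x eta i : eta.1.1 ord0 i ^+ 2 <= sqN eta.
Proof.
rewrite /sqN /sqz (bigD1 i)//= -!addrA lerDl !addr_ge0 ?sqr_ge0//.
by apply: sumr_ge0 => k _; rewrite addr_ge0// sqr_ge0.
Qed.

Lemma le_sqN_y eta i : eta.1.2 ord0 i ^+ 2 <= sqN eta.
Proof.
rewrite /sqN /sqz (bigD1 i)//= -!addrA addrCA lerDl !addr_ge0 ?sqr_ge0//.
by apply: sumr_ge0 => k _; rewrite addr_ge0// sqr_ge0.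
Qed.

Lemma le_sqN_t eta : eta.2 ^+ 2 <= sqN eta.
Proof. by rewrite /sqN lerDr sqz_ge0. Qed.

Lemma sqN_ge0 eta : 0 <= sqN eta.
Proof. exact: le_trans (sqr_ge0 _) (le_sqN_t eta). Qed.

Lemma pol_bound f e : pol f -> 0 < e ->
 exists2 C, 0 <= C & forall eta, `|f eta| <= C * expR (e * sqN eta).
Proof.
have coordb (u : heis R n -> R) e' : 0 < e' -> (forall eta, u eta ^+ 2 <= sqN eta) ->
  exists2 C, 0 <= C & forall eta, `|u eta| <= C * expR (e' * sqN eta).
 move=> e0 hu; have [C C0 h] := expR_sqr_bound e0; exists C => // eta.
 by apply: (le_trans (h _)); rewrite ler_wpM2l// ler_expR ler_wpM2l// ltW.
move=> pf; elim: pf e => [c|i|i||{}f g _ Hf _ Hg|{}f g _ Hf _ Hg] e e0.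
- exists `|c| => // eta; by rewrite ler_peMr// -expR0 ler_expR mulr_ge0 ?sqN_ge0 ?ltW.
- by apply: coordb => // eta; exact: le_sqN_x.
- by apply: coordb => // eta; exact: le_sqN_y.
- by apply: coordb => // eta; exact: le_sqN_t.
- have [C1 C10 h1] := Hf _ e0; have [C2 C20 h2] := Hg _ e0.
 exists (C1 + C2) => [|eta]; first exact: addr_ge0.
 by rewrite (le_trans (ler_normD _ _))// mulrDl lerD.
- have e2 : 0 < e / 2 by rewrite divr_gt0.
 have [C1 C10 h1] := Hf _ e2; have [C2 C20 h2] := Hg _ e2.
 exists (C1 * C2) => [|eta]; first exact: mulr_ge0.
 rewrite normrM (_ : e * sqN eta = e / 2 * sqN eta + e / 2 * sqN eta); last by field.
 by rewrite expRD mulrACA ler_pM.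
Qed.

Lemma sqN_gaussian_sqintg c : 0 < c -> sqintg hm (fun eta => expR (- (c * sqN eta))).
Proof.
move=> c0; have c2 : 0 < 2 * c by rewrite mulr_gt0.
split.
 apply: mcomp => //; apply: mcomp => //; apply: measurable_funM => //.
 exact: (sm_measurable (pol_sm pol_sqN)).
pose phi (x : R) : R[i] := (expR (- ((2 * c) * x ^+ 2)))%:C%C.
have phi1 : L1 leb phi by apply/L1P; split; [exact: intg_gauss|exact: intg0].
have [row1 _] := @integralC_prod R n (fun=> phi) (fun=> phi1).
have /L1P[h1 _] := L1_tensor (L1_tensor row1 row1) phi1.
move: h1; congr intg; apply/funext => eta; rewrite /phi -!rmorph_prod -!rmorphM/=.
rewrite -!(big_morph expR (@expRD R) (@expR0 R))/= -!expRD -expRM_natl; congr expR.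
rewrite /sqN /sqz big_split/= !sumrN -!mulr_sumr; ring.
Qed.

Section gaussian.
Variables (q : heis R n -> R) (c : R).
Hypotheses (pq : pol q) (c0 : 0 < c) (cq : forall eta, c * sqN eta <= q eta).

Definition pg P eta := P eta * expR (- q eta).

Lemma sm_pg P : pol P -> sm (pg P).
Proof.
move=> pP; apply: smM; first exact: pol_sm.
by apply: (@sm_comp _ _ (fun=> expR)); [exact: smooth1_exp|apply: pol_sm; exact: polN].
Qed.

Lemma pg_bound P : pol P -> exists2 C, 0 <= C & forall eta, `|pg P eta| <= C * expR (- (c / 2 * sqN eta)).
Proof.
move=> pP; have c2 : 0 < c / 2 by rewrite divr_gt0.
have [C C0 h] := pol_bound pP c2; exists C => // eta.
rewrite /pg normrM (ger0_norm (expR_ge0 _)).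
apply: (le_trans (ler_pM _ _ (h eta) (_ : _ <= expR (- (c * sqN eta))))) => //.
 by rewrite ler_expR lerN2.
by rewrite -[leLHS]mulrA -expRD ler_wpM2l// ler_expR; lra.
Qed.

Lemma pg_sqintg P : pol P -> sqintg hm (pg P).
Proof.
move=> pP; have [C C0 h] := pg_bound pP.
suff S : sqintg hm (fun eta => C * expR (- (c / 2 * sqN eta))).
 exact: (sqintg_le (sm_measurable (sm_pg pP)) h S).
have [m i] := @sqN_gaussian_sqintg (c / 2) (divr_gt0 c0 (ltr0n _ 2)).
split; first exact: measurable_funM.
by under eq_fun do rewrite exprMn; exact: intgZ.
Qed.

(** The action of a field on the polynomial factor of P exp(-q), read off the product rule. *)
Definition zpol b j P eta := fieldZ b j P eta - P eta * fieldZ b j q eta.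

Lemma pol_zpol b j P : pol P -> pol (zpol b j P).
Proof.
by move=> pP; apply: polB; [exact: pol_fieldZ|apply: polM => //; exact: pol_fieldZ].
Qed.

Lemma fieldZ_pg b j P : pol P -> fieldZ b j (pg P) = pg (zpol b j P).
Proof.
move=> pP; have se : sm (fun eta => expR (- q eta)).
 by apply: (@sm_comp _ _ (fun=> expR)); [exact: smooth1_exp|apply: pol_sm; exact: polN].
rewrite (fieldZM b j (pol_sm pP) se).
have -> : fieldZ b j (fun eta => expR (- q eta)) = fun eta => expR (- q eta) * - fieldZ b j q eta.
 rewrite (fieldZ_comp b j smooth1_exp (pol_sm (polN pq))).
 apply/funext => eta; congr (_ * _).
 have -> : (fun eta => - q eta) = fun eta => -1 * q eta by apply/funext => z; rewrite mulN1r.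
 rewrite (fieldZM b j (sm_cst _ (-1)) (pol_sm pq)) fieldZ_cst; ring.
by apply/funext => eta; rewrite /pg /zpol; ring.
Qed.

(** Cuts off at Euclidean radius sqrt (m + 1). Every derivative of the cutoff brings out a factor 1
    / (m + 1) and a polynomial, which the Gaussian absorbs. *)
Let chi (m : nat) eta := cutoff 0 ((m.+1%:R)^-1 * sqN eta).
Let sm_scaled m : sm (fun eta => (m.+1%:R)^-1 * sqN eta).
Proof. by apply: smM; [exact: sm_cst|exact: (pol_sm pol_sqN)]. Qed.
Let sm_chi m : sm (chi m).
Proof. exact: sm_comp smooth1_cutoff (sm_scaled m). Qed.

Let fieldZ_scaled b j m : fieldZ b j (fun eta => (m.+1%:R)^-1 * sqN eta) =
 fun eta => (m.+1%:R)^-1 * fieldZ b j sqN eta.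
Proof.
rewrite (fieldZM b j (sm_cst _ _) (pol_sm pol_sqN)) fieldZ_cst.
by apply/funext => eta; rewrite mul0r add0r.
Qed.

Let fieldZ_chi b j m : fieldZ b j (chi m) = fun eta =>
 cutoff 1 ((m.+1%:R)^-1 * sqN eta) * ((m.+1%:R)^-1 * fieldZ b j sqN eta).
Proof.
by rewrite (fieldZ_comp b j smooth1_cutoff (sm_scaled m)) fieldZ_scaled.
Qed.

Let fieldZ2_chi b j m : fieldZ b j (fieldZ b j (chi m)) = fun eta =>
 cutoff 2 ((m.+1%:R)^-1 * sqN eta) * ((m.+1%:R)^-1 * fieldZ b j sqN eta) ^+ 2 +
 cutoff 1 ((m.+1%:R)^-1 * sqN eta) * ((m.+1%:R)^-1 * fieldZ b j (fieldZ b j sqN) eta).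
Proof.
have sZ : sm (fieldZ b j sqN) by exact: sm_fieldZ (pol_sm pol_sqN).
have s1 : smooth1 (fun k => @cutoff R k.+1) by move=> k x; exact: smooth1_cutoff.
have sc1 : sm (fun eta => cutoff 1 ((m.+1%:R)^-1 * sqN eta)) by exact: (sm_comp s1 (sm_scaled m)).
rewrite fieldZ_chi (fieldZM b j sc1 (smM (sm_cst _ _) sZ)).
rewrite (fieldZ_comp b j s1 (sm_scaled m)) fieldZ_scaled.
rewrite (fieldZM b j (sm_cst _ _) sZ) fieldZ_cst.
apply/funext => eta; ring.
Qed.

Let fieldZ2M b j f g : sm f -> sm g ->
 fieldZ b j (fieldZ b j (fun eta => f eta * g eta)) = fun eta =>
  g eta * fieldZ b j (fieldZ b j f) eta + (2 * fieldZ b j f eta * fieldZ b j g eta +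
  f eta * fieldZ b j (fieldZ b j g) eta).
Proof.
move=> sf sg; rewrite fieldZM// fieldZD; last 2 first.
- by apply: smM => //; exact: sm_fieldZ.
- by apply: smM => //; exact: sm_fieldZ.
rewrite fieldZM//; last exact: sm_fieldZ.
rewrite fieldZM//; last exact: sm_fieldZ.
apply/funext => eta; move: (fieldZ b j f eta) (fieldZ b j g eta) (f eta) (g eta)
 (fieldZ b j (fieldZ b j f) eta) (fieldZ b j (fieldZ b j g) eta) => *; ring.
Qed.

Let chi_bound k : exists2 M, 0 <= M & forall m eta, `|cutoff k ((m.+1%:R)^-1 * sqN eta)| <= M.
Proof. by have [M M0 h] := @cutoff_bound R k; exists M. Qed.
Let inv_le1 m : (m.+1%:R : R)^-1 <= 1.
Proof. by rewrite invf_le1// ler1n. Qed.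

Let inv_ge0 m : 0 <= (m.+1%:R : R)^-1.
Proof. by rewrite invr_ge0. Qed.
Let inv_cvg0 (a : R) : (m.+1%:R)^-1 * a @[m --> \oo] --> 0.
Proof. by rewrite -[X in _ --> X](mul0r a); apply: cvgM; [exact: cvg_harmonic|exact: cvg_cst]. Qed.

Let chi_cvg eta : chi m eta @[m --> \oo] --> (1 : R).
Proof.
have cc := @smooth1_continuous R _ 0 smooth1_cutoff 0.
have := @cvg_comp _ _ _ (fun m : nat => (m.+1%:R)^-1 * sqN eta) (cutoff 0) _ _ _ (inv_cvg0 (sqN eta)) cc.
by rewrite cutoff0; exact.
Qed.

Let cutoff_ring (A w S1 N1 S c1 c2 N2 : R) :
 A + (2 * S1 * (c1 * (w * N1)) + S * (c2 * (w * N1) ^+ 2 + c1 * (w * N2))) =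
 A + w * (2 * S1 * (c1 * N1) + S * (c2 * w * N1 ^+ 2 + c1 * N2)).
Proof. ring. Qed.

Let three_terms_le (u1 u2 w A B D M1 M2 a b d G : R) :
 `|u1| <= M1 -> `|u2| <= M2 -> 0 <= w -> w <= 1 ->
 `|A| <= a * G -> `|B| <= b * G -> `|D| <= d * G ->
 `|2 * u1 * A + u2 * w * B + u1 * D| <= (2 * M1 * a + M2 * b + M1 * d) * G.
Proof.
move=> h1 h2 w0 w1 hA hB hD.
have M10 := le_trans (normr_ge0 _) h1; have M20 := le_trans (normr_ge0 _) h2.
apply: (le_trans (ler_normD _ _)); rewrite [leRHS]mulrDl lerD//; last first.
 by rewrite normrM -mulrA ler_pM.
apply: (le_trans (ler_normD _ _)); rewrite [leRHS]mulrDl lerD//.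
 by rewrite !normrM (ger0_norm (ler0n _ 2)) -!mulrA ler_wpM2l// ler_pM.
rewrite normrM -mulrA ler_pM// normrM -[leRHS]mulr1 ler_pM//; by rewrite ger0_norm.
Qed.

Section limit.
Variable P : heis R n -> R.
Hypothesis pP : pol P.
Let s := pg P.
Let F m eta := s eta * chi m eta.
Let sF m : sm (F m). Proof. by apply: smM => //; exact: sm_pg. Qed.
Let F_cvg eta : F m eta @[m --> \oo] --> s eta.
Proof. by rewrite -[X in _ --> X]mulr1; apply: cvgM; [exact: cvg_cst|exact: chi_cvg]. Qed.
Let test_F m : test_function (fun eta => (F m eta)%:C%C).
Proof.
split; first exact: sm_smooth (sF m).
 by apply: sm_smooth; exact: (sm_cst n 0).
pose b : R := m.+1%:R; pose I : set R := [set` `[- b, b]].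
have cI : compact I by exact: segment_compact.
pose K1 := [set w : 'rV[R]_n | forall i, I (w ord0 i)].
have cK1 : compact K1 by exact: (@rV_compact R n (fun=> I) (fun=> cI)).
exists ((K1 `*` K1) `*` I); first by apply: compact_setX => //; exact: compact_setX.
move=> eta nK; suff : b <= sqN eta.
 move=> h; rewrite /F /chi cutoff_ge1 ?mulr0//.
 by rewrite mulrC ler_pdivlMr ?mul1r// ltr0n.
rewrite leNgt; apply/negP => hb; apply: nK.
have b1 : 1 <= b by rewrite ler1n.
have inI (u : R) : u ^+ 2 <= sqN eta -> I u.
 move=> hu; have : u ^+ 2 < b by exact: le_lt_trans hb.
 by rewrite /I /= in_itv/=; move: b1; move: (b) => b0; move=> *; apply/andP; split; nra.
split; first split.
- by move=> i; apply: inI; exact: le_sqN_x.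
- by move=> i; apply: inI; exact: le_sqN_y.
- by apply: inI; exact: le_sqN_t.
Qed.

(** The terms of the second derivative of [F m] in which a derivative falls on the cutoff, with one
    factor 1 / (m + 1) taken out. The rest is bounded by a Gaussian uniformly in m, so these terms
    disappear in the limit. *)
Let E b j m eta := 2 * fieldZ b j s eta * (cutoff 1 ((m.+1%:R)^-1 * sqN eta) * fieldZ b j sqN eta) +
  s eta * (cutoff 2 ((m.+1%:R)^-1 * sqN eta) * (m.+1%:R)^-1 * fieldZ b j sqN eta ^+ 2 +
   cutoff 1 ((m.+1%:R)^-1 * sqN eta) * fieldZ b j (fieldZ b j sqN) eta).

Let fieldZ2F b j m eta : fieldZ b j (fieldZ b j (F m)) eta =
 chi m eta * fieldZ b j (fieldZ b j s) eta + (m.+1%:R)^-1 * E b j m eta.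
Proof.
rewrite /F (fieldZ2M b j (sm_pg pP) (sm_chi m)) (fieldZ2_chi b j m) (fieldZ_chi b j m) /E -/s.
exact: cutoff_ring.
Qed.

Let P1 b j := zpol b j P.
Let P2 b j := zpol b j (P1 b j).
Let pP1 b j : pol (P1 b j). Proof. exact: pol_zpol. Qed.
Let pP2 b j : pol (P2 b j). Proof. exact: pol_zpol. Qed.
Let s1E b j : fieldZ b j s = pg (P1 b j). Proof. exact: fieldZ_pg. Qed.
Let s2E b j : fieldZ b j (fieldZ b j s) = pg (P2 b j). Proof. by rewrite s1E fieldZ_pg. Qed.

Let fieldZ2F_bound b j : exists2 C, 0 <= C &
 forall m eta, `|fieldZ b j (fieldZ b j (F m)) eta| <= C * expR (- (c / 2 * sqN eta)) /\
  `|E b j m eta| <= C * expR (- (c / 2 * sqN eta)).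
Proof.
have [M0 M00 h0] := chi_bound 0; have [M1 M10 h1] := chi_bound 1; have [M2 M20 h2] := chi_bound 2.
have pN1 := pol_fieldZ b j pol_sqN; have pN2 := pol_fieldZ b j pN1.
have [Ca Ca0 ha] := pg_bound (pP2 b j).
have [Cb Cb0 hb] := pg_bound (polM (pP1 b j) pN1).
have [Cc Cc0 hc] := pg_bound (polM pP (pol_sqr pN1)).
have [Cd Cd0 hd] := pg_bound (polM pP pN2).
have BE m eta : `|E b j m eta| <= (2 * M1 * Cb + M2 * Cc + M1 * Cd) * expR (- (c / 2 * sqN eta)).
 rewrite /E s1E.
 have -> : 2 * pg (P1 b j) eta * (cutoff 1 ((m.+1%:R)^-1 * sqN eta) * fieldZ b j sqN eta) +
   s eta * (cutoff 2 ((m.+1%:R)^-1 * sqN eta) * (m.+1%:R)^-1 * fieldZ b j sqN eta ^+ 2 +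
   cutoff 1 ((m.+1%:R)^-1 * sqN eta) * fieldZ b j (fieldZ b j sqN) eta) =
   2 * cutoff 1 ((m.+1%:R)^-1 * sqN eta) * pg (fun eta => P1 b j eta * fieldZ b j sqN eta) eta +
   cutoff 2 ((m.+1%:R)^-1 * sqN eta) * (m.+1%:R)^-1 * pg (fun eta => P eta * fieldZ b j sqN eta ^+ 2) eta +
   cutoff 1 ((m.+1%:R)^-1 * sqN eta) * pg (fun eta => P eta * fieldZ b j (fieldZ b j sqN) eta) eta.
  by rewrite /s /pg; ring.
 exact: three_terms_le (h1 m eta) (h2 m eta) (inv_ge0 m) (inv_le1 m) (hb eta) (hc eta) (hd eta).
exists (M0 * Ca + (2 * M1 * Cb + M2 * Cc + M1 * Cd)).
 by rewrite !addr_ge0 ?mulr_ge0.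
move=> m eta; split; last first.
 by apply: (le_trans (BE m eta)); rewrite ler_wpM2r ?expR_ge0// lerDr mulr_ge0.
rewrite fieldZ2F s2E (le_trans (ler_normD _ _))// mulrDl lerD//.
 by rewrite normrM -mulrA ler_pM//; exact: h0.
rewrite normrM -[leRHS]mul1r ler_pM// ger0_norm//.
Qed.

Let lap_F_cvg eta : sublaplacianR (F m) eta @[m --> \oo] --> sublaplacianR s eta.
Proof.
under eq_fun do rewrite sublaplacianRE; rewrite sublaplacianRE.
have cv b j : fieldZ b j (fieldZ b j (F m)) eta @[m --> \oo] --> fieldZ b j (fieldZ b j s) eta.
 under eq_fun do rewrite fieldZ2F.
 suff z0 : (m.+1%:R)^-1 * E b j m eta @[m --> \oo] --> 0.
  have := cvgD (cvgM (chi_cvg eta) (cvg_cst (fieldZ b j (fieldZ b j s) eta))) z0.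
  by rewrite mul1r addr0; exact.
 have [C C0 h] := fieldZ2F_bound b j.
 apply: norm_cvg0.
 apply: (@squeeze_cvgr _ _ _ _ (fun=> 0) (fun m => (m.+1%:R)^-1 * (C * expR (- (c / 2 * sqN eta))))).
 - apply: nearW => m; rewrite normr_ge0/= normrM ger0_norm// ler_wpM2l//.
  exact: (h m eta).2.
 - exact: cvg_cst.
 - exact: inv_cvg0.
by apply: cvg_big => [|j _]; [exact: add_continuous|apply: cvgD; exact: cv].
Qed.

(** The products [F m] with the cutoffs are test functions; both they and their sublaplacians
    converge pointwise under a square integrable majorant, so the weak relation passes to the
    limit. *)
Lemma weak_sublaplacian_pg (f g : heis R n -> R[i]) : L2 hm f -> L2 hm g ->
 (forall H, test_function H -> inner hm f (fun eta => - sublaplacian H eta) = inner hm g H) ->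
 inner hm f (fun eta => (- sublaplacianR s eta)%:C%C) = inner hm g (fun eta => (s eta)%:C%C).
Proof.
move=> f2 g2 weak.
have [fr fi] := L2_sqintg f2; have [gr gi] := L2_sqintg g2.
have innR (h : heis R n -> R[i]) (u : heis R n -> R) : inner hm h (fun eta => (u eta)%:C%C) =
  Complex (\int[hm]_eta ((ReC \o h) eta * u eta)) (\int[hm]_eta ((ImC \o h) eta * u eta)).
 by apply: complexP; apply: eq_Rintegral => eta _; rewrite !cE /=; ring.
have lapR (u : heis R n -> R) : (fun eta => - sublaplacian (fun eta => (u eta)%:C%C) eta) =
  (fun eta => (- sublaplacianR u eta)%:C%C).
 apply/funext => eta; apply: complexP; rewrite cE /= ?raddfN//=.
 rewrite sublaplacianRE big1 ?oppr0// => j _.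
 by rewrite (fieldZ_cst true) (fieldZ_cst true) (fieldZ_cst false) (fieldZ_cst false) addr0.
have [C C0 hC] : exists2 C, 0 <= C & forall m eta, `|- sublaplacianR (F m) eta| <= C * expR (- (c / 2 * sqN eta)).
 pose D b j := projT1 (cid2 (fieldZ2F_bound b j)).
 have D0 b j : 0 <= D b j by rewrite /D; case: cid2.
 have hD b j m eta : `|fieldZ b j (fieldZ b j (F m)) eta| <= D b j * expR (- (c / 2 * sqN eta)).
  by rewrite /D; case: cid2 => /= x x0 h; have [] := h m eta.
 exists (\sum_(j < n) (D true j + D false j)).
  by apply: sumr_ge0 => j _; exact: addr_ge0.
 move=> m eta; rewrite normrN sublaplacianRE mulr_suml (le_trans (ler_norm_sum _ _ _))//.
 by apply: ler_sum => j _; rewrite mulrDl (le_trans (ler_normD _ _))// lerD.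
have G2 : sqintg hm (fun eta => C * expR (- (c / 2 * sqN eta))).
 have [m i] := @sqN_gaussian_sqintg (c / 2) (divr_gt0 c0 (ltr0n _ 2)).
 split; first exact: measurable_funM.
 by under eq_fun do rewrite exprMn; exact: intgZ.
have [M0 M00 h0] := chi_bound 0.
have s2 := pg_sqintg pP.
have S2 : sqintg hm (fun eta => M0 * `|s eta|).
 have [m i] := s2; split; first by apply: measurable_funM => //; exact: mcomp.
 rewrite (_ : (fun _ => _) = fun eta => M0 ^+ 2 * s eta ^+ 2); first exact: intgZ.
 by apply/funext => eta; rewrite exprMn real_normK// num_real.
have mlap u : sm u -> measurable_fun [set: 'rV[R]_n * 'rV[R]_n * measurableTypeR R] (fun eta => - sublaplacianR u eta).
 move=> su; under eq_fun do rewrite sublaplacianRE.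
 apply: mcomp => //; apply: measurable_sum => j.
 by apply: measurable_funD; apply: sm_measurable; apply: sm_fieldZ; exact: sm_fieldZ.
have L phi : sqintg hm phi -> \int[hm]_eta (phi eta * - sublaplacianR (F m) eta) @[m --> \oo] -->
  \int[hm]_eta (phi eta * - sublaplacianR s eta).
 move=> p2; apply: Rint_dominated G2 => //.
 - by move=> m; exact: mlap.
 - by apply: mlap; exact: sm_pg.
 - by move=> eta; apply: cvgN; exact: lap_F_cvg.
have Lg phi : sqintg hm phi -> \int[hm]_eta (phi eta * F m eta) @[m --> \oo] --> \int[hm]_eta (phi eta * s eta).
 move=> p2; apply: Rint_dominated S2 => //.
 - by move=> m; exact: (sm_measurable (sF m)).
 - exact: (sm_measurable (sm_pg pP)).
 - by move=> m eta; rewrite /F normrM [leLHS]mulrC ler_wpM2r//; exact: h0.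
have W m := weak _ (test_F m).
rewrite !innR; congr Complex.
- have c1 := L _ fr; have c2 := Lg _ gr.
 have e : (fun m => \int[hm]_eta ((ReC \o f) eta * - sublaplacianR (F m) eta)) =
      (fun m => \int[hm]_eta ((ReC \o g) eta * F m eta)).
  by apply/funext => m; have := W m; rewrite lapR !innR => -[].
 by rewrite e in c1; exact: (cvg_unique (@norm_hausdorff _ _) c1 c2).
- have c1 := L _ fi; have c2 := Lg _ gi.
 have e : (fun m => \int[hm]_eta ((ImC \o f) eta * - sublaplacianR (F m) eta)) =
      (fun m => \int[hm]_eta ((ImC \o g) eta * F m eta)).
  by apply/funext => m; have := W m; rewrite lapR !innR => -[].
 by rewrite e in c1; exact: (cvg_unique (@norm_hausdorff _ _) c1 c2).
Qed.

End limit.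

End gaussian.
End polynomials.

(** * Complex fields and the sublaplacian of a wave *)

Section complex_fields.
Context {R : realType} (n : nat).
Implicit Types (F G K A : heis R n -> R[i]) (b : bool) (j : 'I_n).

Definition csm F := sm (ReC \o F) /\ sm (ImC \o F).
Definition Zc b j F : heis R n -> R[i] :=
 fun eta => Complex (fieldZ b j (ReC \o F) eta) (fieldZ b j (ImC \o F) eta).

Lemma csm_real (f : heis R n -> R) : sm f -> csm (fun eta => (f eta)%:C%C).
Proof. by move=> sf; split=> //; exact: sm_cst. Qed.

Lemma csm_Complex (f g : heis R n -> R) : sm f -> sm g -> csm (fun eta => Complex (f eta) (g eta)).
Proof. by []. Qed.

Lemma csm_cst c : csm (fun=> c).
Proof. by split; exact: sm_cst. Qed.

Let ReDf F G : ReC \o (fun eta => F eta + G eta) = fun eta => (ReC \o F) eta + (ReC \o G) eta.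
Proof. by apply/funext => eta /=; rewrite ReD. Qed.
Let ImDf F G : ImC \o (fun eta => F eta + G eta) = fun eta => (ImC \o F) eta + (ImC \o G) eta.
Proof. by apply/funext => eta /=; rewrite ImD. Qed.
Let ReMf F G : ReC \o (fun eta => F eta * G eta) =
 fun eta => (ReC \o F) eta * (ReC \o G) eta + (-1 * (ImC \o F) eta) * (ImC \o G) eta.
Proof. by apply/funext => eta /=; rewrite ReM mulN1r mulNr. Qed.
Let ImMf F G : ImC \o (fun eta => F eta * G eta) =
 fun eta => (ReC \o F) eta * (ImC \o G) eta + (ImC \o F) eta * (ReC \o G) eta.
Proof. by apply/funext => eta /=; rewrite ImM. Qed.

Lemma csmD F G : csm F -> csm G -> csm (fun eta => F eta + G eta).
Proof. by move=> [f1 f2] [g1 g2]; split; rewrite ?ReDf ?ImDf; exact: smD. Qed.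

Lemma csmM F G : csm F -> csm G -> csm (fun eta => F eta * G eta).
Proof.
move=> [f1 f2] [g1 g2]; split; rewrite ?ReMf ?ImMf; apply: smD; apply: smM => //.
by apply: smM => //; exact: sm_cst.
Qed.

Lemma csmB F G : csm F -> csm G -> csm (fun eta => F eta - G eta).
Proof.
move=> sf sg; rewrite (_ : (fun _ => _) = fun eta => F eta + -1 * G eta).
 by apply: csmD => //; apply: csmM => //; exact: csm_cst.
by apply/funext => eta; rewrite mulN1r.
Qed.

Lemma csm_prod (I : Type) (s : seq I) (P : pred I) (F : I -> heis R n -> R[i]) :
 (forall i, csm (F i)) -> csm (fun eta => \prod_(i <- s | P i) F i eta).
Proof.
move=> sF; elim: s => [|i s IH].
 by under eq_fun do rewrite big_nil; exact: csm_cst.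
under eq_fun do rewrite big_cons; case: (P i) => //.
exact: csmM.
Qed.

Lemma csm_X F k : csm F -> csm (fun eta => F eta ^+ k).
Proof.
move=> sF; elim: k => [|k IH]; first by under eq_fun do rewrite expr0; exact: csm_cst.
by under eq_fun do rewrite exprS; exact: csmM.
Qed.

Lemma csm_Zc b j F : csm F -> csm (Zc b j F).
Proof. by move=> [f1 f2]; split; exact: sm_fieldZ. Qed.

Lemma Zc_cst b j c : Zc b j (fun=> c) = fun=> 0.
Proof. by apply/funext => eta; rewrite /Zc !(fieldZ_cst b j). Qed.

Lemma ZcD b j F G : csm F -> csm G ->
 Zc b j (fun eta => F eta + G eta) = fun eta => Zc b j F eta + Zc b j G eta.
Proof.
move=> [f1 f2] [g1 g2]; apply/funext => eta; rewrite /Zc ReDf ImDf.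
by rewrite (fieldZD b j f1 g1) (fieldZD b j f2 g2); apply: complexP; rewrite !cE.
Qed.

Lemma ZcM b j F G : csm F -> csm G ->
 Zc b j (fun eta => F eta * G eta) = fun eta => Zc b j F eta * G eta + F eta * Zc b j G eta.
Proof.
move=> [f1 f2] [g1 g2]; apply/funext => eta; rewrite /Zc ReMf ImMf.
have m2 : sm (fun eta => -1 * (ImC \o F) eta) by apply: smM => //; exact: sm_cst.
rewrite (fieldZD b j (smM f1 g1) (smM m2 g2)) (fieldZD b j (smM f1 g2) (smM f2 g1)).
rewrite (fieldZM b j f1 g1) (fieldZM b j m2 g2) (fieldZM b j f1 g2) (fieldZM b j f2 g1).
rewrite (fieldZM b j (sm_cst n (-1)) f2) (fieldZ_cst b j).
apply: complexP; rewrite !cE /=; move: (fieldZ b j _ eta) (fieldZ b j _ eta) (fieldZ b j _ eta)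
 (fieldZ b j _ eta) => *; ring.
Qed.

Lemma ZcZ b j c F : csm F -> Zc b j (fun eta => c * F eta) = fun eta => c * Zc b j F eta.
Proof.
by move=> sF; rewrite (ZcM b j (csm_cst c) sF) Zc_cst; apply/funext => eta; rewrite mul0r add0r.
Qed.

Lemma ZcB b j F G : csm F -> csm G ->
 Zc b j (fun eta => F eta - G eta) = fun eta => Zc b j F eta - Zc b j G eta.
Proof.
move=> sF sG; rewrite (_ : (fun _ => _) = fun eta => F eta + -1 * G eta); last first.
 by apply/funext => eta; rewrite mulN1r.
rewrite (ZcD b j sF (csmM (csm_cst _) sG)) (ZcZ b j _ sG).
by apply/funext => eta; rewrite mulN1r.
Qed.

Lemma Zc_Complex b j (f g : heis R n -> R) :
 Zc b j (fun eta => Complex (f eta) (g eta)) = fun eta => Complex (fieldZ b j f eta) (fieldZ b j g eta).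
Proof. by []. Qed.

Lemma Zc_real b j (f : heis R n -> R) :
 Zc b j (fun eta => (f eta)%:C%C) = fun eta => (fieldZ b j f eta)%:C%C.
Proof. rewrite (@Zc_Complex b j f (fun=> 0)) fieldZ_cst //. Qed.

Lemma sublaplacianZ F eta : sublaplacian F eta =
 \sum_(j < n) (Zc true j (Zc true j F) eta + Zc false j (Zc false j F) eta).
Proof. by apply: complexP; rewrite !cE /= sublaplacianRE; apply: eq_bigr => j _; rewrite ?cE. Qed.

(* The fields differentiate along the center through the coefficient [coefZ b j]. *)
Lemma Zc2M b j A K K1 K2 eta : csm A -> csm K -> csm K1 ->
 Zc b j K = (fun eta => (coefZ b j eta)%:C%C * K1 eta) ->
 Zc b j K1 = (fun eta => (coefZ b j eta)%:C%C * K2 eta) ->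
 Zc b j (fun eta => (coefZ b j eta)%:C%C) = (fun=> 0) ->
 Zc b j (Zc b j (fun eta => A eta * K eta)) eta =
  Zc b j (Zc b j A) eta * K eta + 2 * (coefZ b j eta)%:C%C * Zc b j A eta * K1 eta +
  (coefZ b j eta)%:C%C ^+ 2 * A eta * K2 eta.
Proof.
move=> sA sK sK1 hK hK1 hc.
have sc : csm (fun eta => (coefZ b j eta)%:C%C) by apply: csm_real; exact: sm_coefZ.
have sZ := csm_Zc b j sA.
rewrite (ZcM b j sA sK) hK (ZcD b j (csmM sZ sK) (csmM sA (csmM sc sK1))).
rewrite (ZcM b j sZ sK) (ZcM b j sA (csmM sc sK1)) (ZcM b j sc sK1) hc hK hK1.
move: (Zc b j A eta) (Zc b j (Zc b j A) eta) (coefZ b j eta)%:C%C (K eta) (K1 eta) (K2 eta) (A eta) => *; ring.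
Qed.

Lemma fieldZ_x b j i : fieldZ b j (fun eta : heis R n => eta.1.1 ord0 i) = fun=> (b && (i == j))%:R.
Proof.
rewrite (@fieldZ_val _ _ b j _ (fun=> (b && (i == j))%:R) (fun=> 0)).
- by apply/funext => eta; rewrite mulr0 addr0.
- by apply: is_derive_linear_line => t eta; case: b; rewrite !mxE /= ?eqxx.
- by apply: is_derive_linear_line => t eta; rewrite !mxE.
Qed.

Lemma fieldZ_y b j i : fieldZ b j (fun eta : heis R n => eta.1.2 ord0 i) = fun=> (~~ b && (i == j))%:R.
Proof.
rewrite (@fieldZ_val _ _ b j _ (fun=> (~~ b && (i == j))%:R) (fun=> 0)).
- by apply/funext => eta; rewrite mulr0 addr0.
- by apply: is_derive_linear_line => t eta; case: b; rewrite !mxE /= ?eqxx.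
- by apply: is_derive_linear_line => t eta; rewrite !mxE.
Qed.

Lemma fieldZ_t b j : fieldZ b j (fun eta : heis R n => eta.2) = coefZ b j.
Proof.
rewrite (@fieldZ_val _ _ b j _ (fun=> 0) (fun=> 1)).
- by apply/funext => eta; rewrite mulr1 add0r.
- by apply: is_derive_linear_line => t eta; case: b.
- by apply: is_derive_linear_line => t eta.
Qed.

Lemma Zc_coefZ b j : Zc b j (fun eta => (coefZ b j eta)%:C%C) = fun=> 0.
Proof.
rewrite Zc_real; suff -> : fieldZ b j (@coefZ R n b j) = fun=> 0 by [].
case: b; rewrite /coefZ.
 rewrite (_ : (fun _ => _) = fun eta : heis R n => eta.1.2 ord0 j * - 2^-1).
  rewrite (fieldZM true j (sm_y j) (sm_cst n _)) fieldZ_y fieldZ_cst.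
  by apply/funext => eta; rewrite mul0r mulr0 addr0.
 by apply/funext => eta; rewrite mulrN.
rewrite (fieldZM false j (sm_x j) (sm_cst n _)) fieldZ_x fieldZ_cst.
by apply/funext => eta; rewrite mul0r mulr0 addr0.
Qed.

End complex_fields.

Section wigner_eigenfunctions.
Context {R : realType} (n : nat) (a sg : R) (k l : {ffun 'I_n -> nat}).
Hypothesis sg2 : sg ^+ 2 = 1.
Variable rho : nat -> R -> R.
Hypothesis srho : smooth1 rho.
Implicit Types (b : bool) (i j : 'I_n) (eta : heis R n).

Let io : R[i] := Complex 0 sg.
(** [zz] is a (x_i + i sg y_i) and [ww] its conjugate; [dz] and [dw] are their derivatives along the
    field of the same index, X for [true] and Y for [false]. *)
Let zz i eta : R[i] := Complex (a * eta.1.1 ord0 i) (a * sg * eta.1.2 ord0 i).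
Let ww i eta : R[i] := Complex (a * eta.1.1 ord0 i) (- (a * sg) * eta.1.2 ord0 i).
Let dz b : R[i] := if b then a%:C%C else a%:C%C * io.
Let dw b : R[i] := if b then a%:C%C else - (a%:C%C * io).
Let io2 : io ^+ 2 = -1.
Proof.
apply: complexP; rewrite expr2 !cE /= ?mulr0 ?mul0r ?addr0 ?oppr0 //.
by rewrite -expr2 sg2 sub0r.
Qed.

Let smZ (c : R) f : sm f -> sm (fun eta : heis R n => c * f eta).
Proof. by move=> sf; apply: smM => //; exact: sm_cst. Qed.
Let csm_zz i : csm (zz i).
Proof. by apply: csm_Complex; apply: smZ; [exact: sm_x|exact: sm_y]. Qed.

Let csm_ww i : csm (ww i).
Proof. by apply: csm_Complex; apply: smZ; [exact: sm_x|exact: sm_y]. Qed.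
Let fieldZ_cx b j (c : R) i : fieldZ b j (fun eta : heis R n => c * eta.1.1 ord0 i) = fun=> c * (b && (i == j))%:R.
Proof.
rewrite (fieldZM b j (sm_cst n c) (sm_x i)) fieldZ_x fieldZ_cst.
by apply/funext => eta; rewrite mul0r add0r.
Qed.

Let fieldZ_cy b j (c : R) i : fieldZ b j (fun eta : heis R n => c * eta.1.2 ord0 i) = fun=> c * (~~ b && (i == j))%:R.
Proof.
rewrite (fieldZM b j (sm_cst n c) (sm_y i)) fieldZ_y fieldZ_cst.
by apply/funext => eta; rewrite mul0r add0r.
Qed.

Let Zc_zz b j i : Zc b j (zz i) = fun=> (i == j)%:R * dz b.
Proof.
rewrite Zc_Complex fieldZ_cx fieldZ_cy; apply/funext => eta.
case: (i == j) => /=; rewrite ?andbT ?andbF ?mul1r ?mul0r ?mulr0// /dz.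
by case: b; apply: complexP; rewrite ?cE /=; ring.
Qed.

Let Zc_ww b j i : Zc b j (ww i) = fun=> (i == j)%:R * dw b.
Proof.
rewrite Zc_Complex fieldZ_cx fieldZ_cy; apply/funext => eta.
case: (i == j) => /=; rewrite ?andbT ?andbF ?mul1r ?mul0r ?mulr0// /dw.
by case: b; apply: complexP; rewrite ?cE /=; ring.
Qed.

Let ch k0 l0 i eta := chermite k0 l0 (zz i eta) (ww i eta).
Let csm_ch k0 l0 i : csm (ch k0 l0 i).
Proof.
elim: k0 l0 => [|k0 IH] l0.
 apply: csm_X; rewrite (_ : (fun _ => _) = fun eta => -1 * ww i eta).
  by apply: csmM => //; exact: csm_cst.
 by apply/funext => eta; rewrite mulN1r.
exact: (csmD (csmM (csm_zz i) (IH l0)) (csmM (csm_cst n _) (IH l0.-1))).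
Qed.

Let Zc_ch b j k0 l0 i : Zc b j (ch k0 l0 i) = fun eta => (i == j)%:R *
 (k0%:R * ch k0.-1 l0 i eta * dz b - l0%:R * ch k0 l0.-1 i eta * dw b).
Proof.
elim: k0 l0 => [|k0 IH] l0.
 elim: l0 => [|l0 IH].
  rewrite (Zc_cst b j 1); apply/funext => eta; rewrite !mul0r subr0 mulr0 //.
 have -> : ch 0 l0.+1 i = fun eta => (-1 * ww i eta) * ch 0 l0 i eta.
  by apply/funext => eta; rewrite /ch /= exprS mulN1r.
 rewrite (ZcM b j (csmM (csm_cst n (-1)) (csm_ww i)) (csm_ch 0 l0 i)) IH.
 rewrite (ZcZ b j _ (csm_ww i)) Zc_ww; apply/funext => eta /=.
 have E : l0%:R * ch 0 l0 i eta = - ww i eta * (l0%:R * ch 0 l0.-1 i eta).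
  case: (l0) => [|l1]; first by rewrite !mul0r mulr0.
  by rewrite /ch /= exprS; ring.
 rewrite -[l0.+1%:R]natr1 (mulrDl l0%:R 1) E mul0r; move: (ch _ _ _ _) (ch _ _ _ _) (ww _ _) => *; ring.
have -> : ch k0.+1 l0 i = fun eta => zz i eta * ch k0 l0 i eta + (2 * l0%:R) * ch k0 l0.-1 i eta by [].
rewrite (ZcD b j (csmM (csm_zz i) (csm_ch k0 l0 i)) (csmM (csm_cst n _) (csm_ch k0 l0.-1 i))).
rewrite (ZcZ b j _ (csm_ch k0 l0.-1 i)) (ZcM b j (csm_zz i) (csm_ch k0 l0 i)) !IH Zc_zz.
apply/funext => eta /=.
have E1 : k0%:R * ch k0 l0 i eta = zz i eta * (k0%:R * ch k0.-1 l0 i eta) + 2 * l0%:R * (k0%:R * ch k0.-1 l0.-1 i eta).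
 rewrite chermite_z /ch; ring.
have E2 : l0%:R * ch k0.+1 l0.-1 i eta = l0%:R * (zz i eta * ch k0 l0.-1 i eta + 2 * l0.-1%:R * ch k0 l0.-2 i eta) by [].
rewrite E2 -[k0.+1%:R]natr1 (mulrDl k0%:R 1) E1.
move: (ch k0 l0 i eta) (ch k0.-1 l0 i eta) (ch k0 l0.-1 i eta) (ch k0.-1 l0.-1 i eta) (ch k0 l0.-2 i eta) (zz i eta).
by move=> *; ring.
Qed.

Let rr i eta : R := eta.1.1 ord0 i ^+ 2 + eta.1.2 ord0 i ^+ 2.
Let ee i eta : R := expR (- (a ^+ 2 / 4) * rr i eta).
Let uu b i eta : R := if b then eta.1.1 ord0 i else eta.1.2 ord0 i.
Let rrE b i : rr i = fun eta => uu b i eta * uu b i eta + uu (~~ b) i eta * uu (~~ b) i eta.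
Proof.
by apply/funext => eta; rewrite /rr !expr2; case: b => //; exact: addrC.
Qed.

Let sm_rr i : sm (rr i).
Proof.
by rewrite /rr; under eq_fun do rewrite !expr2; apply: smD; apply: smM; (exact: sm_x || exact: sm_y).
Qed.

Let sm_uu b i : sm (uu b i).
Proof. by case: b; [exact: sm_x|exact: sm_y]. Qed.
Let fieldZ_uu b j i : fieldZ b j (uu b i) = fun=> (i == j)%:R.
Proof. by case: b; rewrite /uu ?fieldZ_x ?fieldZ_y. Qed.

Let sm_ee i : sm (ee i).
Proof. by apply: (@sm_comp _ _ (fun=> expR)); [exact: smooth1_exp|exact: smZ]. Qed.
Let fieldZ_ee b j i : fieldZ b j (ee i) = fun eta => (i == j)%:R * (- (a ^+ 2 / 2) * uu b i eta * ee i eta).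
Proof.
rewrite (fieldZ_comp b j smooth1_exp (smZ _ (sm_rr i))) (fieldZM b j (sm_cst n _) (sm_rr i)) fieldZ_cst.
rewrite (rrE b).
have Zu : fieldZ b j (uu (~~ b) i) = fun=> 0 by case: b; rewrite /uu ?fieldZ_x ?fieldZ_y.
rewrite (fieldZD b j (smM (sm_uu _ _) (sm_uu _ _)) (smM (sm_uu _ _) (sm_uu _ _))).
rewrite !(fieldZM b j (sm_uu _ _) (sm_uu _ _)) fieldZ_uu Zu.
apply/funext => eta; rewrite /ee (rrE b).
by move: (expR _) => e; move: (uu b i eta) => u; field.
Qed.

Let AA i eta : R[i] := (ee i eta)%:C%C * ch (k i) (l i) i eta.
Let csm_ee i : csm (fun eta => (ee i eta)%:C%C).
Proof. exact/csm_real. Qed.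
Let csm_AA i : csm (AA i).
Proof. exact: (csmM (csm_ee i) (csm_ch _ _ i)). Qed.

Let Zc_AA0 b j i : i != j -> Zc b j (AA i) = fun=> 0.
Proof.
move=> /negPf ij; rewrite (ZcM b j (csm_ee i) (csm_ch _ _ i)) Zc_real fieldZ_ee Zc_ch ij.
by apply/funext => eta; rewrite !mul0r mulr0 addr0.
Qed.

Let Zc_ee b j G : csm G -> Zc b j (fun eta => (ee j eta)%:C%C * G eta) =
 fun eta => (ee j eta)%:C%C * (Zc b j G eta - (a ^+ 2 / 2 * uu b j eta)%:C%C * G eta).
Proof.
move=> sG; rewrite (ZcM b j (csm_ee j) sG) Zc_real fieldZ_ee; apply/funext => eta.
rewrite eqxx mul1r mulNr mulNr rmorphN rmorphM /=.
move: (ee j eta)%:C%C (_%:C%C) (G eta) (Zc b j G eta) => *; ring.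
Qed.

(** Names for the derivatives of the polynomial in the variables z and w: [c1] and - [c2] are the
    first ones, [c11], - [c12] and [c22] the second ones. *)
Let c0 j := ch (k j) (l j) j.
Let c1 j eta : R[i] := (k j)%:R * ch (k j).-1 (l j) j eta.
Let c2 j eta : R[i] := (l j)%:R * ch (k j) (l j).-1 j eta.
Let c12 j eta : R[i] := (k j)%:R * (l j)%:R * ch (k j).-1 (l j).-1 j eta.
Let c11 j eta : R[i] := (k j)%:R * (k j).-1%:R * ch (k j).-2 (l j) j eta.
Let c22 j eta : R[i] := (l j)%:R * (l j).-1%:R * ch (k j) (l j).-2 j eta.
Let Zc_c0 b j : Zc b j (c0 j) = fun eta => dz b * c1 j eta - dw b * c2 j eta.
Proof.
rewrite Zc_ch eqxx; apply/funext => eta; rewrite mul1r /c1 /c2; ring.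
Qed.

Let csm_c1 j : csm (c1 j).
Proof. exact: (csmM (csm_cst n _) (csm_ch _ _ j)). Qed.
Let csm_c2 j : csm (c2 j).
Proof. exact: (csmM (csm_cst n _) (csm_ch _ _ j)). Qed.
Let Zc2_c0 b j : Zc b j (Zc b j (c0 j)) = fun eta =>
 dz b ^+ 2 * c11 j eta - 2 * dz b * dw b * c12 j eta + dw b ^+ 2 * c22 j eta.
Proof.
rewrite Zc_c0 (ZcB b j (csmM (csm_cst n _) (csm_c1 j)) (csmM (csm_cst n _) (csm_c2 j))).
rewrite !(ZcZ b j _ (csm_c1 j)) !(ZcZ b j _ (csm_c2 j)) !(ZcZ b j _ (csm_ch _ _ j)) !Zc_ch eqxx.
apply/funext => eta; rewrite !mul1r /c11 /c12 /c22; ring.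
Qed.

Let Zc_AA b j : Zc b j (AA j) = fun eta => (ee j eta)%:C%C *
 (dz b * c1 j eta - dw b * c2 j eta - (a ^+ 2 / 2 * uu b j eta)%:C%C * c0 j eta).
Proof. by rewrite (Zc_ee b j (csm_ch _ _ j)) Zc_c0. Qed.

Let Zc2_AA b j : Zc b j (Zc b j (AA j)) = fun eta => (ee j eta)%:C%C *
 (dz b ^+ 2 * c11 j eta - 2 * dz b * dw b * c12 j eta + dw b ^+ 2 * c22 j eta
  - 2 * (a ^+ 2 / 2 * uu b j eta)%:C%C * (dz b * c1 j eta - dw b * c2 j eta)
  - (a ^+ 2 / 2)%:C%C * c0 j eta + (a ^+ 2 / 2 * uu b j eta)%:C%C ^+ 2 * c0 j eta).
Proof.
have s0 : csm (c0 j) by exact: csm_ch.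
have su : csm (fun eta => (a ^+ 2 / 2 * uu b j eta)%:C%C) by apply: csm_real; exact: smZ.
have sZ := csm_Zc b j s0.
rewrite (Zc_ee b j s0) (Zc_ee b j (csmB sZ (csmM su s0))) (ZcB b j sZ (csmM su s0)) (ZcM b j su s0).
rewrite Zc2_c0 Zc_c0 Zc_real (fieldZM b j (sm_cst n _) (sm_uu b j)) fieldZ_cst fieldZ_uu eqxx.
apply/funext => eta; rewrite mul0r add0r mulr1.
move: (ee j eta)%:C%C ((a ^+ 2 / 2 * uu b j eta)%:C%C) ((a ^+ 2 / 2)%:C%C) (c0 j eta) (c1 j eta)
 (c2 j eta) (c11 j eta) (c12 j eta) (c22 j eta) (dz b) (dw b) => *; ring.
Qed.

Let zzE j eta : zz j eta = a%:C%C * ((uu true j eta)%:C%C + io * (uu false j eta)%:C%C).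
Proof. by apply: complexP; rewrite !cE /=; ring. Qed.
Let wwE j eta : ww j eta = a%:C%C * ((uu true j eta)%:C%C - io * (uu false j eta)%:C%C).
Proof. by apply: complexP; rewrite !cE /=; ring. Qed.
Let num1 j eta : zz j eta * c1 j eta = (k j)%:R * c0 j eta - 2 * c12 j eta.
Proof. by rewrite /c1 /c0 /c12 /ch chermite_z; ring. Qed.
Let num2 j eta : ww j eta * c2 j eta = 2 * c12 j eta - (l j)%:R * c0 j eta.
Proof. by rewrite /c2 /c0 /c12 /ch chermite_w; ring. Qed.
(** [AA j] does not depend on tau, so the fields act as partial derivatives and the sum is a planar
    Laplacian. The pure second derivatives cancel because [io ^+ 2 = -1]; the first-order terms
    reduce by the number operators [num1] and [num2]. *)
Let laplace_AA j eta : Zc true j (Zc true j (AA j)) eta + Zc false j (Zc false j (AA j)) eta =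
 (- (a ^+ 2)%:C%C * ((k j)%:R + (l j)%:R + 1) + (a ^+ 4 / 4 * rr j eta)%:C%C) * AA j eta.
Proof.
rewrite !Zc2_AA /AA -/(c0 j eta) /dz /dw.
have -> : (a ^+ 4 / 4 * rr j eta)%:C%C = (a ^+ 2 / 2 * uu true j eta)%:C%C ^+ 2 +
  (a ^+ 2 / 2 * uu false j eta)%:C%C ^+ 2 :> R[i].
 by rewrite -!rmorphXn -rmorphD /=; congr (_ %:C)%C; rewrite /rr /uu /=; field.
have num : zz j eta * c1 j eta - ww j eta * c2 j eta = ((k j)%:R + (l j)%:R) * c0 j eta - 4 * c12 j eta.
 by rewrite num1 num2; ring.
have E : 2 * (a ^+ 2 / 2 * uu true j eta)%:C%C * (a%:C%C * c1 j eta - a%:C%C * c2 j eta) +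
  2 * (a ^+ 2 / 2 * uu false j eta)%:C%C * (a%:C%C * io * c1 j eta - - (a%:C%C * io) * c2 j eta) =
  (a ^+ 2)%:C%C * (((k j)%:R + (l j)%:R) * c0 j eta - 4 * c12 j eta).
 rewrite -num zzE wwE.
 have Eu b : 2 * (a ^+ 2 / 2 * uu b j eta)%:C%C = (a ^+ 2)%:C%C * (uu b j eta)%:C%C :> R[i].
  rewrite -rmorphM /= (_ : 2 = (2 : R)%:C%C) -?rmorphM //=; last by rewrite rmorph_nat.
  by congr (_ %:C)%C; field.
 rewrite !Eu; move: (c1 _ _) (c2 _ _) (_%:C%C) (_%:C%C) (_%:C%C) (_%:C%C) io => *; ring.
have A2 : 2 * (a ^+ 2 / 2)%:C%C = (a%:C%C) ^+ 2 :> R[i].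
 rewrite (_ : 2 = (2 : R)%:C%C) -?rmorphXn -?rmorphM //=; last by rewrite rmorph_nat.
 by congr (_ %:C)%C; field.
have E0 : (a%:C%C * io) ^+ 2 = - (a%:C%C) ^+ 2 by rewrite exprMn io2 mulrN1.
move: E A2 E0; rewrite [(a ^+ 2)%:C%C]rmorphXn /=.
move: (ee j eta)%:C%C ((a ^+ 2 / 2 * uu true j eta)%:C%C) ((a ^+ 2 / 2 * uu false j eta)%:C%C)
 ((a ^+ 2 / 2)%:C%C) (c0 j eta) (c1 j eta) (c2 j eta) (c11 j eta) (c12 j eta) (c22 j eta)
 (a%:C%C) ((k j)%:R : R[i]) ((l j)%:R : R[i]) => e ut uf h C C1 C2 C11 C12 C22 A kk ll E A2 E0.
rewrite -mulrDr [RHS]mulrC -[RHS]mulrA; congr (e * _).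
transitivity ((A ^+ 2 + (A * io) ^+ 2) * (C11 + C22) - 2 * (A ^+ 2 - (A * io) ^+ 2) * C12
 - (2 * ut * (A * C1 - A * C2) + 2 * uf * (A * io * C1 - - (A * io) * C2)) - 2 * h * C + (ut ^+ 2 + uf ^+ 2) * C).
 ring.
by rewrite E E0 A2; ring.
Qed.

(** The left side is the rotation generator x d/dy - y d/dx in the j-th plane; [AA j] has angular
    momentum sg (k - l). It is the term in which one derivative falls on [AA j] and one on the
    factor in tau. *)
Let rotation_AA j eta : 2 * (coefZ true j eta)%:C%C * Zc true j (AA j) eta +
  2 * (coefZ false j eta)%:C%C * Zc false j (AA j) eta =
 io * ((k j)%:R - (l j)%:R) * AA j eta.
Proof.
rewrite !Zc_AA /AA -/(c0 j eta) /dz /dw.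
have -> : 2 * (coefZ true j eta)%:C%C = - (uu false j eta)%:C%C :> R[i].
 rewrite (_ : 2 = (2 : R)%:C%C) -?rmorphM -?rmorphN //=; last by rewrite rmorph_nat.
 by congr (_ %:C)%C; rewrite /uu; field.
have -> : 2 * (coefZ false j eta)%:C%C = (uu true j eta)%:C%C :> R[i].
 rewrite (_ : 2 = (2 : R)%:C%C) -?rmorphM //=; last by rewrite rmorph_nat.
 by congr (_ %:C)%C; rewrite /uu; field.
have num : zz j eta * c1 j eta + ww j eta * c2 j eta = ((k j)%:R - (l j)%:R) * c0 j eta.
 by rewrite num1 num2; ring.
rewrite [RHS](_ : _ = (ee j eta)%:C%C * (io * (((k j)%:R - (l j)%:R) * c0 j eta))); last by ring.
rewrite -num zzE wwE !(rmorphM _ (a ^+ 2 / 2)) /=.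
have := io2.
move: (ee j eta)%:C%C ((uu true j eta)%:C%C) ((uu false j eta)%:C%C)
 ((a ^+ 2 / 2)%:C%C) (c0 j eta) (c1 j eta) (c2 j eta) io (a%:C%C) => e ut uf h C C1 C2 i0 A i2.
transitivity (e * (i0 * (A * ut * (C1 + C2)) + uf * A * (C2 - C1))); first ring.
transitivity (e * (i0 * (A * ut * (C1 + C2)) + i0 ^+ 2 * (uf * A * (C1 - C2)))).
 by rewrite i2; ring.
ring.
Qed.

Let Zc_rho b j p : Zc b j (fun eta => (rho p eta.2)%:C%C) =
 fun eta => (coefZ b j eta)%:C%C * (rho p.+1 eta.2)%:C%C.
Proof.
have sp : smooth1 (fun q => rho (q + p)%N) by move=> q x; exact: srho.
rewrite Zc_real (fieldZ_comp b j sp (sm_t n)) fieldZ_t.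
by apply/funext => eta; rewrite -rmorphM mulrC.
Qed.

Let csm_rho p : csm (fun eta : heis R n => (rho p eta.2)%:C%C).
Proof.
have sp : smooth1 (fun q => rho (q + p)%N) by move=> q x; exact: srho.
exact: (csm_real (sm_comp sp (sm_t n))).
Qed.

(** For a = sqrt |lam| and sg the sign of lam this is, up to a constant, the conjugate of a Wigner
    function ([wigner_wave]). Here a and sg are free, since a test function cannot depend on the
    frequency. *)
Definition wave eta : R[i] := \prod_(i < n)
 ((expR (- (a ^+ 2 / 4) * (eta.1.1 ord0 i ^+ 2 + eta.1.2 ord0 i ^+ 2)))%:C%C *
  chermite (k i) (l i) (Complex (a * eta.1.1 ord0 i) (a * sg * eta.1.2 ord0 i))
  (Complex (a * eta.1.1 ord0 i) (- (a * sg) * eta.1.2 ord0 i))).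

(** For a factor exp(i lam t) with a^2 = |lam| the middle term would vanish and the wave be an
    eigenfunction. For a general factor [rho] it remains, with the weight |z|^2 / 4. *)
Lemma sublaplacian_wave eta :
 sublaplacian (fun eta => wave eta * (rho 0 eta.2)%:C%C) eta =
  - (a ^+ 2 * (\sum_(i < n) (k i + l i + 1))%:R * rho 0 eta.2)%:C%C * wave eta
  + (sqz eta / 4 * (a ^+ 4 * rho 0 eta.2 + rho 2 eta.2))%:C%C * wave eta
  + Complex 0 (sg * (\sum_(i < n) ((k i)%:R - (l i)%:R)) * rho 1 eta.2) * wave eta.
Proof.
have waveE j : (fun eta => wave eta * (rho 0 eta.2)%:C%C) = fun eta =>
  AA j eta * (\prod_(i < n | i != j) AA i eta * (rho 0 eta.2)%:C%C).
 by apply/funext => z; rewrite /wave (bigD1 j)//= mulrA.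
have sP j : csm (fun eta => \prod_(i < n | i != j) AA i eta) by exact: csm_prod.
have ZP b j : Zc b j (fun eta => \prod_(i < n | i != j) AA i eta) = fun=> 0.
 elim: (index_enum _) => [|i s IH].
  by under eq_fun do rewrite big_nil; exact: Zc_cst.
 case ij : (i != j); last by under eq_fun do rewrite big_cons ij.
 under eq_fun do rewrite big_cons ij.
 rewrite (ZcM b j (csm_AA i) (csm_prod s (fun i => i != j) csm_AA)) IH Zc_AA0//.
 by apply/funext => z; rewrite mul0r mulr0 addr0.
have ZK b j p : Zc b j (fun eta => \prod_(i < n | i != j) AA i eta * (rho p eta.2)%:C%C) =
  fun eta => (coefZ b j eta)%:C%C * (\prod_(i < n | i != j) AA i eta * (rho p.+1 eta.2)%:C%C).
 rewrite (ZcM b j (sP j) (csm_rho p)) ZP Zc_rho.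
 by apply/funext => z; rewrite mul0r add0r mulrCA.
have term j : Zc true j (Zc true j (fun eta => wave eta * (rho 0 eta.2)%:C%C)) eta +
   Zc false j (Zc false j (fun eta => wave eta * (rho 0 eta.2)%:C%C)) eta =
  ((- (a ^+ 2)%:C%C * ((k j)%:R + (l j)%:R + 1) + (a ^+ 4 / 4 * rr j eta)%:C%C) * (rho 0 eta.2)%:C%C +
  io * ((k j)%:R - (l j)%:R) * (rho 1 eta.2)%:C%C + (rr j eta / 4)%:C%C * (rho 2 eta.2)%:C%C) * wave eta.
 have sK p := csmM (sP j) (csm_rho p).
 rewrite (waveE j) !(Zc2M _ (csm_AA j) (sK 0%N) (sK 1%N) (ZK _ j 0%N) (ZK _ j 1%N) (Zc_coefZ _ j)).
 have -> : wave eta = AA j eta * \prod_(i < n | i != j) AA i eta by rewrite /wave (bigD1 j).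
 have L := laplace_AA j eta; have Ro := rotation_AA j eta.
 have C2 : (coefZ true j eta)%:C%C ^+ 2 + (coefZ false j eta)%:C%C ^+ 2 = (rr j eta / 4)%:C%C :> R[i].
  by rewrite -!rmorphXn -rmorphD; congr (_ %:C)%C; rewrite /coefZ /rr; field.
 rewrite -C2.
 transitivity (((Zc true j (Zc true j (AA j)) eta + Zc false j (Zc false j (AA j)) eta) * (rho 0 eta.2)%:C%C +
  (2 * (coefZ true j eta)%:C%C * Zc true j (AA j) eta + 2 * (coefZ false j eta)%:C%C * Zc false j (AA j) eta) *
  (rho 1 eta.2)%:C%C + ((coefZ true j eta)%:C%C ^+ 2 + (coefZ false j eta)%:C%C ^+ 2) * AA j eta * (rho 2 eta.2)%:C%C)
  * \prod_(i < n | i != j) AA i eta).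
  move: (\prod_(i < n | i != j) AA i eta) (AA j eta) (rho 0 eta.2)%:C%C (rho 1 eta.2)%:C%C (rho 2 eta.2)%:C%C
   (Zc true j (Zc true j (AA j)) eta) (Zc true j (AA j) eta) (Zc false j (Zc false j (AA j)) eta) (Zc false j (AA j) eta)
   ((coefZ true j eta)%:C%C) ((coefZ false j eta)%:C%C) => *; ring.
 rewrite L Ro; move: (\prod_(i < n | i != j) AA i eta) (AA j eta) (rho 0 eta.2)%:C%C (rho 1 eta.2)%:C%C
  (rho 2 eta.2)%:C%C (_%:C%C) (_%:C%C) (_%:C%C) (_%:C%C) => *; ring.
set N : R := (\sum_(i < n) (k i + l i + 1))%:R.
set S : R := \sum_(i < n) ((k i)%:R - (l i)%:R).
rewrite sublaplacianZ (eq_bigr _ (fun j _ => term j)) -mulr_suml -!mulrDl; congr (_ * _).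
rewrite !big_split /= -!mulr_suml -mulr_sumr big_split /= -!mulr_sumr.
have -> : \sum_(i < n) ((k i)%:R + (l i)%:R + 1 : R[i]) = N%:C%C.
 rewrite /N natr_sum rmorph_sum; apply: eq_bigr => i _; by rewrite !natrD !rmorphD !rmorph_nat.
have -> : \sum_(i < n) ((k i)%:R - (l i)%:R : R[i]) = S%:C%C.
 by rewrite /S rmorph_sum; apply: eq_bigr => i _; rewrite rmorphB !rmorph_nat.
rewrite -!rmorph_sum -mulr_suml -mulr_sumr -/(sqz eta).
by apply: complexP; rewrite !cE /=; field.
Qed.

End wigner_eigenfunctions.

Lemma innerDr d (T : measurableType d) (R : realType) (mu : {measure set T -> \bar R}) (h f g : T -> R[i]) :
 L2 mu h -> L2 mu f -> L2 mu g -> inner mu h (fun x => f x + g x) = inner mu h f + inner mu h g.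
Proof.
move=> h2 f2 g2; rewrite (innerC h2 (L2D f2 g2)) (innerD f2 g2 h2) rmorphD.
by rewrite (innerC h2 f2) (innerC h2 g2).
Qed.

Lemma innerZr d (T : measurableType d) (R : realType) (mu : {measure set T -> \bar R}) c (h f : T -> R[i]) :
 L2 mu h -> L2 mu f -> inner mu h (fun x => c * f x) = conjc c * inner mu h f.
Proof.
by move=> h2 f2; rewrite (innerC h2 (L2Z c f2)) (innerZ c f2 h2) rmorphM (innerC h2 f2).
Qed.

(** * Waves in the weak equation *)

Section intertwining_waves.
Context {R : realType} (n : nat).
Implicit Types (F : heis R n -> R[i]) (p : {poly R}).

Definition cpol F := pol (ReC \o F) /\ pol (ImC \o F).

Lemma cpolD F G : cpol F -> cpol G -> cpol (fun eta => F eta + G eta).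
Proof.
move=> [f1 f2] [g1 g2]; split.
 by rewrite (_ : _ \o _ = fun eta => (ReC \o F) eta + (ReC \o G) eta); [exact: polD|apply/funext => eta /=; rewrite ReD].
by rewrite (_ : _ \o _ = fun eta => (ImC \o F) eta + (ImC \o G) eta); [exact: polD|apply/funext => eta /=; rewrite ImD].
Qed.

Lemma cpolM F G : cpol F -> cpol G -> cpol (fun eta => F eta * G eta).
Proof.
move=> [f1 f2] [g1 g2]; split.
 rewrite (_ : _ \o _ = fun eta => (ReC \o F) eta * (ReC \o G) eta - (ImC \o F) eta * (ImC \o G) eta).
  by apply: polB; exact: polM.
 by apply/funext => eta /=; rewrite ReM.
rewrite (_ : _ \o _ = fun eta => (ReC \o F) eta * (ImC \o G) eta + (ImC \o F) eta * (ReC \o G) eta).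
 by apply: polD; exact: polM.
by apply/funext => eta /=; rewrite ImM.
Qed.

Lemma cpol_cst c : cpol (fun=> c).
Proof. by split; exact: pol_cst. Qed.

Lemma cpol_chermite k l F G : cpol F -> cpol G -> cpol (fun eta => chermite k l (F eta) (G eta)).
Proof.
move=> pF pG; elim: k l => [|k IH] l.
 elim: l => [|l IH]; first exact: cpol_cst.
 rewrite (_ : (fun _ => _) = fun eta => (-1 * G eta) * chermite 0 l (F eta) (G eta)).
  by apply: cpolM => //; apply: cpolM => //; exact: cpol_cst.
 by apply/funext => eta; rewrite /= exprS mulN1r.
exact: (cpolD (cpolM pF (IH l)) (cpolM (cpol_cst _) (IH l.-1))).
Qed.

Lemma pol_horner p (f : heis R n -> R) : pol f -> pol (fun eta => p.[f eta]).
Proof.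
move=> pf; elim/poly_ind: p => [|p c IH].
 by under eq_fun do rewrite horner0; exact: pol_cst.
under eq_fun do rewrite hornerMXaddC.
by apply: polD; [exact: polM|exact: pol_cst].
Qed.

Variables (a sg : R) (k l : {ffun 'I_n -> nat}).
Hypotheses (a0 : 0 < a) (sg2 : sg ^+ 2 = 1).

(** The Gaussian exponent of a wave times [hrho]; it dominates a positive multiple of [sqN], as the
    Gaussian lemmas require. *)
Definition wave_weight (eta : heis R n) : R := a ^+ 2 / 4 * sqz eta + 4^-1 * eta.2 ^+ 2.

Lemma pol_wave_weight : pol wave_weight.
Proof.
apply: polD; apply: polM; first exact: pol_cst.
- exact: pol_sqz.
- exact: pol_cst.
- by apply: pol_sqr; exact: pol_t.
Qed.

Lemma wave_weight_ge : exists2 c, 0 < c & forall eta : heis R n, c * sqN eta <= wave_weight eta.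
Proof.
have a2 : 0 < a ^+ 2 / 4 by rewrite divr_gt0// exprn_gt0.
exists (Num.min (a ^+ 2 / 4) 4^-1); first by rewrite lt_min a2 invr_gt0 ltr0n.
move=> eta; rewrite /sqN mulrDr lerD// ler_wpM2r ?sqz_ge0 ?sqr_ge0//.
 by rewrite ge_min lexx.
by rewrite ge_min lexx orbT.
Qed.

Lemma wave_pol : exists2 F, cpol F & forall eta : heis R n,
 wave a sg k l eta = F eta * (expR (- (a ^+ 2 / 4 * sqz eta)))%:C%C.
Proof.
exists (fun eta : heis R n => \prod_(i < n) chermite (k i) (l i)
  (Complex (a * eta.1.1 ord0 i) (a * sg * eta.1.2 ord0 i))
  (Complex (a * eta.1.1 ord0 i) (- (a * sg) * eta.1.2 ord0 i))).
 elim: (index_enum _) => [|i s IH].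
  by under eq_fun do rewrite big_nil; exact: cpol_cst.
 under eq_fun do rewrite big_cons; apply: cpolM => //.
 by apply: cpol_chermite; split; apply: polM; (exact: pol_cst || exact: pol_x || exact: pol_y).
move=> eta; rewrite /wave big_split /= mulrC; congr (_ * _).
rewrite -rmorph_prod /= -(big_morph expR (@expRD R) (@expR0 R)); congr (expR _)%:C%C.
by rewrite -mulr_sumr mulNr.
Qed.

(** The m-th derivative of p(t/2) exp(-t^2 / 4). The scale is that of the Fourier transforms of
    polynomials times exp(-v^2), see [gfour_hermite]. *)
Definition hrho p m t : R := (2^-1) ^+ m * pgauss (iter m (@hop R) p) 1 (t / 2).

Lemma smooth1_hrho p : smooth1 (hrho p).
Proof.
move=> m t; rewrite /hrho exprS.
have d2 : is_derive t 1 (fun t : R => t / 2) (1 / 2 + t * 0).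
 apply: (@drv_eq _ _ _ (1 * 2^-1 + t * 0)); last by [].
 exact: (drvM (drv_id t) (drv_cst 2^-1 t)).
apply: (drv_eq (drvZ _ (drv_comp (pgauss_hop _ _) d2))); rewrite iterS; ring.
Qed.

Let wave_hrho p m : exists2 F, cpol F & forall eta : heis R n,
 wave a sg k l eta * (hrho p m eta.2)%:C%C = F eta * (expR (- wave_weight eta))%:C%C.
Proof.
have [F pF hF] := wave_pol.
exists (fun eta => F eta * (2^-1 ^+ m * (iter m (@hop R) p).[eta.2 / 2])%:C%C).
 apply: cpolM => //; split; last exact: pol_cst.
 apply: polM; first exact: pol_cst.
 by apply: pol_horner; apply: polM; [exact: pol_t|exact: pol_cst].
move=> eta; rewrite hF /hrho /pgauss /wave_weight opprD expRD.
have -> : 1 * (eta.2 / 2) ^+ 2 = 4^-1 * eta.2 ^+ 2 by field.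
rewrite !rmorphM /=; ring.
Qed.

Lemma L2_pol_gauss F : cpol F -> L2 hm (fun eta => F eta * (expR (- wave_weight eta))%:C%C).
Proof.
have [c c0 hc] := wave_weight_ge => -[p1 p2].
have s1 := sqintg_L2 (pg_sqintg pol_wave_weight c0 hc p1).
have s2 := sqintg_L2 (pg_sqintg pol_wave_weight c0 hc p2).
move: (L2D s1 (L2Z 'i%C s2)); congr L2; apply/funext => eta.
by apply: complexP; rewrite !cE /pg /=; ring.
Qed.

Lemma L2_wave p m : L2 hm (fun eta => wave a sg k l eta * (hrho p m eta.2)%:C%C).
Proof.
have [F pF hF] := wave_hrho p m; under eq_fun do rewrite hF.
exact: L2_pol_gauss.
Qed.

(** The real and imaginary parts of the wave are polynomials times exp(- [wave_weight]), hence
    covered by [weak_sublaplacian_pg]. *)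
Lemma weak_sublaplacian_wave (f g : heis R n -> R[i]) p : L2 hm f -> L2 hm g ->
 (forall H, test_function H -> inner hm f (fun eta => - sublaplacian H eta) = inner hm g H) ->
 inner hm f (fun eta => - sublaplacian (fun eta => wave a sg k l eta * (hrho p 0 eta.2)%:C%C) eta) =
 inner hm g (fun eta => wave a sg k l eta * (hrho p 0 eta.2)%:C%C).
Proof.
move=> f2 g2 weak; have [F [p1 p2] hF] := wave_hrho p 0.
have [c c0 hc] := wave_weight_ge.
have w1 := weak_sublaplacian_pg pol_wave_weight c0 hc p1 f2 g2 weak.
have w2 := weak_sublaplacian_pg pol_wave_weight c0 hc p2 f2 g2 weak.
pose u := pg wave_weight (ReC \o F); pose v := pg wave_weight (ImC \o F).
have E : (fun eta => wave a sg k l eta * (hrho p 0 eta.2)%:C%C) = fun eta => (u eta)%:C%C + 'i%C * (v eta)%:C%C.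
 by apply/funext => eta; rewrite hF /u /v /pg; apply: complexP; rewrite !cE /=; ring.
have E2 : (fun eta => - sublaplacian (fun eta => wave a sg k l eta * (hrho p 0 eta.2)%:C%C) eta) =
  fun eta => (- sublaplacianR u eta)%:C%C + 'i%C * (- sublaplacianR v eta)%:C%C.
 apply/funext => eta; rewrite E; apply: complexP; rewrite !cE /=.
  rewrite (_ : _ \o _ = u); first by rewrite mul0r mulr0 subrr addr0.
  by apply/funext => z /=; rewrite mul0r mul1r subrr addr0.
 rewrite (_ : _ \o _ = v); first by rewrite mul0r !add0r mul1r.
 by apply/funext => z /=; rewrite mul0r mul1r !add0r.
have lap2 P : pol P -> L2 hm (fun eta => (- sublaplacianR (pg wave_weight P) eta)%:C%C).
 move=> pP; pose Z b j Q := zpol wave_weight b j Q.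
 have -> : (fun eta => (- sublaplacianR (pg wave_weight P) eta)%:C%C) =
   fun eta => \sum_(j < n) ((-1) * (pg wave_weight (Z true j (Z true j P)) eta)%:C%C +
    (-1) * (pg wave_weight (Z false j (Z false j P)) eta)%:C%C).
  apply/funext => eta; rewrite sublaplacianRE -sumrN rmorph_sum; apply: eq_bigr => j _.
  rewrite !(fieldZ_pg pol_wave_weight) //; try exact: (pol_zpol pol_wave_weight).
  by rewrite !mulN1r -opprD rmorphN rmorphD.
 apply: L2_sum => j _.
 have pZ b : pol (Z b j (Z b j P)) by do 2! apply: (pol_zpol pol_wave_weight).
 apply: L2D; apply: L2Z; apply: sqintg_L2; exact: (pg_sqintg pol_wave_weight c0 hc (pZ _)).
have u2 := sqintg_L2 (pg_sqintg pol_wave_weight c0 hc p1).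
have v2 := sqintg_L2 (pg_sqintg pol_wave_weight c0 hc p2).
rewrite E2 E.
apply: eq_trans (innerDr f2 (lap2 _ p1) (L2Z _ (lap2 _ p2))) _.
apply: esym; apply: eq_trans (innerDr g2 u2 (L2Z _ v2)) _.
congr (_ + _); first exact: (esym w1).
apply: eq_trans (innerZr _ g2 v2) _; apply: esym; apply: eq_trans (innerZr _ f2 (lap2 _ p2)) _.
by congr (_ * _); exact: w2.
Qed.

End intertwining_waves.

(** * Intertwining with the symbol *)

Section pairings.
Context d (T : measurableType d) (R : realType) (mu : {measure set T -> \bar R}).

(** Multiplying f by the conjugate of the inner product makes the pairing real, so that [rip_CS]
    applies. *)
Lemma inner_CS (f g : T -> R[i]) : L2 mu f -> L2 mu g ->
 sqnormC (inner mu f g) <= nrm mu f * nrm mu g.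
Proof.
move=> f2 g2; set I := inner mu f g.
have h2 := L2Z (conjc I) f2; have CS := rip_CS h2 g2.
have E : rip mu (fun x => conjc I * f x) g = sqnormC I.
 by rewrite /rip innerZ// !cE /sqnormC -/I; ring.
move: CS; rewrite E nrmZ// sqnormC_conj expr2 -mulrA => CS.
have [s0|s0] := eqVneq (sqnormC I) 0; first by rewrite s0 mulr_ge0 ?nrm_ge0.
by rewrite -(ler_pM2l (_ : 0 < sqnormC I)) // lt_neqAle eq_sym s0 sqnormC_ge0.
Qed.

Lemma integralC_CS (f g : T -> R[i]) : L2 mu f -> L2 mu g ->
 sqnormC (integralC mu (fun x => f x * g x)) <= nrm mu f * nrm mu g.
Proof.
move=> f2 g2; have g2' := L2_conj g2.
have := inner_CS f2 g2'; rewrite /inner.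
have -> : nrm mu (fun x => conjc (g x)) = nrm mu g.
 by rewrite !nrmE; apply: eq_Rintegral => x _; rewrite sqnormC_conj.
congr (sqnormC (integralC _ _) <= _); apply/funext => x; congr (_ * _).
by apply: complexP; rewrite !cE ?opprK.
Qed.

Lemma inner_cvg (f_ : nat -> T -> R[i]) f h : (forall j, L2 mu (f_ j)) -> L2 mu f -> L2 mu h ->
 nrm mu (fun x => f_ j x - f x) @[j --> \oo] --> 0 ->
 sqnormC (inner mu (f_ j) h - inner mu f h) @[j --> \oo] --> 0.
Proof.
move=> f2 F2 h2 c0.
apply: (@squeeze_cvgr _ _ _ _ (fun=> 0) (fun j => nrm mu (fun x => f_ j x - f x) * nrm mu h)).
- apply: nearW => j; rewrite sqnormC_ge0 /=.
 have -> : inner mu (f_ j) h - inner mu f h = inner mu (fun x => f_ j x - f x) h.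
  rewrite -mulN1r -(innerZ _ F2 h2) -(innerD (f2 j) (L2Z _ F2) h2).
  by congr inner; apply/funext => x; rewrite mulN1r.
 exact: inner_CS (L2B (f2 j) F2) h2.
- exact: cvg_cst.
- by rewrite -(mul0r (nrm mu h)); apply: cvgM => //; exact: cvg_cst.
Qed.

(** Complex limits are expressed by the real quantity [sqnormC] of a difference, hence a uniqueness
    statement in this form. *)
Lemma sqnormC_cvg_unique (u v : nat -> R[i]) (a b : R[i]) : (forall j, u j = v j) ->
 sqnormC (u j - a) @[j --> \oo] --> 0 -> sqnormC (v j - b) @[j --> \oo] --> 0 -> a = b.
Proof.
move=> uv ua vb; apply/eqP; rewrite -subr_eq0; apply/eqP; apply: sqnormC_eq0; apply/eqP.
rewrite eq_le sqnormC_ge0 andbT.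
have c : 2 * (sqnormC (v j - b) + sqnormC (u j - a)) @[j --> \oo] --> (2 * (0 + 0) : R).
 by apply: cvgM; [exact: cvg_cst|exact: cvgD].
rewrite (_ : 0 = 2 * (0 + 0)); last by ring.
apply: (ler_cvg_to (cvg_cst _) c); apply: nearW => j.
rewrite (_ : a - b = (v j - b) + - (u j - a)); last by rewrite uv; ring.
by rewrite (le_trans (sqnormCD_le _ _))// sqnormCN.
Qed.

End pairings.

Lemma ae_snd d1 d2 (X : measurableType d1) (Y : measurableType d2) (R : realType)
  (m1 : {sigma_finite_measure set X -> \bar R}) (m2 : {sigma_finite_measure set Y -> \bar R})
  (P : set Y) :
 {ae m2, forall y, P y} -> {ae pmeas m1 m2, forall z, P z.2}.
Proof.
move=> [N [mN N0 PN]]; exists (setT `*` N); split.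
- exact: measurableX.
- by apply: eq_trans (product_measure1E _ _ _ _) _; rewrite ?N0 ?mule0.
- by move=> z Pz; split => //; apply: PN.
Qed.

Section counting_slices.
Context {R : realType}.

Lemma slice_le (G : R * nat -> R[i]) m : L2 KK G ->
 L2 leb (fun lam => G (lam, m)) /\ nrm leb (fun lam => G (lam, m)) <= nrm KK G.
Proof.
move=> G2; have mG := G2.1.
have mq : meas (fun p => (sqnormC (G p))%:E).
 by apply/mEFinP; exact: measurable_sqnormC.
have q0 p : (0 <= (sqnormC (G p))%:E)%E by rewrite lee_fin sqnormC_ge0.
have E : (sqL2norm KK G = \sum_(0 <= k <oo) sqL2norm leb (fun lam => G (lam, k)))%E.
 by rewrite /sqL2norm (Tonelli2 leb (@counting nat R) mq q0) ge0_integral_count// => k;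
   apply: integral_ge0.
have le : (sqL2norm leb (fun lam => G (lam, m)) <= sqL2norm KK G)%E.
 have a0 k : true -> (0 <= sqL2norm leb (fun lam => G (lam, k)))%E by move=> _; apply: integral_ge0.
 rewrite E (@nneseriesD1 _ _ m xpredT a0 isT).
 by rewrite leeDl//; apply: nneseries_ge0 => k _ _; apply: integral_ge0.
have S2 : L2 leb (fun lam => G (lam, m)).
 by split; [exact: (mc_comp mG (pair2_meas m))|exact: le_lt_trans le G2.2].
split=> //; by rewrite -lee_fin -!sqL2E.
Qed.

End counting_slices.

(** * Gaussian bounds for the wave profiles *)

Section gaussian_decay.
Context {R : realType}.

Lemma pow_exp_bound m (e : R) : 0 < e ->
 exists2 C, 0 <= C & forall s, 0 <= s -> s ^+ m <= C * expR (e * s).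
Proof.
move=> e0; have [C C0 h] := @poly_exp_bound R ('X^m); exists (e ^- m * C).
 by rewrite mulr_ge0// invr_ge0 exprn_ge0// ltW.
move=> s s0; have es0 := mulr_ge0 (ltW e0) s0; have := h (e * s) es0.
rewrite hornerXn normrM (ger0_norm (expR_ge0 _)) (ger0_norm (exprn_ge0 m es0)).
rewrite exprMn expRN ler_pdivrMr ?expR_gt0// => H.
by rewrite -mulrA ler_pdivlMl ?exprn_gt0.
Qed.

Lemma sqnormC_X (z : R[i]) m : sqnormC (z ^+ m) = sqnormC z ^+ m.
Proof.
elim: m => [|m IH]; first by rewrite !expr0 /sqnormC /= expr1n expr0n addr0.
by rewrite !exprS sqnormCM IH.
Qed.

Lemma sqnormC_real (x : R) : sqnormC x%:C%C = x ^+ 2.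
Proof. by rewrite /sqnormC /= expr0n addr0. Qed.

Lemma chermite_bound k l (e : R) : 0 < e -> exists2 C, 0 <= C &
 forall z w, sqnormC w = sqnormC z -> sqnormC (chermite k l z w) <= C * expR (e * sqnormC z).
Proof.
elim: k l e => [|k IH] l e e0.
 have [C C0 h] := pow_exp_bound l e0; exists C => // z w zw.
 by rewrite /= sqnormC_X sqnormCN zw h// sqnormC_ge0.
have e2 : 0 < e / 2 by rewrite divr_gt0.
have [C1 C10 h1] := IH l _ e2; have [C2 C20 h2] := IH l.-1 _ e2.
have [C3 C30 h3] := pow_exp_bound 1 e2.
exists (2 * (C3 * C1 + (2 * l%:R) ^+ 2 * C2)).
 by rewrite mulr_ge0// addr_ge0// mulr_ge0// sqr_ge0.
move=> z w zw; rewrite chermiteS (le_trans (sqnormCD_le _ _))// -[leRHS]mulrA ler_wpM2l//.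
have z0 := sqnormC_ge0 z.
rewrite [leRHS]mulrDl !sqnormCM lerD//.
 rewrite (_ : e * sqnormC z = e / 2 * sqnormC z + e / 2 * sqnormC z); last by field.
 rewrite expRD mulrACA ler_pM ?sqnormC_ge0//; last exact: h1.
 by have := h3 _ z0; rewrite expr1.
have -> : sqnormC (2 : R[i]) * sqnormC (l%:R : R[i]) = (2 * l%:R) ^+ 2.
 by rewrite -sqnormCM -[2]/(2%:R) -natrM -(rmorph_nat (@real_complex R)) sqnormC_real natrM.
rewrite -mulrA ler_wpM2l ?sqr_ge0//; apply: (le_trans (h2 _ _ zw)).
by rewrite ler_wpM2l// ler_expR ler_wpM2r//; move: e0; lra.
Qed.

Variable n : nat.
Implicit Types z : 'rV[R]_n * 'rV[R]_n.

Definition gz c z : R := expR (- (c * sqz (z, 0 : R))).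

Lemma gz_integral c : 0 < c -> intg lr2 (gz c) /\ \int[lr2]_z gz c z = (pi / c) ^+ n.
Proof.
move=> c0; pose phi (x : R) : R[i] := (expR (- (c * x ^+ 2)))%:C%C.
have phi1 : L1 leb phi by apply/L1P; split; [exact: intg_gauss|exact: intg0].
have [row1 rowE] := @integralC_prod R n (fun=> phi) (fun=> phi1).
pose G (w : 'rV[R]_n) : R := \prod_(i < n) expR (- (c * w ord0 i ^+ 2)).
have GE (w : 'rV[R]_n) : \prod_(i < n) phi (w ord0 i) = (G w)%:C%C by rewrite /phi /G rmorph_prod.
have fE : (fun w : 'rV[R]_n => \prod_(i < n) phi (w ord0 i)) = fun w => (G w)%:C%C.
 by apply/funext.
rewrite fE in row1 rowE; have /L1P[/= G1 _] := row1.
have IG : \int[lr]_w G w = Num.sqrt (pi / c) ^+ n.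
 have := congr1 (@complex.Re R) rowE; rewrite /= => ->.
 have -> : integralC leb phi = (Num.sqrt (pi / c))%:C%C.
  by apply: complexP; rewrite /= ?Rint_gauss// Rintg0.
 by rewrite prodr_const card_ord -rmorphXn.
have gE : gz c = fun z => G z.1 * G z.2.
 apply/funext => z; rewrite /gz /G -!(big_morph expR (@expRD R) (@expR0 R))/= -!expRD; congr expR.
 by rewrite /sqz big_split/= !sumrN -!mulr_sumr; ring.
rewrite gE; split; first exact: intg_tensor.
rewrite Rint_tensor// IG -exprMn -expr2 sqr_sqrtr// divr_ge0 ?pi_ge0// ltW//.
Qed.

Lemma measurable_gz c : meas (gz c).
Proof.
apply: mcomp => //; apply: mcomp => //; apply: measurable_funM => //.
exact: (mcomp (sm_measurable (pol_sm (@pol_sqz R n))) (pair2_meas (0 : R))).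
Qed.

Lemma gz_le c c' z : c' <= c -> gz c z <= gz c' z.
Proof. by move=> cc; rewrite ler_expR lerN2 ler_wpM2r// sqz_ge0. Qed.

Definition wavez a sg (k l : {ffun 'I_n -> nat}) z : R[i] := wave a sg k l (z, 0 : R).

Lemma waveE a sg k l (eta : heis R n) : wave a sg k l eta = wavez a sg k l eta.1.
Proof. by []. Qed.

Lemma sqzE (eta : heis R n) : sqz eta = sqz (eta.1, 0 : R).
Proof. by []. Qed.

(** The squared modulus contains exp(-a^2 |z|^2 / 2), half of which absorbs the polynomial. That
    polynomial depends on a z only, so one [C] serves all a and sg. *)
Lemma wavez_bound k l : exists2 C, 0 <= C & forall a sg z, sg ^+ 2 = 1 ->
 sqnormC (wavez a sg k l z) <= C * gz (a ^+ 2 / 4) z.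
Proof.
have h i : exists C, 0 <= C /\ forall z w : R[i], sqnormC w = sqnormC z ->
  sqnormC (chermite (k i) (l i) z w) <= C * expR (4^-1 * sqnormC z).
 have [C C0 hC] := @chermite_bound (k i) (l i) 4^-1 ltac:(by rewrite invr_gt0 ltr0n).
 by exists C.
have [D hD] := choice h.
exists (\prod_(i < n) D i) => [|a sg z sg2]; first by apply: prodr_ge0 => i _; have [] := hD i.
have -> : sqnormC (wavez a sg k l z) = \prod_(i < n) sqnormC
 ((expR (- (a ^+ 2 / 4) * (z.1 ord0 i ^+ 2 + z.2 ord0 i ^+ 2)))%:C%C *
  chermite (k i) (l i) (Complex (a * z.1 ord0 i) (a * sg * z.2 ord0 i))
  (Complex (a * z.1 ord0 i) (- (a * sg) * z.2 ord0 i))).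
 rewrite /wavez /wave; apply: (big_morph _ sqnormCM).
 by rewrite (sqnormC_real 1) expr1n.
have -> : gz (a ^+ 2 / 4) z = \prod_(i < n) expR (- (a ^+ 2 / 4) * (z.1 ord0 i ^+ 2 + z.2 ord0 i ^+ 2)).
 by rewrite -(big_morph expR (@expRD R) (@expR0 R)) -mulr_sumr mulNr.
rewrite -big_split /=; apply: ler_prod => i _; rewrite sqnormC_ge0 /=.
rewrite sqnormCM sqnormC_real; move: (z.1 ord0 i) (z.2 ord0 i) => x y.
have zw : sqnormC (Complex (a * x) (- (a * sg) * y)) = sqnormC (Complex (a * x) (a * sg * y)).
 by rewrite /sqnormC /= mulNr sqrrN.
have [_ /(_ _ _ zw) H] := hD i.
apply: (le_trans (ler_wpM2l (sqr_ge0 _) H)).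
have -> : sqnormC (Complex (a * x) (a * sg * y)) = a ^+ 2 * (x ^+ 2 + y ^+ 2).
 by rewrite /sqnormC /= !exprMn sg2; ring.
by rewrite mulrCA expr2 -!expRD le_eqVlt; apply/orP; left; apply/eqP; congr (_ * expR _); field.
Qed.

Lemma mc_wavez a sg k l : measC (wavez a sg k l).
Proof.
apply: mc_prod => i.
have mx : meas (fun z : 'rV[R]_n * 'rV[R]_n => z.1 ord0 i).
 exact: (mcomp (measurable_coord i) measurable_fst).
have my : meas (fun z : 'rV[R]_n * 'rV[R]_n => z.2 ord0 i).
 exact: (mcomp (measurable_coord i) measurable_snd).
apply: mcM.
 apply: mc_real; apply: mcomp => //; apply: measurable_funM => //.
 by apply: measurable_funD; apply: measurable_funX; [exact: mx|exact: my].
elim: (k i) (l i) => [|k' IH] l'.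
 elim: l' => [|l' IH]; first exact: mc_cst.
 rewrite (_ : (fun _ => _) = fun z => - (Complex (a * z.1 ord0 i) (- (a * sg) * z.2 ord0 i)) *
  chermite 0 l' (Complex (a * z.1 ord0 i) (a * sg * z.2 ord0 i))
   (Complex (a * z.1 ord0 i) (- (a * sg) * z.2 ord0 i))).
  by apply: mcM => //; apply: mcN; apply: mc_Complex; apply: measurable_funM.
 by apply/funext => z; rewrite /= exprS.
by apply: mcD; apply: mcM => //; [apply: mc_Complex; apply: measurable_funM|exact: mc_cst].
Qed.

Lemma conjcD (z w : R[i]) : conjc (z + w) = conjc z + conjc w.
Proof. by apply: complexP; rewrite !cE ?opprD. Qed.

Lemma conj_chermite k l (z w : R[i]) : conjc (chermite k l z w) = chermite k l (conjc z) (conjc w).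
Proof.
elim: k l => [|k IH] l /=; first by rewrite rmorphXn rmorphN.
by rewrite conjcD !conjcM !IH !conjc_nat.
Qed.

Definition wave_const (k l : {ffun 'I_n -> nat}) : R :=
 \prod_(i < n) (hnorm (k i) * hnorm (l i) * Num.sqrt pi).

Lemma wigner_wave lam k l z : wigner_row lam k l z =
 (wave_const k l)%:C%C * conjc (wavez (Num.sqrt `|lam|) (Num.sg lam) k l z).
Proof.
rewrite /wigner_row /wavez /wave /wave_const rmorph_prod (rmorph_prod (@conjc R)) -big_split /=.
apply: eq_bigr => i _; rewrite wigner_scale wigner_chermite conjcM conj_chermite.
set a := Num.sqrt `|lam|; move: (z.1 ord0 i) (z.2 ord0 i) => x y.
have a2 : (Num.sg lam) ^+ 2 * a ^+ 2 = a ^+ 2.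
 rewrite /a; have [->|l0] := eqVneq lam 0; first by rewrite normr0 sqrtr0 expr0n mulr0.
 by rewrite sqr_sg l0 mul1r.
have -> : expR (- (4^-1 * ((a * x) ^+ 2 + (Num.sg lam * a * y) ^+ 2))) =
  expR (- (a ^+ 2 / 4) * (x ^+ 2 + y ^+ 2)).
 by congr expR; rewrite !exprMn a2; ring.
have -> : conjc (Complex (a * x) (a * Num.sg lam * y)) = Complex (a * x) (- (Num.sg lam * a * y)).
 by rewrite /= (mulrC a (Num.sg lam)).
have -> : conjc (Complex (a * x) (- (a * Num.sg lam) * y)) = Complex (a * x) (Num.sg lam * a * y).
 by rewrite /= mulNr opprK (mulrC a (Num.sg lam)).
rewrite conjc_real rmorphM /=; move: (chermite _ _ _ _) => ?; rewrite mulrA //.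
Qed.

Lemma wigner_row_bound k l : exists2 C, 0 <= C & forall lam z, lam != 0 ->
 sqnormC (wigner_row lam k l z) <= C * gz (`|lam| / 4) z.
Proof.
have [C C0 h] := wavez_bound k l; exists (wave_const k l ^+ 2 * C).
 by rewrite mulr_ge0// sqr_ge0.
move=> lam z l0; rewrite wigner_wave sqnormCM sqnormC_real sqnormC_conj -[leRHS]mulrA ler_wpM2l ?sqr_ge0//.
have := h (Num.sqrt `|lam|) (Num.sg lam) z; rewrite sqr_sg l0 sqr_sqrtr// => H; exact: H.
Qed.

End gaussian_decay.

(** * The transform in the central variable *)

Section partial_fourier_L2.
Context {R : realType} (n : nat).
Hypothesis n0 : (0 < n)%N.
Local Notation idx := {ffun 'I_n -> nat}.
Implicit Types (f : heis R n -> R[i]) (F : R * ('rV[R]_n * 'rV[R]_n) -> R[i]).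

Definition partialF f (p : R * ('rV[R]_n * 'rV[R]_n)) := partial_fourier f p.1 p.2.

Lemma partialF_L2 f : L12 hm f -> L2 mF (partialF f) /\ nrm mF (partialF f) = 2 * pi * nrm hm f.
Proof.
move=> f12; have mP := mc_partial_fourier f12.2.1.
have mq : meas (fun p => (sqnormC (partialF f p))%:E).
 by apply/mEFinP; exact: measurable_sqnormC.
have q0 p : (0 <= (sqnormC (partialF f p))%:E)%E by rewrite lee_fin sqnormC_ge0.
have E : sqL2norm mF (partialF f) = ((2 * pi)%:E * sqL2norm hm f)%E.
 by rewrite -(partial_fourier_Plancherel f12).2 /sqL2norm (Tonelli1 leb lr2 mq q0).
split; last by rewrite /nrm E fineM//; rewrite (sqL2E f12.2).
split; first exact: mP.
by rewrite E (sqL2E f12.2) -EFinM ltry.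
Qed.

(** Additivity is guaranteed only for those z for which both functions are integrable in tau; by
    Fubini these are almost all. *)
Lemma partialFB_ae f g : L1 hm f -> L1 hm g ->
 {ae mF, forall p, partialF (fun x => f x - g x) p = partialF f p - partialF g p}.
Proof.
move=> f1 g1.
have h : {ae lr2, forall z, L1 leb (fun t => f (z, t)) /\ L1 leb (fun t => g (z, t))}.
 by apply: aeS2 (L1_prod_ae f1) (L1_prod_ae g1) _ => z.
apply: aeS (ae_snd leb h) _ => -[lam z] /= [fz gz].
have mt : meas (fun t : R => - (lam * t)).
 by apply: mcomp => //; exact: measurable_funM.
rewrite /partialF /partial_fourier /fourier1 -integralCB; first last.
- exact: L1_expi gz mt.
- exact: L1_expi fz mt.
by congr integralC; apply/funext => t; rewrite mulrBl.
Qed.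

Lemma nrm_partialFB f g : L12 hm f -> L12 hm g ->
 nrm mF (fun p => partialF f p - partialF g p) = 2 * pi * nrm hm (fun x => f x - g x).
Proof.
move=> f12 g12.
have h12 : L12 hm (fun x => f x - g x) by split; [exact: L1B f12.1 g12.1|exact: L2B f12.2 g12.2].
rewrite -(partialF_L2 h12).2; apply: nrm_ae.
- by apply: mcB; [exact: (partialF_L2 f12).1.1|exact: (partialF_L2 g12).1.1].
- exact: (partialF_L2 h12).1.1.
- by apply: aeS (partialFB_ae f12.1 g12.1) _ => p ->.
Qed.

(* The wave profiles have norm of order |lam|^(-n/2), which the weight |lam|^(n/2)
  of the Plancherel measure compensates. *)
Definition waveT k l F lam : R[i] := (Num.sqrt (`|lam| ^+ n))%:C%C *
 integralC lr2 (fun z => F (lam, z) * wigner_row lam k l z).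

Lemma L2_wigner_row (lam : R) (k l : idx) : lam != 0 -> L2 lr2 (wigner_row lam k l).
Proof.
move=> l0; have [C C0 h] := @wigner_row_bound R n k l.
have c0 : 0 < `|lam| / 4 by rewrite divr_gt0// normr_gt0.
have [i _] := @gz_integral R n _ c0.
apply/L2P; split; first exact: mc_wigner_row1.
apply: intg_le (intgZ C i).
 by apply: measurable_sqnormC; exact: mc_wigner_row1.
by move=> z; rewrite ger0_norm ?sqnormC_ge0//; exact: h.
Qed.

Lemma waveT_bound (k l : idx) : exists2 C, 0 <= C & forall F lam, lam != 0 ->
 L2 lr2 (fun z => F (lam, z)) ->
 sqnormC (waveT k l F lam) <= C * nrm lr2 (fun z => F (lam, z)).
Proof.
have [C C0 h] := @wigner_row_bound R n k l.
exists (C * (4 * pi) ^+ n); first by rewrite mulr_ge0// exprn_ge0// mulr_ge0// pi_ge0.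
move=> F lam l0 F2; have W2 := L2_wigner_row k l l0.
have lam0 : 0 < `|lam| by rewrite normr_gt0.
have c0 : 0 < `|lam| / 4 by rewrite divr_gt0.
have [i I] := @gz_integral R n _ c0.
have W : nrm lr2 (wigner_row lam k l) <= C * (pi / (`|lam| / 4)) ^+ n.
 rewrite nrmE -I -RintZ//; apply: Rint_le.
 - by have /L2P[] := W2.
 - exact: intgZ.
 - by move=> z; exact: h.
rewrite /waveT sqnormCM sqnormC_real sqr_sqrtr ?exprn_ge0//.
apply: (le_trans (ler_wpM2l _ (integralC_CS F2 W2))); first by rewrite exprn_ge0.
apply: (le_trans (ler_wpM2l _ (ler_wpM2l _ W))); rewrite ?exprn_ge0 ?nrm_ge0//.
have -> : (pi / (`|lam| / 4)) ^+ n = `|lam| ^- n * (4 * pi) ^+ n.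
 rewrite -exprVn -exprMn; congr (_ ^+ n); field; exact: lt0r_neq0.
rewrite le_eqVlt; apply/orP; left; apply/eqP.
have Ln0 : `|lam| ^+ n != 0 by rewrite expf_neq0// gt_eqF.
by move: (nrm _ _) ((4 * pi) ^+ n) (`|lam| ^+ n) Ln0 => N P L L0; field.
Qed.

Lemma mc_waveT (k l : idx) F : measC F -> measC (waveT k l F).
Proof.
move=> mF; apply: mcM.
 by apply: mc_real; exact: measurable_sqrt_normX.
apply: (mc_integral lr2 (f := fun q : R * ('rV[R]_n * 'rV[R]_n) => F q * wigner_row q.1 k l q.2)).
by apply: mcM => //; exact: mc_wigner_row.
Qed.

Lemma ae_neq0 : {ae leb, forall lam : R, lam != 0}.
Proof.
exists [set 0]; split; [exact: measurable_set1|exact: lebesgue_measure_set1|].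
by move=> x /= /negP; rewrite negbK => /eqP.
Qed.

Lemma waveT_nrm (k l : idx) : exists2 C, 0 <= C & forall F, L2 mF F ->
 L2 leb (waveT k l F) /\ nrm leb (waveT k l F) <= C * nrm mF F.
Proof.
have [C C0 h] := waveT_bound k l; exists C => // F F2; have mFF := F2.1.
have mT := mc_waveT k l mFF.
have mq : meas (fun p => (sqnormC (F p))%:E).
 by apply/mEFinP; exact: measurable_sqnormC.
have q0 p : (0 <= (sqnormC (F p))%:E)%E by rewrite lee_fin sqnormC_ge0.
have E : sqL2norm mF F = (\int[leb]_lam sqL2norm lr2 (fun z => F (lam, z)))%E.
 by rewrite /sqL2norm (Tonelli1 leb lr2 mq q0).
have le : (sqL2norm leb (waveT k l F) <= C%:E * sqL2norm mF F)%E.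
 rewrite E -ge0_integralZl//; last 2 first.
 - exact: (measurable_Tonelli1 lr2 mq q0).
 - by move=> x _; apply: integral_ge0.
 apply: ae_ge0_le_integral => //.
 - by move=> x _; rewrite lee_fin sqnormC_ge0.
 - by apply/mEFinP; exact: measurable_sqnormC.
 - by move=> x _; rewrite mule_ge0//; apply: integral_ge0.
 - by apply: measurable_funeM; exact: (measurable_Tonelli1 lr2 mq q0).
 - apply: aeS2 ae_neq0 (L2_prod_ae F2) _ => lam l0 Fl _.
  by rewrite (sqL2E Fl) -EFinM lee_fin; exact: h.
have T2 : L2 leb (waveT k l F).
 by split => //; apply: le_lt_trans le _; rewrite (sqL2E F2) -EFinM ltry.
split => //; by rewrite -lee_fin EFinM -(sqL2E T2) -(sqL2E F2).
Qed.

Lemma waveTB (k l : idx) F G : L2 mF F -> L2 mF G ->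
 {ae leb, forall lam, waveT k l (fun p => F p - G p) lam = waveT k l F lam - waveT k l G lam}.
Proof.
move=> F2 G2; apply: aeS2 ae_neq0 _ _; first exact: (filterI (L2_prod_ae F2) (L2_prod_ae G2)).
move=> lam l0 [Fl Gl]; have W2 := L2_wigner_row k l l0.
rewrite /waveT -mulrBr -integralCB; last 2 first.
- exact: L2_mul Fl W2.
- exact: L2_mul Gl W2.
by congr (_ * integralC _ _); apply/funext => z; rewrite mulrBl.
Qed.

(** One sequence serves both the transform in tau and the group transform, so that relations between
    the two pass to the limit together. *)
Definition is_partialF f F := exists f_ : nat -> heis R n -> R[i],
 [/\ forall j, L12 hm (f_ j), L2 mF F,
   nrm hm (fun x => f_ j x - f x) @[j --> \oo] --> 0,
   nrm mF (fun p => partialF (f_ j) p - F p) @[j --> \oo] --> 0 &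
   nrm KK (fun p => fourierK (f_ j) p - toK (fourier f) p) @[j --> \oo] --> 0].

Lemma is_partialF_exists f : L2 hm f -> exists F, is_partialF f F.
Proof.
move=> f2; have [_ g2 [f_ [f12 cf cg]]] := fourierP n0 f2.
have [F F2 cF] : exists2 F, L2 mF F & nrm mF (fun p => partialF (f_ j) p - F p) @[j --> \oo] --> 0.
 apply: Riesz_Fischer => [j|e e0]; first exact: (partialF_L2 (f12 j)).1.
 have p0 : 0 < 2 * pi :> R by rewrite mulr_gt0// pi_gt0.
 have e4 : 0 < e / (2 * pi) / 4 by rewrite !divr_gt0.
 have /cvgr0Pnorm_le /(_ _ e4) [N _ hN] := cf.
 exists N => i j Ni Nj; rewrite (nrm_partialFB (f12 i) (f12 j)).
 rewrite -ler_pdivlMl// mulrC.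
 have bi := hN _ Ni; have bj := hN _ Nj; move: bi bj; rewrite /= !ger0_norm ?nrm_ge0// => bi bj.
 have di := L2B (f12 i).2 f2; have dj := L2B (f12 j).2 f2.
 have := nrmD_le di (L2N dj); rewrite nrmN.
 have -> : (fun x => f_ i x - f x + - (f_ j x - f x)) = (fun x => f_ i x - f_ j x).
  by apply/funext => x; ring.
 move: (nrm hm _) bi bj => N0; lra.
by exists F, f_; split.
Qed.

(** For the approximating functions this is Fubini. Both sides are continuous in L^2, by [slice_le]
    on the left and [waveT_nrm] on the right. *)
Lemma fourier_waveT f F (k l : idx) : L2 hm f -> is_partialF f F ->
 {ae leb, forall lam, toK (fourier f) (lam, pickle (k, l)) = waveT k l F lam}.
Proof.
move=> f2 [f_ [f12 F2 _ cF cg]]; have [_ g2 _] := fourierP n0 f2.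
have [C C0 hC] := waveT_nrm k l.
set m := pickle (k, l); set u := fun lam => toK (fourier f) (lam, m).
have [u2 _] := slice_le m g2; have [v2 _] := hC F F2.
apply: (ae_eq_L2 u2 v2); apply/eqP; rewrite eq_le nrm_ge0 andbT.
pose D j := nrm KK (fun p => fourierK (f_ j) p - toK (fourier f) p).
pose E j := nrm mF (fun p => partialF (f_ j) p - F p).
have c : 2 * (D j + C * E j) @[j --> \oo] --> (2 * (0 + C * 0) : R).
 apply: cvgM; first exact: cvg_cst.
 by apply: cvgD => //; apply: cvgM => //; exact: cvg_cst.
rewrite (_ : 0 = 2 * (0 + C * 0)); last by ring.
apply: (ler_cvg_to (cvg_cst _) c); apply: nearW => j.
have [P2 _] := partialF_L2 (f12 j).
have [K2 _] := fourierK_L2 n0 (f12 j).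
have [s2 sle] := slice_le m (L2B K2 g2).
have [t2 tle] := hC _ (L2B P2 F2).
have hE : {ae leb, forall lam, u lam - waveT k l F lam =
  waveT k l (fun p => partialF (f_ j) p - F p) lam - (fourierK (f_ j) (lam, m) - toK (fourier f) (lam, m))}.
 apply: aeS (waveTB k l P2 F2) _ => lam ->.
 have -> : fourierK (f_ j) (lam, m) = waveT k l (partialF (f_ j)) lam.
  rewrite /fourierK /toK /waveT pickleK_inv; congr (_ * _).
  exact: (fourier_coef_partial lam k l (f12 j).1).2.
 by rewrite /u; ring.
rewrite (nrm_ae (L2B u2 v2).1 (L2B t2 s2).1 hE).
have := nrmD_le t2 (L2N s2); rewrite nrmN => /le_trans; apply.
by rewrite ler_wpM2l// addrC lerD.
Qed.

Section pairing.
Variable V : 'rV[R]_n * 'rV[R]_n -> R[i].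
Hypotheses (V2 : L2 lr2 V) (bV : bddC V).

(** Unlike in [waveT], the profile V is the same for all lam: this is what a test function V(z)
    rho(tau) sees at frequency lam. *)
Definition pairA F lam : R[i] := integralC lr2 (fun z => F (lam, z) * V z).

Lemma mc_pairA F : measC F -> measC (pairA F).
Proof.
move=> mF; apply: (mc_integral lr2 (f := fun q : R * ('rV[R]_n * 'rV[R]_n) => F q * V q.2)).
by apply: mcM => //; exact: (mc_comp V2.1 measurable_snd).
Qed.

Lemma pairA_L2 F : L2 mF F -> L2 leb (pairA F).
Proof.
move=> F2; have mFF := F2.1; have mA := mc_pairA mFF.
have mq : meas (fun p => (sqnormC (F p))%:E).
 by apply/mEFinP; exact: measurable_sqnormC.
have q0 p : (0 <= (sqnormC (F p))%:E)%E by rewrite lee_fin sqnormC_ge0.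
have E : sqL2norm mF F = (\int[leb]_lam sqL2norm lr2 (fun z => F (lam, z)))%E.
 by rewrite /sqL2norm (Tonelli1 leb lr2 mq q0).
have le : (sqL2norm leb (pairA F) <= (nrm lr2 V)%:E * sqL2norm mF F)%E.
 rewrite E -ge0_integralZl//; last 3 first.
 - exact: (measurable_Tonelli1 lr2 mq q0).
 - by move=> x _; apply: integral_ge0.
 - by rewrite lee_fin nrm_ge0.
 apply: ae_ge0_le_integral => //.
 - by move=> x _; rewrite lee_fin sqnormC_ge0.
 - by apply/mEFinP; exact: measurable_sqnormC.
 - by move=> x _; rewrite mule_ge0 ?lee_fin ?nrm_ge0//; apply: integral_ge0.
 - by apply: measurable_funeM; exact: (measurable_Tonelli1 lr2 mq q0).
 - apply: aeS (L2_prod_ae F2) _ => lam Fl _.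
  by rewrite (sqL2E Fl) -EFinM lee_fin mulrC; exact: integralC_CS.
by split => //; apply: le_lt_trans le _; rewrite (sqL2E F2) -EFinM ltry.
Qed.

Variable psi : R -> R[i].
Hypotheses (psi1 : L1 leb psi) (psi2 : L2 leb psi) (rho2 : L2 leb (fourier1 psi)).

Let tensor2 : L2 mF (fun p => psi p.1 * V p.2).
Proof. exact: (L2_tensor (m1 := leb) (m2 := lr2) psi2 V2). Qed.

Lemma pairA_integral F : L2 mF F -> L1 leb (fun lam => psi lam * pairA F lam) /\
 integralC mF (fun p => F p * (psi p.1 * V p.2)) = integralC leb (fun lam => psi lam * pairA F lam).
Proof.
move=> F2; have P1 := L2_mul F2 tensor2.
have [i1 <-] := L1_Fubini1 P1.
have ae_eq : {ae leb, forall lam, integralC lr2 (fun z => F (lam, z) * (psi lam * V z)) = psi lam * pairA F lam}.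
 apply: aeS (L2_prod_ae F2) _ => lam Fl.
 have FV := L2_mul Fl V2.
 by rewrite /pairA -integralCZ//; congr integralC; apply/funext => z; rewrite mulrCA.
have m2 : measC (fun lam => psi lam * pairA F lam).
 by apply: mcM; [exact: psi2.1|exact: mc_pairA F2.1].
split; first exact: (L1_ae (L1_mc i1) m2 ae_eq i1).
exact: (integralC_ae (L1_mc i1) m2 ae_eq).
Qed.

Let pair_L12 f : L12 hm f ->
 integralC hm (fun eta => f eta * (V eta.1 * fourier1 psi eta.2)) =
 integralC mF (fun p => partialF f p * (psi p.1 * V p.2)).
Proof.
move=> f12; have [f1 f2] := f12; have [F2 _] := partialF_L2 f12.
have mV1 : measC (fun eta : heis R n => V eta.1) by exact: (mc_comp V2.1 measurable_fst).
have fV : L1 hm (fun eta => f eta * V eta.1) by apply: L1_bddC => //; exact: (bddC_comp fst bV).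
have mt : meas (fun q : heis R n * R => - (q.1.2 * q.2)).
 apply: mcomp => //; apply: measurable_funM; last exact: measurable_snd.
 exact: (mcomp measurable_snd measurable_fst).
have K1 := L1_expi (L1_tensor fV psi1) mt.
transitivity (integralC (pmeas hm leb) (fun q => f q.1 * V q.1.1 * psi q.2 * expi (- (q.1.2 * q.2)))).
 rewrite -(L1_Fubini1 K1).2; congr integralC; apply/funext => eta.
 have mt' : meas (fun t : R => - (eta.2 * t)).
  by apply: mcomp => //; exact: measurable_funM.
 rewrite mulrA /fourier1 -(integralCZ _ (L1_expi psi1 mt')); congr integralC.
 by apply/funext => lam; rewrite mulrA.
rewrite -(L1_Fubini2 K1).2 (pairA_integral F2).2; congr integralC; apply/funext => lam /=.
have mtl : meas (fun eta : heis R n => - (lam * eta.2)).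
 by apply: mcomp => //; apply: measurable_funM => //; exact: measurable_snd.
have e1 := L1_expi fV mtl.
transitivity (psi lam * integralC hm (fun eta => f eta * V eta.1 * expi (- (lam * eta.2)))).
 rewrite -(integralCZ _ e1); congr integralC; apply/funext => eta.
 by rewrite [lam * _]mulrC; ring.
congr (_ * _); rewrite -(L1_Fubini1 e1).2.
have f1e := L1_expi f1 mtl.
apply: integralC_ae.
- exact: (L1_mc (L1_Fubini1 e1).1).
- apply: mcM; last exact: V2.1.
 exact: (L1_mc (L1_Fubini1 f1e).1).
apply: aeS (L1_prod_ae f1e) _ => z fz.
rewrite /partialF /partial_fourier /fourier1 /= [RHS]mulrC -integralCZ//.
by congr integralC; apply/funext => t; rewrite mulrAC mulrC.
Qed.

(** The multiplication formula of the Fourier transform in tau: the transform moves from psi to f.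
    For integrable f it is Fubini ([pair_L12]), and both sides are continuous in L^2. *)
Lemma is_partialF_pair f F : L2 hm f -> is_partialF f F ->
 integralC hm (fun eta => f eta * (V eta.1 * fourier1 psi eta.2)) =
 integralC leb (fun lam => psi lam * pairA F lam).
Proof.
move=> f2 [f_ [f12 F2 cf cF _]]; rewrite -(pairA_integral F2).2.
have h2 : L2 hm (fun eta => V eta.1 * fourier1 psi eta.2).
 exact: (L2_tensor (m1 := lr2) (m2 := leb) V2 rho2).
have conjE d (T : measurableType d) (mu : {measure set T -> \bar R}) (u v : T -> R[i]) :
  integralC mu (fun x => u x * v x) = inner mu u (fun x => conjc (v x)).
 by congr integralC; apply/funext => x; rewrite conjcK.
rewrite !conjE.
apply: (sqnormC_cvg_unique _ (inner_cvg (fun j => (f12 j).2) f2 (L2_conj h2) cf)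
 (inner_cvg (fun j => (partialF_L2 (f12 j)).1) F2 (L2_conj tensor2) cF)) => j.
by rewrite -!conjE; exact: pair_L12.
Qed.

End pairing.
End partial_fourier_L2.

(** * Gaussian factors in the frequency *)

Section gaussian_transforms.
Context {R : realType}.
Implicit Types (P p : {poly R}) (t v : R).
Local Notation H := (@hermite_poly R).

Definition gpsi P v : R[i] := (pgauss P 1 v)%:C%C.

Lemma gpsi_L1 P : L1 leb (gpsi P).
Proof. by apply/L1P; split; [exact: intg_pgauss|exact: intg0]. Qed.

Lemma gpsi_L2 P : L2 leb (gpsi P).
Proof.
apply/L2P; split; first exact: mc_real (measurable_pgauss P 1).
have i2 : intg leb (pgauss (P * P) 2) by exact: intg_pgauss.
move: i2; congr intg; apply/funext => v; rewrite sqnormC_real /pgauss hornerM exprMn.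
by rewrite -!expr2; congr (_ * _); rewrite [RHS]expr2 -expRD; congr expR; ring.
Qed.

Lemma fourier1_gpsi P : fourier1 (gpsi P) = gfour P.
Proof.
apply/funext => q; apply: complexP; rewrite /gfour /fourier1 /=.
 apply: eq_Rintegral => v _; rewrite cosN mul0r subr0.
 by rewrite [q * v]mulrC.
rewrite -RintN; last exact: intg_pgauss_sin.
by apply: eq_Rintegral => v _; rewrite sinN mul0r addr0 mulrN [q * v]mulrC.
Qed.

Lemma gfour_L2 P : L2 leb (gfour P).
Proof. by rewrite -fourier1_gpsi; have [] := plancherel1 (gpsi_L1 P) (gpsi_L2 P). Qed.

(** H_j exp(-v^2) is, up to sign, the j-th derivative of exp(-v^2), so its transform is a monomial
    times a Gaussian. *)
Lemma gfour_hermite j t : gfour (H j) t =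
 ((Complex 0 (-1)) ^+ j * (Num.sqrt pi)%:C%C) * (hrho ((2 *: 'X) ^+ j) 0 t)%:C%C.
Proof.
have E : (hrho ((2 *: 'X) ^+ j) 0 t)%:C%C = (t%:C%C) ^+ j * (expR (- (4^-1 * t ^+ 2)))%:C%C :> R[i].
 rewrite -rmorphXn -rmorphM; congr (_%:C)%C; rewrite /hrho /pgauss expr0 mul1r /=.
 rewrite horner_exp hornerZ hornerX; congr (_ ^+ j * expR _); by field.
rewrite E mulrACA -exprMn.
have -> : gfour (H j) t = (Complex 0 (-1) * t%:C%C) ^+ j * gfour 1 t.
 elim: j {E} => [|j IH]; first by rewrite expr0 mul1r.
 rewrite exprS -mulrA -IH.
 have := gfour_hop (H j) t; rewrite hop_hermite -[X in gfour X]scaleN1r gfourZ => h.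
 have -> : gfour (H j.+1) t = - ((-1)%:C%C * gfour (H j.+1) t).
  by apply: complexP; rewrite !cE /=; ring.
 by rewrite h; apply: complexP; rewrite !cE /=; ring.
by rewrite gfour1 rmorphM.
Qed.

(** Differentiating the transform in t multiplies the integrand by - i v. In this way the
    derivatives in tau of [sublaplacian_wave] become powers of the frequency. *)
Lemma gfour_derive (d c : R[i]) P p m : (forall t, d * gfour P t = c * (hrho p m t)%:C%C) ->
 forall t, d * Complex 0 (-1) * gfour ('X * P) t = c * (hrho p m.+1 t)%:C%C.
Proof.
move=> h t; have dr : is_derive t 1 (hrho p m) (hrho p m.+1 t) by exact: smooth1_hrho.
have uniq (u : R -> R) (u1 u2 : R) : is_derive t 1 u u1 -> is_derive t 1 u u2 -> u1 = u2.
 by move=> [_ <-] [_ <-].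
apply: complexP.
- apply: (uniq (fun t => ReC d * gcos P t + ImC d * gsin P t)).
  apply: (drv_eq (drvD (drvZ _ (drv_gcos P t)) (drvZ _ (drv_gsin P t)))).
  by rewrite !cE /gfour /=; ring.
 rewrite (_ : (fun t => _) = fun t => ReC c * hrho p m t).
  by apply: (drv_eq (drvZ _ dr)); rewrite !cE /=; ring.
 apply/funext => s; have := congr1 (@complex.Re R) (h s); rewrite !cE /gfour /= => E.
 by rewrite mulr0 subr0 in E; rewrite -E; ring.
- apply: (uniq (fun t => ImC d * gcos P t + (- ReC d) * gsin P t)).
  apply: (drv_eq (drvD (drvZ _ (drv_gcos P t)) (drvZ _ (drv_gsin P t)))).
  by rewrite !cE /gfour /=; ring.
 rewrite (_ : (fun t => _) = fun t => ImC c * hrho p m t).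
  by apply: (drv_eq (drvZ _ dr)); rewrite !cE /=; ring.
 apply/funext => s; have := congr1 (@complex.Im R) (h s); rewrite !cE /gfour /= => E.
 by rewrite mulr0 add0r in E; rewrite -E; ring.
Qed.

(** exp(-v^2) is split into two equal Gaussians: one makes [Psi] square integrable, the other turns
    H_j into a Hermite function, and the Hermite functions are total. *)
Lemma hermite_moments_eq0 (Psi : R -> R[i]) :
 L2 leb (fun v => (expR (- (2^-1 * v ^+ 2)))%:C%C * Psi v) ->
 (forall j, integralC leb (fun v => gpsi (H j) v * Psi v) = 0) ->
 {ae leb, forall v, Psi v = 0}.
Proof.
move=> P2 h0.
suff : {ae leb, forall v, (expR (- (2^-1 * v ^+ 2)))%:C%C * Psi v = 0}.
 move=> ae0; apply: aeS ae0 _ => v /eqP; rewrite mulf_eq0 => /orP[|/eqP//] /eqP h.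
 by have := congr1 (@complex.Re R) h; rewrite /= => /eqP; rewrite gt_eqF ?expR_gt0.
apply: (hermite_total P2) => j.
have i1 := L2_mulc P2 (L2_hermiteC j).
have hn : (hnorm j)%:C%C != 0 :> R[i].
 by apply/eqP => h; have := congr1 (@complex.Re R) h; rewrite /= => /eqP; rewrite gt_eqF ?hnorm_gt0.
have E : integralC leb (fun v => gpsi (H j) v * Psi v) = (hnorm j)%:C%C^-1 *
  inner leb (fun v => (expR (- (2^-1 * v ^+ 2)))%:C%C * Psi v) (hermiteC j).
 rewrite -(integralCZ _ i1); congr integralC; apply/funext => v.
 rewrite conj_hermiteC /gpsi /hermiteC hermite_fun1E.
 have -> : pgauss (H j) 1 v = expR (- (2^-1 * v ^+ 2)) * pgauss (H j) 2^-1 v.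
  by have := @pgauss_half R 1 (H j) v; rewrite mul1r {1}/pgauss hornerC mul1r => <-.
 move: (pgauss (H j) 2^-1 v) (expR _) => x y; rewrite !rmorphM /=.
 move: (hnorm j)%:C%C hn (x%:C%C) (y%:C%C) (Psi v) => h hn0 e p q.
 by field.
by move: E; rewrite h0 => /esym /eqP; rewrite mulf_eq0 invr_eq0 (negPf hn) => /eqP.
Qed.

End gaussian_transforms.

Lemma aeI d (T : measurableType d) (R : realType) (mu : {measure set T -> \bar R}) (P Q : T -> Prop) :
 {ae mu, forall x, P x} -> {ae mu, forall x, Q x} -> {ae mu, forall x, P x /\ Q x}.
Proof. by move=> p q; apply: aeS2 p q _. Qed.

Lemma ae_counting (R : realType) (P : R * nat -> Prop) :
 (forall m, {ae @lebesgue_measure R, forall x, P (x, m)}) ->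
 {ae pmeas (@lebesgue_measure R) (@counting nat R), forall p, P p}.
Proof.
move=> h; have {}h m : {ae pmeas (@lebesgue_measure R) (@counting nat R), forall p, p.2 = m -> P p}.
 have [N [mN N0 PN]] := h m; exists (N `*` [set m]); split.
 - exact: measurableX.
 - apply: eq_trans (product_measure1E (@lebesgue_measure R) (@counting nat R) mN _) _ => //.
  exact: eq_trans (congr1 (fun t => t * _)%E N0) (mul0e _).
 - move=> [x m'] /= /not_implyP[-> nP]; split => //=; exact: PN.
by apply: aeS (ae_foralln h) _ => p hp; exact: hp.
Qed.

(** * The intertwining identity at almost every frequency *)

Section wave_identity.
Context {R : realType} (n : nat).
Hypothesis n0 : (0 < n)%N.
Local Notation idx := {ffun 'I_n -> nat}.
Local Notation H := (@hermite_poly R).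
Implicit Types (z : 'rV[R]_n * 'rV[R]_n).

Lemma gz_L2 (V : 'rV[R]_n * 'rV[R]_n -> R[i]) c C : 0 < c -> measC V ->
 (forall z, sqnormC (V z) <= C * gz c z) -> L2 lr2 V /\ bddC V.
Proof.
move=> c0 mV h; have [i _] := @gz_integral R n _ c0; split.
 apply/L2P; split => //; apply: intg_le (intgZ C i); first exact: measurable_sqnormC.
 by move=> z; rewrite ger0_norm ?sqnormC_ge0//; exact: h.
have C0 : 0 <= C.
 have := le_trans (sqnormC_ge0 _) (h (0, 0)); rewrite pmulr_lge0//; exact: expR_gt0.
have sqb (x y : R) : x ^+ 2 + y ^+ 2 <= C -> `|x| <= C + 1.
 move=> hx; rewrite ler_norml; have := sqr_ge0 y; have := sqr_ge0 (x - 1); have := sqr_ge0 (x + 1).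
 by move=> *; apply/andP; split; nra.
exists (C + 1) => z; have hz : sqnormC (V z) <= C.
 apply: (le_trans (h z)); rewrite -[leRHS]mulr1 ler_wpM2l// -[leRHS]expR0 ler_expR.
 by rewrite oppr_le0 mulr_ge0 ?sqz_ge0// ltW.
by split; [exact: sqb hz|apply: (@sqb _ (ReC (V z))); rewrite addrC].
Qed.

(* The conjugate profiles, without and with the weight |z|^2 / 4. *)
Definition cwave (b : bool) a sg (k l : idx) z : R[i] :=
 (if b then sqz (z, 0 : R) / 4 else 1)%:C%C * conjc (wavez a sg k l z).

(** The same bound serves all a >= a0; the exponent drops from a0^2 / 4 to a0^2 / 8 in order to
    absorb the weight |z|^2 / 4. *)
Lemma cwave_bound b k l a0 : 0 < a0 -> exists2 C, 0 <= C & forall a sg z,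
 sg ^+ 2 = 1 -> a0 <= a -> sqnormC (cwave b a sg k l z) <= C * gz (a0 ^+ 2 / 8) z.
Proof.
move=> a00; have [C C0 h] := @wavez_bound R n k l.
have e0 : 0 < a0 ^+ 2 / 8 by rewrite divr_gt0// exprn_gt0.
have [D D0 hD] := pow_exp_bound 2 e0.
have le a z : a0 <= a -> gz (a ^+ 2 / 4) z <= gz (a0 ^+ 2 / 4) z.
 move=> aa; have a_gt0 := lt_le_trans a00 aa.
 by apply: gz_le; rewrite ler_wpM2r// ler_pXn2r ?nnegrE// ltW.
case: b.
 exists (D * C); first exact: mulr_ge0.
 move=> a sg z sg2 aa; rewrite sqnormCM sqnormC_conj sqnormC_real.
 have z0 := sqz_ge0 (z, 0 : R).
 have d4 : (sqz (z, 0 : R) / 4) ^+ 2 <= D * expR (a0 ^+ 2 / 8 * sqz (z, 0 : R)).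
  apply: le_trans (hD _ z0); rewrite ler_pXn2r ?nnegrE ?divr_ge0//.
  by rewrite ler_pdivrMr// ler_peMr// ler1n.
 apply: (le_trans (ler_pM (sqr_ge0 _) (sqnormC_ge0 _) d4 (le_trans (h a sg z sg2) (ler_wpM2l C0 (le a z aa))))).
 rewrite mulrACA ler_wpM2l ?mulr_ge0// /gz -expRD ler_expR.
 by rewrite le_eqVlt; apply/orP; left; apply/eqP; field.
exists C => // a sg z sg2 aa; rewrite sqnormCM sqnormC_conj sqnormC_real expr1n mul1r.
apply: (le_trans (h a sg z sg2)); rewrite ler_wpM2l//; apply: (le_trans (le a z aa)); apply: gz_le.
by rewrite ler_pM2l ?exprn_gt0// lef_pV2 ?posrE// ler_nat.
Qed.

Lemma mc_cwave b a sg (k l : idx) : measC (cwave b a sg k l).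
Proof.
apply: mcM; last exact: mc_conj (mc_wavez a sg k l).
apply: mc_real; case: b => //; apply: measurable_funM => //.
exact: (mcomp (sm_measurable (pol_sm (@pol_sqz R n))) (pair2_meas (0 : R))).
Qed.

Lemma cwave_L2 b a sg (k l : idx) : sg ^+ 2 = 1 -> 0 < a ->
 L2 lr2 (cwave b a sg k l) /\ bddC (cwave b a sg k l).
Proof.
move=> sg2 a0; have [C C0 h] := cwave_bound b k l a0.
have c0 : 0 < a ^+ 2 / 8 by rewrite divr_gt0// exprn_gt0.
apply: (gz_L2 c0 (mc_cwave _ _ _ _ _)) => z; exact: h.
Qed.

(** The complex pairing consists of four real ones, to each of which dominated convergence
    applies. *)
Lemma pairA_dct (V_ : nat -> 'rV[R]_n * 'rV[R]_n -> R[i]) V Gam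
  (U : R * ('rV[R]_n * 'rV[R]_n) -> R[i]) lam :
 L2 lr2 (fun z => U (lam, z)) -> (forall j, L2 lr2 (V_ j)) -> L2 lr2 V -> sqintg lr2 Gam ->
 (forall z, ReC (V_ j z) @[j --> \oo] --> ReC (V z)) ->
 (forall z, ImC (V_ j z) @[j --> \oo] --> ImC (V z)) ->
 (forall j z, `|ReC (V_ j z)| <= Gam z /\ `|ImC (V_ j z)| <= Gam z) ->
 ReC (pairA (V_ j) U lam) @[j --> \oo] --> ReC (pairA V U lam) /\
 ImC (pairA (V_ j) U lam) @[j --> \oo] --> ImC (pairA V U lam).
Proof.
move=> U2 Vj2 V2 G2 cR cI bnd.
have [ur ui] := L2_sqintg U2; have [vr vi] := L2_sqintg V2.
have vj j := L2_sqintg (Vj2 j).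
have cr phi : sqintg lr2 phi -> \int[lr2]_z (phi z * (ReC \o V_ j) z) @[j --> \oo] -->
  \int[lr2]_z (phi z * (ReC \o V) z).
 move=> p2; apply: (Rint_dominated p2 (fun j => (vj j).1.1) vr.1 cR _ G2).
 by move=> j z; have [] := bnd j z.
have ci phi : sqintg lr2 phi -> \int[lr2]_z (phi z * (ImC \o V_ j) z) @[j --> \oo] -->
  \int[lr2]_z (phi z * (ImC \o V) z).
 move=> p2; apply: (Rint_dominated p2 (fun j => (vj j).2.1) vi.1 cI _ G2).
 by move=> j z; have [] := bnd j z.
have RE W : L2 lr2 W -> ReC (pairA W U lam) =
  \int[lr2]_z ((ReC \o (fun z => U (lam, z))) z * (ReC \o W) z) -
  \int[lr2]_z ((ImC \o (fun z => U (lam, z))) z * (ImC \o W) z).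
 move=> /L2_sqintg[v1 v2]; rewrite -(RintB (sqintg_mul ur v1) (sqintg_mul ui v2)).
 by apply: eq_Rintegral => z _; rewrite ReM.
have IE W : L2 lr2 W -> ImC (pairA W U lam) =
  \int[lr2]_z ((ReC \o (fun z => U (lam, z))) z * (ImC \o W) z) +
  \int[lr2]_z ((ImC \o (fun z => U (lam, z))) z * (ReC \o W) z).
 move=> /L2_sqintg[v1 v2]; rewrite -(RintD (sqintg_mul ur v2) (sqintg_mul ui v1)).
 by apply: eq_Rintegral => z _; rewrite ImM.
split.
 rewrite (RE _ V2) (funext (fun j => RE _ (Vj2 j))).
 by apply: cvgB; [exact: cr ur|exact: ci ui].
rewrite (IE _ V2) (funext (fun j => IE _ (Vj2 j))).
by apply: cvgD; [exact: ci ur|exact: cr ui].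
Qed.

Variables (f g : heis R n -> R[i]) (F G : R * ('rV[R]_n * 'rV[R]_n) -> R[i]).
Hypotheses (f2 : L2 hm f) (g2 : L2 hm g) (fF : is_partialF f F) (gG : is_partialF g G).
Hypothesis weak : forall h, test_function h ->
 inner hm f (fun eta => - sublaplacian h eta) = inner hm g h.

Section fixed_wave.
Variables (a sg : R) (k l : idx).
Hypotheses (a0 : 0 < a) (sg2 : sg ^+ 2 = 1).
Let N : R := (\sum_(i < n) (k i + l i + 1))%:R.
Let S : R := \sum_(i < n) ((k i)%:R - (l i)%:R).
Let V b := cwave b a sg k l.
Let V2 b : L2 lr2 (V b). Proof. by have [] := cwave_L2 b k l sg2 a0. Qed.
Let bV b : bddC (V b). Proof. by have [] := cwave_L2 b k l sg2 a0. Qed.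

(** The residual of the weak equation at frequency lam for a frozen a. The term with the weight
    |z|^2 / 4 carries a^4 - lam^2, which vanishes for a^2 = |lam|. *)
Definition wave_form lam : R[i] :=
 (a ^+ 2 * N + sg * S * lam)%:C%C * pairA (V false) F lam
 - (a ^+ 4 - lam ^+ 2)%:C%C * pairA (V true) F lam - pairA (V false) G lam.

Let J b P (u : heis R n -> R[i]) := integralC hm (fun eta => u eta * (V b eta.1 * gfour P eta.2)).
Let T2 b P : L2 hm (fun eta => V b eta.1 * gfour P eta.2).
Proof. exact: (L2_tensor (m1 := lr2) (m2 := leb) (V2 b) (gfour_L2 P)). Qed.
Let JE b P u U : L2 hm u -> is_partialF u U ->
 J b P u = integralC leb (fun lam => gpsi P lam * pairA (V b) U lam).
Proof.
move=> u2 uU; rewrite /J -fourier1_gpsi.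
apply: (is_partialF_pair (V2 b) (bV b) (gpsi_L1 P) (gpsi_L2 P) _ u2 uU).
by rewrite fourier1_gpsi; exact: gfour_L2.
Qed.

Let partial2 (u : heis R n -> R[i]) U : is_partialF u U -> L2 mF U.
Proof. by move=> [u_ []]. Qed.
Let A1 b P u U : is_partialF u U -> L1 leb (fun lam => gpsi P lam * pairA (V b) U lam).
Proof. by move=> uU; have [] := pairA_integral (V2 b) (gpsi_L2 P) (partial2 uU). Qed.

Let conj_terms (x y q : R) (w : R[i]) : conjc (- (- x%:C%C * w + y%:C%C * w + Complex 0 q * w)) =
 x%:C%C * conjc w - y%:C%C * conjc w + Complex 0 1 * q%:C%C * conjc w.
Proof. by apply: complexP; rewrite !cE /=; ring. Qed.

(** The weak equation tested on the wave whose factor in tau is the transform of H_j exp(-v^2): its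
    two derivatives in tau appear as the factors v and v^2 under [gfour]. *)
Let weak_wave j : (a ^+ 2 * N)%:C%C * J false (H j) f - (a ^+ 4)%:C%C * J true (H j) f
 + J true ('X * ('X * H j)) f + (sg * S)%:C%C * J false ('X * H j) f = J false (H j) g.
Proof.
pose p : {poly R} := (2 *: 'X) ^+ j.
pose c : R[i] := Complex 0 (-1) ^+ j * (Num.sqrt pi)%:C%C.
have r0 t : gfour (H j) t = c * (hrho p 0 t)%:C%C by exact: gfour_hermite.
have r1 : forall t, 1 * Complex 0 (-1) * gfour ('X * H j) t = c * (hrho p 1 t)%:C%C.
 by apply: gfour_derive => t; rewrite mul1r.
have r2 := gfour_derive r1.
have W := weak_sublaplacian_wave sg k l a0 p f2 g2 weak.
have cI (u v : heis R n -> R[i]) : L2 hm u -> L2 hm v -> c * inner hm u v = integralC hm (fun eta => u eta * (c * conjc (v eta))).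
 move=> u2 v2; rewrite -(integralCZ _ (L2_mulc u2 v2)); congr integralC.
 by apply/funext => eta; rewrite mulrCA.
have w2 := L2_wave sg k l a0 p 0.
have E0 eta : c * conjc (wave a sg k l eta * (hrho p 0 eta.2)%:C%C) = V false eta.1 * gfour (H j) eta.2.
 rewrite r0 conjcM conjc_real /V /cwave waveE; ring.
have E1 eta : c * conjc (- sublaplacian (fun eta => wave a sg k l eta * (hrho p 0 eta.2)%:C%C) eta) =
 (a ^+ 2 * N)%:C%C * (V false eta.1 * gfour (H j) eta.2) - (a ^+ 4)%:C%C * (V true eta.1 * gfour (H j) eta.2)
 + V true eta.1 * gfour ('X * ('X * H j)) eta.2 + (sg * S)%:C%C * (V false eta.1 * gfour ('X * H j) eta.2).
 rewrite (sublaplacian_wave a k l sg2 (smooth1_hrho p)) -/N -/S waveE sqzE.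
 have e1 := r1 eta.2; have e2 := r2 eta.2; have e0 := r0 eta.2.
 have i2 : Complex 0 (-1) * Complex 0 (-1) = -1 :> R[i].
  by apply: complexP; rewrite !cE /=; ring.
 rewrite mul1r i2 mulN1r in e2; rewrite mul1r in e1.
 have -> : gfour ('X * ('X * H j)) eta.2 = - (c * (hrho p 2 eta.2)%:C%C) by rewrite -e2 opprK.
 have -> : gfour ('X * H j) eta.2 = Complex 0 1 * (c * (hrho p 1 eta.2)%:C%C).
  by rewrite -e1 mulrA (_ : Complex 0 1 * _ = 1) ?mul1r//; apply: complexP; rewrite !cE /=; ring.
 rewrite e0 /V /cwave.
 rewrite conj_terms (rmorphM _ (a ^+ 2 * N)) (rmorphM _ (sqz _ / 4)) (rmorphM _ (sg * S)) rmorphD (rmorphM _ (a ^+ 4)) /=.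
 have -> : 1%:C%C = 1 :> R[i] by [].
 move: (conjc _) (hrho p 0 eta.2)%:C%C (hrho p 1 eta.2)%:C%C (hrho p 2 eta.2)%:C%C (c) (_ / 4)%:C%C
  (a ^+ 4)%:C%C (a ^+ 2 * N)%:C%C (sg * S)%:C%C (Complex 0 1) => *; ring.
pose comb eta : R[i] := (a ^+ 2 * N)%:C%C * (V false eta.1 * gfour (H j) eta.2)
 - (a ^+ 4)%:C%C * (V true eta.1 * gfour (H j) eta.2)
 + V true eta.1 * gfour ('X * ('X * H j)) eta.2 + (sg * S)%:C%C * (V false eta.1 * gfour ('X * H j) eta.2).
have comb2 : L2 hm comb.
 apply: L2D (L2Z _ (T2 _ _)); apply: L2D (T2 _ _); exact: L2B (L2Z _ (T2 _ _)) (L2Z _ (T2 _ _)).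
have c0 : c != 0.
 apply/eqP => h; have := congr1 (@sqnormC R) h.
 have -> : sqnormC c = pi.
  rewrite /c sqnormCM sqnormC_X sqnormC_real sqr_sqrtr ?pi_ge0//.
  by rewrite /sqnormC /= expr0n sqrrN expr1n add0r expr1n mul1r.
 by rewrite sqnormC0 => /eqP; rewrite gt_eqF ?pi_gt0.
have l2 : L2 hm (fun eta => - sublaplacian (fun eta => wave a sg k l eta * (hrho p 0 eta.2)%:C%C) eta).
 move: (L2_conj (L2Z c^-1 comb2)); congr L2; apply/funext => eta.
 by rewrite /comb -E1 mulKf// conjcK.
have := congr1 (fun t => c * t) W; rewrite /= (cI _ _ f2 l2) (cI _ _ g2 w2).
rewrite (_ : (fun eta => g eta * _) = fun eta => g eta * (V false eta.1 * gfour (H j) eta.2)); last first.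
 by apply/funext => eta; rewrite E0.
move=> W'; apply: etrans W'; apply: esym.
rewrite (_ : (fun eta => f eta * _) = fun eta =>
 (a ^+ 2 * N)%:C%C * (f eta * (V false eta.1 * gfour (H j) eta.2))
 - (a ^+ 4)%:C%C * (f eta * (V true eta.1 * gfour (H j) eta.2))
 + f eta * (V true eta.1 * gfour ('X * ('X * H j)) eta.2)
 + (sg * S)%:C%C * (f eta * (V false eta.1 * gfour ('X * H j) eta.2))); last first.
 by apply/funext => eta; rewrite E1; move: (V _ _) (V _ _) (gfour _ _) (gfour _ _) (gfour _ _) => *; ring.
have t1 b P := L2_mul f2 (T2 b P).
rewrite integralCD; [|exact: L1D (L1B (L1Z _ (t1 _ _)) (L1Z _ (t1 _ _))) (t1 _ _)|exact: L1Z _ (t1 _ _)].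
rewrite integralCD; [|exact: L1B (L1Z _ (t1 _ _)) (L1Z _ (t1 _ _))|exact: t1].
rewrite integralCB; [|exact: L1Z _ (t1 _ _)|exact: L1Z _ (t1 _ _)].
by rewrite !integralCZ; [|exact: t1|exact: t1|exact: t1].
Qed.

(** By the multiplication formula, [weak_wave] says that all Hermite moments of [wave_form]
    vanish. *)
Lemma wave_form_eq0 : {ae leb, forall lam, wave_form lam = 0}.
Proof.
have F2 := partial2 fF; have G2 := partial2 gG.
have AF b := pairA_L2 (V2 b) F2; have AG := pairA_L2 (V2 false) G2.
apply: hermite_moments_eq0.
 have mg (q : {poly R}) : meas (fun v => pgauss q 2^-1 v) by exact: measurable_pgauss.
 have bm (q : {poly R}) A : L2 leb A -> L2 leb (fun v => (pgauss q 2^-1 v)%:C%C * A v).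
  move=> A2; have [C C0 h] := @pgauss_bound R q 2^-1 ltac:(by rewrite invr_gt0).
  apply: (L2_le (g := fun v => C%:C%C * A v)); last 1 first.
  - move=> v; rewrite !sqnormCM !sqnormC_real ler_wpM2r ?sqnormC_ge0//.
   rewrite -[leLHS]real_normK ?num_real// ler_pXn2r ?nnegrE//.
   apply: (le_trans (h v)); rewrite -[leRHS]mulr1 ler_wpM2l// -[leRHS]expR0 ler_expR.
   by rewrite oppr_le0 mulr_ge0 ?sqr_ge0// divr_ge0// invr_ge0.
  - by apply: mcM; [apply: mc_real; exact: mg|exact: A2.1].
  - exact: L2Z.
 have -> : (fun v => (expR (- (2^-1 * v ^+ 2)))%:C%C * wave_form v) = fun v =>
   (pgauss ((a ^+ 2 * N)%:P + (sg * S) *: 'X) 2^-1 v)%:C%C * pairA (V false) F v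
   - (pgauss ((a ^+ 4)%:P - 'X^2) 2^-1 v)%:C%C * pairA (V true) F v
   - (pgauss 1 2^-1 v)%:C%C * pairA (V false) G v.
  apply/funext => v; rewrite /wave_form /pgauss !hornerE !rmorphM /=; ring.
 apply: L2B (bm _ _ AG); apply: L2B; apply: bm; exact: AF.
move=> j; have := weak_wave j; rewrite !(JE _ _ f2 fF) (JE _ _ g2 gG) => E.
have gX q lam : gpsi ('X * q) lam = lam%:C%C * gpsi q lam.
 by rewrite /gpsi /pgauss hornerM hornerX -mulrA rmorphM.
have a1 b P := A1 b P fF; have ag := A1 false (H j) gG.
transitivity ((a ^+ 2 * N)%:C%C * integralC leb (fun lam => gpsi (H j) lam * pairA (V false) F lam) -
 (a ^+ 4)%:C%C * integralC leb (fun lam => gpsi (H j) lam * pairA (V true) F lam)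
 + integralC leb (fun lam => gpsi ('X * ('X * H j)) lam * pairA (V true) F lam)
 + (sg * S)%:C%C * integralC leb (fun lam => gpsi ('X * H j) lam * pairA (V false) F lam)
 - integralC leb (fun lam => gpsi (H j) lam * pairA (V false) G lam)); last first.
 by rewrite E subrr.
rewrite -!integralCZ // -integralCB; [|exact: L1Z|exact: L1Z].
rewrite -integralCD; [|exact: L1B (L1Z _ _) (L1Z _ _)|exact: a1].
rewrite -integralCD; [|exact: L1D (L1B (L1Z _ _) (L1Z _ _)) (a1 _ _)|exact: L1Z].
rewrite -integralCB; [|exact: L1D (L1D (L1B (L1Z _ _) (L1Z _ _)) (a1 _ _)) (L1Z _ _)|exact: ag].
congr integralC; apply/funext => lam; rewrite !gX /wave_form.
have -> : (a ^+ 4 - lam ^+ 2)%:C%C = (a ^+ 4)%:C%C - lam%:C%C ^+ 2 :> R[i] by rewrite rmorphB -rmorphXn.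
have -> : (a ^+ 2 * N + sg * S * lam)%:C%C = (a ^+ 2 * N)%:C%C + (sg * S)%:C%C * lam%:C%C :> R[i].
 by rewrite rmorphD -rmorphM.
move: (pairA _ _ _) (pairA _ _ _) (pairA _ _ _) (gpsi _ _) => *; ring.
Qed.

End fixed_wave.

Let rat_wave (q : nat * nat * bool * idx * idx) lam : R[i] :=
 let: (m, p, b, k, l) := q in wave_form (m.+1%:R / p.+1%:R) (if b then 1 else -1) k l lam.

(** The exceptional null set depends on the parameters, so only countably many can be treated at
    once: positive rational a, both signs and all indices. *)
Lemma wave_form_rat_eq0 : {ae leb, forall lam m p b k l,
 wave_form (m.+1%:R / p.+1%:R) (if b then 1 else -1) k l lam = 0}.
Proof.
have h i : {ae leb, forall lam, if @unpickle (nat * nat * bool * idx * idx)%type i is Some q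
  then rat_wave q lam = 0 else True}.
 case: unpickle => [[[[[m p] b] k] l]|]; last exact: aeW.
 by apply: wave_form_eq0; [rewrite divr_gt0|case: b; rewrite ?sqrrN expr1n].
apply: aeS (ae_foralln h) _ => lam hl m p b k l.
by have := hl (pickle (m, p, b, k, l)); rewrite pickleK.
Qed.

Section limit_wave.
Variables (lam : R) (k l : idx).
Hypotheses (lam0 : lam != 0) (Fl : L2 lr2 (fun z => F (lam, z))) (Gl : L2 lr2 (fun z => G (lam, z))).
Hypothesis wr0 : forall m p b, wave_form (m.+1%:R / p.+1%:R) (if b then 1 else -1) k l lam = 0.
Let a := Num.sqrt `|lam|.
Let sg := Num.sg lam.
(** Rational approximations of a from above: being at least a, they all obey the bound of
    [cwave_bound] with a0 = a. *)
Let a_ (j : nat) : R := (Num.truncn (j.+1%:R * a)).+1%:R / j.+1%:R.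
Let a_gt0 : 0 < a. Proof. by rewrite sqrtr_gt0 normr_gt0. Qed.
Let sg2 : sg ^+ 2 = 1. Proof. by rewrite sqr_sg lam0. Qed.

Let a_itv j : a <= a_ j <= a + j.+1%:R^-1.
Proof.
have x0 : 0 <= j.+1%:R * a by rewrite mulr_ge0// ltW.
have /andP[h1 h2] := truncn_itv x0.
rewrite /a_ ler_pdivlMr ?ltr0n// mulrC ltW//= ler_pdivrMr ?ltr0n// mulrDl mulVf ?pnatr_eq0//.
by rewrite -[leLHS]natr1 lerD2r [leRHS]mulrC.
Qed.

Let a_cvg : a_ j @[j --> \oo] --> a.
Proof.
apply: (@squeeze_cvgr _ _ _ _ (fun=> a) (fun j => a + j.+1%:R^-1)).
- by apply: nearW => j; exact: a_itv.
- exact: cvg_cst.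
- rewrite -[X in _ --> X]addr0; apply: cvgD; [exact: cvg_cst|exact: cvg_harmonic].
Qed.

Let ccvg (u : nat -> R[i]) (w : R[i]) := ReC (u j) @[j --> \oo] --> ReC w /\ ImC (u j) @[j --> \oo] --> ImC w.
Let ccvg_cst w : ccvg (fun=> w) w. Proof. by split; exact: cvg_cst. Qed.
Let ccvgD u w u' w' : ccvg u w -> ccvg u' w' -> ccvg (fun j => u j + u' j) (w + w').
Proof.
move=> [u1 u2] [v1 v2]; split; rewrite ?ReD ?ImD.
 by under eq_fun do rewrite ReD; exact: cvgD.
by under eq_fun do rewrite ImD; exact: cvgD.
Qed.

Let ccvgN u w : ccvg u w -> ccvg (fun j => - u j) (- w).
Proof.
by move=> [u1 u2]; split; rewrite ?ReN ?ImN; [under eq_fun do rewrite ReN|under eq_fun do rewrite ImN]; exact: cvgN.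
Qed.

Let ccvgM u w u' w' : ccvg u w -> ccvg u' w' -> ccvg (fun j => u j * u' j) (w * w').
Proof.
move=> [u1 u2] [v1 v2]; split; rewrite ?ReM ?ImM.
 by under eq_fun do rewrite ReM; apply: cvgB; exact: cvgM.
by under eq_fun do rewrite ImM; apply: cvgD; exact: cvgM.
Qed.

Let ccvg_conj u w : ccvg u w -> ccvg (fun j => conjc (u j)) (conjc w).
Proof.
move=> [u1 u2]; split; rewrite ?Re_conj ?Im_conj; first by under eq_fun do rewrite Re_conj.
by under eq_fun do rewrite Im_conj; exact: cvgN.
Qed.

Let ccvg_chermite k0 l0 u w u' w' : ccvg u w -> ccvg u' w' ->
 ccvg (fun j => chermite k0 l0 (u j) (u' j)) (chermite k0 l0 w w').
Proof.
move=> hu hu'; elim: k0 l0 => [|k0 IH] l0.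
 elim: l0 => [|l0 IH] /=; first exact: ccvg_cst.
 by rewrite exprS; under eq_fun do rewrite exprS; exact: (ccvgM (ccvgN hu') IH).
exact: (ccvgD (ccvgM hu (IH l0)) (ccvgM (ccvg_cst _) (IH l0.-1))).
Qed.

Let cwave_cvg b z : ccvg (fun j => cwave b (a_ j) sg k l z) (cwave b a sg k l z).
Proof.
apply: ccvgM; first exact: ccvg_cst.
apply: ccvg_conj; rewrite /wavez /wave; elim: (index_enum _) => [|i s IH].
 by rewrite big_nil; under eq_fun do rewrite big_nil; exact: ccvg_cst.
rewrite big_cons; under eq_fun do rewrite big_cons; apply: ccvgM => //.
have ca (x y : R) : a_ j * x @[j --> \oo] --> a * x by apply: cvgM; [exact: a_cvg|exact: cvg_cst].
have ca3 (x y : R) : a_ j * x * y @[j --> \oo] --> a * x * y by apply: cvgM; [exact: ca|exact: cvg_cst].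
have caN (x y : R) : - (a_ j * x) * y @[j --> \oo] --> - (a * x) * y.
 by apply: cvgM; [apply: cvgN; exact: ca|exact: cvg_cst].
apply: ccvgM; last by apply: ccvg_chermite; split => /=; (exact: ca || exact: ca3 || exact: caN).
split => /=; last exact: cvg_cst.
apply: (@cvg_comp _ _ _ _ expR _ _ _ _ (@continuous_expR R _)).
apply: cvgM; last exact: cvg_cst.
apply: cvgN; apply: cvgM; last exact: cvg_cst.
by rewrite expr2; under eq_fun do rewrite expr2; apply: cvgM; exact: a_cvg.
Qed.

Let pairA_cvg b U : L2 lr2 (fun z => U (lam, z)) ->
 ccvg (fun j => pairA (cwave b (a_ j) sg k l) U lam) (pairA (cwave b a sg k l) U lam).
Proof.
move=> U2; have [C C0 h] := cwave_bound b k l a_gt0.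
pose Gam z := Num.sqrt C * gz (a ^+ 2 / 16) z.
have c0 : 0 < a ^+ 2 / 16 by rewrite divr_gt0// exprn_gt0.
have GamE z : Gam z ^+ 2 = C * gz (a ^+ 2 / 8) z.
 by rewrite exprMn sqr_sqrtr// expr2 /gz -expRD; congr (_ * expR _); field.
have c8 : 0 < a ^+ 2 / 8 by rewrite divr_gt0// exprn_gt0.
have G2 : sqintg lr2 Gam.
 split; first by apply: measurable_funM => //; exact: measurable_gz.
 by under eq_fun do rewrite GamE; apply: intgZ; exact: (@gz_integral R n _ c8).1.
have Gam0 z : 0 <= Gam z by rewrite mulr_ge0 ?sqrtr_ge0 ?expR_ge0.
have bnd (a' : R) z : a <= a' -> `|ReC (cwave b a' sg k l z)| <= Gam z /\ `|ImC (cwave b a' sg k l z)| <= Gam z.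
 move=> aa; have := h a' sg z sg2 aa; rewrite -GamE => hz.
 have sq (x y : R) : x ^+ 2 + y ^+ 2 <= Gam z ^+ 2 -> `|x| <= Gam z.
  move=> hx; rewrite -(@ler_pXn2r _ 2) ?nnegrE// real_normK ?num_real//.
  by apply: le_trans hx; rewrite lerDl sqr_ge0.
 by split; [exact: sq hz|apply: (@sq _ (ReC (cwave b a' sg k l z))); rewrite addrC].
apply: (pairA_dct U2 _ (cwave_L2 b k l sg2 a_gt0).1 G2).
- move=> j; have aj : 0 < a_ j by apply: lt_le_trans a_gt0 _; have /andP[] := a_itv j.
 exact: (cwave_L2 b k l sg2 aj).1.
- by move=> z; have [] := cwave_cvg b z.
- by move=> z; have [] := cwave_cvg b z.
- by move=> j z; have /andP[aj _] := a_itv j; exact: bnd.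
Qed.

(** In the limit the weighted term has coefficient 0. The sum of k_i + l_i + 1 plus that of k_i -
    l_i is the sum of 2 k_i + 1, so l drops out and the symbol |lam| mu_k remains. *)
Lemma wave_limit : (`|lam| * hermite_ev k)%:C%C * pairA (cwave false a sg k l) F lam =
 pairA (cwave false a sg k l) G lam.
Proof.
have W j : wave_form (a_ j) sg k l lam = 0.
 rewrite (_ : sg = if 0 < lam then 1 else -1); first exact: wr0.
 move: lam0; rewrite neq_lt /sg => /orP[l0|l0]; last by rewrite gtr0_sg// l0.
 by rewrite ltr0_sg// ltNge (ltW l0).
pose N : R := (\sum_(i < n) (k i + l i + 1))%:R.
pose S : R := \sum_(i < n) ((k i)%:R - (l i)%:R).
have c2 : (a_ j) ^+ 2 @[j --> \oo] --> a ^+ 2.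
 by rewrite expr2; under eq_fun do rewrite expr2; apply: cvgM; exact: a_cvg.
have c4 : (a_ j) ^+ 4 @[j --> \oo] --> a ^+ 4.
 have e4 (x : R) : x ^+ 4 = x ^+ 2 * x ^+ 2 by rewrite -exprD.
 by rewrite e4; under eq_fun do rewrite e4; exact: (cvgM c2 c2).
have cW : ccvg (fun j => wave_form (a_ j) sg k l lam) (wave_form a sg k l lam).
 apply: ccvgD; last exact: ccvgN (pairA_cvg false Gl).
 apply: ccvgD; [|apply: ccvgN]; apply: ccvgM; try exact: pairA_cvg; split => /=; try exact: cvg_cst.
  by apply: cvgD; [apply: cvgM; [exact: c2|exact: cvg_cst]|exact: cvg_cst].
 by apply: cvgB; [exact: c4|exact: cvg_cst].
have W0 : wave_form a sg k l lam = 0.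
 have [w1 w2] := cW; move: w1 w2; under eq_fun do rewrite W; under [in X in _ -> X]eq_fun do rewrite W.
 move=> w1 w2; apply: complexP.
  by rewrite -(cvg_unique (@norm_hausdorff _ _) (cvg_cst _) w1).
 by rewrite -(cvg_unique (@norm_hausdorff _ _) (cvg_cst _) w2).
have a2 : a ^+ 2 = `|lam| by rewrite sqr_sqrtr.
move: W0; rewrite /wave_form (exprM a 2 2) a2 real_normK ?num_real// subrr mul0r subr0 => /eqP.
rewrite subr_eq0 => /eqP <-; congr (_%:C%C * _).
have -> : sg * S * lam = `|lam| * S by rewrite normrEsg -/sg; ring.
rewrite -mulrDr; congr (_ * _); rewrite /hermite_ev /N /S natr_sum -big_split /= natrD natrM natr_sum.
transitivity (\sum_(i < n) (2 * (k i)%:R + 1 : R)).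
 by rewrite big_split /= -mulr_sumr sumr_const card_ord.
by apply: eq_bigr => i _; rewrite !natrD; ring.
Qed.

End limit_wave.

Lemma fourier_intertwining_slice (k l : idx) : {ae leb, forall lam,
 toK (fourier g) (lam, pickle (k, l)) =
 (@symb R n (lam, pickle (k, l)))%:C%C * toK (fourier f) (lam, pickle (k, l))}.
Proof.
have wf := fourier_waveT n0 k l f2 fF; have wg := fourier_waveT n0 k l g2 gG.
have F2 : L2 mF F by have [? []] := fF.
have G2 : L2 mF G by have [? []] := gG.
have wE U lam : lam != 0 -> L2 lr2 (fun z => U (lam, z)) -> waveT k l U lam = (Num.sqrt (`|lam| ^+ n))%:C%C *
  ((wave_const k l)%:C%C * pairA (cwave false (Num.sqrt `|lam|) (Num.sg lam) k l) U lam).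
 move=> l0 U2; have a0 : 0 < Num.sqrt `|lam| by rewrite sqrtr_gt0 normr_gt0.
 have s2 : Num.sg lam ^+ 2 = 1 by rewrite sqr_sg l0.
 have [V2 _] := cwave_L2 false k l s2 a0.
 rewrite /waveT -(integralCZ _ (L2_mul U2 V2)); congr (_ * integralC _ _); apply/funext => z.
 by rewrite wigner_wave /cwave (_ : 1%:C%C = 1)// mul1r mulrCA.
apply: aeS2 (aeI wf wg) (aeI wave_form_rat_eq0 (aeI (@ae_neq0 R) (aeI (L2_prod_ae F2) (L2_prod_ae G2)))) _.
move=> lam [-> ->] [wr [l0 [Fl Gl]]].
rewrite (wE _ _ l0 Fl) (wE _ _ l0 Gl) -(wave_limit l0 Fl Gl (fun m p b => wr m p b k l)).
rewrite /symb pickleK_inv /=; move: (pairA _ _ _) (_%:C%C) (_%:C%C) (_%:C%C) => *; ring.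
Qed.

End wave_identity.

Section intertwining.
Context {R : realType} (n : nat).
Hypothesis n0 : (0 < n)%N.

Theorem fourier_intertwining (f g : heis R n -> R[i]) : L2 hm f -> L2 hm g ->
 (forall h, test_function h -> inner hm f (fun eta => - sublaplacian h eta) = inner hm g h) ->
 {ae KK, forall p, toK (fourier g) p = (@symb R n p)%:C%C * toK (fourier f) p}.
Proof.
move=> f2 g2 weak.
have [F fF] := is_partialF_exists n0 f2; have [G gG] := is_partialF_exists n0 g2.
apply: ae_counting => m.
case E : (@pickle_inv ({ffun 'I_n -> nat} * {ffun 'I_n -> nat})%type m) => [[k l]|]; last first.
 by apply: aeW => lam; rewrite /toK /= E mulr0.
have -> : m = pickle (k, l) by have := @pickle_invK ({ffun 'I_n -> nat} * {ffun 'I_n -> nat})%type m; rewrite E /= => <-.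
exact: (fourier_intertwining_slice n0 f2 g2 fF gG weak).
Qed.

End intertwining.

(** * Spectral resolutions *)

Section finite_measures.
Context {R : realType}.
Implicit Types (m : {measure set R -> \bar R}) (phi : R -> R) (I : set R).

Lemma intg_bounded m phi M : (m setT < +oo)%E -> meas phi ->
 (forall t, `|phi t| <= M) -> intg m phi.
Proof.
move=> mT mp bp; have i1 := intg_indic measurableT mT.
have := intgMb i1 mp bp; congr intg; apply/funext => t.
by rewrite indicT mul1r.
Qed.

Lemma Rint_indic m (B : set R) : measurable B -> \int[m]_t \1_B t = fine (m B).
Proof. by move=> mB; rewrite /Rintegral integral_indic// setIT. Qed.

Lemma Rint_bounded m phi M : (m setT < +oo)%E -> meas phi ->
 (forall t, `|phi t| <= M) -> `|\int[m]_t phi t| <= M * fine (m setT).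
Proof.
move=> mT mp bp; have ip := intg_bounded mT mp bp.
apply: (le_trans (Rint_norm ip)).
have i1 := intg_indic measurableT mT.
rewrite -Rint_indic// -RintZ//; apply: Rint_le.
- exact: intg_abs.
- exact: intgZ.
- by move=> t; rewrite indicT mulr1.
Qed.

Lemma intg_agree m m' phi I : measurable I -> meas phi ->
 (forall B, measurable B -> B `<=` I -> m B = m' B) ->
 intg m (fun t => \1_I t * phi t) -> intg m' (fun t => \1_I t * phi t) /\
 \int[m]_t (\1_I t * phi t) = \int[m']_t (\1_I t * phi t).
Proof.
move=> mI mp ag.
have E (psi : R -> \bar R) : (\int[m]_t ((\1_I t)%:E * psi t) = \int[m']_t ((\1_I t)%:E * psi t))%E.
 have r (mm : {measure set R -> \bar R}) : (\int[mm]_t ((\1_I t)%:E * psi t) = \int[mm]_(t in I) psi t)%E.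
  rewrite [RHS]integral_mkcond; apply: eq_integral => t _; rewrite /patch indicE.
  by case: ifPn => tI; rewrite ?mul1e ?mul0e.
 by rewrite !r; apply: eq_measure_integral => B mB BI; exact: ag.
have mip : meas (fun t => \1_I t * phi t) by exact: measurable_funM.
have EE (psi : R -> R) : (\int[m]_t (\1_I t * psi t)%:E = \int[m']_t (\1_I t * psi t)%:E)%E.
 by have := E (EFin \o psi); under eq_integral do rewrite -EFinM; under [in RHS]eq_integral do rewrite -EFinM.
move=> /integrableP[_ h]; split; last by rewrite /Rintegral EE.
apply/integrableP; split; first exact/mEFinP.
move: h; congr (_ < _)%E.
have := EE (fun t => `|phi t|); congr (_ = _); apply: eq_integral => t _;
 by rewrite /= normrM ger0_norm// indicE.
Qed.

(* The polarized integrals only see the set where the spectral measures differ. *)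
Lemma diff_integral m1 m2 m0 phi I M : measurable I -> meas phi ->
 (m1 setT < +oo)%E -> (m2 setT < +oo)%E -> (m0 setT < +oo)%E ->
 (forall B, measurable B -> B `<=` ~` I -> m0 B = m1 B /\ m0 B = m2 B) ->
 (\int[m0]_t ((phi t) ^+ 2)%:E < +oo)%E ->
 (forall t, `|\1_I t * phi t| <= M) ->
 \int[m1]_t phi t - \int[m2]_t phi t =
  \int[m1]_t (\1_I t * phi t) - \int[m2]_t (\1_I t * phi t).
Proof.
move=> mI mp f1 f2 f0 ag sq b; have mC : measurable (~` I) by exact: measurableC.
have i0 : intg m0 (fun t => \1_(~` I) t * phi t).
 have i2 : intg m0 (fun t => phi t ^+ 2).
  by apply/intgP => //; [exact: measurable_funX|move=> t; exact: sqr_ge0].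
 have i1 := intg_indic measurableT f0.
 apply: (intg_le _ _ (intgD i1 i2)); first exact: measurable_funM.
 move=> t; rewrite indicT normrM indicE (ger0_norm (ler0n _ _)).
 apply: (@le_trans _ _ `|phi t|); first by rewrite ler_piMl// lern1 leq_b1.
 rewrite ler_norml; have := sqr_ge0 (phi t - 1); have := sqr_ge0 (phi t + 1); move: (phi t) => x.
 by rewrite /cst => *; apply/andP; split; nra.
have [i1 e1] := intg_agree mC mp (fun B mB BI => (ag B mB BI).1) i0.
have [i2 e2] := intg_agree mC mp (fun B mB BI => (ag B mB BI).2) i0.
have mIp : meas (fun t => \1_I t * phi t) by exact: measurable_funM.
have s (m : {measure set R -> \bar R}) : (m setT < +oo)%E -> intg m (fun t => \1_(~` I) t * phi t) ->
  \int[m]_t phi t = \int[m]_t (\1_I t * phi t) + \int[m]_t (\1_(~` I) t * phi t).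
 move=> fm im; rewrite -RintD//; last exact: intg_bounded b.
 apply: eq_Rintegral => t _; rewrite -mulrDl !indicE in_setC.
 by case: (t \in I); rewrite ?addr0 ?add0r mul1r.
by rewrite (s _ f1 i1) (s _ f2 i2) -e1 -e2; ring.
Qed.

End finite_measures.

Section resolutions.
Context d (T : measurableType d) (R : realType) (mu : {measure set T -> \bar R}).
Variable E : resolution mu.
Local Notation P := (res_proj E).
Local Notation sp := (res_spec E).
Implicit Types (f g h : T -> R[i]) (A B I : set R) (phi psi : R -> R) (M : R).

Lemma spec_nrm f B : measurable B -> L2 mu f -> sp f B = (nrm mu (P B f))%:E.
Proof. by move=> mB f2; rewrite res_specE// sqL2E//; exact: res_proj_L2. Qed.

Lemma spec_setT f : L2 mu f -> sp f setT = (nrm mu f)%:E.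
Proof.
move=> f2; rewrite spec_nrm//; congr EFin; apply: nrm_ae; last exact: res_projT.
 by have [] := @res_proj_L2 _ _ _ _ E setT f measurableT f2.
by have [] := f2.
Qed.

Lemma spec_fin f : L2 mu f -> (sp f setT < +oo)%E.
Proof. by move=> f2; rewrite spec_setT// ltry. Qed.

Lemma proj_inner A B f g : measurable A -> measurable B -> L2 mu f -> L2 mu g ->
 inner mu (P A f) (P B g) = inner mu (P (B `&` A) f) g.
Proof.
move=> mA mB f2 g2; have PA := res_proj_L2 E mA f2.
rewrite -(res_proj_sym E mB PA g2).
have mBA : measurable (B `&` A) by exact: measurableI.
have p1 := (res_proj_L2 E mB PA).1; have p2 := (res_proj_L2 E mBA f2).1.
apply: inner_ae => //; [exact: g2.1|exact: g2.1| |exact: aeW].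
by apply: aeS (res_projI E mB mA f2) _ => x ->.
Qed.

Lemma proj_set0 f g : L2 mu f -> L2 mu g -> inner mu (P set0 f) g = 0.
Proof.
move=> f2 g2; have p2 := res_proj_L2 E measurable0 f2.
have n0 : nrm mu (P set0 f) = 0.
 by have := spec_nrm measurable0 f2; rewrite measure0 => -[].
apply: sqnormC_eq0; apply/eqP; rewrite eq_le sqnormC_ge0 andbT.
by have := inner_CS p2 g2; rewrite n0 mul0r.
Qed.

Lemma nrm_proj B f : measurable B -> L2 mu f -> nrm mu (P B f) = rip mu (P B f) f.
Proof.
move=> mB f2; rewrite -rip_nrm /rip (proj_inner mB mB f2 f2).
by rewrite setIid.
Qed.

(** Linearity is not a field of [resolution]; for the quadratic form |P f|^2 = <P f, f> it is
    derived from symmetry, here and in [nrm_projD]. *)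
Lemma nrm_projZ B c f : measurable B -> L2 mu f ->
 nrm mu (P B (fun x => c * f x)) = sqnormC c * nrm mu (P B f).
Proof.
move=> mB f2; have cf2 := L2Z c f2; rewrite !nrm_proj// /rip (res_proj_sym E mB cf2 cf2).
have pc := res_proj_L2 E mB cf2; have pf := res_proj_L2 E mB f2.
rewrite (innerZ _ f2 pc) -(res_proj_sym E mB f2 cf2) (innerZr _ pf f2) mulrA !cE /sqnormC.
have -> : ImC (inner mu (P B f) f) = 0.
 have := congr1 (@complex.Im R) (innerC pf f2); rewrite Im_conj (res_proj_sym E mB f2 f2) => h.
 by lra.
by rewrite /=; ring.
Qed.

Lemma nrm_projD B f g : measurable B -> L2 mu f -> L2 mu g ->
 nrm mu (P B (fun x => f x + g x)) = nrm mu (P B f) + 2 * rip mu (P B f) g + nrm mu (P B g).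
Proof.
move=> mB f2 g2; have fg2 := L2D f2 g2.
have pf := res_proj_L2 E mB f2; have pg := res_proj_L2 E mB g2; have pfg := res_proj_L2 E mB fg2.
have sym u v : L2 mu u -> L2 mu v -> rip mu (P B u) v = rip mu u (P B v).
 by move=> u2 v2; rewrite /rip (res_proj_sym E mB u2 v2).
rewrite (nrm_proj mB fg2) (nrm_proj mB f2) (nrm_proj mB g2) (ripDr f2 g2 pfg).
rewrite (sym _ _ fg2 f2) (sym _ _ fg2 g2) (ripDl f2 g2 pf) (ripDl f2 g2 pg).
rewrite (ripC mu f (P B f)) (ripC mu g (P B f)) -(sym _ _ f2 g2) (ripC mu g (P B g)); ring.
Qed.

Definition fneg g : T -> R[i] := fun x => -1 * g x.
(** The real part of the integral of phi against <E f, g>, by real polarization: two spectral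
    measures instead of the four of [is_fcalc]. The imaginary part is reached through i g. *)
Definition polar (phi : R -> R) f g : R :=
 4^-1 * (\int[sp (fun x => f x + g x)]_t phi t - \int[sp (fun x => f x + fneg g x)]_t phi t).

Lemma L2_fneg g : L2 mu g -> L2 mu (fneg g).
Proof. exact: L2Z. Qed.

Lemma nrm_proj_fneg B g : measurable B -> L2 mu g -> nrm mu (P B (fneg g)) = nrm mu (P B g).
Proof. by move=> mB g2; rewrite nrm_projZ// /sqnormC /= oppr0 expr0n addr0 sqrrN expr1n mul1r. Qed.

Lemma rip_fneg f g : L2 mu f -> L2 mu g -> rip mu f (fneg g) = - rip mu f g.
Proof.
move=> f2 g2; rewrite -(ripNr g2 f2); congr (rip mu f _).
by apply/funext => x; rewrite /fneg mulN1r.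
Qed.

Lemma polar_indic B f g : measurable B -> L2 mu f -> L2 mu g ->
 polar (\1_B) f g = rip mu (P B f) g.
Proof.
move=> mB f2 g2; have n2 := L2_fneg g2; have pf := res_proj_L2 E mB f2.
rewrite /polar !Rint_indic// !spec_nrm//; [|exact: L2D|exact: L2D].
by rewrite /= !nrm_projD// nrm_proj_fneg// rip_fneg//; field.
Qed.

(** Each integral is at most M times the mass of its measure, and the masses add up to 2 (|f|^2 +
    |g|^2) by the parallelogram law. Rescaling one argument later turns this into an operator
    bound. *)
Lemma polar_bound phi M f g : L2 mu f -> L2 mu g -> meas phi ->
 (forall t, `|phi t| <= M) -> `|polar phi f g| <= M / 2 * (nrm mu f + nrm mu g).
Proof.
move=> f2 g2 mp b; have n2 := L2_fneg g2; have fp := L2D f2 g2; have fm := L2D f2 n2.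
have b1 := Rint_bounded (spec_fin fp) mp b; have b2 := Rint_bounded (spec_fin fm) mp b.
rewrite !spec_setT//= in b1 b2.
rewrite /polar normrM ger0_norm ?invr_ge0//.
have nE : nrm mu (fun x => f x + g x) + nrm mu (fun x => f x + fneg g x) = 2 * (nrm mu f + nrm mu g).
 rewrite !nrmD// rip_fneg// (_ : nrm mu (fneg g) = nrm mu g); first by ring.
 by rewrite /fneg nrmZ// /sqnormC /= oppr0 expr0n addr0 sqrrN expr1n mul1r.
have := ler_normB (\int[sp (fun x => f x + g x)]_t phi t) (\int[sp (fun x => f x + fneg g x)]_t phi t).
move=> /le_trans /(_ (lerD b1 b2)); rewrite -mulrDr nE => h.
by rewrite -ler_pdivlMl ?invr_gt0// invrK; apply: (le_trans h); rewrite le_eqVlt; apply/orP; left; apply/eqP; field.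
Qed.

Lemma polarB phi psi M M' f g : L2 mu f -> L2 mu g ->
 meas phi -> meas psi ->
 (forall t, `|phi t| <= M) -> (forall t, `|psi t| <= M') ->
 polar (fun t => phi t - psi t) f g = polar phi f g - polar psi f g.
Proof.
move=> f2 g2 mp ms bp bs; have n2 := L2_fneg g2; have fp := L2D f2 g2; have fm := L2D f2 n2.
rewrite /polar !RintB; try exact: intg_bounded (spec_fin _) _ _; first by ring.
all: by apply: intg_bounded; [exact: spec_fin|eassumption|eassumption].
Qed.

(* The range of the projection on [I], in a weak form. *)
Definition in_range I f := L2 mu f /\
 forall B h, measurable B -> B `&` I = set0 -> L2 mu h -> inner mu (P B h) f = 0.

Lemma in_range_proj I f : measurable I -> L2 mu f -> in_range I (P I f).
Proof.
move=> mI f2; split; first exact: res_proj_L2.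
by move=> B h mB BI h2; rewrite proj_inner// setIC BI proj_set0.
Qed.

Lemma in_range_rip I f B h : in_range I f -> measurable B -> B `&` I = set0 -> L2 mu h ->
 rip mu (P B h) f = 0.
Proof. by move=> [_ r] mB BI h2; rewrite /rip r. Qed.

Lemma in_rangeZ I c f : in_range I f -> in_range I (fun x => c * f x).
Proof.
move=> [f2 r]; split; first exact: L2Z.
move=> B h mB BI h2; rewrite innerZr ?r ?mulr0//; exact: res_proj_L2.
Qed.

(** On sets disjoint from I, the mixed and the pure term contributed by f both vanish: adding f
    changes a spectral measure inside I only. *)
Lemma in_range_spec I f B h : in_range I f -> measurable I -> measurable B -> B `<=` ~` I -> L2 mu h ->
 sp h B = sp (fun x => h x + f x) B.
Proof.
move=> rf mI mB BI h2; have [f2 _] := rf.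
have B0 : B `&` I = set0 by apply/disjoints_subset.
rewrite !spec_nrm ?nrm_projD//; last exact: L2D.
rewrite (in_range_rip rf mB B0 h2) mulr0 addr0 [nrm mu (P B f)]nrm_proj//.
by rewrite (in_range_rip rf mB B0 f2) addr0.
Qed.

Lemma spec_range0 I f B : in_range I f -> measurable B -> B `<=` ~` I -> sp f B = 0%E.
Proof.
move=> rf mB BI; have [f2 _] := rf.
have B0 : B `&` I = set0 by apply/disjoints_subset.
by rewrite spec_nrm// nrm_proj// (in_range_rip rf mB B0 f2).
Qed.

(** The spectral measure of f is finite and carried by I, where phi is bounded. *)
Lemma fcalc_dom_range phi I f M : measurable I -> in_range I f -> meas phi ->
 (forall t, `|\1_I t * phi t| <= M) -> fcalc_dom E phi f.
Proof.
move=> mI rf mp b; have [f2 _] := rf; split => //.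
have mC : measurable (~` I) by exact: measurableC.
have m2 : meas (fun t => phi t ^+ 2) by exact: measurable_funX.
have N0 : (sp f).-negligible (~` I) by exists (~` I); split => //; exact: (spec_range0 rf).
have -> : (\int[sp f]_t ((phi t) ^+ 2)%:E = \int[sp f]_t ((\1_I t * phi t) ^+ 2)%:E)%E.
 apply: ae_eq_integral => //.
 - exact/mEFinP.
 - by apply/mEFinP; apply: measurable_funX; exact: measurable_funM.
 - apply: (negligibleS _ N0) => t /= /not_implyP[_ h] It; apply: h.
  by rewrite indicE mem_set// mul1r.
have i : intg (sp f) (fun t => (\1_I t * phi t) ^+ 2).
 apply: (intg_bounded (M := M ^+ 2) (spec_fin f2)).
  by apply: measurable_funX; exact: measurable_funM.
 by move=> t; rewrite normrX ler_sqr ?nnegrE ?normr_ge0// (le_trans (normr_ge0 _) (b t)).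
by apply/intgP => //; [apply: measurable_funX; exact: measurable_funM|move=> t; exact: sqr_ge0].
Qed.

(* The functional calculus pairing, read off the polarization identity. *)
Lemma is_fcalc_polar phi I f g h M : measurable I -> meas phi ->
 (forall t, `|\1_I t * phi t| <= M) -> is_fcalc E phi g h -> in_range I f ->
 rip mu h f = polar (fun t => \1_I t * phi t) g f /\
 ImC (inner mu h f) = polar (fun t => \1_I t * phi t) g (fun x => 'i%C * f x).
Proof.
move=> mI mp b [[g2 gphi] h2 hE] rf; have [f2 _] := rf.
have df := fcalc_dom_range mI rf mp b; have H := hE f df; rewrite !big_ord_recr big_ord0 /= add0r in H.
have i2 : Complex 0 1 ^+ 2 = -1 :> R[i] by apply: complexP; rewrite expr2 !cE /=; ring.
have i3 : Complex 0 1 ^+ 3 = - Complex 0 1 :> R[i] by rewrite exprS i2 mulrN1.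
have dp u : in_range I u -> 4^-1 * (\int[sp (fun x => g x + u x)]_t phi t - \int[sp (fun x => g x + fneg u x)]_t phi t) =
  polar (fun t => \1_I t * phi t) g u.
 move=> ru; have [u2 _] := ru; have rn : in_range I (fneg u) by exact: in_rangeZ.
 congr (_ * _); apply: (diff_integral mI mp _ _ _ _ gphi b).
 - by apply: spec_fin; exact: L2D.
 - by apply: spec_fin; apply: L2D => //; exact: L2_fneg.
 - exact: spec_fin.
 - by move=> B mB BI; split; [exact: (in_range_spec ru mI mB BI g2)|exact: (in_range_spec rn mI mB BI g2)].
have e0 : (fun x => g x + Complex 0 1 ^+ 0 * f x) = (fun x => g x + f x).
 by apply/funext => x; rewrite expr0 mul1r.
have e1 : (fun x => g x + Complex 0 1 ^+ 1 * f x) = (fun x => g x + 'i%C * f x).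
 by apply/funext => x; rewrite expr1.
have e2 : (fun x => g x + Complex 0 1 ^+ 2 * f x) = (fun x => g x + fneg f x).
 by apply/funext => x; rewrite i2.
have e3 : (fun x => g x + Complex 0 1 ^+ 3 * f x) = (fun x => g x + fneg (fun x => 'i%C * f x) x).
 by apply/funext => x; rewrite i3 /fneg mulN1r mulNr.
rewrite e0 e1 e2 e3 i2 i3 expr0 expr1 in H; split.
 rewrite /rip H -(dp f rf) -[4%:R](rmorph_nat (@real_complex R)) -[_^-1]fmorphV !cE /=; ring.
rewrite H -(dp _ (in_rangeZ 'i%C rf)) -[4%:R](rmorph_nat (@real_complex R)) -[_^-1]fmorphV !cE /=; ring.
Qed.

(** * The operator on the range of a bounded interval *)

Section bounded_range.
Variables (a b : R).
Hypothesis ab : a < b.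
Let I : set R := [set` `[a, b[].
Let dl N : R := (b - a) / N.+1%:R.
Let c N (i : nat) : R := a + i%:R * dl N.
Let J N (i : nat) : set R := [set` `[c N i, c N i.+1[].
Let st N t : R := \sum_(i < N.+1) c N i * \1_(J N i) t.
Let dl_gt0 N : 0 < dl N. Proof. by rewrite divr_gt0// subr_gt0. Qed.
Let mJ N i : measurable (J N i). Proof. exact: measurable_itv. Qed.
Let mI : measurable I. Proof. exact: measurable_itv. Qed.
Let JE N i t : J N i t <-> i%:R <= (t - a) / dl N < i.+1%:R.
Proof.
rewrite /J /c /= in_itv /= ler_pdivlMr ?ltr_pdivrMr//.
by rewrite -!lerBrDl -ltrBlDl.
Qed.

Let JI N (i : 'I_N.+1) : J N i `<=` I.
Proof.
move=> t /JE /andP[h1 h2]; rewrite /I /= in_itv /=; apply/andP; split.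
 by have := le_trans (ler0n R i) h1; rewrite pmulr_lge0 ?invr_gt0// subr_ge0.
have : (t - a) / dl N < N.+1%:R by apply: lt_le_trans h2 _; rewrite ler_nat.
by rewrite ltr_pdivrMr// /dl mulrCA divff ?pnatr_eq0// mulr1 ltrD2r.
Qed.

Let st_out N t : ~ I t -> st N t = 0.
Proof.
move=> nI; rewrite /st big1// => i _; rewrite indicE memNset ?mulr0//.
by move=> /JI.
Qed.

Let st_in N t : I t -> exists2 i : 'I_N.+1, J N i t & st N t = c N i.
Proof.
rewrite /I /= in_itv /= => /andP[at_ tb].
have x0 : 0 <= (t - a) / dl N by rewrite divr_ge0 ?subr_ge0// ltW.
have xN : (t - a) / dl N < N.+1%:R.
 by rewrite ltr_pdivrMr// /dl mulrCA divff ?pnatr_eq0// mulr1 ltrD2r.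
have /andP[h1 h2] := truncn_itv x0; set i := Num.truncn _ in h1 h2.
have iN : (i < N.+1)%N by rewrite -(ltr_nat R); exact: le_lt_trans h1 xN.
exists (Ordinal iN); first by apply/JE; rewrite /= h1 h2.
rewrite /st (bigD1 (Ordinal iN))//= big1 => [|k ki].
 by rewrite indicE mem_set ?mulr1 ?addr0//; apply/JE; rewrite h1 h2.
rewrite indicE memNset ?mulr0// => /JE /andP[k1 k2].
have k_le : (k < i.+1)%N by rewrite -(ltr_nat R); exact: le_lt_trans k1 h2.
have i_le : (i < k.+1)%N by rewrite -(ltr_nat R); exact: le_lt_trans h1 k2.
move/eqP: ki; apply; apply: val_inj; apply/eqP.
by change ((k : nat) == i); rewrite eqn_leq -ltnS k_le -ltnS i_le.
Qed.

Let st_close N t : `|\1_I t * t - st N t| <= dl N.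
Proof.
have [It|nI] := pselect (I t); last first.
 by rewrite st_out// indicE memNset// mul0r subr0 normr0 ltW.
have [i /JE /andP[h1 h2] ->] := st_in N It; rewrite indicE mem_set// mul1r /c opprD addrA.
rewrite ler_pdivlMr// in h1; rewrite ltr_pdivrMr// -[i.+1%:R]natr1 mulrDl mul1r in h2.
by rewrite ger0_norm ?subr_ge0// lerBlDl ltW.
Qed.

Let st_close2 (N M : nat) t : `|st N t - st M t| <= dl N + dl M.
Proof.
rewrite (_ : _ - _ = (\1_I t * t - st M t) - (\1_I t * t - st N t)); last by ring.
by rewrite (le_trans (ler_normB _ _))// addrC lerD.
Qed.

Let bI : R := `|a| + `|b|.
Let id_bound t : `|\1_I t * t| <= bI.
Proof.
have [It|nI] := pselect (I t); last by rewrite indicE memNset// mul0r normr0 addr_ge0.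
rewrite indicE mem_set// mul1r; move: It; rewrite /I /= in_itv /= => /andP[h1 h2].
rewrite ler_norml; have := ler_norm b; have := ler_norm (- a); rewrite normrN.
have := normr_ge0 a; have := normr_ge0 b; rewrite /bI; move: (`|a|) (`|b|) => x y *.
by apply/andP; split; lra.
Qed.

Let st_bound N t : `|st N t| <= bI + dl N.
Proof.
rewrite (_ : st N t = \1_I t * t - (\1_I t * t - st N t)); last by ring.
by rewrite (le_trans (ler_normB _ _))// lerD.
Qed.

Let mst N : meas (st N).
Proof. by apply: measurable_sum => i; apply: measurable_funM => //; exact: measurable_indic. Qed.
Let mid : meas (fun t : R => \1_I t * t).
Proof. by apply: measurable_funM => //; exact: measurable_indic. Qed.

Let polar_st N f g : L2 mu f -> L2 mu g ->
 polar (st N) f g = \sum_(i < N.+1) c N i * rip mu (P (J N i) f) g.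
Proof.
move=> f2 g2; have n2 := L2_fneg g2; have fp := L2D f2 g2; have fm := L2D f2 n2.
have sE (m : {measure set R -> \bar R}) : (m setT < +oo)%E -> \int[m]_t st N t = \sum_(i < N.+1) c N i * \int[m]_t \1_(J N i) t.
 move=> mT; have mfin i : (m (J N i) < +oo)%E.
  by apply: le_lt_trans mT; apply: le_measure; rewrite ?inE.
 rewrite /st Rint_sum; last by move=> i _; apply: intgZ; exact: intg_indic.
 by apply: eq_bigr => i _; rewrite RintZ//; exact: intg_indic.
rewrite /polar !sE; [|exact: spec_fin|exact: spec_fin].
rewrite -sumrB mulr_sumr; apply: eq_bigr => i _; rewrite -mulrBr mulrCA; congr (_ * _).
by rewrite -(polar_indic (mJ N i) f2 g2).
Qed.

Section range_vector.
Variable f : T -> R[i].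
Hypothesis rf : in_range I f.
Let f2 : L2 mu f := rf.1.
(** The integral of the step function [st N] against the resolution, applied to f. *)
Let gN N x : R[i] := \sum_(i < N.+1) (c N i)%:C%C * P (J N i) f x.
Let gN2 N : L2 mu (gN N).
Proof. by apply: L2_sum => i _; apply: L2Z; exact: res_proj_L2. Qed.
Let inner_gN N h : L2 mu h -> inner mu h (gN N) = \sum_(i < N.+1) (c N i)%:C%C * inner mu (P (J N i) h) f.
Proof.
move=> h2; have pf (i : 'I_N.+1) : L2 mu (P (J N i) f) by exact: res_proj_L2.
rewrite (innerC h2 (gN2 N)) /gN (inner_suml _ _ pf h2).
rewrite (big_morph (@conjc R) (@conjcD R) (conjc0 R)); apply: eq_bigr => i _.
by rewrite conjcM conjc_real -(innerC h2 (pf i)) (res_proj_sym E (mJ N i) h2 f2).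
Qed.

Let rip_gN N h : L2 mu h -> rip mu h (gN N) = polar (st N) h f /\
 rip mu h (fun x => 'i%C * gN N x) = polar (st N) h (fun x => 'i%C * f x).
Proof.
move=> h2; have if2 := L2Z 'i%C f2; rewrite !polar_st//.
have E1 := inner_gN N h2; have E2 := inner_rip h2 (gN2 N); split.
 rewrite /rip E1 Re_sum; apply: eq_bigr => i _; rewrite !cE /=; ring.
have -> : rip mu h (fun x => 'i%C * gN N x) = ImC (inner mu h (gN N)) by rewrite E2.
rewrite E1 Im_sum; apply: eq_bigr => i _; have ph := res_proj_L2 E (mJ N i) h2.
by rewrite [inner mu (P _ h) f](inner_rip ph f2) !cE /=; ring.
Qed.

Let dl_cvg e : 0 < e -> exists K, forall N, (K <= N)%N -> dl N <= e.
Proof.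
move=> e0; exists (Num.truncn ((b - a) / e)) => N KN.
have x0 : 0 <= (b - a) / e by rewrite divr_ge0 ?subr_ge0// ltW.
have /andP[_ h] := truncn_itv x0; rewrite /dl ler_pdivrMr// mulrC -ler_pdivrMr//.
by apply: (le_trans (ltW h)); rewrite ler_nat.
Qed.

(** With D = dl N + dl M, [polar_bound] gives X <= (D / 2) (X + Y) for the squared norms X of the
    difference and Y of f; D <= 1 allows X to be absorbed on the left. *)
Let gN_cauchy (N M : nat) : dl N + dl M <= 1 ->
 nrm mu (fun x => gN N x - gN M x) <= (dl N + dl M) * nrm mu f.
Proof.
move=> D1; have u2 := L2B (gN2 N) (gN2 M); set u := (fun x => _) in u2 *.
have : nrm mu u = polar (fun t => st N t - st M t) u f.
 rewrite (polarB u2 f2 (mst N) (mst M) (st_bound N) (st_bound M)).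
 by rewrite -(rip_gN N u2).1 -(rip_gN M u2).1 -(ripBr (gN2 N) (gN2 M) u2) rip_nrm.
have := polar_bound u2 f2 (measurable_funB (mst N) (mst M)) (st_close2 N M).
rewrite ler_norml => /andP[_ h] uE; rewrite -uE in h.
have := nrm_ge0 mu u; have := nrm_ge0 mu f; move: (nrm mu u) (nrm mu f) h => X Y h X0 Y0.
by have := dl_gt0 N; have := dl_gt0 M; move: (dl N + dl M) D1 h => D *; nra.
Qed.

(* [g] is the limit of step functions [\sum_i c_i P_(J_i) f]. *)
Lemma range_operator : exists g, [/\ in_range I g,
 nrm mu (fun x => g x - ((a + b) / 2)%:C%C * f x) <= ((b - a) / 2) ^+ 2 * nrm mu f &
 forall h k, is_fcalc E id h k -> inner mu f k = inner mu g h].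
Proof.
have [g g2 cg] : exists2 g, L2 mu g & nrm mu (fun x => gN j x - g x) @[j --> \oo] --> 0.
 apply: Riesz_Fischer => // e e0.
 have [K hK] := @dl_cvg (Num.min (1 / 2) (e / (2 * (nrm mu f + 1)))) ltac:(
  by rewrite lt_min !divr_gt0// mulr_gt0// ltr_wpDl// nrm_ge0).
 exists K => N M KN KM; have := hK _ KN; have := hK _ KM; rewrite !le_min => /andP[m1 m2] /andP[n1 n2].
 have D1 : dl N + dl M <= 1 by lra.
 apply: (le_trans (gN_cauchy D1)); have F0 := nrm_ge0 mu f.
 rewrite !ler_pdivlMr ?mulr_gt0 ?ltr_wpDl// in m2 n2.
 by have := dl_gt0 N; have := dl_gt0 M; move: (dl N) (dl M) (nrm mu f) F0 m2 n2 => x y z *; nra.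
have if2 := L2Z 'i%C f2; have ig2 := L2Z 'i%C g2.
have pl h u : L2 mu h -> L2 mu u -> polar (st j) h u @[j --> \oo] --> polar (fun t => \1_I t * t) h u.
 move=> h2 u2; apply/cvgrPdist_le => e e0; set Y := nrm mu h + nrm mu u.
 have Y0 : 0 <= Y by rewrite addr_ge0 ?nrm_ge0.
 have [K hK] := @dl_cvg (e / (Y + 1)) ltac:(by rewrite divr_gt0// ltr_wpDl).
 exists K => // j /hK dj; rewrite -(polarB h2 u2 mid (mst j) id_bound (st_bound j)).
 apply: (le_trans (polar_bound h2 u2 (measurable_funB mid (mst j)) (st_close j))); rewrite -/Y.
 rewrite ler_pdivlMr ?ltr_wpDl// in dj.
 by have := dl_gt0 j; move: (dl j) dj => x *; nra.
have l1 h : L2 mu h -> rip mu h g = polar (fun t => \1_I t * t) h f.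
 move=> h2; have c1 := nrm_cvg gN2 g2 cg h2.
 apply: (cvg_unique (@norm_hausdorff _ _) _ (pl _ _ h2 f2)); rewrite ripC.
 rewrite (_ : (fun j => _) = fun j => rip mu (gN j) h)//.
 by apply/funext => j; rewrite ripC (rip_gN j h2).1.
have l2 h : L2 mu h -> rip mu h (fun x => 'i%C * g x) = polar (fun t => \1_I t * t) h (fun x => 'i%C * f x).
 move=> h2; have c1 := nrm_cvg gN2 g2 cg (L2Z (- 'i%C) h2).
 have sw u : L2 mu u -> rip mu u (fun x => - 'i%C * h x) = rip mu h (fun x => 'i%C * u x).
  move=> u2; rewrite ripC !ripE; apply: eq_Rintegral => x _; rewrite !cE /=; ring.
 rewrite sw// in c1.
 apply: (cvg_unique (@norm_hausdorff _ _) _ (pl _ _ h2 if2)).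
 rewrite (_ : (fun j => _) = fun j => rip mu (gN j) (fun x => - 'i%C * h x))//.
 by apply/funext => j; rewrite sw// (rip_gN j h2).2.
have rg : in_range I g.
 split => // B h mB BI h2; have pb := res_proj_L2 E mB h2.
 have z N : inner mu (P B h) (gN N) = 0.
  rewrite inner_gN// big1// => i _; have [_ r] := rf.
  have Z : inner mu (P (J N i) (P B h)) f = inner mu (P (J N i `&` B) h) f.
   have mJB : measurable (J N i `&` B) by exact: measurableI.
   apply: inner_ae; [exact: (res_proj_L2 E (mJ N i) pb).1|exact: (res_proj_L2 E mJB h2).1|exact: f2.1|exact: f2.1| |exact: aeW].
   by apply: aeS (res_projI E (mJ N i) mB h2) _ => x ->.
  rewrite Z (_ : J N i `&` B = set0) ?proj_set0 ?mulr0//.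
  by rewrite -subset0 => t [/JI It Bt]; rewrite -BI.
 have c0 := inner_cvg gN2 g2 pb cg.
 apply/eqP; rewrite -[_ == _]negbK; apply/negP => ne.
 have : sqnormC (inner mu (P B h) g) = 0.
  apply: (cvg_unique (@norm_hausdorff _ _) _ c0).
  rewrite (_ : (fun j => _) = fun=> sqnormC (inner mu (P B h) g)); first exact: cvg_cst.
  apply/funext => j; rewrite (innerC (gN2 j) pb) z conjc0 sub0r sqnormCN.
  by rewrite (innerC g2 pb) sqnormC_conj.
 by move=> /sqnormC_eq0 h0; rewrite h0 eqxx in ne.
exists g; split => //.
(* [cc] is the midpoint and [r] half the length, so |t - cc| <= r on I; this bounds the form of [w]
   = (A - cc) f. *)
- set cc := (a + b) / 2; set r := (b - a) / 2.
 have r0 : 0 < r by rewrite divr_gt0// subr_gt0.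
 pose w x := g x - cc%:C%C * f x; have cf2 := L2Z cc%:C%C f2; have w2 : L2 mu w by exact: L2B.
 have mone (B : set R) : measurable B -> meas (\1_B : R -> R) by move=> ?; exact: measurable_indic.
 have one_b (B : set R) t : `|\1_B t : R| <= 1 by rewrite indicE ger0_norm// lern1 leq_b1.
 have ripI h : L2 mu h -> rip mu h f = polar (\1_I) h f.
  move=> h2; have mC : measurable (~` I) by exact: measurableC.
  have T1 : rip mu h f = polar (\1_setT) h f.
   rewrite polar_indic//; apply: rip_ae; [exact: h2.1|exact: (res_proj_L2 E measurableT h2).1|exact: f2.1|exact: f2.1| |exact: aeW].
   by apply: aeS (res_projT E h2) _ => x ->.
  have T2 : polar (\1_(~` I)) h f = 0.
   by rewrite polar_indic// (in_range_rip rf mC _ h2)// setICl.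
  apply/eqP; rewrite -subr_eq0 T1 -(polarB h2 f2 (mone _ measurableT) (mone _ mI) (one_b _) (one_b _)) -T2.
  by apply/eqP; congr polar; apply/funext => t; rewrite !indicE in_setT in_setC; case: (t \in I) => /=; ring.
 have wE h : L2 mu h -> rip mu h w <= r / 2 * (nrm mu h + nrm mu f).
  move=> h2; rewrite /w (ripBr g2 cf2 h2) ripZr// l1// ripI//.
  have cE : cc * polar (\1_I) h f = polar (fun t => cc * \1_I t) h f.
   have i1 u : L2 mu u -> intg (sp u) (\1_I).
    by move=> u2; exact: (intg_bounded (spec_fin u2) (mone I mI) (one_b I)).
   rewrite /polar !RintZ; [by ring|apply: i1|apply: i1]; apply: L2D => //; exact: L2_fneg.
  have mcI : meas (fun t : R => cc * \1_I t) by apply: measurable_funM => //; exact: mone.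
  have bcI t : `|cc * \1_I t| <= `|cc| by rewrite normrM ler_piMr.
  rewrite cE -(polarB h2 f2 mid mcI id_bound bcI).
  apply: (le_trans (ler_norm _)); apply: polar_bound => //; first exact: measurable_funB.
  move=> t; have [It|nI] := pselect (I t); last by rewrite indicE memNset// mul0r mulr0 subr0 normr0 ltW.
  rewrite indicE mem_set// mul1r mulr1; move: It; rewrite /I /= in_itv /= => /andP[ta tb].
  by rewrite ler_norml /cc /r; apply/andP; split; lra.
 (* The bound on the pairing with [w] is not homogeneous; the choice h = w / r makes it |w|^2 <= r^2
    |f|^2. *)
 have iw2 := L2Z (r^-1)%:C%C w2.
 have := wE _ iw2; rewrite nrmZ// sqnormC_real ripC ripZr// rip_nrm.
 have := nrm_ge0 mu w; move: (nrm mu w) (nrm mu f) => X F X0 h.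
 have h' : r * (r^-1 * X) <= r * (r / 2 * (r^-1 ^+ 2 * X + F)) by rewrite ler_wpM2l// ltW.
 have rX : r * (r^-1 * X) = X by rewrite mulrA mulfV ?gt_eqF// mul1r.
 rewrite rX in h'.
 have rE : r * (r / 2 * (r^-1 ^+ 2 * X + F)) = X / 2 + r ^+ 2 * F / 2 by field; rewrite gt_eqF.
 by rewrite rE in h'; lra.
- move=> h k hk; have [[h2 _] k2 _] := hk.
 have mid' : meas (@id R) by [].
 have [e1 e2] := is_fcalc_polar mI mid' id_bound hk rf.
 rewrite (innerC f2 k2) (innerC g2 h2); congr conjc.
 rewrite [inner mu h g](inner_rip h2 g2) l1// l2//.
 by apply: complexP; [exact: e1|exact: e2].
Qed.

End range_vector.
End bounded_range.
End resolutions.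

(** * Projections on intervals *)

Section interval_projections.
Context d (T : measurableType d) (R : realType) (mu : {measure set T -> \bar R}).
Variable E : resolution mu.
Local Notation P := (res_proj E).
Local Notation sp := (res_spec E).
Implicit Types (f g h : T -> R[i]) (A B I : set R) (a b c : R) (phi psi : R -> R).

Lemma in_rangeD I f g : in_range E I f -> in_range E I g -> in_range E I (fun x => f x + g x).
Proof.
move=> [f2 rf] [g2 rg]; split; first exact: L2D.
move=> B h mB BI h2; rewrite innerDr ?rf ?rg ?addr0//; exact: res_proj_L2.
Qed.

Lemma co_disjoint a b c e : b <= c -> [set` `[a, b[] `&` [set` `[c, e[] = set0 :> set R.
Proof.
move=> bc; rewrite -subset0 => t [] /=; rewrite !in_itv /= => /andP[_ tb] /andP[ct _].
by have := lt_le_trans tb (le_trans bc ct); rewrite ltxx.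
Qed.

Lemma nrm_proj_split f a b c : L2 mu f -> a <= b -> b <= c ->
 nrm mu (P [set` `[a, c[] f) = nrm mu (P [set` `[a, b[] f) + nrm mu (P [set` `[b, c[] f).
Proof.
move=> f2 ab bc.
have e : sp f [set` `[a, c[] = (sp f [set` `[a, b[] + sp f [set` `[b, c[])%E.
 rewrite (itv_bndbnd_setU (x := BLeft b)) ?bnd_simp//.
 by apply: measureU => //; exact: co_disjoint.
by have := e; rewrite !spec_nrm// -EFinD => -[].
Qed.

Lemma nrm_proj_cvg f : L2 mu f ->
 nrm mu (P [set` `[- k%:R, k%:R[] f) @[k --> \oo] --> nrm mu f.
Proof.
move=> f2; apply: fine_cvg; rewrite -(spec_setT E f2).
have U : \bigcup_k [set` `[- k%:R, k%:R[] = [set: R].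
 rewrite -subTset => t _; exists (Num.truncn `|t|).+1 => //=; rewrite in_itv /=.
 have /andP[_ h] := truncn_itv (normr_ge0 t); have /andP[h1 h2] : - `|t| <= t <= `|t| by rewrite -ler_norml.
 by apply/andP; split; lra.
rewrite -U; rewrite (_ : (fun k => _) = fun k => sp f [set` `[- k%:R, k%:R[]); last by apply/funext => k; rewrite res_specE.
apply: nondecreasing_cvg_mu => //; first by rewrite U.
move=> m n mn; apply/subsetPset => t /=; rewrite !in_itv /= => /andP[h1 h2].
have mn' : m%:R <= n%:R :> R by rewrite ler_nat.
by apply/andP; split; lra.
Qed.

Lemma rip_proj_disjoint A B f g : measurable A -> measurable B -> A `&` B = set0 ->
 L2 mu f -> L2 mu g -> rip mu (P A f) (P B g) = 0.
Proof. by move=> mA mB AB f2 g2; rewrite /rip proj_inner// setIC AB proj_set0. Qed.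

Lemma nrm_sub_proj3 A B C f : measurable A -> measurable B -> measurable C ->
 A `&` B = set0 -> A `&` C = set0 -> B `&` C = set0 -> L2 mu f ->
 nrm mu (fun x => f x - P A f x - P B f x - P C f x) =
 nrm mu f - nrm mu (P A f) - nrm mu (P B f) - nrm mu (P C f).
Proof.
move=> mA mB mC AB AC BC f2.
have [a2 b2 c2] : [/\ L2 mu (P A f), L2 mu (P B f) & L2 mu (P C f)] by split; exact: res_proj_L2.
have fa := L2B f2 a2; have fab := L2B fa b2.
rewrite (nrmB fab c2) (nrmB fa b2) (nrmB f2 a2).
rewrite (ripBl fa b2 c2) (ripBl f2 a2 c2) (ripBl f2 a2 b2).
rewrite !rip_proj_disjoint// (ripC mu f (P A f)) (ripC mu f (P B f)) (ripC mu f (P C f)).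
by rewrite -!nrm_proj//; ring.
Qed.

(* [polar psi f (P I f)] is the integral of [psi] over [I] against the spectral measure of [f]. *)
Lemma polar_proj_ge0 psi M I f : measurable I -> meas psi -> L2 mu f ->
 (forall t, 0 <= psi t <= M) -> (forall t, ~ I t -> psi t = 0) -> 0 <= polar E psi f (P I f).
Proof.
move=> mI mp f2 bp p0; have i2 := res_proj_L2 E mI f2; have n2 := L2_fneg i2.
have g2 := L2D f2 n2; set g := (fun x => f x + _) in g2.
have bn t : `|psi t| <= M by have /andP[h1 h2] := bp t; rewrite ger0_norm.
have sI : sp g I = 0%E.
 rewrite spec_nrm// nrm_projD// nrm_proj_fneg//.
 have e : nrm mu (P I (P I f)) = nrm mu (P I f).
  have pii := res_proj_L2 E mI i2.
  apply: nrm_ae; [exact: pii.1|exact: i2.1|].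
  by apply: aeS (res_projI E mI mI f2) _ => x <-; rewrite setIid.
 by rewrite rip_fneg// rip_nrm e; congr EFin; ring.
have z : \int[sp g]_t psi t = 0.
 rewrite (@Rint_ae _ _ _ _ psi (fun=> 0)) ?Rintg0//.
 exists I; split => // t /= h; apply: contrapT => nI; exact: (h (p0 t nI)).
rewrite /polar -/g z subr0 mulr_ge0// ?invr_ge0//; apply: Rint_ge0 => t.
by have /andP[] := bp t.
Qed.

Lemma polarZ psi M c f g : L2 mu f -> L2 mu g -> meas psi ->
 (forall t, `|psi t| <= M) -> polar E (fun t => c * psi t) f g = c * polar E psi f g.
Proof.
move=> f2 g2 mp bp; have n2 := L2_fneg g2.
have i1 u : L2 mu u -> intg (sp u) psi by move=> u2; exact: (intg_bounded (spec_fin E u2) mp bp).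
by rewrite /polar !RintZ; [ring|apply: i1; exact: L2D|apply: i1; exact: L2D].
Qed.

(** On the range of E([a, b)) the form of phi is compared with those of the constants m and M, by
    [polar_proj_ge0] for the differences. With phi = t^alpha these constants become the rates in
    Gronwall's inequality. *)
Lemma fcalc_proj_bounds phi f G a b (m M : R) : is_fcalc E phi f G -> meas phi ->
 a < b -> (forall t, a <= t < b -> m <= phi t <= M) -> 0 <= m ->
 m * nrm mu (P [set` `[a, b[] f) <= rip mu G (P [set` `[a, b[] f) <= M * nrm mu (P [set` `[a, b[] f).
Proof.
move=> fG mp ab bp m0; have [[f2 _] _ _] := fG; set I := [set` `[a, b[].
have mI : measurable I by exact: measurable_itv.
have i2 := res_proj_L2 E mI f2; have m1 := measurable_indic (R := R) mI.
have mM : 0 <= m <= M.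
 by rewrite m0 /=; have /andP[] := bp a ltac:(by rewrite lexx ab) => h1 h2; exact: le_trans h1 h2.
pose psi t := \1_I t * phi t; have mpsi : meas psi by exact: measurable_funM.
have inI t : I t -> psi t = phi t by move=> It; rewrite /psi indicE mem_set// mul1r.
have outI t : ~ I t -> psi t = 0 by move=> nI; rewrite /psi indicE memNset// mul0r.
have in1 t : I t -> \1_I t = 1 :> R by move=> It; rewrite indicE mem_set.
have out1 t : ~ I t -> \1_I t = 0 :> R by move=> nI; rewrite indicE memNset.
have bI t : I t -> m <= phi t <= M by rewrite /I /= in_itv /=; exact: bp.
have bpsi t : `|psi t| <= M.
 have [It|nI] := pselect (I t); last by rewrite outI// normr0; lra.
 by rewrite inI//; have := bI t It; rewrite ler_norml; lra.
have b1 t : `|\1_I t : R| <= 1 by rewrite indicE ger0_norm// lern1 leq_b1.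
have bc c t : `|c * \1_I t| <= `|c| by rewrite normrM ler_piMr.
have mc c : meas (fun t : R => c * \1_I t) by exact: measurable_funM.
have [-> _] := is_fcalc_polar mI mp bpsi fG (in_range_proj E mI f2).
have pc c : polar E (fun t => c * \1_I t) f (P I f) = c * nrm mu (P I f).
 by rewrite (polarZ _ f2 i2 (m1 _) b1) polar_indic// rip_nrm.
rewrite -!pc; apply/andP; split; rewrite -subr_ge0.
- rewrite -(polarB E f2 i2 mpsi (mc m) bpsi (bc m)).
 apply: (polar_proj_ge0 (M := M) mI (measurable_funB mpsi (mc m)) f2) => t => [|nI]; last by rewrite /psi /= !(out1 t nI); ring.
 have [It|nI] := pselect (I t); last by rewrite /psi /= !(out1 t nI); lra.
 by rewrite /psi /= !(in1 t It); have := bI t It; lra.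
- rewrite -(polarB E f2 i2 (mc M) mpsi (bc M) bpsi).
 apply: (polar_proj_ge0 (M := M) mI (measurable_funB (mc M) mpsi) f2) => t => [|nI]; last by rewrite /psi /= !(out1 t nI); ring.
 have [It|nI] := pselect (I t); last by rewrite /psi /= !(out1 t nI); lra.
 by rewrite /psi /= !(in1 t It); have := bI t It; lra.
Qed.

End interval_projections.

Section cut.
Context d (T : measurableType d) (R : realType) (mu : {measure set T -> \bar R}).
Variables (A : set T) (G : T -> R[i]).
Hypotheses (G2 : L2 mu G) (mA : measurable A).

Lemma sqnormC_cut x : sqnormC ((\1_A x)%:C%C * G x) = \1_A x * sqnormC (G x).
Proof. by rewrite sqnormCM sqnormC_real indicE; case: (x \in A); rewrite ?expr1n ?expr0n. Qed.

Lemma L2_cut : L2 mu (fun x => (\1_A x)%:C%C * G x).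
Proof.
apply: L2_le G2 _; first by apply: mcM; [apply: mc_real; exact: measurable_indic|exact: G2.1].
by move=> x; rewrite sqnormC_cut ler_piMl ?sqnormC_ge0// indicE lern1 leq_b1.
Qed.

Lemma nrm_cut_le : nrm mu (fun x => (\1_A x)%:C%C * G x) <= nrm mu G.
Proof.
rewrite !nrmE; apply: Rint_le; [exact: ((L2P _ _).1 L2_cut).2|exact: ((L2P _ _).1 G2).2|].
by move=> x; rewrite sqnormC_cut ler_piMl ?sqnormC_ge0// indicE lern1 leq_b1.
Qed.

End cut.

(** * Interval projections as multiplications *)

Section spectral_fourier.
Context {R : realType} (n : nat).
Hypothesis n0 : (0 < n)%N.
Local Notation U f := (toK (fourier f)).
Local Notation sy := (@symb R n).
Implicit Types (f g : heis R n -> R[i]) (a b : R).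

Lemma L2_U f : L2 hm f -> L2 KK (U f).
Proof. by move=> f2; have [] := fourierP n0 f2. Qed.

Lemma nrm_U f : L2 hm f -> nrm KK (U f) = plancherel_const n * nrm hm f.
Proof. by move=> f2; exact: is_fourierK_nrm n0 _ _ (fourierP n0 f2). Qed.

Lemma U_lin c f g : L2 hm f -> L2 hm g ->
 {ae KK, forall p, U (fun x => f x + c * g x) p = U f p + c * U g p}.
Proof.
move=> f2 g2; have h2 := L2D f2 (L2Z c g2).
have k1 := fourierP n0 h2; have k2 := is_fourierK_lin n0 c (fourierP n0 f2) (fourierP n0 g2).
have [_ K2 _] := k2.
have k3 := is_fourierK_lin n0 (-1) k1 k2.
apply: ae_eq_L2; [exact: L2_U|exact: K2|].
have := is_fourierK_nrm n0 k3.
rewrite [nrm hm _](_ : _ = 0); last first.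
 by rewrite nrmE (_ : (fun x => _) = fun=> 0) ?Rintg0//; apply/funext => x; rewrite mulN1r subrr sqnormC0.
rewrite mulr0 => <-; congr nrm; apply/funext => p; by rewrite mulN1r.
Qed.

Lemma U_sub f g : L2 hm f -> L2 hm g -> {ae KK, forall p, U (fun x => f x - g x) p = U f p - U g p}.
Proof.
move=> f2 g2; rewrite (_ : (fun x => f x - g x) = fun x => f x + (-1) * g x).
 by apply: aeS (U_lin (-1) f2 g2) _ => p ->; rewrite mulN1r.
by apply/funext => x; rewrite mulN1r.
Qed.

(** For a given pair of indices |lam| mu_k = b has at most two solutions, since mu_k > 0, and there
    are countably many pairs. *)
Lemma symb_level_null (F : R -> {ffun 'I_n -> nat} -> {ffun 'I_n -> nat} -> R[i]) b :
 {ae KK, forall p, sy p = b -> toK F p = 0}.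
Proof.
apply: ae_counting => m; rewrite /symb /toK /=; case: pickle_inv => [kl|]; last exact: aeW.
have e0 : 0 < @hermite_ev R n kl.1 by rewrite ltr0n addn_gt0 n0 orbT.
exists ([set b / hermite_ev kl.1] `|` [set - (b / hermite_ev kl.1)]); split.
- by apply: measurableU; exact: measurable_set1.
- by apply/eqP; rewrite eq_le measure_ge0 andbT (le_trans (measureU2 _ _ _))//= ?lebesgue_measure_set1 ?adde0//; exact: measurable_set1.
- move=> x /= /not_implyP[<- _]; rewrite mulfK ?gt_eqF//.
 by have [|] := ger0P x => _; [left|right; rewrite opprK].
Qed.

Section resolved.
Variable E : resolution (hmu R n).
Hypothesis rE : @resolves_sublaplacian R n E.
Local Notation P := (res_proj E).
Let C := plancherel_const (R := R) n.

(** Every step applies A minus the midpoint. [range_operator] gives A f weakly on test functions,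
    which is what [fourier_intertwining] takes: on the transform, A is multiplication by the
    symbol. *)
Lemma range_iter a b f k : a < b -> in_range E [set` `[a, b[] f ->
 exists fk, [/\ in_range E [set` `[a, b[] fk,
  nrm hm fk <= (((b - a) / 2) ^+ 2) ^+ k * nrm hm f &
  {ae KK, forall p, U fk p = ((sy p - (a + b) / 2) ^+ k)%:C%C * U f p}].
Proof.
move=> ab rf; elim: k => [|k [fk [rk nk uk]]].
 by exists f; rewrite expr0 mul1r; split => //; apply: aeW => p; rewrite expr0 mul1r.
have [g [rg ng wg]] := range_operator ab rk; set cc := (a + b) / 2 in ng uk *.
have [g2 _] := rg; have [k2 _] := rk.
have F : (fun x => g x - cc%:C%C * fk x) = fun x => g x + (- cc%:C%C) * fk x.
 by apply/funext => x; rewrite mulNr.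
exists (fun x => g x + (- cc%:C%C) * fk x); split.
- by apply: in_rangeD => //; exact: in_rangeZ.
- rewrite F in ng; rewrite (le_trans ng)// [_ ^+ k.+1]exprS -[leRHS]mulrA ler_wpM2l ?sqr_ge0//.
- have ug := fourier_intertwining n0 k2 g2 (fun h th => wg _ _ (rE th)).
 have alg (z z1 z2 z3 : R[i]) (t c : R) : z = z1 + (- c%:C%C) * z2 -> z1 = t%:C%C * z2 /\
   z2 = ((t - c) ^+ k)%:C%C * z3 -> z = ((t - c) ^+ k.+1)%:C%C * z3.
  by move=> -> [-> ->]; rewrite exprS; move: (_ ^+ k) => Y; apply: complexP; rewrite !cE /=; ring.
 exact: (aeS2 (U_lin (- cc%:C%C) g2 k2) (aeI ug uk) (fun p => @alg _ _ _ _ _ _)).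
Qed.

Lemma nrm_geometric_eq0 (x M N : R) : 0 <= x < 1 -> 0 <= N -> (forall k, N <= x ^+ k * M) -> N = 0.
Proof.
move=> /andP[x0 x1] N0 h; apply/eqP; rewrite eq_le N0 andbT.
have c : M * x ^+ k @[k --> \oo] --> 0 by apply: cvg_geometric; rewrite ger0_norm.
by apply: (cvgr_to_ge c); apply: nearW => k; rewrite mulrC.
Qed.

(** Where the symbol is at distance at least q > r from the midpoint, q^(2k) |U f|^2 has integral at
    most a constant times r^(2k), for every k, so U f vanishes there. The values q = r + 1 / (m + 1)
    exhaust the complement. *)
Lemma U_range a b f : a < b -> in_range E [set` `[a, b[] f ->
 {ae KK, forall p, ~ (a <= sy p <= b) -> U f p = 0}.
Proof.
move=> ab rf; have [f2 _] := rf; set cc := (a + b) / 2; set r := (b - a) / 2.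
have r0 : 0 < r by rewrite divr_gt0// subr_gt0.
have main m : {ae KK, forall p, r + m.+1%:R^-1 <= `|sy p - cc| -> U f p = 0}.
 set q := r + _; have q0 : 0 < q by rewrite addr_gt0.
 pose A := [set p | q <= `|sy p - cc|].
 have mA : measurable A.
  have ms : meas (fun p => `|sy p - cc|).
   by apply: mcomp; [exact: normr_measurable|apply: measurable_funB => //; exact: measurable_symb].
  by have := ms measurableT _ (measurable_itv `[q, +oo[); rewrite setTI; congr measurable; apply/funext => p; rewrite /A /= in_itv /= andbT.
 pose v p : R[i] := (\1_A p)%:C%C * U f p.
 have U2 := L2_U f2.
 have sv p : sqnormC (v p) = \1_A p * sqnormC (U f p) by exact: sqnormC_cut.
 have v2 : L2 KK v := L2_cut U2 mA.
 have v0 : nrm KK v = 0.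
  apply: (@nrm_geometric_eq0 ((r / q) ^+ 2) (C * nrm hm f)); last first.
  - move=> k; have [fk [[k2 _] nk uk]] := range_iter k ab rf.
   have qv2 : L2 KK (fun p => (q ^+ k)%:C%C * v p) by exact: L2Z.
   have Uk := L2_U k2.
   have W2 : L2 KK (fun p => ((sy p - cc) ^+ k)%:C%C * U f p).
    apply: (L2_ae _ uk) => //; apply: mcM; last exact: U2.1.
    by apply: mc_real; apply: measurable_funX; apply: measurable_funB => //; exact: measurable_symb.
   have le1 : nrm KK (fun p => (q ^+ k)%:C%C * v p) <= nrm KK (fun p => ((sy p - cc) ^+ k)%:C%C * U f p).
    rewrite !nrmE; apply: Rint_le; [exact: ((L2P _ _).1 qv2).2|exact: ((L2P _ _).1 W2).2|].
    move=> p; rewrite (sqnormCM _ (v p)) sv sqnormCM !sqnormC_real indicE; have s0 := sqnormC_ge0 (U f p).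
    have [pA|nA] := boolP (p \in A); last by rewrite mul0r mulr0 mulr_ge0// sqr_ge0.
    rewrite mul1r ler_wpM2r// -!exprM mulnC !exprM lerXn2r ?nnegrE ?sqr_ge0//.
    by rewrite -[leRHS]real_normK ?num_real// ler_sqr ?nnegrE ?(ltW q0)//; exact: set_mem pA.
   rewrite (nrmZ _ v2) sqnormC_real in le1.
   rewrite -(nrm_ae Uk.1 W2.1 uk) (nrm_U k2) -/C in le1.
   have C0 : 0 < C by exact: plancherel_const_gt0.
   have Q0 : 0 < (q ^+ k) ^+ 2 by rewrite !exprn_gt0.
   rewrite -(ler_pM2l Q0) (le_trans le1)// mulrA [leRHS](_ : _ = C * (((r ^+ 2) ^+ k) * nrm hm f)).
    by rewrite ler_pM2l.
   have -> : (r / q) ^+ 2 = (q ^+ 2)^-1 * r ^+ 2 by rewrite expr_div_n mulrC.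
   have alg (Y Z c X : R) : Y != 0 -> Y * (Y^-1 * Z * c * X) = c * (Z * X) by move=> Y0; field.
   by rewrite exprMn exprVn (exprAC q 2 k) alg// gt_eqF.
  - exact: nrm_ge0.
  - have rq : 0 <= r / q < 1 by rewrite divr_ge0 ?(ltW r0) ?(ltW q0)//= ltr_pdivrMr// mul1r ltrDl invr_gt0.
   by have /andP[h1 h2] := rq; rewrite sqr_ge0 expr_lt1.
 apply: aeS (nrm_eq0 v2 v0) _ => p vp qp.
 by move: vp; rewrite /v indicE mem_set// mul1r.
apply: aeS (ae_foralln main) _ => p hp np.
have rp : r < `|sy p - cc|.
 by rewrite ltNge; apply/negP; rewrite ler_norml => /andP[h1 h2]; apply: np; rewrite /cc /r in h1 h2 *; apply/andP; split; lra.
have d0 : 0 < `|sy p - cc| - r by rewrite subr_gt0.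
have /andP[_ h] := truncn_itv (ltW (ltac:(rewrite invr_gt0; exact: d0) : 0 < (`|sy p - cc| - r)^-1)).
apply: (hp (Num.truncn (`|sy p - cc| - r)^-1)).
rewrite -lerBrDl -[leRHS]invrK lef_pV2 ?posrE ?invr_gt0//; exact: ltW.
Qed.

(* The level sets of the symbol are negligible: the endpoints do not matter. *)
Lemma U_proj a b f : a < b -> L2 hm f ->
 {ae KK, forall p, U (P [set` `[a, b[] f) p = (\1_([set` `[a, b[] : set R) (sy p))%:C%C * U f p}.
Proof.
move=> ab f2; set I : set R := [set` `[a, b[].
have mI (c d : R) : measurable ([set` `[c, d[] : set R) by exact: measurable_itv.
have p2 (c d : R) : L2 hm (P [set` `[c, d[] f) by exact: res_proj_L2.
have Uf2 := L2_U f2; have Up2 := L2_U (p2 a b).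
have out (c d : R) : c < d -> {ae KK, forall p, ~ (c <= sy p <= d) -> U (P [set` `[c, d[] f) p = 0}.
 by move=> cd; exact: (U_range cd (in_range_proj E (mI c d) f2)).
pose J := [set p | a < sy p < b].
have mJ : measurable J.
 rewrite (_ : J = setT `&` sy @^-1` [set` `]a, b[]); first by apply: measurable_symb => //; exact: measurable_itv.
 by rewrite setTI; apply/funext => p; rewrite /J /= in_itv.
pose v p : R[i] := (\1_J p)%:C%C * (U f p - U (P I f) p).
have d2 := L2B Uf2 Up2; have v2 : L2 KK v := L2_cut d2 mJ.
(* Over [J] the transforms of the projections on [-K, a) and [b, K) vanish, so [v] is the cut
   transform of f minus all three projections, whose norm tends to 0 with growing K. *)
have vq k : - k%:R < a -> b < k%:R -> nrm KK v <= C * (nrm hm f - nrm hm (P [set` `[- k%:R, k%:R[] f)).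
 move=> ka bk; set K : R := k%:R in ka bk *.
 have s1 := nrm_proj_split E f2 (ltW ka) (ltW (lt_trans ab bk)).
 have s2 := nrm_proj_split E f2 (ltW ab) (ltW bk).
 have AB := co_disjoint (- K) b (lexx a); have AC := co_disjoint a K (lexx b).
 have BC := co_disjoint (- K) K (ltW ab).
 have q1 := L2B f2 (p2 a b); have q2 := L2B q1 (p2 (- K) a); have q3 := L2B q2 (p2 b K).
 have := nrm_sub_proj3 E (mI a b) (mI (- K) a) (mI b K) _ AC BC f2.
 rewrite setIC => /(_ AB) e.
 have -> : nrm hm f - nrm hm (P [set` `[- K, K[] f) =
   nrm hm (fun x => f x - P [set` `[a, b[] f x - P [set` `[- K, a[] f x - P [set` `[b, K[] f x).
  by rewrite e s1 s2; ring.
 rewrite -(nrm_U q3); have Q2 := L2_U q3; have w2 := L2_cut Q2 mJ.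
 set w := (fun p => _ * _) in w2.
 have vw : {ae KK, forall p, v p = w p}.
  have alg (x u1 u2 z1 z2 y : R[i]) : x = u1 - z1 -> u1 = u2 - z2 -> u2 = y -> z1 = 0 -> z2 = 0 -> y = x.
   by move=> -> -> -> -> ->; rewrite !subr0.
  have H1 := aeI (U_sub q2 (p2 b K)) (U_sub q1 (p2 (- K) a)).
  have H2 := aeI (U_sub f2 (p2 a b)) (aeI (out _ _ bk) (out _ _ ka)).
  apply: (aeS2 H1 H2) => p [e1 e2] [e3 [k1 k2]].
  rewrite /v /w indicE; have [pJ|_] := boolP (p \in J); last by rewrite !mul0r.
  have /andP[j1 j2] := set_mem pJ.
  have z1 := k1 ltac:(by move=> /andP[h _]; have := lt_le_trans j2 h; rewrite ltxx).
  have z2 := k2 ltac:(by move=> /andP[_ h]; have := lt_le_trans j1 h; rewrite ltxx).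
  exact: (congr1 ( *%R _) (alg _ _ _ _ _ _ e1 e2 e3 z1 z2)).
 rewrite (nrm_ae v2.1 w2.1 vw); exact: nrm_cut_le.
have v0 : nrm KK v = 0.
 apply/eqP; rewrite eq_le nrm_ge0 andbT.
 have c : C * (nrm hm f - nrm hm (P [set` `[- k%:R, k%:R[] f)) @[k --> \oo] --> C * (nrm hm f - nrm hm f).
  by apply: cvgM; [exact: cvg_cst|apply: cvgB; [exact: cvg_cst|exact: nrm_proj_cvg]].
 rewrite subrr mulr0 in c; apply: (cvgr_to_ge c).
 exists (Num.truncn (`|a| + `|b|)).+1 => // k /= hk.
 have x0 : 0 <= `|a| + `|b| by rewrite addr_ge0.
 have /andP[_ h1] := truncn_itv x0.
 have h2 : (Num.truncn (`|a| + `|b|)).+1%:R <= k%:R :> R by rewrite ler_nat.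
 have := ler_norm b; have := ler_norm (- a); rewrite normrN => h3 h4.
 have := normr_ge0 a; have := normr_ge0 b => h5 h6.
 by apply: vq; lra.
have lv := aeI (symb_level_null (fourier f) a) (aeI (symb_level_null (fourier (P I f)) a) (symb_level_null (fourier (P I f)) b)).
apply: (aeS2 (aeI (nrm_eq0 v2 v0) (out _ _ ab)) lv) => p [v0p op] [la [la' lb']].
rewrite indicE; have [pI|pI] := boolP (sy p \in _).
 rewrite mul1r; move: (set_mem pI); rewrite /I /= in_itv /= => /andP[]; rewrite le_eqVlt => /orP[/eqP ae_ _|ap pb].
  by rewrite (la (esym ae_)) (la' (esym ae_)).
 have pJ : p \in J by apply/mem_set; rewrite /J /= ap pb.
 have alg (x y : R[i]) : (1 : R)%:C%C * (x - y) = 0 -> y = x.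
  by rewrite mul1r => /eqP; rewrite subr_eq0 => /eqP.
 by rewrite /v indicE pJ in v0p; exact: (alg _ _ v0p).
rewrite mul0r; have [e|ne] := eqVneq (sy p) b; first exact: lb'.
apply: op => /andP[h1 h2]; move/negP: pI; apply; apply/mem_set; rewrite /I /= in_itv /= h1 /=.
by rewrite lt_neqAle ne.
Qed.

End resolved.
End spectral_fourier.

Section projections.
Context {R : realType} (n : nat).
Hypothesis n0 : (0 < n)%N.
Local Notation U f := (toK (fourier f)).
Local Notation sy := (@symb R n).
Implicit Types (f g : heis R n -> R[i]) (a b : R) (E : resolution (hmu R n)).
Local Notation resolves E := (@resolves_sublaplacian R n E).
Let C := plancherel_const (R := R) n.
Let C0 : 0 < C := plancherel_const_gt0 n.

Lemma U_eq0 f : L2 hm f -> {ae KK, forall p, U f p = 0} -> nrm hm f = 0.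
Proof.
move=> f2 u0; have := nrm_U n0 f2; rewrite (nrm_ae0 u0 (L2_U n0 f2).1) => /esym/eqP.
by rewrite mulf_eq0 (gt_eqF C0) => /eqP.
Qed.

(** Both projections have the same transform. This is needed because the equation may use a
    different resolution of -Delta_H at each time. *)
Lemma proj_unique E E' a b f : resolves E -> resolves E' -> a < b -> L2 hm f ->
 {ae hm, forall x, res_proj E [set` `[a, b[] f x = res_proj E' [set` `[a, b[] f x}.
Proof.
move=> rE rE' ab f2; have mI : measurable [set` `[a, b[] by exact: measurable_itv.
have p2 := res_proj_L2 E mI f2; have p2' := res_proj_L2 E' mI f2.
apply: (ae_eq_L2 p2 p2'); apply: (U_eq0 (L2B p2 p2')).
have alg (x y z w : R[i]) : x = y - z -> y = w /\ z = w -> x = 0 by move=> -> [-> ->]; rewrite subrr.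
exact: (aeS2 (U_sub n0 p2 p2') (aeI (U_proj n0 rE ab f2) (U_proj n0 rE' ab f2)) (fun p => @alg _ _ _ _)).
Qed.

Lemma proj_neg E a b f : resolves E -> a < b -> b <= 0 -> L2 hm f ->
 nrm hm (res_proj E [set` `[a, b[] f) = 0.
Proof.
move=> rE ab b0 f2; have mI : measurable [set` `[a, b[] by exact: measurable_itv.
apply: (U_eq0 (res_proj_L2 E mI f2)); apply: aeS (U_proj n0 rE ab f2) _ => p ->.
rewrite indicE memNset ?mul0r// /= in_itv /= => /andP[_ h].
by have := lt_le_trans h (le_trans b0 (symb_ge0 n p)); rewrite ltxx.
Qed.

Lemma nrm_le_proj E f (M : R) : resolves E -> L2 hm f ->
 (forall b, 0 < b -> nrm hm (res_proj E [set` `[0, b[] f) <= M) -> nrm hm f <= M.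
Proof.
move=> rE f2 h; apply: (cvgr_to_le (nrm_proj_cvg E f2)); exists 1%N => // k /= k0.
have k0' : 0 < k%:R :> R by rewrite ltr0n.
have k1 : - k%:R < 0 :> R by rewrite oppr_lt0.
by rewrite (nrm_proj_split E f2 (ltW k1) (ltW k0')) proj_neg// add0r h.
Qed.

(** The cut-off |lam| <= rho^2 / mu_k says that the symbol lies in [0, rho^2]; dropping the endpoint
    costs a level set of the symbol, which is negligible. *)
Lemma decay_ratioE E (r rho : R) f : resolves E -> L2 hm f -> 0 < rho ->
 decay_ratio r f rho = (rho `^ (- 2 * r - (homdim n)%:R) *
  (plancherel_cst (R := R) n * C * nrm hm (res_proj E [set` `[0, rho ^+ 2[] f)))%:E.
Proof.
move=> rE f2 r0; have [mF _] := is_fourier_fourier n0 f2.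
have q0 : 0 < rho ^+ 2 by rewrite exprn_gt0.
pose B : set R := [set` `[0, rho ^+ 2]]; have mB : measurable B by exact: measurable_itv.
have U2 := L2_U n0 f2.
pose A := sy @^-1` B; have mA : measurable A.
 by rewrite -[A]setTI; apply: measurable_symb => //; exact: measurable_itv.
have c2 := L2_cut U2 mA.
have mI : measurable ([set` `[0, rho ^+ 2[] : set R) by exact: measurable_itv.
have e2 := res_proj_L2 E mI f2; have Ue2 := L2_U n0 e2.
rewrite /decay_ratio (_ : (\esum_(kl in _) _)%E = (C * nrm hm (res_proj E [set` `[0, rho ^+ 2[] f))%:E).
 by rewrite -EFinM -!mulrA.
rewrite -(nrm_U n0 e2).
have -> : nrm KK (U (res_proj E [set` `[0, rho ^+ 2[] f)) = nrm KK (fun p => (\1_A p)%:C%C * U f p).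
 apply: (nrm_ae Ue2.1 c2.1).
 apply: (aeS2 (U_proj n0 rE q0 f2) (symb_level_null n0 (fourier f) (rho ^+ 2))) => p -> l0.
 have [e|ne] := eqVneq (sy p) (rho ^+ 2); first by rewrite l0// !mulr0.
 congr (_%:C%C * _); rewrite !indicE; congr (_%:R); congr nat_of_bool.
 apply/idP/idP; rewrite !inE /A /B /= !in_itv /= => /andP[h1 h2]; rewrite h1 /=; first exact: ltW.
 by rewrite lt_neqAle ne.
rewrite -sqL2E//; have := sqL2_toK_symb mB mF; rewrite [LHS](_ : _ = sqL2norm KK (fun p => (\1_A p)%:C%C * U f p)) => [->|//].
apply: eq_esum => kl _; rewrite integral_mkcond; apply: eq_integral => lam _.
have ev0 : 0 < @hermite_ev R n kl.1 by rewrite ltr0n addn_gt0 n0 orbT.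
have [->|l0] := eqVneq lam 0.
 by rewrite /patch normr0 expr0n gtn_eqF// mul0r mulr0; case: ifP.
rewrite /patch indicE; have -> : (lam \in [set lam : R | lam != 0 /\ `|lam| <= (hermite_ev kl.1)^-1 * rho ^+ 2]) =
  (`|lam| * hermite_ev kl.1 \in B).
 apply/idP/idP; rewrite !inE /B /= in_itv /= ?mulr_ge0 ?(ltW ev0)//=.
  by move=> [_]; rewrite ler_pdivlMl// mulrC.
 by move=> h; split => //; rewrite ler_pdivlMl// mulrC.
by case: ifP; rewrite ?mul1r ?mul0r.
Qed.

End projections.

(** * Decay *)

Section gronwall.
Context {R : realType}.
Implicit Types (y : R -> R) (s k : R).

(** exp(k (t - s)) y(t) is nonincreasing. At s only right continuity is asked, since the solution
    need not be differentiable there. *)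
Lemma gronwall y s k :
 (forall t, s < t -> exists2 dy : R, is_derive t (1 : R) y dy & dy <= - k * y t) ->
 y t @[t --> s^'+] --> y s ->
 forall t, s <= t -> y t <= expR (- k * (t - s)) * y s.
Proof.
move=> dyP cy t st; pose e (x : R) := expR (k * (x - s)); pose F x := e x * y x.
have de (x : R) : is_derive x (1 : R) e (k * e x).
 have d0 : is_derive x 1 (fun z : R => k * (z - s)) k.
  have D := is_deriveM (is_derive_cst k x 1) (is_deriveB (is_derive_id x 1) (is_derive_cst s x 1)).
  by apply: is_derive_eq D _; rewrite subr0 scaler0 addr0 /cst /GRing.scale /= mulr1.
 by have := @is_derive1_comp R expR (fun z => k * (z - s)) x _ _ (is_derive_expR _) d0; rewrite /GRing.scale /= mulrC.
have dF (x : R) : s < x -> exists2 dy : R, is_derive x (1 : R) F (e x * dy + y x * (k * e x)) & dy <= - k * y x.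
 move=> /dyP[dy ddy h]; exists dy => //.
 by have := is_deriveM (de x) ddy; rewrite /GRing.scale.
have dec : F t <= F s.
 apply: (@ler0_derive1_nincry _ F s _ _ _ s t (lexx s) st).
 - by move=> x; rewrite in_itv /= andbT => /dF[dy d _]; exact: ex_derive.
 - move=> x; rewrite in_itv /= andbT => /dF[dy d h]; rewrite derive1E derive_val.
  have e0 : 0 < e x by exact: expR_gt0.
  by have := ler_wpM2l (ltW e0) h; lra.
 - apply/continuous_within_itvcyP; split.
   move=> x; rewrite in_itv /= andbT => /dF[dy d h].
   by apply/differentiable_continuous/derivable1_diffP; exact: ex_derive.
  apply: cvgM => //; apply: cvg_at_right_filter.
  by apply/differentiable_continuous/derivable1_diffP; exact: (@ex_derive _ _ _ _ _ _ _ (de s)).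
move: dec; rewrite /F /e subrr mulr0 expR0 mul1r => dec.
by rewrite mulNr expRN ler_pdivlMl ?expR_gt0.
Qed.

End gronwall.

(** * Decay rates from the energy bounds *)

Section decay.
Context {R : realType}.
(** [N t] stands for |u(t)|^2 and [m t a b] for |E([a, b)) u(t)|^2; the rates follow from the
    properties below alone. *)
Variables (alpha s q : R) (N : R -> R) (m : R -> R -> R -> R).
Hypothesis a0 : 0 < alpha.
Hypothesis m_upper : forall t a b, s <= t -> 0 <= a -> a < b ->
 m t a b <= expR (- (2 * a `^ alpha) * (t - s)) * m s a b.
Hypothesis m_lower : forall t a b, s <= t -> 0 <= a -> a < b ->
 expR (- (2 * b `^ alpha) * (t - s)) * m s a b <= m t a b.
Hypothesis m_ge0 : forall t a b, s <= t -> 0 <= m t a b.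
Hypothesis m_split : forall t a b c, s <= t -> a <= b -> b <= c -> m t a c = m t a b + m t b c.
Hypothesis m_le : forall t b, s <= t -> 0 < b -> m t 0 b <= N t.
Hypothesis N_le : forall t M, s <= t -> (forall b, 0 < b -> m t 0 b <= M) -> N t <= M.

(** With T = 1 + t - s take rho = (d / 2) T^(-1 / (2 alpha)). It is below d because T >= 1; rho^(2
    alpha) (t - s) stays bounded, so the exponential factor is bounded below; and rho^q is the
    claimed rate. *)
Lemma decay_from_below c d : 0 < c -> 0 < d ->
 (forall rho, 0 < rho -> rho < d -> c * rho `^ q <= m s 0 (rho ^+ 2)) ->
 exists2 C, 0 < C & forall t, s <= t -> C * (1 + t - s) `^ (- (q / (2 * alpha))) <= N t.
Proof.
move=> c0 d0 h; set k := ((d / 2) ^+ 2) `^ alpha.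
have d2 : 0 < d / 2 by rewrite divr_gt0.
exists (expR (- 2 * k) * (c * (d / 2) `^ q)) => [|t st].
 by rewrite !mulr_gt0 ?expR_gt0 ?powR_gt0.
set T := 1 + t - s; have T1 : 1 <= T by rewrite /T; lra.
have T0 : 0 < T by lra.
pose x := T `^ (- (2 * alpha)^-1); have x0 : 0 < x by rewrite powR_gt0.
have x1 : x <= 1 by rewrite -(powRr0 T) ler_powR// oppr_le0 invr_ge0 mulr_ge0// ltW.
have xa : (x ^+ 2) `^ alpha = T^-1.
 rewrite -(powR_mulrn 2 (ltW x0)) -!powRrM -(powR_inv1 (ltW T0)); congr powR.
 by field; rewrite gt_eqF.
pose rho := d / 2 * x; have r0 : 0 < rho by rewrite mulr_gt0.
have rd : rho < d by rewrite /rho; nra.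
have q0 : 0 < rho ^+ 2 by rewrite exprn_gt0.
apply: le_trans (m_le st q0); apply: le_trans (m_lower st (lexx 0) q0).
have -> : (rho ^+ 2) `^ alpha = k * T^-1 by rewrite exprMn powRM ?sqr_ge0// xa.
have -> : T `^ (- (q / (2 * alpha))) = x `^ q.
 by rewrite -powRrM; congr powR; field; rewrite gt_eqF.
have rq : rho `^ q = (d / 2) `^ q * x `^ q by rewrite powRM ?ltW.
have := h rho r0 rd; rewrite rq => hr.
rewrite -mulrA ler_pM ?expR_ge0//.
- by rewrite !mulr_ge0 ?powR_ge0// ltW.
- have : k / T * (t - s) <= k.
  by rewrite -mulrA ler_piMr ?powR_ge0// mulrC ler_pdivrMr// mul1r /T; lra.
 by rewrite ler_expR; lra.
- by rewrite -mulrA.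
Qed.

(** From ln x <= x - 1 at x = (j + 1) / p. In the sum over pieces this growth is beaten by exp(-2
    j). *)
Lemma powR_natS_le (p : R) (j : nat) : 0 < p ->
 (j.+1%:R) `^ p <= expR (1 - p + p * ln p) * expR j%:R.
Proof.
move=> p0; have j0 : 0 < j.+1%:R :> R by rewrite ltr0n.
rewrite -expRD /powR gt_eqF// ler_expR.
have x0 : 0 < j.+1%:R / p by rewrite divr_gt0.
have : ln (j.+1%:R / p) <= j.+1%:R / p - 1.
 by have := @le_ln1Dx _ (j.+1%:R / p - 1); rewrite addrCA subrr addr0; apply; lra.
rewrite ln_div ?posrE// => h.
have : p * (ln j.+1%:R - ln p) <= p * (j.+1%:R / p - 1) by rewrite ler_pM2l.
have -> : p * (j.+1%:R / p - 1) = j.+1%:R - p by field; rewrite gt_eqF.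
by rewrite -[j.+1%:R in X in _ <= X -> _]natr1; lra.
Qed.

(** With tau = t - s, the initial energy of the j-th piece is O((j + 1)^p tau^(-p)) and its factor
    exp(-2 j), so a geometric series remains. For q <= 0, and for tau <= 1, the energy being
    nonincreasing is enough. *)
Lemma decay_from_above c d : 0 <= c -> 0 < d ->
 (forall rho, 0 < rho -> rho < d -> m s 0 (rho ^+ 2) <= c * rho `^ q) ->
 exists2 C, 0 < C & forall t, s <= t -> N t <= C * (1 + t - s) `^ (- (q / (2 * alpha))).
Proof.
move=> c0 d0 h; set p := q / (2 * alpha).
have N_dec t : s <= t -> N t <= N s.
 move=> st; apply: (N_le st) => b b0; apply: le_trans (m_le (lexx s) b0).
 by have := m_upper st (lexx 0) b0; rewrite powR0 ?gt_eqF// mulr0 oppr0 mul0r expR0 mul1r.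
have Ns0 : 0 <= N s by apply: le_trans (m_le (lexx s) ltr01); exact: m_ge0.
have [q0|q0] := leP q 0.
 exists (N s + 1) => [|t st]; first by lra.
 have T1 : 1 <= 1 + t - s by lra.
 have : 1 <= (1 + t - s) `^ (- p).
  rewrite -[leLHS](powRr0 (1 + t - s)) ler_powR// oppr_ge0 /p.
  by rewrite pmulr_lle0// invr_gt0 mulr_gt0.
 by have := N_dec t st; move: (_ `^ _) => X *; nra.
have p0 : 0 < p by rewrite divr_gt0// mulr_gt0.
(* The second summand covers sqrt b >= d, where only the total energy [N s] bounds the left side. *)
pose c' := c + N s / d `^ q; have dq : 0 < d `^ q by rewrite powR_gt0.
have c'0 : 0 <= c' by rewrite addr_ge0// divr_ge0// ltW.
have ms b : 0 < b -> m s 0 b <= c' * b `^ (q / 2).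
 move=> b0; have sb : (Num.sqrt b) ^+ 2 = b by rewrite sqr_sqrtr// ltW.
 have s0 : 0 < Num.sqrt b by rewrite sqrtr_gt0.
 have -> : b `^ (q / 2) = Num.sqrt b `^ q.
  by rewrite -powR12_sqrt ?ltW// -powRrM mulrC.
 have X0 := powR_gt0 q s0; have [sd|sd] := ltP (Num.sqrt b) d.
  have := h _ s0 sd; rewrite sb => /le_trans; apply.
  by rewrite ler_pM2r// lerDl divr_ge0// ltW.
 apply: (le_trans (m_le (lexx s) b0)).
 apply: (@le_trans _ _ (N s / d `^ q * Num.sqrt b `^ q)).
  rewrite -mulrA ler_peMr// ler_pdivlMl// mulr1 ge0_ler_powR ?nnegrE ?(ltW q0) ?(ltW d0) ?(ltW s0)//.
 by rewrite ler_pM2r// lerDr.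
pose A := expR (1 - p + p * ln p); have A0 : 0 < A by exact: expR_gt0.
have main t : s < t -> N t <= 2 * A * c' * (t - s) `^ (- p).
 move=> st; have st' := ltW st; set tau := t - s; have tau0 : 0 < tau by rewrite subr_gt0.
 (* Chosen so that (b j)^alpha tau = j. *)
 pose b (j : nat) := (j%:R / tau) `^ alpha^-1.
 have b_ge0 j : 0 <= b j by exact: powR_ge0.
 have ba j : b j `^ alpha = j%:R / tau.
  by rewrite -powRrM mulVf ?gt_eqF// powRr1// divr_ge0// ltW.
 have b_lt j : b j < b j.+1.
  rewrite gt0_ltr_powR ?invr_gt0 ?nnegrE ?divr_ge0 ?(ltW tau0)//.
  by rewrite ltr_pM2r ?invr_gt0// ltr_nat.
 have t0 : 0 < tau `^ (- p) by rewrite powR_gt0.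
 have piece j : m t (b j) (b j.+1) <= c' * tau `^ (- p) * A * 2^-1 ^+ j.
  apply: (le_trans (m_upper st' (b_ge0 j) (b_lt j))).
  have -> : - (2 * b j `^ alpha) * (t - s) = - (2 * j%:R).
   by rewrite ba -/tau; field; rewrite gt_eqF.
  have bj0 : 0 < b j.+1 by exact: le_lt_trans (b_ge0 j) (b_lt j).
  have m1 : m s (b j) (b j.+1) <= c' * (j.+1%:R `^ p * tau `^ (- p)).
   apply: (@le_trans _ _ (m s 0 (b j.+1))).
    by rewrite (m_split (lexx s) (b_ge0 j) (ltW (b_lt j))) lerDr m_ge0.
   have -> : j.+1%:R `^ p * tau `^ (- p) = b j.+1 `^ (q / 2); last exact: ms.
   rewrite /b -powRrM powRN -powR_inv1 ?powR_ge0// -powRrM mulrN1 powRM ?invr_ge0 ?ltW//.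
   rewrite -[tau^-1]powR_inv1 ?ltW// -powRrM mulN1r.
   by congr (_ `^ _ * _ `^ _); rewrite /p; field; rewrite gt_eqF.
  have pj := powR_natS_le j p0; rewrite -/A in pj.
  (* The product is exp(-j), and e >= 2. *)
  have e2 : expR (- (2 * j%:R)) * expR j%:R <= 2^-1 ^+ j :> R.
   rewrite -expRD (_ : _ + _ = j%:R * (- 1)); last by ring.
   rewrite expRM_natl lerXn2r ?nnegrE ?expR_ge0 ?invr_ge0//.
   rewrite expRN lef_pV2 ?posrE ?expR_gt0//; have := expR_ge1Dx (1 : R); lra.
  apply: (le_trans (ler_wpM2l (expR_ge0 _) m1)).
  have X0 := expR_gt0 (- (2 * j%:R) : R).
  rewrite [leLHS](_ : _ = c' * tau `^ (- p) * (expR (- (2 * j%:R)) * j.+1%:R `^ p)); last by ring.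
  rewrite -!mulrA ler_wpM2l// ler_wpM2l ?(ltW t0)//.
  apply: (le_trans (ler_wpM2l (ltW X0) pj)).
  by rewrite mulrCA ler_wpM2l// ltW.
 apply: (N_le st') => x x0.
 pose J := (Num.truncn (x `^ alpha * tau)).+1.
 have xJ : x <= b J.
  have z0 : 0 <= x `^ alpha * tau by rewrite mulr_ge0 ?powR_ge0// ltW.
  have /andP[_ /ltW hJ] := truncn_itv z0.
  have -> : x = (x `^ alpha) `^ alpha^-1 by rewrite -powRrM mulfV ?gt_eqF// powRr1// ltW.
  apply: ge0_ler_powR; rewrite ?nnegrE ?invr_ge0 ?powR_ge0 ?divr_ge0 ?(ltW a0) ?(ltW tau0)//.
  by rewrite ler_pdivlMr// /J.
 have sum k : m t 0 (b k) <= c' * tau `^ (- p) * A * (2 - 2 * 2^-1 ^+ k).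
  elim: k => [|k IH].
   rewrite /b mul0r powR0 ?invr_eq0 ?gt_eqF// expr0 mulr1 subrr mulr0.
   by have := m_split st' (lexx 0) (lexx 0); lra.
  rewrite (m_split st' (b_ge0 k) (ltW (b_lt k))).
  apply: (le_trans (lerD IH (piece k))); rewrite exprS.
  by rewrite -mulrDr le_eqVlt; apply/orP; left; apply/eqP; congr (_ * _); field.
 rewrite (_ : 2 * A * c' * _ = c' * tau `^ (- p) * A * 2); last by ring.
 have -> : m t 0 x = m t 0 (b J) - m t x (b J) by rewrite (m_split st' (ltW x0) xJ); ring.
 have := sum J; have := m_ge0 x (b J) st'.
 have : 0 <= c' * tau `^ (- p) * A * (2 * 2^-1 ^+ J).
  by rewrite !mulr_ge0 ?exprn_ge0 ?invr_ge0 ?(ltW A0) ?(ltW t0).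
 by move: (c' * _ * A) (2^-1 ^+ J) => X Y; nra.
have P2 : 0 < 2 `^ p :> R by rewrite powR_gt0.
exists (2 `^ p * (N s + 2 * A * c') + 1) => [|t st].
 by rewrite ltr_wpDl// mulr_ge0 ?(ltW P2)// addr_ge0// !mulr_ge0// ltW.
set T := 1 + t - s; have T1 : 1 <= T by rewrite /T; lra.
have T0 : 0 < T by lra.
have X0 : 0 < T `^ (- p) by rewrite powR_gt0.
(* Replaces z by T at the cost of 2^p; used with z = 1 and z = t - s. *)
have half z : 0 < z -> T <= 2 * z -> z `^ (- p) <= 2 `^ p * T `^ (- p).
 move=> z0 Tz; rewrite !powRN ler_pdivlMr ?powR_gt0// ler_pdivrMl ?powR_gt0// mulrC -powRM ?(ltW z0)//.
 by apply: ge0_ler_powR => //; [exact: ltW|rewrite nnegrE; lra|rewrite nnegrE; lra].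
apply: (@le_trans _ _ (2 `^ p * (N s + 2 * A * c') * T `^ (- p))); last by rewrite ler_pM2r// lerDl.
have B0 : 0 <= 2 * A * c' by rewrite !mulr_ge0// ltW.
have [t1|t1] := leP (t - s) 1.
- have := half 1 ltr01; rewrite powR1 mulr1 => /(_ ltac:(by rewrite /T; lra)) h1.
 by have := N_dec t st; move: (2 `^ p) (T `^ (- p)) (2 * A * c') P2 X0 B0 h1 => X Y B *; nra.
- have h1 := half (t - s) ltac:(lra) ltac:(by rewrite /T; lra).
 apply: (le_trans (main t _)); first by lra.
 have := ler_wpM2l B0 h1; have : 0 <= 2 `^ p * N s * T `^ (- p) by rewrite !mulr_ge0 ?(ltW P2) ?(ltW X0).
 by move: (2 * A * c') => B *; lra.
Qed.

End decay.

(** * The energy of the solution on an interval *)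

Section quadratic.
Context d (T : measurableType d) (R : realType) (mu : {measure set T -> \bar R}).
Variable E : resolution mu.
Variable I : set R.
Hypothesis mI : measurable I.
Local Notation P := (res_proj E I).
Implicit Types (f g w : T -> R[i]).

Lemma nrm_proj_le f : L2 mu f -> nrm mu (P f) <= nrm mu f.
Proof. by move=> f2; rewrite -lee_fin -(spec_setT E f2) -(spec_nrm E mI f2) le_measure// inE. Qed.

Lemma rip_sqrt f g : L2 mu f -> L2 mu g -> `|rip mu f g| <= Num.sqrt (nrm mu f * nrm mu g).
Proof. by move=> f2 g2; rewrite -sqrtr_sqr ler_wsqrtr// rip_CS. Qed.

Lemma nrm_proj_diff f g : L2 mu f -> L2 mu g ->
 `|nrm mu (P g) - nrm mu (P f)| <=
 2 * Num.sqrt (nrm mu f * nrm mu (fun x => g x - f x)) + nrm mu (fun x => g x - f x).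
Proof.
move=> f2 g2; have d2 := L2B g2 f2; have p2 := res_proj_L2 E mI f2.
have e : g = fun x => f x + (g x - f x) by apply/funext => x; rewrite addrC subrK.
rewrite {1}e (nrm_projD E mI f2 d2); set w := (fun x => g x - f x) in d2 *.
have h1 := rip_sqrt p2 d2; have h2 := nrm_proj_le d2; have h3 := nrm_ge0 mu (P w).
have h4 : Num.sqrt (nrm mu (P f) * nrm mu w) <= Num.sqrt (nrm mu f * nrm mu w).
 by rewrite ler_wsqrtr// ler_wpM2r ?nrm_ge0// nrm_proj_le.
move: h1 h2 h3 h4; rewrite !ler_norml.
move: (rip mu (P f) w) (Num.sqrt (nrm mu (P f) * nrm mu w)) (Num.sqrt (nrm mu f * nrm mu w)) => X Y Z.
by move: (nrm mu (P w)) (nrm mu w) (nrm mu (P f)) => A B D /andP[h1 h1'] h2 h3 h4; apply/andP; split; lra.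
Qed.

(** [v] is the residual of the equation, so g = f + h (v - w), and the quadratic form |P g|^2 can be
    expanded. The energy is thus differentiated without differentiating P u. *)
Lemma nrm_proj_quotient f g v w (h : R) : h != 0 -> L2 mu f -> L2 mu g -> L2 mu w ->
 (forall x, v x = (h^-1)%:C%C * (g x - f x) + w x) ->
 `|h^-1 * (nrm mu (P g) - nrm mu (P f)) + 2 * rip mu (P f) w| <=
 2 * Num.sqrt (nrm mu f * nrm mu v) + `|h| * (2 * (nrm mu v + nrm mu w)).
Proof.
move=> h0 f2 g2 w2 vE; have p2 := res_proj_L2 E mI f2.
have v2 : L2 mu v by rewrite (funext vE); apply: L2D w2; apply: L2Z; exact: L2B.
have z2 := L2B v2 w2; set z := (fun x => v x - w x) in z2.
have e : g = fun x => f x + h%:C%C * z x.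
 apply/funext => x; rewrite /z vE addrK mulrA.
 have -> : h%:C%C * (h^-1)%:C%C = 1 by apply: complexP; rewrite !cE /= ?mulfV//; ring.
 by rewrite mul1r addrC subrK.
have ez : nrm mu (P g) = nrm mu (P f) + 2 * (h * rip mu (P f) z) + h ^+ 2 * nrm mu (P z).
 by rewrite {1}e (nrm_projD E mI f2 (L2Z _ z2)) (nrm_projZ E _ mI z2) (ripZr h z2 p2) sqnormC_real.
have -> : h^-1 * (nrm mu (P g) - nrm mu (P f)) + 2 * rip mu (P f) w = 2 * rip mu (P f) v + h * nrm mu (P z).
 rewrite ez (_ : rip mu (P f) z = rip mu (P f) v - rip mu (P f) w); last exact: ripBr.
 by move: (nrm _ _) (nrm _ _) (rip _ _ _) (rip _ _ _) => A B X Y; field.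
apply: (le_trans (ler_normD _ _)); rewrite !normrM ger0_norm//.
have h1 := rip_sqrt p2 v2.
have h4 : Num.sqrt (nrm mu (P f) * nrm mu v) <= Num.sqrt (nrm mu f * nrm mu v).
 by rewrite ler_wsqrtr// ler_wpM2r ?nrm_ge0// nrm_proj_le.
apply: lerD; first by rewrite ler_wpM2l// (le_trans h1).
rewrite ler_wpM2l// ger0_norm ?nrm_ge0// (le_trans (nrm_proj_le z2))//.
by have := nrmD_le v2 (L2N w2); rewrite nrmN.
Qed.

End quadratic.

Lemma cvg_sqrt_bound {R : realType} (F : set_system R) {FF : Filter F} (A : R) (nu : R -> R) :
 nu h @[h --> F] --> 0 -> 2 * Num.sqrt (A * nu h) + nu h @[h --> F] --> 0.
Proof.
move=> c; rewrite [X in _ --> X](_ : _ = 2 * Num.sqrt (A * 0) + 0); last by rewrite mulr0 sqrtr0 mulr0 addr0.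
apply: cvgD => //; apply: cvgM; first exact: cvg_cst.
apply: continuous_cvg; first exact: sqrt_continuous.
by apply: cvgM => //; exact: cvg_cst.
Qed.

Section heat.
Context {R : realType} (n : nat).
Hypothesis n0 : (0 < n)%N.
Variables (alpha s : R) (u0 : heis R n -> R[i]) (u : R -> heis R n -> R[i]).
Hypothesis a0 : 0 < alpha.
Hypothesis sol : heat_solution alpha s u0 u.
Variable E : resolution (hmu R n).
Hypothesis rE : @resolves_sublaplacian R n E.
Local Notation P := (res_proj E).
Let u2 t : s <= t -> L2 hm (u t).
Proof. by have [h _ _ _] := sol => /h. Qed.
Let fin0 (F : set_system R) {FF : Filter F} (v : R -> \bar R) : v h @[h --> F] --> 0%E -> fine (v h) @[h --> F] --> (0 : R).
Proof. by move/(fine_cvg (f := v)). Qed.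

Lemma heat_energy_cvg (I : set R) : measurable I ->
 nrm hm (P I (u t)) @[t --> s^'+] --> nrm hm (P I (u s)).
Proof.
move=> mI; have [_ _ c _] := sol; have {}c := c s (lexx s).
have c' : nrm hm (fun x => u t x - u s x) @[t --> s^'+] --> 0.
 apply: fin0; apply: cvg_trans c; apply: cvg_app => A [e e0 he]; exists e => //= t te st.
 exact: he te (ltW st).
apply/cvgrPdist_le => e e0; have /cvgrPdist_le /(_ e e0) H : 2 * Num.sqrt (nrm hm (u s) * nrm hm (fun x => u t x - u s x)) + nrm hm (fun x => u t x - u s x) @[t --> s^'+] --> 0.
 exact: cvg_sqrt_bound.
near=> t.
have st : s < t by near: t; exact: nbhs_right_gt.
rewrite distrC; apply: (le_trans (nrm_proj_diff E mI (u2 (lexx s)) (u2 (ltW st)))).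
by apply: le_trans (ler_norm _) _; rewrite -[X in `|X|]subr0 distrC; near: t.
Unshelve. all: by end_near. Qed.

Lemma heat_energy_derive (I : set R) t : measurable I -> s < t ->
 exists2 G, is_sublaplacian_power alpha (u t) G &
 is_derive t (1 : R) (fun t => nrm hm (P I (u t))) (- 2 * rip hm (P I (u t)) G).
Proof.
move=> mI st; have [_ _ _ /(_ t st)[G pG c]] := sol; exists G => //.
have G2 : L2 hm G by have [E' _ []] := pG.
set dy := - 2 * _.
have cv : h^-1 *: (nrm hm (P I (u (h *: 1 + t))) - nrm hm (P I (u t))) @[h --> 0^'] --> dy.
 apply/cvgrPdist_le => e e0.
 pose v h x := (h^-1)%:C%C * (u (t + h) x - u t x) + G x.
 have {}c : nrm hm (v h) @[h --> 0^'] --> 0 by exact: fin0.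
 have c1 : 2 * Num.sqrt (nrm hm (u t) * nrm hm (v h)) + nrm hm (v h) @[h --> 0^'] --> 0 by exact: cvg_sqrt_bound.
 have c2 : 2 * Num.sqrt (nrm hm (u t) * nrm hm (v h)) + nrm hm (v h) + `|h| * (2 * (nrm hm (v h) + nrm hm G)) @[h --> 0^'] --> 0.
  have e0' : 0 + `|0 : R| * (2 * (0 + nrm hm G)) = 0 by rewrite normr0 mul0r addr0.
  rewrite -[X in _ --> X]e0'; apply: cvgD => //; apply: cvgM.
   by apply: cvg_norm; apply: cvg_within_filter; exact: cvg_id.
  by apply: cvgM; [exact: cvg_cst|apply: cvgD => //; exact: cvg_cst].
 move/cvgrPdist_le : c2 => /(_ e e0) H; near=> h.
 have h0 : h != 0 by near: h; exact: nbhs_dnbhs_neq.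
 have sth : s <= t + h.
  have hts : `|h| < t - s by near: h; apply: dnbhs0_lt; rewrite subr_gt0.
  by have := ler_norm (- h); rewrite normrN; lra.
 have q := nrm_proj_quotient E mI h0 (u2 (ltW st)) (u2 sth) G2 (fun x => erefl (v h x)).
 rewrite /dy [h%:A]mulr1 [h + t]addrC -normrN opprB mulNr opprK; apply: (le_trans q).
 have Hh : `|0 - (2 * Num.sqrt (nrm hm (u t) * nrm hm (v h)) + nrm hm (v h) + `|h| * (2 * (nrm hm (v h) + nrm hm G)))| <= e by near: h.
 rewrite sub0r normrN in Hh; apply: le_trans (le_trans (ler_norm _) Hh).
 by rewrite -addrA lerD2l lerDr nrm_ge0.
have dv : derivable (fun t => nrm hm (P I (u t))) t 1 by apply/cvg_ex; exists dy; exact: cv.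
by apply: DeriveDef => //; apply: cvg_lim => //; exact: cv.
Unshelve. all: by end_near. Qed.

(* d/dt |P u|^2 = - 2 <(-Delta)^alpha u, P u> lies between - 2 b^alpha |P u|^2 and
  - 2 a^alpha |P u|^2. *)
Lemma heat_energy_bounds a b t : 0 <= a -> a < b -> s <= t ->
 let y t := nrm hm (P [set` `[a, b[] (u t)) in
 y t <= expR (- (2 * a `^ alpha) * (t - s)) * y s /\
 expR (- (2 * b `^ alpha) * (t - s)) * y s <= y t.
Proof.
move=> a_ge0 ab st y; have mI : measurable ([set` `[a, b[] : set R) by exact: measurable_itv.
have cy : y t @[t --> s^'+] --> y s by exact: heat_energy_cvg.
have dy t' : s < t' -> exists2 d, is_derive t' (1 : R) y d &
  - (2 * b `^ alpha) * y t' <= d <= - (2 * a `^ alpha) * y t'.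
 move=> st'; have [G [E' rE' fG] dG] := heat_energy_derive mI st'; exists (- 2 * rip hm (P [set` `[a, b[] (u t')) G) => //.
 have ut := u2 (ltW st'); have [_ G2 _] := fG.
 have mp : meas (fun t : R => t `^ alpha) by exact: measurable_powR.
 have bp x : a <= x < b -> a `^ alpha <= x `^ alpha <= b `^ alpha.
  move=> /andP[h1 h2]; have x0 := le_trans a_ge0 h1; have b0 := le_trans x0 (ltW h2).
  by rewrite !ge0_ler_powR ?nnegrE ?(ltW a0) ?(ltW h2).
 have := fcalc_proj_bounds fG mp ab bp (powR_ge0 _ _).
 (* The bounds hold for [E'], the resolution that defines [G] at this time; [proj_unique] carries
    them over to [E]. *)
 have p2 := res_proj_L2 E mI ut; have p2' := res_proj_L2 E' mI ut.
 have pp := proj_unique n0 rE rE' ab ut.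
 rewrite (ripC hm G) -(rip_ae p2.1 p2'.1 G2.1 G2.1 pp (aeW _ (fun=> erefl))) -(nrm_ae p2.1 p2'.1 pp) -/(y t').
 by move: (a `^ _) (b `^ _) (y t') (rip _ _ _) => A B Y X /andP[h1 h2]; apply/andP; split; lra.
split.
- by apply: gronwall => // t' /dy[d h /andP[_ h2]]; exists d.
- have := @gronwall _ (fun t => - y t) s (2 * b `^ alpha) _ (cvgN cy) t st.
 rewrite mulrN lerN2; apply => t' /dy[d h /andP[h1 _]]; exists (- d); first exact: is_deriveN.
 by rewrite mulrN lerN2.
Qed.

End heat.

(** * Decay indicators and conclusion *)

Section indicators.
Context {R : realType}.

Lemma limf_einf_gt0 (f : R -> \bar R) : (0 < limf_einf f 0^'+)%E ->
 exists c d : R, [/\ 0 < c, 0 < d & forall rho, 0 < rho -> rho < d -> (c%:E <= f rho)%E].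
Proof.
rewrite limf_einfE => /ereal_sup_gt[_ [V /= [d /= d0 hd] <-] inf0].
have hV rho : 0 < rho -> rho < d -> V rho.
 by move=> r0 rd; apply: hd => //=; rewrite sub0r normrN gtr0_norm.
have le rho : 0 < rho -> rho < d -> (ereal_inf (f @` V) <= f rho)%E.
 by move=> r0 rd; apply: ereal_inf_lbound; exists rho => //; exact: hV.
move: inf0 le; case: (ereal_inf _) => [c||] //=.
- by rewrite lte_fin => c0 le; exists c, d.
- by move=> _ le; exists 1, d; split => // rho r0 rd; apply: le_trans (le _ r0 rd); exact: leey.
Qed.

Lemma limf_esup_lty (f : R -> \bar R) : (limf_esup f 0^'+ < +oo)%E ->
 exists c d : R, [/\ 0 <= c, 0 < d & forall rho, 0 < rho -> rho < d -> (f rho <= c%:E)%E].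
Proof.
rewrite limf_esupE => /ereal_inf_lt[_ [V /= [d /= d0 hd] <-] supV].
have hV rho : 0 < rho -> rho < d -> V rho.
 by move=> r0 rd; apply: hd => //=; rewrite sub0r normrN gtr0_norm.
have le rho : 0 < rho -> rho < d -> (f rho <= ereal_sup (f @` V))%E.
 by move=> r0 rd; apply: ereal_sup_ubound; exists rho => //; exact: hV.
move: supV le; case: (ereal_sup _) => [c||] //=.
- move=> _ le; exists (Num.max c 0), d; split => // [|rho r0 rd]; first by rewrite le_max lexx orbT.
 by apply: (le_trans (le _ r0 rd)); rewrite lee_fin le_max lexx.
- by move=> _ le; exists 0, d; split => // rho r0 rd; apply: (le_trans (le _ r0 rd)); exact: leNye.
Qed.

End indicators.

Theorem theorem3p1 (R : realType) (n : nat) (alpha s r : R)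
  (u0 : heis R n -> R[i]) (u : R -> heis R n -> R[i]) :
 (0 < n)%N -> 0 < alpha -> 0 <= s ->
 L2 (heis_measure R n) u0 ->
 heat_solution alpha s u0 u ->
 ((0 < decay_lower r u0)%E ->
   exists2 C : R, 0 < C & forall t, s <= t ->
    ((C * (1 + t - s) `^ (- ((2 * r + (homdim n)%:R) / (2 * alpha))))%:E
     <= sqL2norm (heis_measure R n) (u t))%E) /\
 ((decay_upper r u0 < +oo)%E ->
   exists2 C : R, 0 < C & forall t, s <= t ->
    (sqL2norm (heis_measure R n) (u t)
     <= (C * (1 + t - s) `^ (- ((2 * r + (homdim n)%:R) / (2 * alpha))))%:E)%E).
Proof.
move=> n0 a0 _ u02 sol; have [u2 us _ dsol] := sol.
(* A resolution is available through the equation only; any time after s provides one. *)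
have [G [E rE _] _] := dsol (s + 1) ltac:(by rewrite ltrDl).
set mu := heis_measure R n in u02 u2 us E rE *; set q := 2 * r + _.
pose N t := nrm mu (u t); pose m t a b := nrm mu (res_proj E [set` `[a, b[] (u t)).
have NE t : s <= t -> sqL2norm mu (u t) = (N t)%:E by move=> st; exact: (sqL2E (u2 t st)).
have K0 : 0 < plancherel_cst (R := R) n * plancherel_const n.
 by rewrite mulr_gt0 ?plancherel_const_gt0// invr_gt0 exprn_gt0// mulr_gt0// pi_gt0.
set K := _ * _ in K0.
have ratio rho : 0 < rho -> decay_ratio r u0 rho = (rho `^ (- q) * (K * m s 0 (rho ^+ 2)))%:E.
 move=> r0; rewrite (decay_ratioE n0 r rE u02 r0) (_ : - 2 * r - _ = - q); last by rewrite /q; ring.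
 have us2 := u2 s (lexx s); have mI : measurable ([set` `[0, rho ^+ 2[] : set R) by exact: measurable_itv.
 (* The initial value is attained almost everywhere, which identifies the spectral energies of u0
    with those of u(s). *)
 have d0 : nrm mu (fun x => u s x - u0 x) = 0.
  by apply: nrm_ae0; [apply: aeS us _ => x ->; rewrite subrr|exact: (L2B us2 u02).1].
 have := nrm_proj_diff E mI u02 us2; rewrite d0 mulr0 sqrtr0 mulr0 addr0 normr_le0 subr_eq0.
 by move=> /eqP <-.
have m_upper t a b : s <= t -> 0 <= a -> a < b -> m t a b <= expR (- (2 * a `^ alpha) * (t - s)) * m s a b.
 by move=> st a_ge0 ab; have [] := heat_energy_bounds n0 a0 sol rE a_ge0 ab st.
have m_lower t a b : s <= t -> 0 <= a -> a < b -> expR (- (2 * b `^ alpha) * (t - s)) * m s a b <= m t a b.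
 by move=> st a_ge0 ab; have [] := heat_energy_bounds n0 a0 sol rE a_ge0 ab st.
have m_ge0 t a b : s <= t -> 0 <= m t a b by move=> _; exact: nrm_ge0.
have m_split t a b c : s <= t -> a <= b -> b <= c -> m t a c = m t a b + m t b c.
 by move=> st; exact: (nrm_proj_split E (u2 t st)).
have m_le t b : s <= t -> 0 < b -> m t 0 b <= N t.
 by move=> st b0; exact: (nrm_proj_le E (measurable_itv _) (u2 t st)).
have N_le t M : s <= t -> (forall b, 0 < b -> m t 0 b <= M) -> N t <= M.
 by move=> st; exact: (nrm_le_proj n0 rE (u2 t st)).
split=> [/limf_einf_gt0|/limf_esup_lty] [c [d [c0 d0 h]]].
- have [rho r0 rd|C C0 hC] := @decay_from_below _ alpha s q N m a0 m_lower m_le (c / K) d (divr_gt0 c0 K0) d0.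
  have := h rho r0 rd; rewrite ratio// lee_fin powRN => h'.
  rewrite mulrAC ler_pdivrMr// [c * _]mulrC [leRHS]mulrC.
  by rewrite ler_pdivlMl ?powR_gt0// in h'.
 by exists C => // t st; rewrite NE// lee_fin; exact: hC.
- have [rho r0 rd|C C0 hC] := @decay_from_above _ alpha s q N m a0 m_upper m_ge0 m_split m_le N_le (c / K) d (divr_ge0 c0 (ltW K0)) d0.
  have := h rho r0 rd; rewrite ratio// lee_fin powRN => h'.
  rewrite mulrAC ler_pdivlMr// mulrC [c * _]mulrC.
  by rewrite ler_pdivrMl ?powR_gt0// in h'.
 by exists C => // t st; rewrite NE// lee_fin; exact: hC.
Qed.
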